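(* Let $q\in L_2(0,\pi)$ and $M_0\in L_2(0,\pi)$ be complex-valued, $M(x)=(\pi-x)^{-1}M_0(x)$, and $\mathbf f=\{q,M_0\}$. The eigenvalues $\{\mu_k\}_{k\ge1}$ of the Dirichlet–Neumann problem $$-y''(x)+q(x)y(x)+\int_0^x M(x-t)y(t)\,dt=\mu y(x)\ \ (0<x<\pi),\qquad y(0)=y'(\pi)=0,$$ satisfy $$\mu_k^{1/2}=k-\frac12+\frac{[q]}{2k-1}-\frac{a_{2k-1}}{2(2k-1)}+\frac{m_{2k-1}}{2(2k-1)}+\frac{\delta_k}{k^2},\qquad k=1,2,\dots,$$ where $$[q]=\frac1\pi\int_0^\pi q(t)\,dt,\quad a_k=\frac2\pi\int_0^\pi q(t)\cos kt\,dt,\quad m_k=\frac2\pi\int_0^\pi M_0(t)\cos\Big(\frac{kt}{2}\Big)dt,$$ and the sequence $\{\delta_k\}_{k=1}^\infty$ satisfies $$\Big(\sum_{k=1}^\infty|\delta_k|^2\Big)^{1/2}={\cal O}(\mathbf f^{\,2}),$$ i.e. for every $r_0>0$ there is a constant $C=C(r_0)$ such that $\big(\sum_{k\ge1}|\delta_k|^2\big)^{1/2}\le C\|\mathbf f\|^2$ for all $\mathbf f\in L_2\oplus L_2$ with $\|\mathbf f\|\le r_0$.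
   Context: $L_2=L_2(0,\pi)$; the norm on pairs is $\|\mathbf f\|=\|q\|_{L_2}+2\|M_0\|_{L_2}$. Conventions on eigenvalues: let $S(x,\rho)$ be the solution of the equation with spectral parameter $\mu=\rho^2$ and $S(0,\rho)=0$, $S'(0,\rho)=1$ (prime denotes $d/dx$). The eigenvalues are $\mu_k=(\rho_k')^2$, where $\rho_k'=\mu_k^{1/2}$ are the zeros of the even entire function $\rho\mapsto S'(\pi,\rho)$ with the branch $-\pi/2<\arg\rho_k'\le\pi/2$; eigenvalues are counted with algebraic multiplicity (multiplicity of $\mu_k$ as a zero of $\mu\mapsto S'(\pi,\sqrt\mu)$) and numbered $k=1,2,\dots$ in order of increasing modulus. *)

(* Defs.v *)
From HB Require Import structures.
From mathcomp Require Import all_boot all_order all_algebra.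
From mathcomp Require Import all_classical all_reals all_analysis.
From mathcomp Require Export complex.

Set Implicit Arguments.
Unset Strict Implicit.
Unset Printing Implicit Defensive.

Import Order.TTheory GRing.Theory Num.Theory.
Import numFieldNormedType.Exports.

Local Open Scope classical_set_scope.
Local Open Scope complex_scope.
Local Open Scope ring_scope.

Section ComplexIntegral.
Context {R : realType}.
Implicit Types (D : set R) (f : R -> R[i]).

Definition cintegrable D f : Prop :=
  (@lebesgue_measure R).-integrable D (fun x => (complex.Re (f x))%:E) /\
  (@lebesgue_measure R).-integrable D (fun x => (complex.Im (f x))%:E).

Definition cintegral D f : R[i] :=
  (\int[@lebesgue_measure R]_(x in D) complex.Re (f x)) +i*
  (\int[@lebesgue_measure R]_(x in D) complex.Im (f x)).

(* Functions, not classes modulo a.e. equality. *)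
Definition in_L2 f : Prop :=
  [/\ measurable_fun `]0, (@pi R)[ (fun x : R => complex.Re (f x)),
      measurable_fun `]0, (@pi R)[ (fun x : R => complex.Im (f x)) &
      (\int[@lebesgue_measure R]_(x in `]0%R, (@pi R)[)
         ((Normc.normc (f x) ^+ 2)%:E) < +oo)%E].

Definition L2norm f : R :=
  Num.sqrt (\int[@lebesgue_measure R]_(x in `]0, (@pi R)[)
              Normc.normc (f x) ^+ 2).

Definition pair_norm (q M0 : R -> R[i]) : R := L2norm q + 2 * L2norm M0.

(* f is absolutely continuous on [0, pi], and g = f' almost everywhere. *)
Definition ac_with_derivative f (g : R -> R[i]) : Prop :=
  cintegrable `[0, (@pi R)] g /\
  forall x, x \in `[0, (@pi R)] -> f x = f 0 + cintegral `[0, x] g.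

End ComplexIntegral.

Section Problem.
Context {R : realType}.
Implicit Types (q y dy : R -> R[i]) (lambda rho : R[i]).

Definition conv_kernel (M0 : R -> R[i]) : R -> R[i] :=
  fun x => ((@pi R - x)^-1)%:C * M0 x.

(* y is a solution of -y'' + q y + int_0^x M(x-t) y(t) dt = lambda y on
   (0, pi), with y and y' absolutely continuous on [0, pi] and the equation
   holding almost everywhere.  Since dy is continuous on [0, pi], it is the
   everywhere-defined derivative y' there (one-sided at 0 and at pi). *)
Definition is_solution q (M0 : R -> R[i]) lambda y dy : Prop :=
  exists2 d2y : R -> R[i],
    ac_with_derivative y dy /\ ac_with_derivative dy d2y &
    {ae @lebesgue_measure R, forall x, x \in `]0, (@pi R)[ ->
       - d2y x + q x * y x
         + cintegral `]0, x[ (fun t => conv_kernel M0 (x - t) * y t)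
       = lambda * y x}.

Definition is_sine_solution q (M0 : R -> R[i]) rho y dy : Prop :=
  [/\ is_solution q M0 (rho ^+ 2) y dy, y 0 = 0 & dy 0 = 1].

Definition mean q : R[i] := ((@pi R)^-1)%:C * cintegral `]0, (@pi R)[ q.

Definition a_coef q (k : nat) : R[i] :=
  (2 / @pi R)%:C *
    cintegral `]0, (@pi R)[ (fun t => q t * (cos (k%:R * t))%:C).

Definition m_coef (M0 : R -> R[i]) (k : nat) : R[i] :=
  (2 / @pi R)%:C *
    cintegral `]0, (@pi R)[ (fun t => M0 t * (cos (k%:R * t / 2))%:C).

End Problem.

(* a is a zero of multiplicity m of F (m = 0: F is holomorphic near a and
   F a <> 0). *)
Definition zero_of_order (K : numFieldType) (F : K -> K) (a : K) (m : nat) :=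
  exists g : K -> K,
    [/\ \forall z \near a, derivable g z 1,
        g a != 0 &
        \forall z \near a, F z = (z - a) ^+ m * g z].

(* mu 1, mu 2, ... lists all the zeros of F, each one repeated according to its
   multiplicity, in order of increasing modulus; the value mu 0 is not used.
   Zeros of equal modulus may come in any order. *)
Definition numbered_zeros (K : numFieldType) (F : K -> K) (mu : nat -> K) :=
  (forall k, (1 <= k)%N -> `|mu k| <= `|mu k.+1|) /\
  (forall a, exists2 m, zero_of_order F a m &
     ([set k : nat | (1 <= k)%N /\ mu k = a] #= `I_m)%card).

(* The square root sqrtc of the library is the principal one: its values have
   argument in ]-pi/2, pi/2].  dS x rho is S'(x, rho). *)
Definition dn_eigenvalues (R : realType) (q M0 : R -> R[i])
    (mu : nat -> R[i]) : Prop :=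
  exists S dS : R -> R[i] -> R[i],
    (forall rho, is_sine_solution q M0 rho (S ^~ rho) (dS ^~ rho)) /\
    numbered_zeros (fun lambda : R[i] => dS pi (sqrtc lambda)) mu.

(* Main.v *)
(* Write a = |q|, b = |M_0|, D = 2 a + 2 b. The derivative v = S'(., rho) solves the Volterra
   equation v = 1 + int_0^x (q S + M * S - rho^2 S), S = int_0^x v; the kernel M = (pi - t)^-1 M_0 is
   harmless because the length pi - t of the remaining interval compensates the singularity.
   Variation of constants turns S'(pi, rho) = 0 into
     - cos(pi rho) = (2 rho)^-1 E(rho) + rho^-2 Q(rho),
     E(rho) = sin(pi rho) int q + int q(t) sin(rho (2 t - pi)) dt + int M_0(u) sin(rho (pi - u)) du,
   where Q is quadratic in (q, M_0).

   Comparing S'(pi, sqrt l) with cos(pi sqrt l) by a Rouche argument (which rests on an elementary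
   minimum principle rather than on contour integrals) gives |rho_k - (k - 1/2)| <= K D / k whenever
   k >= K D. Since - cos(pi rho_k) is, up to sign, sin(pi (rho_k - (k - 1/2))), the equation determines
   rho_k - (k - 1/2), and E(k - 1/2) produces exactly the coefficients [q], a_{2k-1} and m_{2k-1}.
   The errors E(rho_k) - E(k - 1/2) and Q(rho_k) are square summable over k by Bessel's inequality
   for the frequencies rho_k, which are perturbations of the half-integers; the singular kernel is
   handled by Cauchy-Schwarz with the weight pi - t. All constants are O(|f|^4) for the sum of squares.
   The finitely many remaining k < K D force |f| to be bounded below, so there boundedness of
   delta_k suffices. *)
Require Import Defs.
From HB Require Import structures.
From mathcomp Require Import all_boot all_order all_algebra.
From mathcomp Require Import all_classical all_reals all_analysis.
From mathcomp Require Import complex measurable_realfun ring lra.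
Import Order.TTheory GRing.Theory Num.Theory.
Import numFieldNormedType.Exports.
Set Implicit Arguments.
Unset Strict Implicit.
Unset Printing Implicit Defensive.
Local Open Scope classical_set_scope.
Local Open Scope complex_scope.
Local Open Scope ring_scope.

(** The delicate point is [quadratic_term]. A size estimate makes it O(|f|^2) for each k, which
    would only give bounded delta_k. To sum its squares, p^2 times the error of S against sin(p x) /
    p is split into the explicit oscillation - 1/2 cos(p x) int_0^x q and a part [beta], whose
    square sum over k at fixed x is at most a constant plus a multiple of int_0^x dt / (pi - t).
    This logarithm is the price of dividing by the weight pi - t. It is harmless, because its
    integral over (0, y) is at most y for y <= pi, which is all that one more convolution with M
    requires. All sums over k run over finite lists of indices, with constants that depend on the
    norms only; the series is reached at the very end through its partial sums. Complex analysis is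
    reduced to Taylor expansions at single points. Analyticity in l comes from the Volterra equation
    itself, by solving for the coefficients in powers of l - l0, and cos(pi sqrt l) is the special
    case of zero coefficients. *)

Local Notation nc := Normc.normc.

(** * Complex exponential and trigonometric functions *)

Section norm.
Context {R : realType}.
Implicit Types z w : R[i].

Lemma normc_nc z : `|z| = (nc z)%:C.
Proof. by []. Qed.

Lemma nc_sqr z : nc z ^+ 2 = complex.Re z ^+ 2 + complex.Im z ^+ 2.
Proof. by case: z => a b; rewrite /nc sqr_sqrtr // addr_ge0 // sqr_ge0. Qed.

Lemma nc_ge0 z : 0 <= nc z.
Proof. by case: z => a b; rewrite /nc sqrtr_ge0. Qed.

Lemma ncD z w : nc (z + w) <= nc z + nc w.
Proof. by rewrite -lecR rmorphD/= -!normc_nc ler_normD. Qed.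

Lemma ncN z : nc (- z) = nc z.
Proof. by apply: complexI; rewrite -!normc_nc normrN. Qed.

Lemma ncB z w : nc (z - w) <= nc z + nc w.
Proof. by rewrite -(ncN w) ncD. Qed.

Lemma ncC z w : nc (z - w) = nc (w - z).
Proof. by rewrite -ncN opprB. Qed.

Lemma ncM z w : nc (z * w) = nc z * nc w.
Proof. exact: Normc.normcM. Qed.

Lemma ncV z : nc z^-1 = (nc z)^-1.
Proof. exact: Normc.normcV. Qed.

Lemma nc_real (x : R) : nc x%:C = `|x|.
Proof. by rewrite /nc/= expr0n /= addr0 sqrtr_sqr. Qed.

Lemma nc0 : nc (0 : R[i]) = 0.
Proof. by rewrite (nc_real 0) normr0. Qed.

Lemma nc1 : nc (1 : R[i]) = 1.
Proof. by rewrite (nc_real 1) normr1. Qed.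

Lemma nc_nat n : nc (n%:R : R[i]) = n%:R.
Proof. by rewrite -(rmorph_nat (real_complex R)) nc_real normr_nat. Qed.

Lemma nc_eq0 z : (nc z == 0) = (z == 0).
Proof. by apply/eqP/eqP => [/Normc.eq0_normc|->]; rewrite ?nc0. Qed.

Lemma nc_gt0 z : (0 < nc z) = (z != 0).
Proof. by rewrite lt_def nc_ge0 nc_eq0 andbT. Qed.

Lemma ncX z n : nc (z ^+ n) = nc z ^+ n.
Proof. by elim: n => [|n ih]; rewrite ?expr0 ?nc1 // !exprS ncM ih. Qed.

Lemma nc_sum (I : Type) (r : seq I) (P : pred I) (f : I -> R[i]) :
  nc (\sum_(i <- r | P i) f i) <= \sum_(i <- r | P i) nc (f i).
Proof.
elim/big_ind2: _ => //; first by rewrite nc0.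
by move=> x1 x2 y1 y2 h1 h2; rewrite (le_trans (ncD _ _)) // lerD.
Qed.

Lemma nc_Re z : `|complex.Re z| <= nc z.
Proof.
rewrite -(ler_pXn2r (_ : 0 < 2)%N) ?nnegrE ?nc_ge0 // nc_sqr real_normK ?num_real //.
by rewrite lerDl sqr_ge0.
Qed.

Lemma nc_Im z : `|complex.Im z| <= nc z.
Proof.
rewrite -(ler_pXn2r (_ : 0 < 2)%N) ?nnegrE ?nc_ge0 // nc_sqr real_normK ?num_real //.
by rewrite lerDr sqr_ge0.
Qed.

Lemma nc_ReIm z : nc z <= `|complex.Re z| + `|complex.Im z|.
Proof.
case: z => a b /=.
rewrite -(ler_pXn2r (_ : 0 < 2)%N) ?nnegrE ?sqrtr_ge0 ?addr_ge0 // sqr_sqrtr ?addr_ge0 ?sqr_ge0 // sqrrD !real_normK ?num_real //.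
by rewrite addrAC lerDl mulrn_wge0 // mulr_ge0.
Qed.

Lemma nc_lerB z w : nc z - nc w <= nc (z - w).
Proof. by rewrite lerBlDr -{1}(subrK w z) ncD. Qed.

Lemma nc_conj z : nc (z^*) = nc z.
Proof. by case: z => a b; rewrite /nc /= sqrrN. Qed.

Lemma mul_conj z : z * z^* = ((nc z) ^+ 2)%:C.
Proof. by rewrite -sqr_normc normc_nc rmorphXn. Qed.

Lemma sqrtc_Re_ge0 z : 0 <= complex.Re (sqrtc z).
Proof. by case: z => a b; rewrite /sqrtc /= sqrtr_ge0. Qed.

Lemma nc_sqrtc z : nc (sqrtc z) ^+ 2 = nc z.
Proof. by rewrite -ncX sqr_sqrtc. Qed.

Lemma normr_le_nc z w : (`|z| <= `|w|) = (nc z <= nc w).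
Proof. by rewrite !normc_nc lecR. Qed.

Definition cexp z : R[i] := (expR (complex.Re z))%:C * (cos (complex.Im z) +i* sin (complex.Im z)).
Lemma cReM z w : complex.Re (z * w) = complex.Re z * complex.Re w - complex.Im z * complex.Im w.
Proof. by case: z w => [a b] [c d]. Qed.

Lemma cImM z w : complex.Im (z * w) = complex.Re z * complex.Im w + complex.Im z * complex.Re w.
Proof. by case: z w => [a b] [c d]. Qed.

Lemma cReD z w : complex.Re (z + w) = complex.Re z + complex.Re w.
Proof. by case: z w => [a b] [c d]. Qed.

Lemma cImD z w : complex.Im (z + w) = complex.Im z + complex.Im w.
Proof. by case: z w => [a b] [c d]. Qed.

Lemma cReN z : complex.Re (- z) = - complex.Re z.
Proof. by case: z => [a b]. Qed.

Lemma cImN z : complex.Im (- z) = - complex.Im z.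
Proof. by case: z => [a b]. Qed.

Lemma cReB z w : complex.Re (z - w) = complex.Re z - complex.Re w.
Proof. by rewrite cReD cReN. Qed.

Lemma cImB z w : complex.Im (z - w) = complex.Im z - complex.Im w.
Proof. by rewrite cImD cImN. Qed.

Lemma complex_eqP z w : complex.Re z = complex.Re w -> complex.Im z = complex.Im w -> z = w.
Proof. by case: z w => [a b] [c d] /= -> ->. Qed.

Lemma cexpD z w : cexp (z + w) = cexp z * cexp w.
Proof.
rewrite /cexp cReD cImD expRD cosD sinD.
by apply: complex_eqP; rewrite !(cReM, cImM) /=; ring.
Qed.

Lemma cexp0 : cexp 0 = 1.
Proof. by rewrite /cexp /= expR0 cos0 sin0 mulr1. Qed.

Lemma nc_cexp z : nc (cexp z) = expR (complex.Re z).
Proof.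
rewrite /cexp ncM nc_real ger0_norm ?expR_ge0 //.
by rewrite [X in _ * X]/nc cos2Dsin2 sqrtr1 mulr1.
Qed.

Lemma cexpN z : cexp z * cexp (- z) = 1.
Proof. by rewrite -cexpD subrr cexp0. Qed.

Definition ccos z := (cexp ('i * z) + cexp (- ('i * z))) / 2.
Definition csin z := (cexp ('i * z) - cexp (- ('i * z))) / (2 * 'i).
Lemma i_neq0 : ('i : R[i]) != 0.
Proof. by rewrite eq_complex /= oner_eq0 andbF. Qed.

Lemma ccos0 : ccos 0 = 1.
Proof. by rewrite /ccos mulr0 oppr0 cexp0 -[1+1]/(2%:R) divff. Qed.

Lemma ccosN z : ccos (- z) = ccos z.
Proof. by rewrite /ccos mulrN opprK addrC. Qed.

Lemma csinN z : csin (- z) = - csin z.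
Proof. by rewrite /csin mulrN opprK -[RHS]mulNr opprB. Qed.

Lemma ccosD z w : ccos (z + w) = ccos z * ccos w - csin z * csin w.
Proof.
rewrite /ccos /csin mulrDr opprD !cexpD.
have i2 : 'i * 'i = -1 :> R[i] by rewrite -expr2 sqr_i.
have i0 := i_neq0.
field: i2; exact/i0. 
Qed.

Lemma csinD z w : csin (z + w) = csin z * ccos w + ccos z * csin w.
Proof.
rewrite /ccos /csin mulrDr opprD !cexpD.
by have i0 := i_neq0; field.
Qed.

Lemma cexp_i_real (x : R) : cexp ('i * x%:C) = (cos x)%:C + 'i * (sin x)%:C.
Proof.
rewrite /cexp.
have -> : complex.Re ('i * x%:C) = 0 by rewrite cReM /=; ring.
have -> : complex.Im ('i * x%:C) = x by rewrite cImM /=; ring.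
rewrite expR0.
by apply: complex_eqP; rewrite !(cReD, cImD, cReM, cImM) /=; ring.
Qed.

Lemma ccos_real (x : R) : ccos x%:C = (cos x)%:C.
Proof.
rewrite /ccos -mulrN -rmorphN !cexp_i_real cosN sinN rmorphN /=.
by field.
Qed.

Lemma csin_real (x : R) : csin x%:C = (sin x)%:C.
Proof.
have -> : csin x%:C = (cexp ('i * x%:C) - cexp ('i * (- x)%:C)) / (2 * 'i) by rewrite /csin rmorphN mulrN.
rewrite !cexp_i_real cosN sinN rmorphN /=.
by have i0 := i_neq0; field.
Qed.

Lemma Re_i z : complex.Re ('i * z) = - complex.Im z.
Proof. by rewrite cReM /=; ring. Qed.

Lemma nc_i : nc ('i : R[i]) = 1.
Proof. by rewrite /nc /= expr0n expr1n add0r sqrtr1. Qed.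

Lemma nc_ccos z : nc (ccos z) <= expR `|complex.Im z|.
Proof.
rewrite /ccos ncM ncV (nc_nat 2) ler_pdivrMr // (le_trans (ncD _ _)) //.
rewrite !nc_cexp cReN Re_i opprK.
have h1 : expR (- complex.Im z) <= expR `|complex.Im z| by rewrite ler_expR -normrN ler_norm.
have h2 : expR (complex.Im z) <= expR `|complex.Im z| by rewrite ler_expR ler_norm.
lra.
Qed.

Lemma nc_csin z : nc (csin z) <= expR `|complex.Im z|.
Proof.
rewrite /csin ncM ncV ncM (nc_nat 2) nc_i mulr1 ler_pdivrMr // (le_trans (ncB _ _)) //.
rewrite !nc_cexp cReN Re_i opprK.
have h1 : expR (- complex.Im z) <= expR `|complex.Im z| by rewrite ler_expR -normrN ler_norm.
have h2 : expR (complex.Im z) <= expR `|complex.Im z| by rewrite ler_expR ler_norm.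
lra.
Qed.

(** The second square is sinh(y)^2: the parts cos x cosh y and - sin x sinh y combine through cosh^2
    = sinh^2 + 1. *)
Lemma nc_ccos_sqr (x y : R) :
  nc (ccos (x +i* y)) ^+ 2 = cos x ^+ 2 + ((expR y - expR (- y)) / 2) ^+ 2.
Proof.
have -> : ccos (x +i* y) =
    (cos x * ((expR y + expR (- y)) / 2)) +i* (- sin x * ((expR y - expR (- y)) / 2)).
  rewrite /ccos /cexp !(cReN, cImN) !Re_i.
  have -> : complex.Im ('i * (x +i* y)) = x by rewrite cImM /=; ring.
  rewrite cosN sinN /= opprK.
  apply: (mulIf (_ : (2 : R[i]) != 0)) => //.
  rewrite mulfVK //.
  have -> : (2 : R[i]) = 2%:C by rewrite rmorph_nat.
  by apply: complex_eqP; rewrite !(cReD, cImD, cReM, cImM) /=; field.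
rewrite nc_sqr /= !exprMn sqrrN sin2cos2.
have he : expR y * expR (- y) = 1 by rewrite -expRD subrr expR0.
set a := expR y in he *; set b := expR (- y) in he *; set c := cos x.
have -> : (a + b) ^+ 2 = (a - b) ^+ 2 + a * b * 4 by ring.
rewrite he mul1r.
by field.
Qed.

Lemma sin_sqrDnpi (x : R) (n : nat) : sin (x + pi * n%:R) ^+ 2 = sin x ^+ 2.
Proof.
elim: n => [|n ih]; first by rewrite mulr0 addr0.
by rewrite -natr1 mulrDr mulr1 addrA sinDpi sqrrN.
Qed.

Lemma sin_sqrDzpi (x : R) (n : int) : sin (x + pi * n%:~R) ^+ 2 = sin x ^+ 2.
Proof.
case: n => n; first exact: sin_sqrDnpi.
rewrite NegzE mulrNz -(sin_sqrDnpi (x + pi * - n.+1%:~R) n.+1).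
by rewrite mulrN -pmulrn subrK.
Qed.

(** A weak form of Jordan's inequality, by the double angle formula: on [0, u/2] the cosine is at
    least cos(pi/4), so sin(u/2) >= cos(pi/4) u/2, and cos(pi/4)^2 = 1/2. The factor 1/2 is enough
    for [ccos_lb] because pi >= 2. *)
Lemma sin_ge_half (u : R) : 0 <= u -> u <= pi / 2 -> u / 2 <= sin u.
Proof.
move=> u0 u2; have p0 := pi_gt0 R.
have q2 : cos (pi / 4 : R) ^+ 2 = 1 / 2.
  have := cos_mulr2n (pi / 4 : R).
  have -> : pi / 4 *+ 2 = pi / 2 :> R by field.
  by rewrite cos_pihalf => /eqP; rewrite eq_sym subr_eq0 => /eqP h; lra.
have q0 : 0 < cos (pi / 4 : R) by apply: cos_gt0_pihalf; lra.
have hc (v : R) : 0 <= v -> v <= pi / 4 -> cos (pi / 4) <= cos v.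
  move=> v0 v1; rewrite leNgt ltr_cos ?in_itv /= -?leNgt //; lra.
pose v := u / 2; have v0 : 0 <= v by rewrite /v; lra.
have v1 : v <= pi / 4 by rewrite /v; lra.
have sv : cos (pi / 4) * v <= sin v.
  have [|z] := @MVT_segment _ sin cos 0 v v0.
    exact/continuous_subspaceT/continuous_sin.
  rewrite in_itv /= => /andP[z0 z1]; rewrite sin0 !subr0 => ->.
  by rewrite ler_wpM2r // hc // (le_trans z1).
have -> : u = v *+ 2 by rewrite /v; field.
rewrite sin_mulr2n; have cv := hc _ v0 v1.
have : cos (pi / 4) * (cos (pi / 4) * v) <= cos v * sin v.
  by apply: ler_pM => //; [exact: ltW|rewrite mulr_ge0 // ltW].
rewrite mulrA -expr2 q2 => h; lra.
Qed.

Lemma ler_abs_sin (u : R) : `|u| <= pi / 2 -> `|u| / 2 <= `|sin u|.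
Proof.
move=> hu.
have [u0|u0] := leP 0 u.
  by rewrite ger0_norm // in hu *; rewrite (le_trans (sin_ge_half u0 hu)) // ler_norm.
rewrite ltr0_norm // in hu *.
have := @sin_ge_half (- u) _ hu; rewrite oppr_ge0 (ltW u0) => /(_ isT) h.
by rewrite (le_trans h) // sinN -normrN ler_norm.
Qed.

Lemma ccos_lb : exists2 c : R, 0 < c & forall z : R[i], exists j : int,
  c * Num.min 1 (nc (z - (j%:~R - 1 / 2)%:C)) * expR (pi * `|complex.Im z|)
    <= nc (ccos (pi%:C * z)).
Proof.
have p2 := pi_ge2 R; have e10 := expR_gt0 (1 : R).
have e1 : 2 <= expR (1 : R) by have := expR_ge1Dx (1 : R); lra.
exists ((expR 1)^-1 / 4); first by rewrite divr_gt0 // invr_gt0.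
case=> x y; exists (Num.floor x + 1).
have /andP[f1 f2] := floor_itv x.
set n := Num.floor x in f1 f2 *.
rewrite intrD in f2.
pose u := x - (n%:~R + 1 / 2).
have hu : `|u| <= 1 / 2 by rewrite ler_norml /u; lra.
have -> : x +i* y - ((n + 1)%:~R - 1 / 2)%:C = u +i* y.
  by apply: complex_eqP; rewrite ?(cReB, cImB) /= /u ?intrD; lra.
rewrite [complex.Im _]/=.
have -> : pi%:C * (x +i* y) = (pi * x) +i* (pi * y).
  by apply: complex_eqP; rewrite ?(cReM, cImM) /=; ring.
have hY : pi * `|y| = `|pi * y| by rewrite normrM (ger0_norm (pi_ge0 R)).
rewrite hY; set Y := pi * y in hY *.
have sq := nc_ccos_sqr (pi * x) Y.
set Z := nc (ccos _) in sq *.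
have Z0 : 0 <= Z by exact: nc_ge0.
have cx : cos (pi * x) ^+ 2 = sin (pi * u) ^+ 2.
  have -> : pi * x = pi * u + pi / 2 + pi * n%:~R by rewrite /u; field.
  by rewrite cos2sin2 sin_sqrDzpi sinDpihalf sin2cos2.
rewrite cx in sq.
have sqs (a b : R) : 0 <= b -> a ^+ 2 <= b ^+ 2 -> a <= b.
  move=> b0 ab; have [a0|a0] := leP 0 a; last by rewrite (le_trans (ltW a0)).
  by rewrite -(ler_pXn2r (_ : 0 < 2)%N) ?nnegrE.
have hs : ((expR Y - expR (- Y)) / 2) ^+ 2 = ((expR `|Y| - expR (- `|Y|)) / 2) ^+ 2.
  by case: (ger0P Y) => _ //; rewrite opprK; field.
rewrite {}hs in sq.
set s := (expR `|Y| - expR (- `|Y|)) / 2 in sq.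
have eY := expR_gt0 `|Y|.
have ie : 0 < (expR (1 : R))^-1 by rewrite invr_gt0.
have ie2 : (expR (1 : R))^-1 <= 1 / 2 by rewrite -[X in _ <= X]invrK lef_pV2 ?posrE ?invr_gt0; lra.
have [Y1|Y1] := leP 1 `|Y|.
  have E2 : 2 <= expR `|Y| by rewrite (le_trans e1) // ler_expR.
  have E3 : expR (- `|Y|) <= 1 by rewrite -expR0 ler_expR oppr_le0.
  have s8 : expR `|Y| / 8 <= s by rewrite /s; lra.
  have : s <= Z.
    by apply: sqs => //; rewrite sq lerDr sqr_ge0.
  move=> /(le_trans s8); apply: le_trans.
  have m1 : Num.min 1 (nc (u +i* y)) <= 1 by rewrite ge_min lexx.
  have m0 : 0 <= Num.min 1 (nc (u +i* y)) by rewrite le_min ler01 nc_ge0.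
  have h : (expR 1)^-1 / 4 * Num.min 1 (nc (u +i* y)) <= 1 / 8 by nra.
  by apply: le_trans (ler_wpM2r (ltW eY) h) _; lra.
have sY : `|Y| / 2 <= s.
  have := expR_ge1Dx `|Y|.
  have E3 : expR (- `|Y|) <= 1 by rewrite -expR0 ler_expR oppr_le0.
  rewrite /s; lra.
have su := @ler_abs_sin (pi * u).
have : nc (u +i* y) <= Z.
  apply: sqs => //; rewrite sq nc_sqr /= lerD //.
    rewrite -[leLHS]real_normK ?num_real // -[leRHS]real_normK ?num_real //.
    rewrite lerXn2r ?nnegrE // (le_trans _ (su _)) ?normrM ?(ger0_norm (pi_ge0 R)) //.
      have := normr_ge0 u; nra.
    have := normr_ge0 u; nra.
  rewrite -[leLHS]real_normK ?num_real //.
  rewrite lerXn2r ?nnegrE //; first by rewrite (le_trans _ sY) // divr_ge0.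
  apply: le_trans sY; rewrite -hY; have := normr_ge0 y; nra.
apply: le_trans.
have E4 : expR `|Y| <= expR 1 by rewrite ler_expR ltW.
have m1 : Num.min 1 (nc (u +i* y)) <= nc (u +i* y) by rewrite ge_min lexx orbT.
have m0 : 0 <= Num.min 1 (nc (u +i* y)) by rewrite le_min ler01 nc_ge0.
apply: le_trans m1.
set m := Num.min _ _ in m0 *.
have : (expR 1)^-1 * expR `|Y| <= 1 by rewrite mulrC ler_pdivrMr // mul1r.
have : 0 <= (expR 1)^-1 * expR `|Y| by rewrite mulr_ge0 // ltW.
set k := (expR 1)^-1 * expR `|Y| => k0 k1.
have -> : (expR 1)^-1 / 4 * m * expR `|Y| = k * (m / 4).
  by rewrite /k; have := lt0r_neq0 e10; move=> ?; field.
nra.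
Qed.
End norm.

(** * Complex-valued integrals *)

Section cmeas.
Context {d : measure_display} {T : measurableType d} {R : realType}.
Implicit Types f g : T -> R[i].

Definition cmfun f := measurable_fun setT (fun x => complex.Re (f x)) /\
  measurable_fun setT (fun x => complex.Im (f x)).

Lemma cmfun_cst (c : R[i]) : cmfun (fun=> c).
Proof. by split; exact: measurable_cst. Qed.

Lemma cmfun_real (g : T -> R) : measurable_fun setT g -> cmfun (fun x => (g x)%:C).
Proof. by move=> mg; split => //=; exact: measurable_cst. Qed.

Lemma cmfun_if (b : T -> bool) f g : measurable_fun setT b -> cmfun f -> cmfun g ->
  cmfun (fun x => if b x then f x else g x).
Proof.
move=> mb [f1 f2] [g1 g2]; split.
  rewrite (_ : (fun x => _) = (fun x => if b x then complex.Re (f x) else complex.Re (g x))).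
    exact: measurable_fun_ifT.
  by apply/funext => x; case: (b x).
rewrite (_ : (fun x => _) = (fun x => if b x then complex.Im (f x) else complex.Im (g x))).
  exact: measurable_fun_ifT.
by apply/funext => x; case: (b x).
Qed.

Lemma measurable_boolR (b : T -> bool) : measurable_fun setT b ->
  measurable_fun setT (fun x => (b x)%:R : R).
Proof.
move=> mb; rewrite (_ : (fun x => _) = (fun x => if b x then 1 else 0)).
  by apply: measurable_fun_ifT => //; exact: measurable_cst.
by apply/funext => x; case: (b x).
Qed.

Lemma cmfun_bool (b : T -> bool) : measurable_fun setT b ->
  cmfun (fun x => (b x)%:R).
Proof.
move=> mb; rewrite (_ : (fun x => _) = (fun x => if b x then 1 else 0)).
  by apply: cmfun_if => //; exact: cmfun_cst.
by apply/funext => x; case: (b x).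
Qed.

Lemma cmfunD f g : cmfun f -> cmfun g -> cmfun (fun x => f x + g x).
Proof.
move=> [f1 f2] [g1 g2]; split.
- by under eq_fun do rewrite cReD; exact: measurable_funD.
- by under eq_fun do rewrite cImD; exact: measurable_funD.
Qed.

Lemma cmfunN f : cmfun f -> cmfun (fun x => - f x).
Proof.
move=> [f1 f2]; split.
- by under eq_fun do rewrite cReN; exact: measurableT_comp.
- by under eq_fun do rewrite cImN; exact: measurableT_comp.
Qed.

Lemma cmfunB f g : cmfun f -> cmfun g -> cmfun (fun x => f x - g x).
Proof. by move=> hf hg; apply: cmfunD => //; exact: cmfunN. Qed.

Lemma cmfunM f g : cmfun f -> cmfun g -> cmfun (fun x => f x * g x).
Proof.
move=> [f1 f2] [g1 g2]; split.
- under eq_fun do rewrite cReM.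
  by apply: measurable_funB; exact: measurable_funM.
- under eq_fun do rewrite cImM.
  by apply: measurable_funD; exact: measurable_funM.
Qed.

Lemma cmfunZ (c : R[i]) f : cmfun f -> cmfun (fun x => c * f x).
Proof. by apply: cmfunM; exact: cmfun_cst. Qed.

Lemma cmfun_sum (I : Type) (r : seq I) (F : I -> T -> R[i]) :
  (forall i, cmfun (F i)) -> cmfun (fun x => \sum_(i <- r) F i x).
Proof.
move=> h; elim: r => [|i r ih].
  by under eq_fun do rewrite big_nil; exact: cmfun_cst.
by under eq_fun do rewrite big_cons; exact: cmfunD.
Qed.

Lemma cmfun_nc f : cmfun f -> measurable_fun setT (fun x => nc (f x)).
Proof.
move=> [f1 f2].
rewrite (_ : (fun x => _) = Num.sqrt \o
    (fun x => complex.Re (f x) ^+ 2 + complex.Im (f x) ^+ 2)); last first.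
  by apply/funext => x /=; rewrite -nc_sqr sqrtr_sqr ger0_norm // nc_ge0.
apply: measurableT_comp.
  by apply: continuous_measurable_fun; exact: sqrt_continuous.
by apply: measurable_funD; exact: measurable_funX.
Qed.

End cmeas.

Lemma cmfun_comp {d d' : measure_display} {T : measurableType d}
  {T' : measurableType d'} {R : realType} (f : T -> R[i]) (g : T' -> T) :
  measurable_fun setT g -> cmfun f -> cmfun (fun x => f (g x)).
Proof. by move=> mg [f1 f2]; split; [exact: (measurableT_comp f1)|exact: (measurableT_comp f2)]. Qed.

Lemma cmfun_cexp {d : measure_display} {T : measurableType d} {R : realType} (f : T -> R[i]) :
  cmfun f -> cmfun (fun x => cexp (f x)).
Proof.
move=> [f1 f2]; apply: cmfunM.
  by apply: cmfun_real; apply: measurableT_comp => //; exact: measurable_expR.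
split => /=; apply: measurableT_comp => //; apply: continuous_measurable_fun.
  exact: continuous_cos.
exact: continuous_sin.
Qed.

Lemma cmfun_ccos {d : measure_display} {T : measurableType d} {R : realType} (f : T -> R[i]) :
  cmfun f -> cmfun (fun x => ccos (f x)).
Proof.
move=> hf; have h : cmfun (fun x => 'i * f x) by exact: cmfunZ.
apply: cmfunM; last exact: cmfun_cst.
by apply: cmfunD; apply: cmfun_cexp => //; exact: cmfunN.
Qed.

Lemma cmfun_csin {d : measure_display} {T : measurableType d} {R : realType} (f : T -> R[i]) :
  cmfun f -> cmfun (fun x => csin (f x)).
Proof.
move=> hf; have h : cmfun (fun x => 'i * f x) by exact: cmfunZ.
apply: cmfunM; last exact: cmfun_cst.
by apply: cmfunB; apply: cmfun_cexp => //; exact: cmfunN.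
Qed.

Section integral.
Context {R : realType}.
Implicit Types f g : R -> R[i].
Local Notation mu := (@lebesgue_measure R).
Local Open Scope ereal_scope.

(** Integrals are taken over the whole line, and a domain enters as a Boolean factor of the
    integrand, such as [(0 < t < x)%R%:R]. Fubini, translations and reflections then need no change
    of domain. *)
Definition cint f : R[i] := cintegral setT f.

Definition L1 f := cmfun f /\ \int[mu]_x (nc (f x))%:E < +oo.

Lemma integral_ncE f : cmfun f -> \int[mu]_x `|(nc (f x))%:E| = \int[mu]_x (nc (f x))%:E.
Proof. by move=> _; apply: eq_integral => x _; rewrite gee0_abs // lee_fin nc_ge0. Qed.

Lemma L1_integrable f : L1 f ->
  mu.-integrable setT (EFin \o (fun x => complex.Re (f x))) /\
  mu.-integrable setT (EFin \o (fun x => complex.Im (f x))).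
Proof.
move=> [mf fi]; have mn := cmfun_nc mf; have [m1 m2] := mf.
have ni : mu.-integrable setT (EFin \o (fun x => nc (f x))).
  apply/integrableP; split; first exact/measurable_EFinP.
  by rewrite integral_ncE.
split; apply: le_integrable ni => //; try exact/measurable_EFinP.
- by move=> x _ /=; rewrite lee_fin [leRHS]ger0_norm ?nc_ge0 // nc_Re.
- by move=> x _ /=; rewrite lee_fin [leRHS]ger0_norm ?nc_ge0 // nc_Im.
Qed.

Lemma L1_norm_integrable f : L1 f -> mu.-integrable setT (EFin \o (fun x => nc (f x))).
Proof.
move=> [mf fi]; apply/integrableP; split; first exact/measurable_EFinP/cmfun_nc.
by rewrite integral_ncE.
Qed.

Lemma Re_cint f : L1 f -> (complex.Re (cint f))%:E = \int[mu]_x (complex.Re (f x))%:E.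
Proof.
by move=> /L1_integrable[f1 f2]; rewrite /= /Rintegral fineK //; exact: integrable_fin_num.
Qed.

Lemma le_int (f g : R -> R) : measurable_fun setT f -> measurable_fun setT g ->
  (forall x, 0 <= f x)%R -> (forall x, f x <= g x)%R ->
  \int[mu]_x (f x)%:E <= \int[mu]_x (g x)%:E.
Proof.
move=> mf mg f0 fg; apply: ge0_le_integral => //; try exact/measurable_EFinP.
- by move=> x _; rewrite lee_fin.
- by move=> x _; rewrite lee_fin.
Qed.

Lemma L1_le f g : cmfun f -> L1 g -> (forall x, (nc (f x) <= nc (g x))%R) -> L1 f.
Proof.
move=> mf [mg gi] fg; split => //; apply: le_lt_trans gi.
by apply: le_int => [||x|x] //; [exact: cmfun_nc|exact: cmfun_nc|exact: nc_ge0].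
Qed.

Lemma L1D f g : L1 f -> L1 g -> L1 (fun x => f x + g x)%R.
Proof.
move=> [mf fi] [mg gi]; split; first exact: cmfunD.
apply: (@le_lt_trans _ _ (\int[mu]_x ((nc (f x))%:E + (nc (g x))%:E))).
  apply: ge0_le_integral => //.
  - by move=> x _; rewrite lee_fin nc_ge0.
  - exact/measurable_EFinP/cmfun_nc/cmfunD.
  - by apply: emeasurable_funD; exact/measurable_EFinP/cmfun_nc.
  - by move=> x _; rewrite -EFinD lee_fin ncD.
rewrite ge0_integralD //; last 4 first.
- by move=> x _; rewrite lee_fin nc_ge0.
- exact/measurable_EFinP/cmfun_nc.
- by move=> x _; rewrite lee_fin nc_ge0.
- exact/measurable_EFinP/cmfun_nc.
by rewrite lte_add_pinfty.
Qed.

Lemma L1Z (c : R[i]) f : L1 f -> L1 (fun x => c * f x)%R.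
Proof.
move=> [mf fi]; split; first exact: cmfunZ.
under eq_integral do rewrite ncM EFinM.
rewrite ge0_integralZl_EFin ?nc_ge0 //; last 2 first.
- by move=> x _; rewrite lee_fin nc_ge0.
- exact/measurable_EFinP/cmfun_nc.
by rewrite lte_mul_pinfty // lee_fin nc_ge0.
Qed.

Lemma L1N f : L1 f -> L1 (fun x => - f x)%R.
Proof. by move=> /(L1Z (-1)%R); under eq_fun do rewrite mulN1r. Qed.

Lemma L1B f g : L1 f -> L1 g -> L1 (fun x => f x - g x)%R.
Proof. by move=> hf hg; apply: L1D => //; exact: L1N. Qed.

Lemma L1_0 : L1 (fun=> 0%R).
Proof.
split; first exact: cmfun_cst.
by under eq_integral do rewrite nc0; rewrite integral0.
Qed.

Lemma cintD f g : L1 f -> L1 g -> cint (fun x => f x + g x)%R = (cint f + cint g)%R.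
Proof.
move=> /L1_integrable[f1 f2] /L1_integrable[g1 g2].
apply: complex_eqP; rewrite ?(cReD, cImD) /=.
  by under eq_Rintegral do rewrite cReD; rewrite RintegralD.
by under eq_Rintegral do rewrite cImD; rewrite RintegralD.
Qed.

Lemma cintZ (c : R[i]) f : L1 f -> cint (fun x => c * f x)%R = (c * cint f)%R.
Proof.
move=> /L1_integrable[f1 f2].
have hz (a b : R) (u v : R -> R) : mu.-integrable setT (EFin \o u) -> mu.-integrable setT (EFin \o v) ->
    (\int[mu]_x (a * u x + b * v x) = a * \int[mu]_x u x + b * \int[mu]_x v x)%R.
  move=> hu hv; rewrite RintegralD //; last 2 first.
    by rewrite (_ : _ \o _ = (fun x => a%:E * (EFin \o u) x)) //; exact: integrableZl.
    by rewrite (_ : _ \o _ = (fun x => b%:E * (EFin \o v) x)) //; exact: integrableZl.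
  by rewrite !RintegralZl.
apply: complex_eqP; rewrite ?(cReM, cImM) /=.
  under eq_Rintegral do rewrite cReM -mulNr.
  by rewrite hz // mulNr.
under eq_Rintegral do rewrite cImM.
by rewrite hz.
Qed.

Lemma cintN f : L1 f -> cint (fun x => - f x)%R = (- cint f)%R.
Proof. by move=> hf; under eq_fun do rewrite -mulN1r; rewrite cintZ // mulN1r. Qed.

Lemma cintB f g : L1 f -> L1 g -> cint (fun x => f x - g x)%R = (cint f - cint g)%R.
Proof. by move=> hf hg; rewrite cintD ?cintN //; exact: L1N. Qed.

Lemma cint0 : cint (fun=> 0%R) = 0%R.
Proof. by have := @cintZ 0%R _ L1_0; under eq_fun do rewrite mul0r; rewrite mul0r. Qed.

Lemma L1_sum (I : Type) (r : seq I) (F : I -> R -> R[i]) :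
  (forall i, L1 (F i)) -> L1 (fun x => \sum_(i <- r) F i x)%R.
Proof.
move=> h; elim: r => [|i r ih].
  by under eq_fun do rewrite big_nil; exact: L1_0.
by under eq_fun do rewrite big_cons; exact: L1D.
Qed.

Lemma cint_sum (I : Type) (r : seq I) (F : I -> R -> R[i]) :
  (forall i, L1 (F i)) -> cint (fun x => \sum_(i <- r) F i x)%R = (\sum_(i <- r) cint (F i))%R.
Proof.
move=> h; elim: r => [|i r ih].
  by under eq_fun do rewrite big_nil; rewrite big_nil cint0.
under eq_fun do rewrite big_cons; rewrite big_cons cintD ?ih //.
exact: L1_sum.
Qed.

(** Rotation trick: if w is the integral, |w|^2 is the real part of the integral of f times the
    conjugate of w, hence at most |w| times the integral of |f|. *)
Lemma nc_cint f : cmfun f -> (nc (cint f))%:E <= \int[mu]_x (nc (f x))%:E.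
Proof.
move=> mf; have [fi|] := ltP (\int[mu]_x (nc (f x))%:E) +oo; last first.
  by rewrite leye_eq => /eqP ->; rewrite leey.
have Lf : L1 f by [].
set w := cint f.
have [w0|w0] := eqVneq (nc w) 0%R.
  by rewrite w0; apply: integral_ge0 => x _; rewrite lee_fin nc_ge0.
have wp : (0 < nc w)%R by rewrite lt_def w0 nc_ge0.
have key : ((nc w) ^+ 2)%:E <= (nc w)%:E * \int[mu]_x (nc (f x))%:E.
  have -> : (nc w ^+ 2 = complex.Re (cint (fun x => w^* * f x)))%R.
    rewrite cintZ // -/w mulrC mul_conj /=; ring.
  rewrite -ge0_integralZl_EFin ?nc_ge0 //; last 2 first.
  - by move=> x _; rewrite lee_fin nc_ge0.
  - exact/measurable_EFinP/cmfun_nc.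
  have [i1 i2] := L1_integrable (L1Z (w^*)%R Lf).
  rewrite Re_cint; last exact: L1Z.
  apply: le_integral => //.
    have := L1_norm_integrable (L1Z (w^*)%R Lf).
    by apply: eq_integrable => // x _ /=; rewrite ncM nc_conj EFinM.
  by move=> x _; rewrite -EFinM lee_fin -[in leRHS](nc_conj w) -ncM (le_trans (ler_norm _)) // nc_Re.
have fin : \int[mu]_x (nc (f x))%:E \is a fin_num.
  by rewrite ge0_fin_numE // integral_ge0 // => x _; rewrite lee_fin nc_ge0.
move: key; rewrite -(fineK fin) -EFinM !lee_fin expr2.
by rewrite ler_pM2l.
Qed.

Lemma eq_cint f g : f =1 g -> cint f = cint g.
Proof. by move=> /funext ->. Qed.

Lemma ae_eq_cint f g : cmfun f -> cmfun g -> {ae mu, forall x, f x = g x} -> cint f = cint g.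
Proof.
move=> [f1 f2] [g1 g2] fg; apply: complex_eqP => /=; congr fine.
  apply: ae_eq_integral => //; try exact/measurable_EFinP.
  move: fg; apply: (@filterS _ _ (ae_filter_ringOfSetsType mu)) => x /= -> _ //.
apply: ae_eq_integral => //; try exact/measurable_EFinP.
move: fg; apply: (@filterS _ _ (ae_filter_ringOfSetsType mu)) => x /= -> _ //.
Qed.

Lemma cintegral_cint (D : set R) f : measurable D -> cintegral D f = cint (fun x => (\1_D x)%:C * f x)%R.
Proof.
move=> mD; rewrite /cint /cintegral; congr (_ +i* _)%C.
  rewrite [LHS]Rintegral_mkcond; apply: eq_Rintegral => x _.
  by rewrite cReM /= mul0r subr0 patchE indicE; case: (x \in D); rewrite ?mul1r ?mul0r.
rewrite [LHS]Rintegral_mkcond; apply: eq_Rintegral => x _.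
by rewrite cImM /= mul0r addr0 patchE indicE; case: (x \in D); rewrite ?mul1r ?mul0r.
Qed.

(** Uniqueness of Lebesgue measure: the shifted measure has the same values on half-open
    intervals. *)
Lemma pushforward_shift (s : R) (A : set R) : measurable A ->
  pushforward mu (fun t : measurableTypeR R => t - s : measurableTypeR R)%R A = mu A.
Proof.
move=> mA.
have mp : measurable_fun setT (fun t : measurableTypeR R => t - s : measurableTypeR R)%R.
  by apply: measurable_funB => //; exact: measurable_cst.
pose phi_mixin := isMeasurableFun.Build _ _ _ _ _ mp.
pose phi : {mfun measurableTypeR R >-> measurableTypeR R} := HB.pack (fun t : R => t - s)%R phi_mixin.
apply/esym/(@lebesgue_measure_unique _ (pushforward mu phi)) => //= _ [[a b]] _ <-.
rewrite /pushforward.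
rewrite (_ : _ @^-1` _ = `](a + s)%R, (b + s)%R]%classic); last first.
  apply/seteqP; split=> x /=; rewrite !in_itv /= => /andP[h1 h2]; apply/andP; split; lra.
rewrite !lebesgue_measure_itv/= !lte_fin ltrD2r.
by case: ifP => // _; rewrite -!EFinB; congr EFin; ring.
Qed.

Lemma ge0_integral_shift (g : R -> \bar R) (s : R) : measurable_fun setT g -> (forall x, 0 <= g x) ->
  \int[mu]_x g (x - s)%R = \int[mu]_x g x.
Proof.
move=> mg g0.
have mp : measurable_fun setT (fun t : measurableTypeR R => t - s : measurableTypeR R)%R.
  by apply: measurable_funB => //; exact: measurable_cst.
rewrite -[LHS](@ge0_integral_pushforward _ _ _ _ _ _ mp mu setT g) //.
by apply: eq_measure_integral => A mA _; exact: pushforward_shift.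
Qed.

Lemma ge0_integral_opp (g : R -> \bar R) : measurable_fun setT g -> (forall x, 0 <= g x) ->
  \int[mu]_x g (- x)%R = \int[mu]_x g x.
Proof.
move=> mg g0.
have mp : measurable_fun setT (-%R : measurableTypeR R -> measurableTypeR R).
  by apply: continuous_measurable_fun; exact: opp_continuous.
rewrite -[LHS](@ge0_integral_pushforward _ _ _ _ _ _ mp mu setT g) //.
by apply: eq_measure_integral => A mA _; exact: lebesgue_measureN.
Qed.

End integral.

Section integral2.
Context {R : realType}.
Implicit Types f g : R -> R[i].
Local Notation mu := (@lebesgue_measure R).
Local Open Scope ereal_scope.

Lemma measurable_subr (s : R) : measurable_fun setT (fun t : R => t - s)%R.
Proof. by apply: measurable_funB => //; exact: measurable_cst. Qed.

Lemma integral_shift (g : R -> \bar R) (s : R) : measurable_fun setT g ->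
  \int[mu]_x g (x - s)%R = \int[mu]_x g x.
Proof.
move=> mg; rewrite integralE [RHS]integralE; congr (_ - _).
- have <- := @ge0_integral_shift _ (g^\+) s (measurable_funepos mg) (fun=> funepos_ge0 _ _).
  by apply: eq_integral => x _; rewrite !funeposE.
- have <- := @ge0_integral_shift _ (g^\-) s (measurable_funeneg mg) (fun=> funeneg_ge0 _ _).
  by apply: eq_integral => x _; rewrite !funenegE.
Qed.

Lemma integral_opp (g : R -> \bar R) : measurable_fun setT g ->
  \int[mu]_x g (- x)%R = \int[mu]_x g x.
Proof.
move=> mg; rewrite integralE [RHS]integralE; congr (_ - _).
- have <- := @ge0_integral_opp _ (g^\+) (measurable_funepos mg) (fun=> funepos_ge0 _ _).
  by apply: eq_integral => x _; rewrite !funeposE.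
- have <- := @ge0_integral_opp _ (g^\-) (measurable_funeneg mg) (fun=> funeneg_ge0 _ _).
  by apply: eq_integral => x _; rewrite !funenegE.
Qed.

Lemma integral_refl (g : R -> \bar R) (s : R) : measurable_fun setT g ->
  \int[mu]_x g (s - x)%R = \int[mu]_x g x.
Proof.
move=> mg; rewrite -[RHS]integral_opp // -[RHS](integral_shift s).
  by apply: eq_integral => x _; rewrite opprB.
apply: (measurableT_comp mg); apply: continuous_measurable_fun; exact: opp_continuous.
Qed.

Lemma cint_refl f (s : R) : cmfun f -> cint (fun t => f (s - t)%R) = cint f.
Proof.
move=> [f1 f2]; apply: complex_eqP => /=; congr fine.
- by rewrite (@integral_refl (fun x => (complex.Re (f x))%:E)) //; exact/measurable_EFinP.
- by rewrite (@integral_refl (fun x => (complex.Im (f x))%:E)) //; exact/measurable_EFinP.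
Qed.

Lemma measurable_int_param {d} {T : measurableType d} (h : T * R -> R) :
  measurable_fun setT h -> (forall p, 0 <= h p)%R ->
  measurable_fun setT (fun x => \int[mu]_y (h (x, y))%:E).
Proof.
move=> mh h0.
have := @measurable_fun_fubini_tonelli_F _ _ T _ R mu (EFin \o h).
by apply => //; exact/measurable_EFinP.
Qed.

(** Tonelli makes the integrals of the positive and negative parts measurable in the parameter, and
    [fine] of their difference stays measurable also where the integral diverges and takes its
    default value. *)
Lemma measurable_Rint_param {d} {T : measurableType d} (h : T * R -> R) :
  measurable_fun setT h ->
  measurable_fun setT (fun x => \int[mu]_y (h (x, y)))%R.
Proof.
move=> mh; rewrite (_ : (fun x => _) = fine \o (fun x =>
   \int[mu]_y (Num.max (h (x, y)) 0)%:E - \int[mu]_y (Num.max (- h (x, y)) 0)%:E)).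
  apply: measurableT_comp; first exact: (@fine_measurable R setT).
  apply: emeasurable_funB.
    apply: (@measurable_int_param _ _ (fun p => Num.max (h p) 0)%R).
      by apply: measurable_maxr => //; exact: measurable_cst.
    by move=> p; rewrite le_max lexx orbT.
  apply: (@measurable_int_param _ _ (fun p => Num.max (- h p) 0)%R).
    by apply: measurable_maxr => //; exact: measurableT_comp.
  by move=> p; rewrite le_max lexx orbT.
apply/funext => x /=; rewrite /Rintegral integralE; congr fine; congr (_ - _).
- by apply: eq_integral => y _; rewrite funeposE EFin_max.
- by apply: eq_integral => y _; rewrite funenegE EFin_max EFinN.
Qed.

Lemma cmfun_cint {d} {T : measurableType d} (h : T * R -> R[i]) :
  cmfun h -> cmfun (fun x => cint (fun y => h (x, y))).
Proof.
move=> [h1 h2]; split => /=.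
- exact: (@measurable_Rint_param _ _ (fun p => complex.Re (h p))).
- exact: (@measurable_Rint_param _ _ (fun p => complex.Im (h p))).
Qed.

Lemma Rfubini (h : R * R -> R) : measurable_fun setT h ->
  \int[mu]_x \int[mu]_y (`|h (x, y)|)%:E < +oo ->
  (\int[mu]_x (\int[mu]_y h (x, y)) = \int[mu]_y (\int[mu]_x h (x, y)))%R.
Proof.
move=> mh hfin.
have ih : (mu \x mu).-integrable setT (EFin \o h).
  apply/(@integrable12ltyP _ _ _ _ _ _ _ _ _).2 => //; exact/measurable_EFinP.
have F := Fubini ih.
have ae1 := ae_integrable1 ih.
have ae2 := ae_integrable2 ih.
rewrite /Rintegral.
(* The real inner integral agrees with the extended one where h(x, .) is integrable, that is almost
   everywhere. *)
have e1 : \int[mu]_x (fine (\int[mu]_y (h (x, y))%:E))%:E = \int[mu]_x \int[mu]_y (h (x, y))%:E.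
  apply: ae_eq_integral; first exact: measurableT.
  - apply/measurable_EFinP; exact: measurable_Rint_param.
  - exact: (measurable_fubini_F ih).
  - move: ae1; apply: (@filterS _ _ (ae_filter_ringOfSetsType mu)) => x hx _ /=.
    by rewrite fineK //; apply: integrable_fin_num.
have mG := measurable_fubini_G ih.
have e2 : \int[mu]_y (fine (\int[mu]_x (h (x, y))%:E))%:E = \int[mu]_y \int[mu]_x (h (x, y))%:E.
  apply: ae_eq_integral; first exact: measurableT.
  - apply/measurable_EFinP; apply: (@measurable_Rint_param _ _ (fun p => h (p.2, p.1))).
    apply: (measurableT_comp mh).
    exact: measurable_swap.
  - exact: mG.
  - move: ae2; apply: (@filterS _ _ (ae_filter_ringOfSetsType mu)) => x hx _ /=.
    by rewrite fineK //; apply: integrable_fin_num.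
by rewrite e1 e2 F.
Qed.

Lemma cfubini (h : R * R -> R[i]) : cmfun h ->
  \int[mu]_x \int[mu]_y (nc (h (x, y)))%:E < +oo ->
  cint (fun x => cint (fun y => h (x, y))) = cint (fun y => cint (fun x => h (x, y))).
Proof.
move=> mh hfin; have mn := cmfun_nc mh; have [h1 h2] := mh.
have bnd (k : R * R -> R) : measurable_fun setT k -> (forall p, `|k p| <= nc (h p))%R ->
    \int[mu]_x \int[mu]_y (`|k (x, y)|)%:E < +oo.
  move=> mk kh; apply: le_lt_trans hfin.
  have mk' : measurable_fun setT (fun p => `|k p|)%R by exact: measurableT_comp.
  have tp (x : R) : measurable_fun setT (fun y : R => (x, y)) by exact: pair1_measurable.
  apply: ge0_le_integral => //.
  - by move=> x _; apply: integral_ge0 => y _; rewrite lee_fin.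
  - by apply: (@measurable_int_param _ _ (fun p => `|k p|)%R).
  - by apply: (@measurable_int_param _ _ (fun p => nc (h p))) => // p; exact: nc_ge0.
  - by move=> x _; apply: le_int => //; try exact: (measurableT_comp mk' (tp x)); try exact: (measurableT_comp mn (tp x)); move=> y; exact: kh.
apply: complex_eqP => /=.
- exact: (@Rfubini (fun p => complex.Re (h p)) h1 (bnd _ h1 (fun p => nc_Re (h p)))).
- exact: (@Rfubini (fun p => complex.Im (h p)) h2 (bnd _ h2 (fun p => nc_Im (h p)))).
Qed.

Lemma tonelli (h : R * R -> R) : measurable_fun setT h -> (forall p, 0 <= h p)%R ->
  \int[mu]_x \int[mu]_y (h (x, y))%:E = \int[mu]_y \int[mu]_x (h (x, y))%:E.
Proof.
move=> mh h0; apply: (@fubini_tonelli _ _ _ _ R mu mu (EFin \o h)) => //.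
exact/measurable_EFinP.
Qed.

End integral2.

Section ftc.
Context {R : realType}.
Local Notation mu := (@lebesgue_measure R).

Lemma indic_itv (x s u : R) : (\1_(`]s, u[%classic) x)%:C = ((s < x < u)%R)%:R :> R[i].
Proof. by rewrite indicE mem_setE in_itv /=; case: (s < x < u). Qed.

Lemma cintegral_oo (s u : R) (f : R -> R[i]) :
  cintegral `]s, u[%classic f = cint (fun x => ((s < x < u)%R)%:R * f x).
Proof.
rewrite cintegral_cint //; apply: eq_cint => x; by rewrite indic_itv.
Qed.

Lemma Re_cexp (b : R[i]) (t : R) :
  complex.Re (cexp (b * t%:C)) = expR (complex.Re b * t) * cos (complex.Im b * t).
Proof. by rewrite /cexp !cReM !cImM /= !mulr0 subr0 add0r mul0r subr0. Qed.

Lemma Im_cexp (b : R[i]) (t : R) :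
  complex.Im (cexp (b * t%:C)) = expR (complex.Re b * t) * sin (complex.Im b * t).
Proof. by rewrite /cexp cImM !cReM !cImM /= !mulr0 subr0 add0r mul0r addr0. Qed.

Lemma is_derive_cexp_Re (b : R[i]) (t : R) :
  is_derive t 1 (fun t : R => complex.Re (cexp (b * t%:C))) (complex.Re (b * cexp (b * t%:C))).
Proof.
rewrite (_ : (fun t : R => _) = (fun t => expR (complex.Re b * t) * cos (complex.Im b * t))); last first.
  by apply/funext => x; rewrite Re_cexp.
apply: is_derive_eq; rewrite cReM Re_cexp Im_cexp.
rewrite /GRing.scale /=; ring.
Qed.

Lemma is_derive_cexp_Im (b : R[i]) (t : R) :
  is_derive t 1 (fun t : R => complex.Im (cexp (b * t%:C))) (complex.Im (b * cexp (b * t%:C))).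
Proof.
rewrite (_ : (fun t : R => _) = (fun t => expR (complex.Re b * t) * sin (complex.Im b * t))); last first.
  by apply/funext => x; rewrite Im_cexp.
apply: is_derive_eq; rewrite cImM Re_cexp Im_cexp.
rewrite /GRing.scale /=; ring.
Qed.

Lemma continuous_cexp_Re (b : R[i]) : continuous (fun t : R => complex.Re (cexp (b * t%:C))).
Proof.
move=> t; apply: differentiable_continuous; apply/derivable1_diffP.
by case: (is_derive_cexp_Re b t).
Qed.

Lemma continuous_cexp_Im (b : R[i]) : continuous (fun t : R => complex.Im (cexp (b * t%:C))).
Proof.
move=> t; apply: differentiable_continuous; apply/derivable1_diffP.
by case: (is_derive_cexp_Im b t).
Qed.

Lemma integral_FTC_oo (F f : R -> R) (s x : R) : s <= x -> continuous f ->
  (forall t : R, is_derive t 1 F (f t)) ->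
  (\int[mu]_t ((s < t < x)%R%:R * f t)%:E = (F x - F s)%:E)%E.
Proof.
move=> sx cf dF.
have cF : continuous F.
  by move=> t; apply: differentiable_continuous; apply/derivable1_diffP; case: (dF t).
transitivity (\int[mu]_(t in `]s, x[) (f t)%:E)%E.
  rewrite [RHS]integral_mkcond; apply: eq_integral => t _.
  by rewrite patchE mem_setE in_itv /=; case: (s < t < x); rewrite ?mul1r ?mul0r.
have [->|sx'] := eqVneq s x.
  by rewrite set_itvE integral_set0 subrr.
have {}sx' : s < x by rewrite lt_neqAle sx'.
have mf (i : interval R) : measurable_fun [set` i] f.
  by apply: measurable_funS (continuous_measurable_fun cf).
have mE (i : interval R) : measurable_fun [set` i] (fun t => (f t)%:E).
  by apply/measurable_EFinP; exact: mf.
rewrite (@integral_itv_obnd_cbnd R s (BLeft x) (fun t => (f t)%:E) (mE _)).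
rewrite (@integral_itv_bndo_bndc R (BLeft s) x (fun t => (f t)%:E) (mE _)).
rewrite (@continuous_FTC2 _ f F s x) //.
- exact: continuous_subspaceT.
- split; [by move=> t _; case: (dF t)| |].
    by apply: cvg_at_right_filter; exact: cF.
  by apply: cvg_at_left_filter; exact: cF.
- by move=> t _; rewrite derive1E; case: (dF t).
Qed.

Lemma FTC_oo (F f : R -> R) (s x : R) : s <= x -> continuous f ->
  (forall t : R, is_derive t 1 F (f t)) ->
  \int[mu]_t ((s < t < x)%R%:R * f t) = F x - F s.
Proof. by move=> sx cf dF; rewrite /Rintegral integral_FTC_oo. Qed.

Lemma integral_expR (c x : R) : 0 <= x ->
  (\int[mu]_t ((0 < t < x)%R%:R * (c * expR (c * t)))%:E = (expR (c * x) - 1)%:E)%E.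
Proof.
move=> x0.
have dE (t : R) : is_derive t 1 (fun t : R => expR (c * t)) (c * expR (c * t)).
  by apply: is_derive_eq; rewrite /GRing.scale /=; ring.
rewrite (@integral_FTC_oo (fun t => expR (c * t)) (fun t => c * expR (c * t))) //; last first.
  have cE : continuous (fun t : R => expR (c * t)).
    by move=> t; apply: differentiable_continuous; apply/derivable1_diffP; case: (dE t).
  by move=> t; apply: cvgM; [exact: cvg_cst|exact: cE].
by rewrite mulr0 expR0.
Qed.

Lemma cint_cexp (b : R[i]) (s x : R) : s <= x ->
  cint (fun t => (s < t < x)%R%:R * (b * cexp (b * t%:C))) = cexp (b * x%:C) - cexp (b * s%:C).
Proof.
move=> sx.
have mE : cmfun (fun t : R => cexp (b * t%:C)).
  by apply: cmfun_cexp; apply: cmfunZ; apply: cmfun_real; exact: measurable_id.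
have bR (c : bool) (z : R[i]) : complex.Re (c%:R * z) = c%:R * complex.Re z /\ complex.Im (c%:R * z) = c%:R * complex.Im z.
  by case: c; rewrite ?mul1r ?mul0r.
have ReI f : complex.Re (cint f) = \int[mu]_x complex.Re (f x) by [].
have ImI f : complex.Im (cint f) = \int[mu]_x complex.Im (f x) by [].
apply: complex_eqP; rewrite ?(cReB, cImB) ?ReI ?ImI.
- have cf : continuous (fun t : R => complex.Re (b * cexp (b * t%:C))).
    move=> t; rewrite (_ : (fun _ => _) = (fun t => complex.Re b * complex.Re (cexp (b * t%:C)) - complex.Im b * complex.Im (cexp (b * t%:C)))).
      by apply: cvgB; apply: cvgM; try exact: cvg_cst; [exact: continuous_cexp_Re|exact: continuous_cexp_Im].
    by apply/funext => u; rewrite cReM.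
  rewrite -(FTC_oo sx cf (is_derive_cexp_Re b)).
  by apply: eq_Rintegral => t _; rewrite (bR _ _).1.
- have cf : continuous (fun t : R => complex.Im (b * cexp (b * t%:C))).
    move=> t; rewrite (_ : (fun _ => _) = (fun t => complex.Re b * complex.Im (cexp (b * t%:C)) + complex.Im b * complex.Re (cexp (b * t%:C)))).
      by apply: cvgD; apply: cvgM; try exact: cvg_cst; [exact: continuous_cexp_Im|exact: continuous_cexp_Re].
    by apply/funext => u; rewrite cImM.
  rewrite -(FTC_oo sx cf (is_derive_cexp_Im b)).
  by apply: eq_Rintegral => t _; rewrite (bR _ _).2.
Qed.

Lemma integral_itv_len (s x : R) : s <= x ->
  (\int[mu]_t (((s < t < x)%R)%:R)%:E = (x - s)%:E)%E.
Proof.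
move=> sx.
transitivity (\int[mu]_t (\1_(`]s, x[%classic) t)%:E)%E.
  by apply: eq_integral => t _; rewrite indicE mem_setE in_itv.
rewrite integral_indic // setIT.
rewrite (_ : _ `]s, x[%classic = lebesgue_measure `]s, x[%classic) // lebesgue_measure_itv /= lte_fin.
case: ifP => [_|/negbT]; first by rewrite EFinB.
by rewrite -leNgt => h; congr EFin; lra.
Qed.

(** Integrate f g <= (s f^2 + s^-1 g^2) / 2 and choose s = I / A, where I is the integral of f g.
    The case s = 1 first shows that I is finite. If A = 0 < B and I > 0, the choice s = B / I gives
    I <= I / 2, a contradiction. *)
Lemma CS_le (f g : R -> R) (A B : R) : measurable_fun setT f -> measurable_fun setT g ->
  (forall x, 0 <= f x) -> (forall x, 0 <= g x) ->
  (\int[mu]_x (f x ^+ 2)%:E <= A%:E)%E -> (\int[mu]_x (g x ^+ 2)%:E <= B%:E)%E ->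
  (\int[mu]_x (f x * g x)%:E <= (Num.sqrt (A * B))%:E)%E.
Proof.
move=> mf mg f0 g0 hA hB.
have A0 : 0 <= A.
  by rewrite -lee_fin (le_trans _ hA) // integral_ge0 // => x _; rewrite lee_fin sqr_ge0.
have B0 : 0 <= B.
  by rewrite -lee_fin (le_trans _ hB) // integral_ge0 // => x _; rewrite lee_fin sqr_ge0.
have mf2 := measurable_funX 2 mf; have mg2 := measurable_funX 2 mg.
have key (s : R) : 0 < s -> (\int[mu]_x (f x * g x)%:E <= ((s * A + s^-1 * B) / 2)%:E)%E.
  move=> s0.
  apply: (@le_trans _ _ (\int[mu]_x ((s / 2)%:E * (f x ^+ 2)%:E + (s^-1 / 2)%:E * (g x ^+ 2)%:E))%E).
    under [leRHS]eq_integral do rewrite -!EFinM -EFinD.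
    apply: le_int => //.
    - exact: measurable_funM.
    - by apply: measurable_funD; apply: measurable_funM => //; exact: measurable_cst.
    - by move=> x; rewrite mulr_ge0.
    - move=> x; rewrite -subr_ge0.
      have -> : s / 2 * f x ^+ 2 + s^-1 / 2 * g x ^+ 2 - f x * g x = s^-1 / 2 * (s * f x - g x) ^+ 2.
        by have := lt0r_neq0 s0; move=> ?; field.
      by rewrite mulr_ge0 ?sqr_ge0 // divr_ge0 // invr_ge0 ltW.
  have si : 0 <= s^-1 by rewrite invr_ge0 ltW.
  rewrite ge0_integralD //; last 4 first.
  - by move=> x _; rewrite -EFinM lee_fin mulr_ge0 ?sqr_ge0 // divr_ge0 // ltW.
  - by apply/measurable_EFinP; apply: measurable_funM => //; exact: measurable_cst.
  - by move=> x _; rewrite -EFinM lee_fin mulr_ge0 ?sqr_ge0 // divr_ge0.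
  - by apply/measurable_EFinP; apply: measurable_funM => //; exact: measurable_cst.
  rewrite !ge0_integralZl_EFin //; last 6 first.
  - by move=> x _; rewrite lee_fin sqr_ge0.
  - exact/measurable_EFinP.
  - by rewrite divr_ge0.
  - by move=> x _; rewrite lee_fin sqr_ge0.
  - exact/measurable_EFinP.
  - by rewrite divr_ge0 // ltW.
  have -> : (s * A + s^-1 * B) / 2 = s / 2 * A + s^-1 / 2 * B by ring.
  by rewrite EFinD !EFinM leeD // lee_wpmul2l // lee_fin divr_ge0 // ltW.
have fin : (\int[mu]_x (f x * g x)%:E)%E \is a fin_num.
  rewrite ge0_fin_numE; first exact: le_lt_trans (key 1 ltr01) (ltry _).
  by apply: integral_ge0 => x _; rewrite lee_fin mulr_ge0.
rewrite -(fineK fin) lee_fin; set I := fine _.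
have {}key s : 0 < s -> I <= (s * A + s^-1 * B) / 2 by move=> s0; rewrite -lee_fin /I fineK //; exact: key.
have I0 : 0 <= I.
  by rewrite -lee_fin /I fineK // integral_ge0 // => x _; rewrite lee_fin mulr_ge0.
have [A00|An] := eqVneq A 0.
  have [//|Ip] := leP I 0; first by rewrite A00 mul0r sqrtr0.
  exfalso; have [B00|Bn] := eqVneq B 0; first by have := key 1 ltr01; rewrite A00 B00; lra.
  have Bp : 0 < B by rewrite lt_def Bn.
  have := key (B / I) (divr_gt0 Bp Ip).
  have -> : (B / I * A + (B / I)^-1 * B) / 2 = I / 2 by rewrite A00; have In := lt0r_neq0 Ip; field; rewrite Bn In.
  lra.
have Ap : 0 < A by rewrite lt_def An.
have [I00|In] := eqVneq I 0; first by rewrite I00 sqrtr_ge0.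
have Ip : 0 < I by rewrite lt_def In.
have h := key (I / A) (divr_gt0 Ip Ap).
rewrite -(ler_pXn2r (_ : 0 < 2)%N) ?nnegrE ?sqrtr_ge0 // sqr_sqrtr ?mulr_ge0 //.
have e : (I / A * A + (I / A)^-1 * B) / 2 = (I ^+ 2 + A * B) / (2 * I).
  by field; rewrite In An.
move: h; rewrite e ler_pdivlMr; last by rewrite mulr_gt0.
nra.
Qed.
End ftc.

(** * Minimum principle and comparison of zeros *)

Section taylor.
Context {R : realType}.
Implicit Types (f g : R[i] -> R[i]) (a b z h : R[i]).

Definition near0_bounded g := exists M e : R,
  0 < e /\ forall h, nc h < e -> nc (g h) <= M.

Lemma near0_bounded_cst c : near0_bounded (fun=> c).
Proof. by exists (nc c), 1. Qed.

Lemma near0_bounded_id : near0_bounded id.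
Proof. by exists 1, 1; split => // h /ltW. Qed.

Lemma near0_boundedD f g : near0_bounded f -> near0_bounded g ->
  near0_bounded (fun h => f h + g h).
Proof.
move=> [M [e [e0 hf]]] [N [d [d0 hg]]]; exists (M + N), (Num.min e d).
rewrite lt_min e0 d0; split => // h; rewrite lt_min => /andP[h1 h2].
by rewrite (le_trans (ncD _ _)) // lerD ?hf ?hg.
Qed.

Lemma near0_boundedM f g : near0_bounded f -> near0_bounded g ->
  near0_bounded (fun h => f h * g h).
Proof.
move=> [M [e [e0 hf]]] [N [d [d0 hg]]]; exists (M * N), (Num.min e d).
rewrite lt_min e0 d0; split => // h; rewrite lt_min => /andP[h1 h2].
by rewrite ncM ler_pM ?nc_ge0 ?hf ?hg.
Qed.

Lemma near0_boundedN f : near0_bounded f -> near0_bounded (fun h => - f h).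
Proof. by move=> [M [e [e0 hf]]]; exists M, e; split => // h /hf; rewrite ncN. Qed.

Lemma near0_boundedB f g : near0_bounded f -> near0_bounded g ->
  near0_bounded (fun h => f h - g h).
Proof. by move=> hf hg; apply: near0_boundedD => //; exact: near0_boundedN. Qed.

(** An expansion at one point with a third-order remainder that is only bounded near 0. This is all
    that [min_principle] uses, and differences, products and quotients preserve it by explicit
    formulas, without a notion of derivative. *)
Definition taylor2 f z := exists (c0 c1 c2 : R[i]) (g : R[i] -> R[i]),
  near0_bounded g /\ forall h, f (z + h) = c0 + c1 * h + c2 * h ^+ 2 + h ^+ 3 * g h.

Lemma taylor2_ext f g z : f =1 g -> taylor2 f z -> taylor2 g z.
Proof. by move=> /funext ->. Qed.

Lemma taylor2_cst c z : taylor2 (fun=> c) z.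
Proof.
exists c, 0, 0, (fun=> 0); split; first exact: near0_bounded_cst.
by move=> h; ring.
Qed.

Lemma taylor2_id z : taylor2 id z.
Proof.
exists z, 1, 0, (fun=> 0); split; first exact: near0_bounded_cst.
by move=> h; ring.
Qed.

Lemma taylor2B f g z : taylor2 f z -> taylor2 g z -> taylor2 (fun x => f x - g x) z.
Proof.
move=> [a0 [a1 [a2 [u [bu hf]]]]] [b0 [b1 [b2 [v [bv hg]]]]].
exists (a0 - b0), (a1 - b1), (a2 - b2), (fun h => u h - v h).
split; first exact: near0_boundedB.
by move=> h; rewrite hf hg; ring.
Qed.

Lemma taylor2M f g z : taylor2 f z -> taylor2 g z -> taylor2 (fun x => f x * g x) z.
Proof.
move=> [a0 [a1 [a2 [u [bu hf]]]]] [b0 [b1 [b2 [v [bv hg]]]]].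
exists (a0 * b0), (a0 * b1 + a1 * b0), (a0 * b2 + a1 * b1 + a2 * b0).
exists (fun h => (a1 * b2 + a2 * b1) + h * (a2 * b2) + u h * (b0 + h * (b1 + h * b2))
  + (a0 + h * (a1 + h * a2)) * v h + (h * (h * h)) * (u h * v h)).
have bc := near0_bounded_cst; have bi := near0_bounded_id.
split; last by move=> h; rewrite hf hg; ring.
by do ![apply: near0_boundedD | apply: near0_boundedM | apply: bc | apply: bi].
Qed.

Lemma taylor2_lb f z : taylor2 f z -> f z != 0 ->
  exists e : R, 0 < e /\ forall h, nc h < e -> nc (f z) / 2 <= nc (f (z + h)).
Proof.
move=> [a0 [a1 [a2 [u [bu hf]]]]] fz.
have a00 : a0 = f z by rewrite -[z]addr0 hf; ring.
have [M [e [e0 hM]]] : near0_bounded (fun h => a1 + h * a2 + (h * h) * u h).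
  have bc := near0_bounded_cst; have bi := near0_bounded_id.
  by do ![apply: near0_boundedD | apply: near0_boundedM | apply: bc | apply: bi].
have fp : 0 < nc (f z) by rewrite nc_gt0.
have M0 : 0 <= M by rewrite (le_trans _ (hM 0 _)) ?nc_ge0 // nc0.
exists (Num.min e (nc (f z) / (2 * (M + 1)))).
have d0 : 0 < nc (f z) / (2 * (M + 1)) by rewrite divr_gt0 // mulr_gt0 // ltr_wpDl.
rewrite lt_min e0 d0; split => // h; rewrite lt_min => /andP[h1 h2].
have -> : f (z + h) = f z - - (h * (a1 + h * a2 + (h * h) * u h)) by rewrite hf a00; ring.
apply: le_trans (nc_lerB _ _).
rewrite ncN ncM.
have h3 : nc h * nc (a1 + h * a2 + (h * h) * u h) <= nc (f z) / (2 * (M + 1)) * M.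
  by rewrite ler_pM ?nc_ge0 ?hM // ltW.
have h4 : nc (f z) / (2 * (M + 1)) * M <= nc (f z) / 2.
  rewrite invfM mulrA -mulrA ler_piMr ?divr_ge0 ?nc_ge0 // mulrC ler_pdivrMr ?ltr_wpDl // mul1r.
  by rewrite lerDl.
lra.
Qed.

Lemma taylor2_div f g z : taylor2 f z -> taylor2 g z -> g z != 0 -> taylor2 (fun x => f x / g x) z.
Proof.
move=> hf hg gz; have [d [d0 lb]] := taylor2_lb hg gz.
move: hf hg => [a0 [a1 [a2 [u [bu hf]]]]] [b0 [b1 [b2 [v [bv hg]]]]].
have b00 : b0 = g z by rewrite -[z]addr0 hg; ring.
have bn : b0 != 0 by rewrite b00.
(* Division of power series up to order 2; [S] is what remains of f minus the quotient polynomial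
   times g after division by h^3. *)
pose c0 := a0 / b0; pose c1 := (a1 - c0 * b1) / b0; pose c2 := (a2 - c0 * b2 - c1 * b1) / b0.
pose S h := u h - (c1 * b2 + c2 * b1 + h * (c2 * b2)) - (c0 + h * (c1 + h * c2)) * v h.
(* [taylor2] asks for the identity at every h. Where g vanishes the quotient is 0 by convention, so
   the remainder absorbs the polynomial there. Boundedness matters only near 0, where g is bounded
   away from 0. *)
pose T h := if g (z + h) == 0 then (0 - (c0 + c1 * h + c2 * h ^+ 2)) / h ^+ 3 else S h / g (z + h).
exists c0, c1, c2, T; split.
  have [M [e [e0 hM]]] : near0_bounded S.
    have bc := near0_bounded_cst; have bi := near0_bounded_id.
    apply: near0_boundedB; first apply: (near0_boundedB bu).
      by apply: near0_boundedD; [exact: bc|apply: near0_boundedM; [exact: bi|exact: bc]].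
    apply: near0_boundedM (bv); apply: near0_boundedD; first exact: bc.
    apply: near0_boundedM; first exact: bi.
    by apply: near0_boundedD; [exact: bc|apply: near0_boundedM; [exact: bi|exact: bc]].
  have gp : 0 < nc (g z) / 2 by rewrite divr_gt0 // nc_gt0.
  exists (M / (nc (g z) / 2)), (Num.min e d); rewrite lt_min e0 d0; split => // h; rewrite lt_min => /andP[h1 h2].
  have l := lb _ h2; have lp := lt_le_trans gp l.
  rewrite /T -nc_eq0 (gt_eqF lp) ncM ncV ler_pM ?nc_ge0 ?invr_ge0 ?nc_ge0 ?hM //.
  by rewrite lef_pV2 ?posrE.
move=> h; rewrite /T; have [g0|g0] := eqVneq (g (z + h)) 0.
  have [h0|h0] := eqVneq h 0.
    by move: gz; rewrite -[z]addr0 -{1}h0 g0 eqxx.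
  by rewrite g0 invr0 mulr0; field.
have key : f (z + h) = (c0 + c1 * h + c2 * h ^+ 2) * g (z + h) + h ^+ 3 * S h.
  by rewrite hf hg /S /c2 /c1 /c0; field.
by rewrite key; field.
Qed.

Lemma taylor2_prod (I : Type) (s : seq I) (F : I -> R[i] -> R[i]) z :
  (forall i, taylor2 (F i) z) -> taylor2 (fun x => \prod_(i <- s) F i x) z.
Proof.
move=> h; elim: s => [|i s ih].
  apply: (@taylor2_ext (fun=> 1)); last exact: taylor2_cst.
  by move=> x; rewrite big_nil.
apply: (@taylor2_ext (fun x => F i x * \prod_(j <- s) F j x)); last exact: taylor2M.
by move=> x; rewrite big_cons.
Qed.

Lemma taylor2X f n z : taylor2 f z -> taylor2 (fun x => f x ^+ n) z.
Proof.
move=> h; elim: n => [|n ih]; first exact: (taylor2_cst 1).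
apply: (@taylor2_ext (fun x => f x * f x ^+ n)); last exact: taylor2M.
by move=> x; rewrite exprS.
Qed.

Lemma taylor2_cont f z : taylor2 f z -> forall e : R, 0 < e -> exists d : R, 0 < d /\
  forall h, nc h < d -> nc (f (z + h) - f z) <= e.
Proof.
move=> [a0 [a1 [a2 [u [bu hf]]]]] e e0.
have a00 : a0 = f z by rewrite -[z]addr0 hf; ring.
have [M [d [d0 hM]]] : near0_bounded (fun h => a1 + h * a2 + (h * h) * u h).
  have bc := near0_bounded_cst; have bi := near0_bounded_id.
  by do ![apply: near0_boundedD | apply: near0_boundedM | apply: bc | apply: bi].
have M0 : 0 <= M by rewrite (le_trans _ (hM 0 _)) ?nc_ge0 // nc0.
have M1 : 0 < M + 1 by rewrite ltr_wpDl.
exists (Num.min d (e / (M + 1))); rewrite lt_min d0 divr_gt0 //; split => // h.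
rewrite lt_min => /andP[h1 h2].
have -> : f (z + h) - f z = h * (a1 + h * a2 + (h * h) * u h) by rewrite hf a00; ring.
rewrite ncM; apply: (@le_trans _ _ (e / (M + 1) * M)).
  by rewrite ler_pM ?nc_ge0 ?hM // ltW.
rewrite -mulrA ler_piMr ?(ltW e0) // mulrC ler_pdivrMr // mul1r lerDl //.
Qed.

Lemma Rcont_of (u : R[i] -> R) (p : R * R) :
  (forall e : R, 0 < e -> exists d : R, 0 < d /\
    forall h, nc h < d -> `|u ((p.1 +i* p.2) + h) - u (p.1 +i* p.2)| <= e) ->
  {for p, continuous (fun q : R * R => u (q.1 +i* q.2))}.
Proof.
move=> hu; rewrite /prop_for /continuous_at; apply/cvgrPdist_le => e e0.
have [d [d0 hd]] := hu e e0.
have d2 : 0 < d / 2 by rewrite divr_gt0.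
exists (ball p.1 (d / 2), ball p.2 (d / 2)) => /=.
  by split; apply: nbhsx_ballx.
move=> q [/= q1 q2].
rewrite distrC.
have -> : q.1 +i* q.2 = (p.1 +i* p.2) + ((q.1 - p.1) +i* (q.2 - p.2)).
  by apply: complex_eqP; rewrite ?(cReD, cImD) /=; ring.
apply: hd; apply: (le_lt_trans (nc_ReIm _)) => /=.
move: q1 q2; rewrite /ball /= distrC [X in _ -> X < _ -> _]distrC => q1 q2; lra.
Qed.

(** The condition P bears on |z|^2, a polynomial in the coordinates, so that one statement covers
    the minimum on the circle and the minimum on the closed disc. Compactness is that of a closed
    subset of a square in R x R. *)
Lemma compact_disc (r : R) (P : R -> bool) (u : R[i] -> R) : closed [set x : R | P x] ->
  (forall x, P x -> x <= r ^+ 2) ->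
  (exists z, P (nc z ^+ 2)) ->
  (forall z, P (nc z ^+ 2) -> forall e : R, 0 < e -> exists d : R, 0 < d /\
    forall h, nc h < d -> `|u (z + h) - u z| <= e) ->
  exists2 z, P (nc z ^+ 2) & forall w, P (nc w ^+ 2) -> u z <= u w.
Proof.
move=> cP Pr [z0 Pz0] hu.
pose A := [set q : R * R | P (q.1 ^+ 2 + q.2 ^+ 2)].
have [] := @compact_EVT_min _ R (fun q : R * R => u (q.1 +i* q.2)) A.
- by exists (complex.Re z0, complex.Im z0); rewrite /A /= -nc_sqr.
- apply: (@subclosed_compact _ A (`[- `|r|, `|r|]%classic `*` `[- `|r|, `|r|]%classic)).
  + apply: (@preimage_closed _ _ (fun q : R * R => q.1 ^+ 2 + q.2 ^+ 2) [set x | P x]) => //.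
    move=> q _; apply: cvgD; rewrite !expr2; under eq_fun do rewrite expr2.
      by apply: cvgM; exact: cvg_fst.
    by apply: cvgM; exact: cvg_snd.
  + by apply: compact_setX; exact: segment_compact.
  + move=> [a b] /= /Pr /= h; rewrite !in_itv /= -!ler_norml.
    split; rewrite -(ler_pXn2r (_ : 0 < 2)%N) ?nnegrE // !real_normK ?num_real //; apply: le_trans h.
      by rewrite lerDl sqr_ge0.
    by rewrite lerDr sqr_ge0.
- apply: continuous_in_subspaceT => p; rewrite inE /A /= => Pp.
  by apply: Rcont_of => e e0; apply: hu => //; rewrite nc_sqr.
- move=> [a b]; rewrite inE /A /= => Pab hmin.
  exists (a +i* b); first by rewrite nc_sqr.
  move=> [c d] Pw; have := hmin (c, d); rewrite inE /A /=; apply.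
  by move: Pw; rewrite nc_sqr.
Qed.

(* The mean of Re f - e |z|^2 over the four points z + t, z - t, z + i t, z - i t is
   below its value at z for small t, so no interior point is a minimum; a second-order
   Taylor expansion at each point is enough for this. *)
Lemma min_principle (r : R) (f : R[i] -> R[i]) : 0 < r ->
  (forall z, nc z <= r -> taylor2 f z) ->
  (forall z, nc z = r -> 0 < complex.Re (f z)) -> 0 < complex.Re (f 0).
Proof.
move=> r0 tf fp; rewrite ltNge; apply/negP => f0.
have cRe z : nc z <= r -> forall e : R, 0 < e -> exists d : R, 0 < d /\
    forall h, nc h < d -> `|complex.Re (f (z + h)) - complex.Re (f z)| <= e.
  move=> zr e e0; have [d [d0 hd]] := taylor2_cont (tf _ zr) e0.
  by exists d; split => // h /hd; apply: le_trans; rewrite -cReB; exact: nc_Re.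
have sq_le (x y : R) : 0 <= x -> 0 <= y -> x ^+ 2 <= y ^+ 2 -> x <= y.
  by move=> x0 y0; rewrite ler_pXn2r ?nnegrE.
have [||||z1 z1r hz1] := @compact_disc r (fun x => x == r ^+ 2) (fun z => complex.Re (f z)).
- rewrite (_ : [set x | _] = [set r ^+ 2]); first exact: closed_eq.
  by apply/seteqP; split => x /= /eqP.
- by move=> x /eqP ->.
- by exists r%:C; rewrite nc_real real_normK ?num_real.
- by move=> z /eqP zr; apply: cRe; apply: sq_le; rewrite ?nc_ge0 ?(ltW r0) // zr.
have z1r' : nc z1 = r.
  move/eqP: z1r => z1r; apply/eqP; rewrite eq_le; apply/andP; split; apply: sq_le; rewrite ?nc_ge0 ?z1r // ltW //.
have mp := fp _ z1r'.
set m := complex.Re (f z1) in mp hz1.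
(* m is the minimum of Re f on the circle, and k r^2 = m / 2. Hence v >= m / 2 > 0 >= v 0 on the
   circle, and the minimum of v over the disc is attained inside. *)
pose k := m / (2 * r ^+ 2).
have k0 : 0 < k by rewrite divr_gt0 // mulr_gt0 // exprn_gt0.
pose v z := complex.Re (f z) - k * nc z ^+ 2.
have [||||z2 z2r hz2] := @compact_disc r (fun x => x <= r ^+ 2) v.
- exact: closed_le.
- by [].
- by exists 0; rewrite nc0 expr0n /= exprn_ge0 // ltW.
- move=> z zr e e0.
  have zr' : nc z <= r by apply: sq_le; rewrite ?nc_ge0 ?(ltW r0).
  have e20 : 0 < e / 2 by rewrite divr_gt0.
  have [d [d0 hd]] := cRe z zr' _ e20.
  pose d' := e / 2 / (k * (2 * r + 1)).
  have kr : 0 < k * (2 * r + 1) by rewrite mulr_gt0 // addr_gt0 // mulr_gt0.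
  exists (Num.min d (Num.min 1 d')); rewrite !lt_min d0 ltr01 divr_gt0 //; split => // h.
  rewrite !lt_min => /and3P[h1 h2 h3].
  have -> : v (z + h) - v z = (complex.Re (f (z + h)) - complex.Re (f z)) - k * (nc (z + h) ^+ 2 - nc z ^+ 2).
    by rewrite /v; ring.
  apply: (le_trans (ler_normB _ _)).
  have := hd _ h1.
  have : `|k * (nc (z + h) ^+ 2 - nc z ^+ 2)| <= e / 2; last by lra.
  rewrite normrM (gtr0_norm k0) subr_sqr normrM.
  have a1 : `|nc (z + h) - nc z| <= nc h.
    rewrite ler_norml; have := ncD z h; have := nc_lerB z (- h); rewrite ncN opprK; lra.
  have a2 : `|nc (z + h) + nc z| <= 2 * r + 1.
    rewrite ger0_norm ?addr_ge0 ?nc_ge0 //; have := ncD z h; lra.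
  apply: (@le_trans _ _ (k * (d' * (2 * r + 1)))).
    by rewrite ler_wpM2l ?(ltW k0) // ler_pM // (le_trans a1) // ltW.
  by rewrite /d' mulrCA divfK // lt0r_neq0.
have v0 : v 0 <= 0 by rewrite /v nc0 expr0n /= mulr0 subr0.
have z2lt : nc z2 < r.
  rewrite lt_neqAle; apply/andP; split; last by apply: sq_le; rewrite ?nc_ge0 ?(ltW r0).
  apply/eqP => z2e.
  have h1 : v z2 <= v 0 by apply: hz2; rewrite nc0 expr0n /= exprn_ge0 // ltW.
  have h2 : m <= complex.Re (f z2) by apply: hz1; rewrite z2e.
  have h3 : k * nc z2 ^+ 2 = m / 2.
    by rewrite z2e /k; field; rewrite lt0r_neq0.
  move: h1 v0; rewrite {1}/v h3 => h1 v0; lra.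
have [c0 [c1 [c2 [g [[M [e [e0 hM]]] hf]]]]] := tf _ (ltW z2lt).
have M0 : 0 <= M by rewrite (le_trans _ (hM 0 _)) ?nc_ge0 // nc0.
(* The three bounds keep the four points in the range of the Taylor expansion, keep them in the
   disc, and make the cubic error t^3 M smaller than k t^2. *)
pose t := Num.min (e / 2) (Num.min ((r - nc z2) / 2) (k / (M + 1) / 2)).
have M1 : 0 < M + 1 by rewrite ltr_wpDl.
have rz : 0 < r - nc z2 by rewrite subr_gt0.
have p1 : 0 < e / 2 by apply: divr_gt0.
have p2 : 0 < (r - nc z2) / 2 by apply: divr_gt0.
have p3 : 0 < k / (M + 1) / 2 by apply: divr_gt0 => //; apply: divr_gt0.
have t0 : 0 < t by rewrite /t !lt_min p1 p2 p3.
have [t1 t2 t3] : [/\ t <= e / 2, t <= (r - nc z2) / 2 & t <= k / (M + 1) / 2].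
  by split; rewrite /t !ge_min lexx ?orbT.
have key w : nc w = 1 -> v z2 <= v (z2 + t%:C * w).
  move=> w1; apply: hz2; rewrite lerXn2r ?nnegrE ?nc_ge0 ?(ltW r0) //.
  apply: (le_trans (ncD _ _)); rewrite ncM w1 mulr1 nc_real (gtr0_norm t0); lra.
have ex w : nc w = 1 -> complex.Re (f (z2 + t%:C * w)) <=
    complex.Re (c0 + c1 * (t%:C * w) + c2 * (t%:C * w) ^+ 2) + t ^+ 3 * M.
  move=> w1.
  have -> : complex.Re (f (z2 + t%:C * w)) = complex.Re (c0 + c1 * (t%:C * w) + c2 * (t%:C * w) ^+ 2)
     + complex.Re ((t%:C * w) ^+ 3 * g (t%:C * w)) by rewrite hf [LHS]cReD.
  rewrite lerD2l.
  apply: (le_trans (ler_norm _)); apply: (le_trans (nc_Re _)).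
  rewrite ncM ncX ncM w1 mulr1 nc_real (gtr0_norm t0).
  rewrite ler_wpM2l ?exprn_ge0 ?(ltW t0) // hM // ncM w1 mulr1 nc_real (gtr0_norm t0); lra.
have fz2 : complex.Re (f z2) = complex.Re c0.
  by rewrite -[z2]addr0 hf; congr complex.Re; ring.
have n1 : nc (1 : R[i]) = 1 by rewrite nc1.
have nN1 : nc (-1 : R[i]) = 1 by rewrite ncN nc1.
have nNi : nc (- 'i : R[i]) = 1 by rewrite ncN nc_i.
have K1 := key _ n1; have K2 := key _ nN1; have K3 := key _ nc_i; have K4 := key _ nNi.
have E1 := ex _ n1; have E2 := ex _ nN1; have E3 := ex _ nc_i; have E4 := ex _ nNi.
(* Over the directions 1, -1, i, -i the linear terms of f cancel in pairs and the quadratic ones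
   because 1 + i^2 = 0, whereas |z|^2 gains t^2 on average. *)
have sumN : nc (z2 + t%:C * 1) ^+ 2 + nc (z2 + t%:C * -1) ^+ 2 + nc (z2 + t%:C * 'i) ^+ 2 + nc (z2 + t%:C * - 'i) ^+ 2
    = 4 * nc z2 ^+ 2 + 4 * t ^+ 2.
  by rewrite !nc_sqr !(cReD, cImD, cReM, cImM, cReN, cImN) /=; ring.
have sumE : complex.Re (c0 + c1 * (t%:C * 1) + c2 * (t%:C * 1) ^+ 2) + complex.Re (c0 + c1 * (t%:C * -1) + c2 * (t%:C * -1) ^+ 2)
   + complex.Re (c0 + c1 * (t%:C * 'i) + c2 * (t%:C * 'i) ^+ 2) + complex.Re (c0 + c1 * (t%:C * - 'i) + c2 * (t%:C * - 'i) ^+ 2) = 4 * complex.Re c0.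
  rewrite -!cReD; have -> : c0 + c1 * (t%:C * 1) + c2 * (t%:C * 1) ^+ 2 + (c0 + c1 * (t%:C * -1) + c2 * (t%:C * -1) ^+ 2) +
      (c0 + c1 * (t%:C * 'i) + c2 * (t%:C * 'i) ^+ 2) + (c0 + c1 * (t%:C * - 'i) + c2 * (t%:C * - 'i) ^+ 2) =
      c0 + c0 + c0 + c0 + 2 * c2 * t%:C ^+ 2 * (1 + 'i ^+ 2) by ring.
  by rewrite sqr_i subrr mulr0 addr0 !cReD; ring.
have fin : t ^+ 3 * M < k * t ^+ 2.
  rewrite exprSr -mulrA mulrC ltr_pM2r ?exprn_gt0 //.
  have : t * (M + 1) <= k / 2.
    rewrite -(ler_pM2r M1) in t3; apply: (le_trans t3).
    by rewrite le_eqVlt; apply/orP; left; apply/eqP; field; rewrite lt0r_neq0.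
  nra.
rewrite /v in K1 K2 K3 K4; rewrite fz2 in K1 K2 K3 K4.
have : k * (4 * nc z2 ^+ 2 + 4 * t ^+ 2) = 4 * (k * nc z2 ^+ 2) + 4 * (k * t ^+ 2) by ring.
rewrite -sumN !mulrDr => hs.
lra.
Qed.

End taylor.

(** * Comparison of numbers of zeros and removal of zeros *)

Section rouche.
Context {R : realType}.
Implicit Types (f g : R[i] -> R[i]) (a b z h : R[i]).

Definition rootpoly (s : seq R[i]) z : R[i] := \prod_(b <- s) (z - b).

Lemma rootpoly_neq0 (s : seq R[i]) z : z \notin s -> rootpoly s z != 0.
Proof.
move=> zs; rewrite /rootpoly prodf_seq_neq0; apply/allP => b bs /=.
by rewrite subr_eq0; apply: contra zs => /eqP ->.
Qed.

(* If s were longer than t by n, apply the minimum principle to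
   z^n prod_t (r^2 - b^* z) H / (K prod_s (r^2 - b^* z)), which vanishes at 0. On |z| = r one has
   r^2 - b^* z = z (z - b)^*, so its real part there has the sign of the last hypothesis. *)
Lemma rouche_le (r : R) (s t : seq R[i]) (H K : R[i] -> R[i]) : 0 < r ->
  (forall b, b \in s -> nc b < r) -> (forall b, b \in t -> nc b < r) ->
  (forall z, nc z <= r -> taylor2 H z) -> (forall z, nc z <= r -> taylor2 K z) ->
  (forall z, nc z <= r -> K z != 0) ->
  (forall z, nc z = r ->
     0 < complex.Re ((rootpoly s z * H z) * (rootpoly t z * K z)^*)) ->
  (size s <= size t)%N.
Proof.
move=> r0 hs ht tH tK K0 pos; rewrite leqNgt; apply/negP => ts.
pose r2 : R[i] := (r ^+ 2)%:C.
pose refl (u : seq R[i]) z : R[i] := \prod_(b <- u) (r2 - b^* * z).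
have refl_t u z : taylor2 (refl u) z.
  apply: taylor2_prod => b; apply: taylor2B; first exact: taylor2_cst.
  by apply: taylor2M; [exact: taylor2_cst|exact: taylor2_id].
have refl0 z : nc z <= r -> refl s z != 0.
  move=> zr; rewrite /refl prodf_seq_neq0; apply/allP => b bs /=.
  rewrite -nc_gt0; apply: lt_le_trans (nc_lerB _ _).
  rewrite nc_real normrX (gtr0_norm r0) ncM nc_conj subr_gt0 expr2.
  apply: (@le_lt_trans _ _ (nc b * r)); first by rewrite ler_wpM2l ?nc_ge0.
  by rewrite ltr_pM2r // hs.
pose n := (size s - size t)%N; have n0 : (0 < n)%N by rewrite subn_gt0.
pose Phi z := (z ^+ n * refl t z * H z) / (K z * refl s z).
suff : 0 < complex.Re (Phi 0) by rewrite /Phi expr0n (gtn_eqF n0) !mul0r /= ltxx.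
apply: (@min_principle R r) => // z zr.
  apply: taylor2_div.
  - apply: taylor2M; last exact: tH.
    by apply: taylor2M => //; apply: taylor2X; exact: taylor2_id.
  - by apply: taylor2M => //; exact: tK.
  - by rewrite mulf_neq0 ?K0 ?refl0.
have zz : z * z^* = r2 by rewrite mul_conj zr.
have z0 : z != 0 by rewrite -nc_gt0 zr.
have reflE u : refl u z = z ^+ size u * (rootpoly u z)^*.
  rewrite /refl /rootpoly rmorph_prod /=.
  elim: u => [|b u ih]; first by rewrite !big_nil mul1r.
  by rewrite !big_cons ih exprS rmorphB /= -zz; ring.
have zs : z \notin s by apply/negP => /hs; rewrite zr ltxx.
have zt : z \notin t by apply/negP => /ht; rewrite zr ltxx.
have Ps := rootpoly_neq0 zs; have Pt := rootpoly_neq0 zt.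
have Kz : K z != 0 by rewrite K0 // zr.
have -> : Phi z = (rootpoly s z * H z) * (rootpoly t z * K z)^* * ((nc (K z * rootpoly s z)) ^- 2)%:C.
  have -> : (nc (K z * rootpoly s z) ^- 2)%:C = ((K z * rootpoly s z) * (K z * rootpoly s z)^*)^-1.
    by rewrite mul_conj; exact: (fmorphV (real_complex R)).
  rewrite /Phi !reflE !rmorphM /=.
  have -> : z ^+ size s = z ^+ n * z ^+ size t by rewrite -exprD subnK // ltnW.
  have zn : z ^+ n != 0 by rewrite expf_neq0.
  have zt' : z ^+ size t != 0 by rewrite expf_neq0.
  have Psc : (rootpoly s z)^* != 0 by rewrite conjc_eq0.
  have Kc : (K z)^* != 0 by rewrite conjc_eq0.
  by field; rewrite Kz Kc Ps Psc zn zt'.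
rewrite cReM /= mulr0 subr0 mulr_gt0 ?pos // invr_gt0 exprn_gt0 // nc_gt0 mulf_neq0 //.
Qed.

(* Taylor expansions of every order stand in for holomorphy: this class is visibly stable
   under division by z - a at a zero a, without any Cauchy theory. *)
Definition analytic f := forall a, exists c : nat -> R[i], forall n, exists M e : R,
  0 < e /\ forall z, nc (z - a) < e ->
    nc (f z - \sum_(j < n) c j * (z - a) ^+ j) <= M * nc (z - a) ^+ n.

Lemma le0_of_le_mul (x M e : R) : 0 < e -> (forall d, 0 < d -> d < e -> x <= M * d) -> x <= 0.
Proof.
move=> e0 h; rewrite leNgt; apply/negP => x0.
pose d := Num.min (e / 2) (x / (2 * (`|M| + 1))).
have M1 : 0 < `|M| + 1 by rewrite ltr_wpDl.
have d0 : 0 < d by rewrite lt_min !divr_gt0 // mulr_gt0.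
have de : d < e by rewrite /d gt_min; apply/orP; left; lra.
have := h _ d0 de; have d2 : d <= x / (2 * (`|M| + 1)) by rewrite ge_min lexx orbT.
have : M * d <= `|M| * d by rewrite ler_wpM2r ?ler_norm // ltW.
have : d * (`|M| + 1) <= x / 2.
  rewrite -(ler_pM2r M1) in d2; apply: (le_trans d2).
  by rewrite le_eqVlt; apply/orP; left; apply/eqP; field; rewrite lt0r_neq0.
nra.
Qed.

Lemma analytic_taylor2 f a : analytic f -> taylor2 f a.
Proof.
move=> /(_ a) [c hc]; have [M [e [e0 hM]]] := hc 3%N.
exists (c 0%N), (c 1%N), (c 2%N).
pose p h := c 0%N + c 1%N * h + c 2%N * h ^+ 2.
have pE h : \sum_(j < 3) c j * h ^+ j = p h.
  by rewrite !big_ord_recl big_ord0 /= /bump /= /p; ring.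
exists (fun h => (f (a + h) - p h) / h ^+ 3); split.
  exists `|M|, e; split => // h he.
  have := hM (a + h); rewrite addrAC subrr add0r pE => /(_ he) hb.
  have [->|h0] := eqVneq h 0; first by rewrite expr0n invr0 mulr0 nc0.
  rewrite ncM ncV ncX ler_pdivrMr ?exprn_gt0 ?nc_gt0 //; apply: (le_trans hb).
  by rewrite ler_wpM2r ?exprn_ge0 ?nc_ge0 // ler_norm.
move=> h; have [->|h0] := eqVneq h 0.
  have := hM a; rewrite subrr pE nc0 expr0n /= mulr0 => /(_ e0).
  rewrite addr0 !mulr0 !addr0 /p => h0.
  have : nc (f a - p 0) == 0 by rewrite eq_le nc_ge0 andbT.
  by rewrite nc_eq0 subr_eq0 => /eqP ->; rewrite /p; ring.
by rewrite -/(p h); field.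
Qed.

(** At a the coefficients of the quotient are those of f shifted by one. At any other point the
    expansion of f is divided by the nonvanishing linear factor, so that expansions are again found
    point by point. *)
Lemma analytic_div f a : analytic f -> f a = 0 ->
  exists2 g, analytic g & forall z, f z = (z - a) * g z.
Proof.
move=> af fa.
have [c hc] := af a.
have c0 : c 0%N = 0.
  have [M [e [e0 h]]] := hc 1%N.
  have := h a; rewrite subrr nc0 big_ord_recl big_ord0 /= expr0 fa => /(_ e0).
  rewrite mulr1 addr0 sub0r expr0n /= mulr0 => h0; apply/eqP.
  by rewrite -nc_eq0 -ncN eq_le nc_ge0 h0.
pose g z := if z == a then c 1%N else f z / (z - a).
have fg z : f z = (z - a) * g z.
  rewrite /g; case: eqVneq => [->|za]; first by rewrite subrr mul0r.
  by rewrite mulrC divfK // subr_eq0.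
exists g => // b; have [->|ba] := eqVneq b a.
  exists (fun j => c j.+1) => n; have [M [e [e0 h]]] := hc n.+1.
  have [M1 [e1 [e10 h1]]] := hc 2%N.
  exists (Num.max M (nc (c 1%N))), e; split => // z ze.
  have [->|za] := eqVneq z a.
    rewrite subrr /g eqxx; case: n {h} => [|n]; last first.
      rewrite big_ord_recl big1 => [|j _]; last by rewrite expr0n mulr0.
      by rewrite expr0 mulr1 addr0 subrr nc0 mulr_ge0 // ?le_max ?nc_ge0 ?orbT // exprn_ge0 // nc_ge0.
    by rewrite big_ord0 subr0 expr0 mulr1; rewrite le_max lexx orbT.
  have zn : 0 < nc (z - a) by rewrite nc_gt0 subr_eq0.
  rewrite -(ler_pM2l zn) -ncM mulrBr -fg.
  have -> : (z - a) * (\sum_(j < n) c j.+1 * (z - a) ^+ j) = \sum_(j < n.+1) c j * (z - a) ^+ j.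
    rewrite big_ord_recl c0 mul0r add0r mulr_sumr; apply: eq_bigr => j _.
    by rewrite lift0 exprS; ring.
  rewrite mulrCA -exprS; apply: (le_trans (h _ ze)).
  by rewrite ler_wpM2r ?exprn_ge0 ?nc_ge0 // le_max lexx.
have [cb hb] := af b.
pose w := b - a; have w0 : w != 0 by rewrite subr_eq0.
(* Since z - a = w + (z - b), the coefficients at b have to satisfy w d_0 = cb_0 and w d_(j+1) + d_j
   = cb_(j+1). *)
pose d := fix d j := match j with 0%N => cb 0%N / w | j'.+1 => (cb j'.+1 - d j') / w end.
have dS j : w * d j.+1 + d j = cb j.+1 by rewrite /=; field.
have d00 : w * d 0%N = cb 0%N by rewrite /=; field.
clearbody d.
exists d => n; have [M [e [e0 h]]] := hb n.
have wp : 0 < nc w by rewrite nc_gt0.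
exists ((Num.max M 0 + nc (d n.-1)) / (nc w / 2)), (Num.min e (nc w / 2)).
rewrite lt_min e0 divr_gt0 //; split => // z; rewrite lt_min => /andP[z1 z2].
have za : nc w / 2 <= nc (z - a).
  have -> : z - a = w - (b - z) by rewrite /w; ring.
  have := nc_lerB w (b - z); rewrite (ncC b) => ?; lra.
have zap : 0 < nc (z - a) by rewrite (lt_le_trans _ za) // divr_gt0.
have key : (z - a) * (\sum_(j < n) d j * (z - b) ^+ j) =
    \sum_(j < n) cb j * (z - b) ^+ j + (if n is n'.+1 then d n' * (z - b) ^+ n else 0).
  have zE : z - a = (z - b) + w by rewrite /w; ring.
  elim: n {h} => [|n ih]; first by rewrite !big_ord0 mulr0 addr0.
  rewrite big_ord_recr /= mulrDr ih big_ord_recr /= zE; case: n {ih} => [|n].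
    by rewrite big_ord0 -d00; ring.
  by rewrite -(dS n) !exprS; ring.
rewrite -(ler_pM2l zap) -ncM mulrBr -fg key opprD addrA.
apply: (le_trans (ncB _ _)).
have b1 := h _ z1.
have b2 : nc (if n is n'.+1 then d n' * (z - b) ^+ n else 0) <= nc (d n.-1) * nc (z - b) ^+ n.
  by case: n {h key b1} => [|n]; rewrite ?nc0 ?mulr_ge0 ?exprn_ge0 ?nc_ge0 // ncM ncX.
have N0 := exprn_ge0 n (nc_ge0 (z - b)).
have b3 : M * nc (z - b) ^+ n <= Num.max M 0 * nc (z - b) ^+ n by rewrite ler_wpM2r // le_max lexx.
apply: (@le_trans _ _ ((Num.max M 0 + nc (d n.-1)) * nc (z - b) ^+ n)); first lra.
set A := Num.max M 0 + _; have A0 : 0 <= A by rewrite addr_ge0 ?nc_ge0 // le_max lexx orbT.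
rewrite mulrCA mulrA -mulrA mulrA.
have -> : A / (nc w / 2) * nc (z - a) * nc (z - b) ^+ n = (A * nc (z - b) ^+ n) * (nc (z - a) / (nc w / 2)) by ring.
by rewrite ler_peMr ?mulr_ge0 // ler_pdivlMr ?mul1r // divr_gt0.
Qed.

(** Multiplicity expressed by size. It follows from [zero_of_order] with no more than continuity of
    the cofactor, and it can be tracked when linear factors are divided out. *)
Definition has_order f a (m : nat) := exists k K e : R, [/\ 0 < k, 0 < e &
  forall z, nc (z - a) < e -> k * nc (z - a) ^+ m <= nc (f z) <= K * nc (z - a) ^+ m].

Lemma has_order0 f a : has_order f a 0 -> f a != 0.
Proof.
move=> [k [K [e [k0 e0 h]]]]; have := h a; rewrite subrr nc0 expr0 mulr1 => /(_ e0) /andP[h1 _].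
by rewrite -nc_gt0 (lt_le_trans k0).
Qed.

Lemma has_orderS f a m : has_order f a m.+1 -> f a = 0.
Proof.
move=> [k [K [e [k0 e0 h]]]]; have := h a; rewrite subrr nc0 expr0n /= !mulr0 => /(_ e0) /andP[_ h1].
by apply/eqP; rewrite -nc_eq0 eq_le nc_ge0 h1.
Qed.

(** Near a point a other than b the factor z - b lies between two positive constants, so only k and
    K change. At a = b the exponent drops by one for z <> b at once, and the value at b itself is
    recovered from the points b + t by continuity of g. *)
Lemma has_order_div f g b a m : analytic g -> (forall z, f z = (z - b) * g z) ->
  has_order f a m -> (b == a -> 0 < m)%N -> has_order g a (m - (b == a)).
Proof.
move=> ag fg hf; have [ab|ba] := eqVneq b a; last first.
  move=> _; rewrite subn0; move: hf => [k [K [e [k0 e0 h]]]].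
  have w0 : 0 < nc (a - b) by rewrite nc_gt0 subr_eq0 eq_sym.
  set w := nc (a - b) in w0.
  exists (k / (2 * w)), (K / (w / 2)), (Num.min e (w / 2)); split.
  - by rewrite divr_gt0 // mulr_gt0.
  - by rewrite lt_min e0 divr_gt0.
  move=> z; rewrite lt_min => /andP[z1 z2].
  have /andP[h1 h2] := h _ z1.
  have zb1 : w / 2 <= nc (z - b).
    have -> : z - b = (a - b) - (a - z) by ring.
    have := nc_lerB (a - b) (a - z); rewrite (ncC a z) -/w; lra.
  have zb2 : nc (z - b) <= 2 * w.
    have := ncD (a - b) (z - a); rewrite -/w (_ : a - b + (z - a) = z - b); last by ring.
    lra.
  have zbp : 0 < nc (z - b) by rewrite (lt_le_trans _ zb1) // divr_gt0.
  have gz : nc (g z) = nc (f z) / nc (z - b) by rewrite fg ncM mulrC mulKf // lt0r_neq0.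
  have N0 := exprn_ge0 m (nc_ge0 (z - a)).
  rewrite gz; apply/andP; split.
    rewrite ler_pdivlMr // (le_trans _ h1) //.
    have -> : k / (2 * w) * nc (z - a) ^+ m * nc (z - b) = (k * nc (z - a) ^+ m) * (nc (z - b) / (2 * w)) by ring.
    by rewrite ler_piMr ?mulr_ge0 ?(ltW k0) // ler_pdivrMr ?mul1r // mulr_gt0.
  rewrite ler_pdivrMr // (le_trans h2) //.
  have K0 : 0 <= K * nc (z - a) ^+ m by rewrite (le_trans _ h2) ?nc_ge0.
  have -> : K / (w / 2) * nc (z - a) ^+ m * nc (z - b) = (K * nc (z - a) ^+ m) * (nc (z - b) / (w / 2)) by ring.
  by rewrite ler_peMr // ler_pdivlMr ?mul1r // divr_gt0.
subst a; move=> /(_ isT); case: m hf => [//|m] [k [K [e [k0 e0 h]]]] _; rewrite subn1 /=.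
have gP z : nc (z - b) < e -> z != b -> k * nc (z - b) ^+ m <= nc (g z) <= K * nc (z - b) ^+ m.
  move=> ze zb; have zp : 0 < nc (z - b) by rewrite nc_gt0 subr_eq0.
  have := h _ ze; rewrite fg ncM !exprS => /andP[h1 h2].
  by apply/andP; split; rewrite -(ler_pM2l zp) // mulrCA.
have [M [d [d0 hM]]] : exists M d : R, 0 < d /\ forall z, nc (z - b) < d -> nc (g z - g b) <= M * nc (z - b).
  have [c hc] := ag b; have [M [d [d0 hd]]] := hc 1%N; exists M, d; split => // z zd.
  have cb : c 0%N = g b.
    have := hd b; rewrite subrr nc0 big_ord_recl big_ord0 /= expr0 expr0n /= mulr0 mulr1 addr0 => /(_ d0) h0.
    by apply/eqP; rewrite eq_sym -subr_eq0 -nc_eq0 eq_le nc_ge0 h0.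
  by have := hd z zd; rewrite big_ord_recl big_ord0 /= expr0 expr1 mulr1 addr0 cb.
have pt (t : R) : 0 < t -> nc ((b + t%:C) - b) = t /\ b + t%:C != b.
  move=> t0; rewrite addrAC subrr add0r nc_real gtr0_norm //; split => //.
  by rewrite -subr_eq0 addrAC subrr add0r -nc_eq0 nc_real gtr0_norm // lt0r_neq0.
(* If the remaining order is 0, g b has to be bounded away from 0; otherwise it has to vanish. *)
case: m h gP => [|m] h gP.
  have gb : k <= nc (g b).
    rewrite -subr_le0; apply: (@le0_of_le_mul _ M (Num.min e d)); first by rewrite lt_min e0 d0.
    move=> t t0; rewrite lt_min => /andP[te td]; have [n1 n2] := pt t t0.
    have := gP (b + t%:C); rewrite n1 => /(_ te n2); rewrite expr0 mulr1 => /andP[g1 _].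
    have := hM (b + t%:C); rewrite n1 => /(_ td) g2.
    have g4 := ncD (g (b + t%:C) - g b) (g b); rewrite subrK in g4; lra.
  exists k, (Num.max K (nc (g b))), e; split => // z ze; rewrite expr0 !mulr1.
  have [->|zb] := eqVneq z b; first by rewrite gb le_max lexx orbT.
  by have := gP _ ze zb; rewrite expr0 !mulr1 => /andP[-> g2]; rewrite le_max g2.
have gb : nc (g b) <= 0.
  apply: (@le0_of_le_mul _ (`|K| + M) (Num.min 1 (Num.min e d))); first by rewrite !lt_min ltr01 e0 d0.
  move=> t t0; rewrite !lt_min => /and3P[t1 te td]; have [n1 n2] := pt t t0.
  have := gP (b + t%:C); rewrite n1 => /(_ te n2) => /andP[_ g1].
  have := hM (b + t%:C); rewrite n1 => /(_ td) g2.
  have g3 : nc (g b) <= nc (g (b + t%:C)) + nc (g (b + t%:C) - g b).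
    have E : g (b + t%:C) - (g (b + t%:C) - g b) = g b by ring.
    by have := ncB (g (b + t%:C)) (g (b + t%:C) - g b); rewrite E.
  have g4 : K * t ^+ m.+1 <= `|K| * t.
    rewrite (le_trans (ler_wpM2r _ (ler_norm K))) ?exprn_ge0 ?(ltW t0) //.
    by rewrite ler_wpM2l // exprS ler_piMr ?(ltW t0) // exprn_ile1 // ltW.
  by rewrite mulrDl; lra.
exists k, K, e; split => // z ze; have [->|zb] := eqVneq z b; last exact: gP.
by rewrite subrr nc0 expr0n /= !mulr0 nc_ge0 gb.
Qed.

(** The list s need not contain all zeros. The orders left over are recorded, so that the cofactor
    is known not to vanish at a point once s exhausts the multiplicity there. *)
Lemma analytic_factor f (s : seq R[i]) (m : R[i] -> nat) : analytic f ->
  (forall a, has_order f a (m a)) -> (forall a, count_mem a s <= m a)%N ->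
  exists g, [/\ analytic g, forall z, f z = rootpoly s z * g z &
    forall a, has_order g a (m a - count_mem a s)].
Proof.
elim: s f m => [|b s ih] f m af fo fs.
  exists f; split => // [z|a]; first by rewrite /rootpoly big_nil mul1r.
  by rewrite subn0.
have mb : (0 < m b)%N by rewrite (leq_trans _ (fs b)) //= eqxx.
have fb : f b = 0 by have := fo b; case: (m b) mb => // n _ /has_orderS.
have [g ag fg] := analytic_div af fb.
have [] := ih g (fun a => m a - (b == a))%N ag.
- by move=> a; apply: has_order_div (fo a) _ => // /eqP <-.
- move=> a; have h := fs a; rewrite -(leq_add2l (b == a)) subnKC //.
  exact: leq_trans (leq_addr _ _) h.
move=> h [ah gh oh]; exists h; split => // [z|a]; last by have := oh a; rewrite -subnDA.
by rewrite fg gh /rootpoly big_cons mulrA.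
Qed.

End rouche.

Section count.
Context {R : realType}.
Implicit Types (f g : R[i] -> R[i]) (a b z h : R[i]).

Local Notation K := (R[i] : numFieldType).

(** The radius of a ball of R[i] is itself an element of R[i]; being positive it is real. *)
Lemma near_nc (a : K) (P : K -> Prop) : (\forall z \near a, P z) ->
  exists2 e : R, 0 < e & forall z, nc (z - a) < e -> P z.
Proof.
move=> /nbhs_ballP[e /= e0 he].
have eE : e = (complex.Re e)%:C by rewrite RRe_real // gtr0_real.
exists (complex.Re e); first by rewrite -ltcR -eE.
by move=> z hz; apply: he; rewrite /ball /= normc_nc ncC eE ltcR.
Qed.

Lemma zero_of_order_has_order f a m : zero_of_order f a m -> has_order f a m.
Proof.
move=> [g [/nbhs_singleton dg g0 hf]].
have cg : {for a, continuous g} by apply: differentiable_continuous; apply/derivable1_diffP.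
have gp : 0 < nc (g a) / 2 by rewrite divr_gt0 // nc_gt0.
have [e e0 he] := near_nc hf.
have gpC : 0 < (nc (g a) / 2)%:C by rewrite ltcR.
have [d d0 hd] := near_nc ((@cvgrPdist_lt _ _ _ _ _ g (g a)).1 cg _ gpC).
exists (nc (g a) / 2), (2 * nc (g a)), (Num.min e d); split => //; first by rewrite lt_min e0 d0.
move=> z; rewrite lt_min => /andP[z1 z2].
have := hd _ z2; rewrite normc_nc ltcR => h.
rewrite he // ncM ncX.
have N0 := exprn_ge0 m (nc_ge0 (z - a)).
have h1 := nc_lerB (g a) (g a - g z); have h2 := ncB (g a) (g a - g z).
have E : g a - (g a - g z) = g z by ring.
rewrite E in h1 h2.
rewrite mulrC; apply/andP; split.
  by apply: ler_wpM2l => //; lra.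
by rewrite [leRHS]mulrC; apply: ler_wpM2l => //; lra.
Qed.

Lemma card_size_le (A : set nat) m (s : seq nat) : (A #= `I_m)%card -> uniq s ->
  (forall k, k \in s -> A k) -> (size s <= m)%N.
Proof.
move=> Am us sA; rewrite -(card_fset_set Am); apply: uniq_leq_size => // k /sA Ak.
by rewrite in_fset_set ?inE //; apply/finite_setP; exists m.
Qed.

Lemma card_size_ge (A : set nat) m (s : seq nat) : (A #= `I_m)%card ->
  (forall k, A k -> k \in s) -> (m <= size s)%N.
Proof.
move=> Am As; rewrite -(card_fset_set Am); apply: uniq_leq_size.
  exact: finmap.fset_uniq.
move=> k; rewrite in_fset_set; last by apply/finite_setP; exists m.
by rewrite inE => /As.
Qed.

(** [rouche_le] is used in both directions. With the [mu j] on the smaller side the cofactor of f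
    may vanish, so the size of t bounds how many [mu j] lie inside; this yields a first index
    outside the disc. Only then is the cofactor of f known to be free of zeros in the disc, and the
    roles can be exchanged. *)
Lemma count_zeros (f g k : R[i] -> R[i]) (r : R) (mu : nat -> R[i]) (t : seq R[i]) :
  0 < r -> analytic f -> numbered_zeros f mu ->
  (forall z, nc z = r -> 0 < complex.Re (f z * (g z)^*)) ->
  (forall z, g z = rootpoly t z * k z) -> (forall z, nc z <= r -> taylor2 k z) ->
  (forall z, nc z <= r -> k z != 0) -> (forall b, b \in t -> nc b < r) ->
  (forall j, (1 <= j <= size t)%N -> nc (mu j) < r) /\
  (forall j, (size t < j)%N -> r <= nc (mu j)).
Proof.
move=> r0 af [mono zo] pos gE tk k0 ht.
have mono' i j : (1 <= i)%N -> (i <= j)%N -> nc (mu i) <= nc (mu j).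
  move=> i1; elim: j => [|j ih].
    by rewrite leqn0 => /eqP i0; rewrite i0 in i1.
  rewrite leq_eqVlt => /predU1P[-> //|]; rewrite ltnS => ij.
  by rewrite (le_trans (ih ij)) // -normr_le_nc mono // (leq_trans i1).
have [m hm] : exists m : R[i] -> nat, forall a, has_order f a (m a) /\
    ([set j : nat | (1 <= j)%N /\ mu j = a] #= `I_(m a))%card.
  have h a : exists n, has_order f a n /\ ([set j : nat | (1 <= j)%N /\ mu j = a] #= `I_n)%card.
    by have [n /zero_of_order_has_order h1 h2] := zo a; exists n.
  by exists (fun a => projT1 (cid (h a))) => a; exact: (projT2 (cid (h a))).
pose s n := [seq mu j | j <- iota 1 n].
have cs n a : count_mem a (s n) = size [seq j <- iota 1 n | mu j == a].
  by rewrite count_map size_filter; apply: eq_count.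
have cle n a : (count_mem a (s n) <= m a)%N.
  rewrite cs; apply: card_size_le (hm a).2 _ _; first by rewrite filter_uniq // iota_uniq.
  by move=> j; rewrite mem_filter mem_iota => /andP[/eqP ja /andP[j1 _]].
have sr n : (forall j, (1 <= j <= n)%N -> nc (mu j) < r) -> forall b, b \in s n -> nc b < r.
  move=> hn b /mapP[j]; rewrite mem_iota add1n ltnS => jn ->; exact: hn.
have stepA n : (forall j, (1 <= j <= n)%N -> nc (mu j) < r) -> (n <= size t)%N.
  move=> hn.
  have [h [ah fh oh]] := analytic_factor af (fun a => (hm a).1) (cle n).
  rewrite -[n](size_iota 1) -(size_map mu).
  apply: (rouche_le r0 (sr _ hn) ht (fun z _ => analytic_taylor2 z ah) tk k0) => z zr.
  by rewrite -fh -gE pos.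
(* Without such an index every [mu j] would lie in the disc, against [stepA] at n = size t + 1. *)
have [n hn nn] : exists2 n, (forall j, (1 <= j <= n)%N -> nc (mu j) < r) & r <= nc (mu n.+1).
  apply: contrapT => hno.
  have all_n n : forall j, (1 <= j <= n)%N -> nc (mu j) < r.
    elim: n => [|n ih] j /andP[j1 jn]; first by have := leq_trans j1 jn.
    move: jn; rewrite leq_eqVlt => /predU1P[->|jn]; last by apply: ih; rewrite j1.
    by rewrite ltNge; apply/negP => hr; apply: hno; exists n.
  by have := stepA _ (all_n (size t).+1); rewrite ltnn.
have hgt j : (n < j)%N -> r <= nc (mu j) by move=> nj; apply: (le_trans nn); apply: mono'.
have [h [ah fh oh]] := analytic_factor af (fun a => (hm a).1) (cle n).
have fc z : nc z = r -> f z != 0.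
  by move=> zr; apply/eqP => fz; have := pos _ zr; rewrite fz mul0r ltxx.
(* On the circle f itself does not vanish. Inside, every copy of z in the numbering has index at
   most n and has been divided out, so the order left is 0. *)
have h0 z : nc z <= r -> h z != 0.
  rewrite le_eqVlt => /predU1P[zr|zr].
    by have := fc _ zr; rewrite fh mulf_eq0 negb_or => /andP[].
  apply: has_order0; have := oh z.
  suff -> : count_mem z (s n) = m z by rewrite subnn.
  apply/eqP; rewrite eqn_leq cle cs /=.
  apply: card_size_ge (hm z).2 _ => j [j1 jz].
  rewrite mem_filter jz eqxx mem_iota j1 add1n ltnS leqNgt /=.
  by apply/negP => /hgt; rewrite jz leNgt zr.
have stepB : (size t <= n)%N.
  rewrite -[n](size_iota 1) -(size_map mu).
  apply: (rouche_le r0 ht (sr _ hn) tk (fun z _ => analytic_taylor2 z ah) h0) => z zr.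
  rewrite -gE -fh; have := pos _ zr; rewrite !cReM; case: (f z) (g z) => [u v] [x y] /=; lra.
have -> : size t = n by apply/eqP; rewrite eqn_leq stepB stepA.
by [].
Qed.

End count.

(** * The Volterra equation *)

Section neumann.
Context {R : realType}.
Implicit Types (u v g : R -> R[i]).

Lemma ler_limit (x y c : R) : (forall n : nat, x <= y + c * (3 / 4) ^+ n) -> x <= y.
Proof.
move=> h; rewrite leNgt; apply/negP => xy.
have h1 : (fun n : nat => c * (3 / 4 : R) ^+ n) @ \oo --> (0 : R).
  rewrite -[X in _ --> X](mulr0 c); apply: cvgM; first exact: cvg_cst.
  by apply: cvg_expr; rewrite ger0_norm; lra.
have d0 : 0 < x - y by rewrite subr_gt0.
have [N _ hN] := (@cvgrPdist_lt _ _ _ _ _ (fun n : nat => c * (3 / 4 : R) ^+ n) 0).1 h1 _ d0.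
have := hN N (leqnn N); rewrite /= sub0r normrN => h2.
have := h N; have := ler_norm (c * (3 / 4) ^+ N); lra.
Qed.

(** The map a -> c + 3a/4 has the fixed point 4c. Starting from the a priori bound C, each use of
    the equation multiplies the excess over 4c by 3/4, so C disappears in the limit. The operator is
    only ever evaluated at v. *)
Lemma gronwall (D : set R) (w : R -> R) (T : (R -> R[i]) -> R -> R[i]) (c C : R) v g :
  (forall x, D x -> 0 <= w x) ->
  (forall a, 0 <= a -> (forall x, D x -> nc (v x) <= a * w x) ->
     forall x, D x -> nc (T v x) <= (3 / 4 * a) * w x) ->
  0 <= c -> 0 <= C ->
  (forall x, D x -> nc (v x) <= C * w x) ->
  (forall x, D x -> nc (g x) <= c * w x) ->
  (forall x, D x -> v x = g x + T v x) ->
  forall x, D x -> nc (v x) <= 4 * c * w x.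
Proof.
move=> w0 hT c0 C0 vC gc vE.
have key n : forall x, D x -> nc (v x) <= (4 * c + C * (3 / 4) ^+ n) * w x.
  elim: n => [|n ih] x Dx.
    rewrite expr0 mulr1 mulrDl (le_trans (vC _ Dx)) // lerDr !mulr_ge0 // w0 //.
  have a0 : 0 <= 4 * c + C * (3 / 4) ^+ n.
    have : 0 <= (3 / 4 : R) ^+ n by rewrite exprn_ge0 //; lra.
    nra.
  rewrite vE // (le_trans (ncD _ _)) // (le_trans (lerD (gc _ Dx) (hT _ a0 ih _ Dx))) //.
  by rewrite -mulrDl ler_wpM2r ?w0 // exprS; lra.
move=> x Dx; apply: (@ler_limit _ _ (C * w x)) => n.
by apply: (le_trans (key n x Dx)); rewrite mulrDl lerD2l mulrAC.
Qed.

Lemma geometric_series_cvg (a : nat -> R) (C : R) : (forall n, `|a n| <= C * (3 / 4) ^+ n) ->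
  exists l : R, (series a @ \oo --> l) /\ forall n, `|l - series a n| <= 4 * C * (3 / 4) ^+ n.
Proof.
move=> ha.
have C0 : 0 <= C by have := ha 0%N; rewrite expr0 mulr1; exact: le_trans.
have ca : cvgn (series a).
  apply: normed_cvg.
  apply: (@series_le_cvg _ (fun n => `|a n|) (fun n => C * (3 / 4) ^+ n)) => //.
    by move=> n; rewrite mulr_ge0 // exprn_ge0 //; lra.
  by apply: is_cvg_geometric_series; rewrite ger0_norm; lra.
exists (limn (series a)); split => // n.
pose s (m : nat) : R := series a m.
have sS m : s m.+1 = s m + a m by rewrite /s seriesSr.
have tail (m : nat) : `|s (n + m)%N - s n| <= 4 * C * (3 / 4) ^+ n.
  have : `|s (n + m)%N - s n| <= 4 * C * (3 / 4) ^+ n - 4 * C * (3 / 4) ^+ (n + m).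
    elim: m => [|m ih]; first by rewrite addn0 !subrr normr0.
    rewrite addnS sS.
    have -> : s (n + m)%N + a (n + m)%N - s n = (s (n + m)%N - s n) + a (n + m)%N by ring.
    apply: (le_trans (ler_normD _ _)); have := ha (n + m)%N; rewrite exprS; lra.
  move/le_trans; apply; rewrite gerBl mulr_ge0 ?mulr_ge0 // exprn_ge0 //; lra.
have hc : (fun m => `|series a (n + m) - series a n|) @ \oo --> `|limn (series a) - series a n|.
  apply: cvg_norm; apply: cvgB; last exact: cvg_cst.
  rewrite (_ : (fun m : nat => _) = (fun m : nat => series a (m + n)%N)).
    by rewrite (cvg_shiftn n (series a)).
  by apply/funext => m; rewrite addnC.
rewrite -(cvg_lim _ hc) //; apply: limr_le; first by apply/cvg_ex; eexists; exact: hc.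
by apply: nearW => m; exact: tail.
Qed.

(** The solution is the pointwise limit of the sums of the iterates of T on g. Additivity is asked
    only for functions bounded by a multiple of w, because integral operators are additive only on
    integrable functions. The constant is 8c and not 4c because real and imaginary parts are summed
    separately. *)
Lemma neumann_series (D : set R) (w : R -> R) (T : (R -> R[i]) -> R -> R[i]) (c : R) g :
  measurable D -> (forall x, D x -> 0 <= w x) ->
  (forall v a, cmfun v -> 0 <= a -> (forall x, D x -> nc (v x) <= a * w x) ->
     cmfun (T v) /\ forall x, D x -> nc (T v x) <= (3 / 4 * a) * w x) ->
  (forall u v a b, cmfun u -> cmfun v -> (forall x, D x -> nc (u x) <= a * w x) ->
     (forall x, D x -> nc (v x) <= b * w x) ->
     forall x, D x -> T (fun x => u x + v x) x = T u x + T v x) ->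
  (forall u v, (forall x, D x -> u x = v x) -> forall x, D x -> T u x = T v x) ->
  0 <= c -> cmfun g -> (forall x, D x -> nc (g x) <= c * w x) ->
  exists v, [/\ cmfun v, forall x, D x -> nc (v x) <= 8 * c * w x &
    forall x, D x -> v x = g x + T v x].
Proof.
move=> mD w0 hT linT extT c0 mg gc.
(* The estimates on T hold on D only; the iterates are cut off so that the series converges at every
   point and its sum is measurable on the whole line. *)
pose chi x : R[i] := (\1_D x)%:C.
have chiD x : D x -> chi x = 1 by move=> Dx; rewrite /chi indicE mem_set.
have chiN x : ~ D x -> chi x = 0 by move=> Dx; rewrite /chi indicE memNset.
have mchi : cmfun chi by apply: cmfun_real.
pose u := fix u n := if n is n'.+1 then fun x => chi x * T (u n') x else fun x => chi x * g x.
have hu n : cmfun (u n) /\ forall x, D x -> nc (u n x) <= (c * (3 / 4) ^+ n) * w x.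
  elim: n => [|n [ih1 ih2]] /=.
    by split; [exact: cmfunM|move=> x Dx; rewrite chiD // mul1r expr0 mulr1 gc].
  have a0 : 0 <= c * (3 / 4) ^+ n by rewrite mulr_ge0 // exprn_ge0 //; lra.
  have [h1 h2] := hT _ _ ih1 a0 ih2.
  split; first exact: cmfunM.
  by move=> x Dx; rewrite chiD // mul1r (le_trans (h2 _ Dx)) // exprS mulrCA.
have u0 n x : ~ D x -> u n x = 0 by move=> Dx; case: n => [|n] /=; rewrite chiN // mul0r.
have wn x n : nc (u n x) <= (c * Num.max 0 (w x)) * (3 / 4) ^+ n.
  have [Dx|Dx] := pselect (D x).
    by rewrite max_r ?w0 // mulrAC; exact: (hu n).2.
  by rewrite u0 // nc0 !mulr_ge0 // ?le_max ?lexx // exprn_ge0 //; lra.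
have hRe x : exists l : R, series (fun n => complex.Re (u n x)) @ \oo --> l /\
    forall n, `|l - series (fun n => complex.Re (u n x)) n| <= 4 * (c * Num.max 0 (w x)) * (3 / 4) ^+ n.
  by apply: geometric_series_cvg => n; exact: le_trans (nc_Re _) (wn x n).
have hIm x : exists l : R, series (fun n => complex.Im (u n x)) @ \oo --> l /\
    forall n, `|l - series (fun n => complex.Im (u n x)) n| <= 4 * (c * Num.max 0 (w x)) * (3 / 4) ^+ n.
  by apply: geometric_series_cvg => n; exact: le_trans (nc_Im _) (wn x n).
have [vr hvr] := choice hRe; have [vi hvi] := choice hIm.
pose v x := vr x +i* vi x; pose s n x := \sum_(0 <= j < n) u j x.
have sRe n x : complex.Re (s n x) = series (fun n => complex.Re (u n x)) n.
  rewrite /s /series /=; elim: n => [|n ih]; first by rewrite !big_geq.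
  by rewrite !big_nat_recr //= cReD ih.
have sIm n x : complex.Im (s n x) = series (fun n => complex.Im (u n x)) n.
  rewrite /s /series /=; elim: n => [|n ih]; first by rewrite !big_geq.
  by rewrite !big_nat_recr //= cImD ih.
have ms n : cmfun (s n).
  by apply: cmfun_sum => j; exact: (hu j).1.
have mv : cmfun v.
  split => /=.
    apply: (@measurable_fun_cvg _ _ _ setT (fun n x => complex.Re (s n x))) => // [n|x _].
      exact: (ms n).1.
    by under eq_fun do rewrite sRe; exact: (hvr x).1.
  apply: (@measurable_fun_cvg _ _ _ setT (fun n x => complex.Im (s n x))) => // [n|x _].
    exact: (ms n).2.
  by under eq_fun do rewrite sIm; exact: (hvi x).1.
have vs n x : D x -> nc (v x - s n x) <= (8 * c * (3 / 4) ^+ n) * w x.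
  move=> Dx; apply: (le_trans (nc_ReIm _)); rewrite cReB cImB sRe sIm /=.
  have := (hvr x).2 n; have := (hvi x).2 n; rewrite max_r ?w0 //; nra.
have vb x : D x -> nc (v x) <= 8 * c * w x.
  by move=> Dx; have := vs 0%N x Dx; rewrite /s big_geq // subr0 expr0 mulr1.
have sb n x : D x -> nc (s n x) <= (16 * c) * w x.
  move=> Dx; have -> : s n x = v x - (v x - s n x) by ring.
  apply: (le_trans (ncB _ _)).
  have p : (3 / 4 : R) ^+ n <= 1 by rewrite exprn_ile1 //; lra.
  have p0 : 0 <= (3 / 4 : R) ^+ n by rewrite exprn_ge0 //; lra.
  have := vs n x Dx; have := vb x Dx; have w0x := w0 _ Dx.
  have : 8 * c * (3 / 4) ^+ n * w x <= 8 * c * w x.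
    by rewrite ler_wpM2r // ler_piMr // mulr_ge0.
  lra.
have sS n x : D x -> s n.+1 x = g x + T (s n) x.
  move: x; elim: n => [|n ih] x Dx.
    rewrite /s big_nat1 /= chiD // mul1r.
    have s00 : forall x, D x -> nc (s 0%N x) <= 0 * w x.
      by move=> y Dy; rewrite /s big_geq // nc0 mul0r.
    have := (hT (s 0%N) 0 (ms _) (lexx _) s00).2 _ Dx.
    rewrite mulr0 mul0r => h0; have /eqP : nc (T (s 0%N) x) == 0 by rewrite eq_le nc_ge0 h0.
    by move/eqP; rewrite nc_eq0 => /eqP; rewrite /s => ->; rewrite addr0.
  rewrite {1}/s big_nat_recr //= -/(s n.+1 x) ih // chiD // mul1r -addrA; congr (_ + _).
  rewrite -(linT (s n) (u n) _ _ (ms n) (hu n).1 (sb n) (hu n).2) //.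
  by apply: extT => // y Dy; rewrite /s big_nat_recr.
exists v; split => // x Dx.
apply/eqP; rewrite -subr_eq0 -nc_eq0 eq_le nc_ge0 andbT.
(* The defect of v in the equation equals (v - s_(n+1)) - T (v - s_n), which tends to 0
   geometrically. *)
apply: (@ler_limit _ _ (16 * c * w x)) => n; rewrite add0r.
have E : v x - (g x + T v x) = (v x - s n.+1 x) - T (fun x => v x - s n x) x.
  rewrite sS //.
  have -> : T v x = T (fun x => s n x + (v x - s n x)) x.
    by apply: extT => // y Dy; ring.
  rewrite (linT (s n) (fun x => v x - s n x) _ _ (ms n) _ (sb n) (vs n)) //; last exact: cmfunB.
  ring.
rewrite E (le_trans (ncB _ _)) //.
have a0 : 0 <= 8 * c * (3 / 4) ^+ n by rewrite !mulr_ge0 // exprn_ge0 //; lra.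
have h1 := (hT (fun x => v x - s n x) _ (cmfunB mv (ms n)) a0 (vs n)).2 _ Dx.
have h2 := vs n.+1 x Dx.
have w0x := w0 _ Dx.
have : 8 * c * (3 / 4) ^+ n.+1 * w x + 3 / 4 * (8 * c * (3 / 4) ^+ n) * w x = 12 * c * (3 / 4) ^+ n * w x by rewrite exprS; field.
have : 12 * c * (3 / 4) ^+ n * w x <= 16 * c * w x * (3 / 4) ^+ n.
  have p0 : 0 <= (3 / 4 : R) ^+ n by rewrite exprn_ge0 //; lra.
  have cw : 0 <= c * w x by rewrite mulr_ge0.
  have -> : 12 * c * (3 / 4) ^+ n * w x = (12 * (c * w x)) * (3 / 4) ^+ n by ring.
  have -> : 16 * c * w x * (3 / 4) ^+ n = (16 * (c * w x)) * (3 / 4) ^+ n by ring.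
  by rewrite ler_wpM2r //; lra.
lra.
Qed.

End neumann.

(** * The integral operator and its weighted estimates *)

Section volterra.
Context {R : realType}.
Implicit Types (q M y v : R -> R[i]).
Local Notation mu := (@lebesgue_measure R).

Definition bR (b : bool) : R := b%:R.

Lemma nc_boolM (b : bool) (z : R[i]) : nc (b%:R * z) = bR b * nc z.
Proof. by case: b; rewrite /bR ?mul1r ?mul0r ?nc0. Qed.

Lemma bR_ge0 b : 0 <= bR b.
Proof. exact: ler0n. Qed.

Lemma bR_le1 b : bR b <= 1.
Proof. by case: b; rewrite /bR. Qed.

(** The L1 information that suffices for bounds and for analyticity; the L2 norms enter later
    through [l2_data]. Vanishing outside (0, pi) lets the convolution run over the whole line. *)
Record volterra_data q M (A B : R) : Prop := VolterraData {
  vd_q : cmfun q;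
  vd_M : cmfun M;
  vd_qsupp : forall t, ~~ (0 < t < pi) -> q t = 0;
  vd_Msupp : forall t, ~~ (0 < t < pi) -> M t = 0;
  vd_A : (\int[mu]_t (nc (q t))%:E <= A%:E)%E;
  vd_B : (\int[mu]_t (nc (M t) * (pi - t))%:E <= B%:E)%E }.

Definition voltV q M y t := q t * y t + cint (fun s => M (t - s) * y s).

Lemma measurable_ltC (a : R) : measurable_fun setT (fun x : R => a < x).
Proof. by apply: measurable_fun_ltr => //; exact: measurable_cst. Qed.

Lemma measurable_ltCr (a : R) : measurable_fun setT (fun x : R => x < a).
Proof. by apply: measurable_fun_ltr => //; exact: measurable_cst. Qed.

Lemma measurable_itvb (a b : R) : measurable_fun setT (fun x : R => a < x < b).
Proof. by apply: measurable_and; [exact: measurable_ltC|exact: measurable_ltCr]. Qed.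

Lemma cmfun_itv (a b : R) : cmfun (fun x : R => (a < x < b)%R%:R : R[i]).
Proof. exact: cmfun_bool (measurable_itvb a b). Qed.

Lemma measurable_bR {d} {T : measurableType d} (b : T -> bool) : measurable_fun setT b ->
  measurable_fun setT (fun x => bR (b x)).
Proof. exact: measurable_boolR. Qed.

Lemma measurable_sub2 : measurable_fun setT (fun p : R * R => p.1 - p.2).
Proof. by apply: measurable_funB; [exact: measurable_fst|exact: measurable_snd]. Qed.

Section data.
Context (q M : R -> R[i]) (A B : R) (hd : volterra_data q M A B).

Let mq := vd_q hd.
Let mM := vd_M hd.

Lemma vd_A0 : 0 <= A.
Proof.
rewrite -lee_fin; apply: le_trans (vd_A hd); apply: integral_ge0 => t _.
by rewrite lee_fin nc_ge0.
Qed.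

Lemma Mpi_ge0 t : 0 <= nc (M t) * (pi - t).
Proof.
have [/andP[t0 tp]|h] := boolP (0 < t < pi).
  by rewrite mulr_ge0 ?nc_ge0 // subr_ge0 ltW.
by rewrite (vd_Msupp hd h) nc0 mul0r.
Qed.

Lemma vd_B0 : 0 <= B.
Proof.
rewrite -lee_fin; apply: le_trans (vd_B hd); apply: integral_ge0 => t _.
by rewrite lee_fin Mpi_ge0.
Qed.

Lemma cmfun_conv2 y : cmfun y -> cmfun (fun p : R * R => M (p.1 - p.2) * y p.2).
Proof.
move=> my; apply: cmfunM.
  exact: (cmfun_comp measurable_sub2 mM).
exact: (cmfun_comp measurable_snd my).
Qed.

Lemma cmfun_conv1 y (t : R) : cmfun y -> cmfun (fun s : R => M (t - s) * y s).
Proof.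
move=> my; apply: cmfunM => //.
apply: (cmfun_comp _ mM); apply: measurable_funB => //; exact: measurable_cst.
Qed.

Lemma cmfun_V y : cmfun y -> cmfun (voltV q M y).
Proof.
move=> my; apply: cmfunD; first exact: cmfunM.
exact: (cmfun_cint (cmfun_conv2 my)).
Qed.

(* The singular kernel is controlled because the measure of [u, pi] compensates 1 / (pi - u). *)
Lemma conv_bound : (\int[mu]_t \int[mu]_s (bR (t < pi) * (bR (0 < s) * nc (M (t - s))))%:E <= B%:E)%E.
Proof.
apply: le_trans (vd_B hd).
have mT : measurable_fun setT (fun p : R * R => bR (p.1 < pi) * (bR (p.2 < p.1) * nc (M p.2))).
  apply: measurable_funM; first by apply: measurable_bR; apply: measurable_fun_ltr; [exact: measurable_fst|exact: measurable_cst].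
  apply: measurable_funM; first by apply: measurable_bR; apply: measurable_fun_ltr; [exact: measurable_snd|exact: measurable_fst].
  exact: (measurableT_comp (cmfun_nc mM) measurable_snd).
rewrite (_ : \int[mu]_t _ = \int[mu]_t \int[mu]_s (bR (t < pi) * (bR (s < t) * nc (M s)))%:E)%E; last first.
  apply: eq_integral => t _.
  rewrite -(@integral_refl _ (fun s => (bR (t < pi) * (bR (s < t) * nc (M s)))%:E) t).
    by apply: eq_integral => s _; rewrite ltrBlDr ltrDl.
  apply/measurable_EFinP; exact: (measurableT_comp mT (pair1_measurable t)).
rewrite (tonelli mT); last by move=> p; rewrite !mulr_ge0 ?bR_ge0 ?nc_ge0.
rewrite le_eqVlt; apply/orP; left; apply/eqP; apply: eq_integral => u _ /=.
have [/andP[u0 up]|h] := boolP (0 < u < pi); last first.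
  by rewrite (vd_Msupp hd h) nc0 mul0r; under eq_integral do rewrite !mulr0; rewrite integral0.
transitivity (\int[mu]_t ((nc (M u))%:E * (((u < t < pi)%R)%:R)%:E))%E.
  apply: eq_integral => t _; rewrite -EFinM; congr EFin.
  by rewrite /bR; case: (t < pi); case: (u < t); rewrite /= ?mul1r ?mulr1 ?mul0r ?mulr0.
rewrite ge0_integralZl_EFin ?nc_ge0 //.
- by rewrite integral_itv_len ?(ltW up) // EFinM.
- by apply/measurable_EFinP; exact: (measurable_bR (measurable_itvb u pi)).
Qed.

Lemma nc_V y t : cmfun y ->
  ((nc (voltV q M y t))%:E <= (nc (q t) * nc (y t))%:E + \int[mu]_s (nc (M (t - s)) * nc (y s))%:E)%E.
Proof.
move=> my; apply: (@le_trans _ _ ((nc (q t * y t))%:E + (nc (cint (fun s => M (t - s) * y s)))%:E)%E).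
  by rewrite -EFinD lee_fin ncD.
rewrite ncM leeD2l //; apply: (le_trans (nc_cint (cmfun_conv1 t my))).
by under eq_integral do rewrite ncM.
Qed.

(** An exponential weight costs nothing: in the convolution s < t, so e^(-g t) e^(g s) <= 1, and
    what is left is [conv_bound]. With g = |Im rho| this makes all later estimates uniform in
    rho. *)
Lemma V_bound y (c g x : R) : cmfun y -> 0 <= c -> 0 <= g -> x <= pi ->
  (forall s : R, ~~ (0 < s) -> y s = 0) ->
  (forall s : R, 0 < s < x -> nc (y s) <= c * expR (g * s)) ->
  (\int[mu]_t (bR (0 < t < x) * (expR (- (g * t)) * nc (voltV q M y t)))%:E <= (c * (A + B))%:E)%E.
Proof.
move=> my c0 g0 xpi ysupp yb.
have mE : measurable_fun setT (fun t : R => expR (- (g * t))).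
  apply: measurableT_comp; first exact: measurable_expR.
  apply: measurableT_comp => //; apply: measurable_funM => //; exact: measurable_cst.
have mn := cmfun_nc my; have mnM := cmfun_nc mM; have mnq := cmfun_nc mq.
have mK : measurable_fun setT (fun p : R * R => bR (p.1 < pi) * (bR (0 < p.2) * nc (M (p.1 - p.2)))).
  apply: measurable_funM; first by apply: measurable_bR; apply: measurable_fun_ltr; [exact: measurable_fst|exact: measurable_cst].
  apply: measurable_funM; first by apply: measurable_bR; apply: measurable_fun_ltr; [exact: measurable_cst|exact: measurable_snd].
  exact: (measurableT_comp mnM measurable_sub2).
have bnd (t : R) : ((bR (0 < t < x) * (expR (- (g * t)) * nc (voltV q M y t)))%:E <=
   c%:E * ((nc (q t))%:E + \int[mu]_s (bR (t < pi) * (bR (0 < s) * nc (M (t - s))))%:E))%E.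
  have I0 : (0 <= \int[mu]_s (bR (t < pi) * (bR (0 < s) * nc (M (t - s))))%:E)%E.
    by apply: integral_ge0 => s _; rewrite lee_fin !mulr_ge0 ?bR_ge0 ?nc_ge0.
  have [/andP[t0 tx]|_] := boolP (0 < t < x); last first.
    by rewrite /bR mul0r mule_ge0 ?lee_fin // adde_ge0 // lee_fin nc_ge0.
  have tpi := lt_le_trans tx xpi.
  rewrite {1}/bR mul1r EFinM.
  apply: (le_trans (lee_wpmul2l _ (nc_V t my))); first by rewrite lee_fin expR_ge0.
  rewrite ge0_muleDr ?lee_fin ?mulr_ge0 ?nc_ge0 //; last first.
    by apply: integral_ge0 => s _; rewrite lee_fin mulr_ge0 ?nc_ge0.
  rewrite [X in (_ <= X)%E]ge0_muleDr //; last by rewrite lee_fin nc_ge0.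
  apply: leeD.
    rewrite -!EFinM lee_fin mulrCA [leRHS]mulrC ler_wpM2l ?nc_ge0 //.
    rewrite expRN mulrC ler_pdivrMr ?expR_gt0 //; apply: yb; rewrite t0 tx; done.
  rewrite -ge0_integralZl_EFin ?expR_ge0 //; last 2 first.
  - by move=> s _; rewrite lee_fin mulr_ge0 ?nc_ge0.
  - apply/measurable_EFinP; apply: measurable_funM => //.
    apply: (measurableT_comp mnM); apply: measurable_funB => //; exact: measurable_cst.
  rewrite -ge0_integralZl_EFin //; last 2 first.
  - by move=> s _; rewrite lee_fin !mulr_ge0 ?bR_ge0 ?nc_ge0.
  - by apply/measurable_EFinP; exact: (measurableT_comp mK (pair1_measurable t)).
  apply: le_int => [||s|s].
  - apply: measurable_funM; first exact: measurable_cst.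
    apply: measurable_funM => //.
    apply: (measurableT_comp mnM); apply: measurable_funB => //; exact: measurable_cst.
  - by apply: measurable_funM; [exact: measurable_cst|exact: (measurableT_comp mK (pair1_measurable t))].
  - by rewrite !mulr_ge0 ?expR_ge0 ?nc_ge0.
  rewrite tpi {1}/bR mul1r.
  have [s0|s0] := boolP (0 < s); last first.
    by rewrite ysupp // nc0 !mulr0 /bR mul0r mulr0.
  rewrite /bR mul1r.
  have [st|st] := boolP (0 < t - s < pi); last first.
    by rewrite (vd_Msupp hd st) nc0 !mul0r !mulr0.
  have /andP[ts _] := st; rewrite subr_gt0 in ts.
  rewrite mulrCA [leRHS]mulrC ler_wpM2l ?nc_ge0 //.
  apply: (@le_trans _ _ (expR (- (g * t)) * (c * expR (g * s)))).
    by rewrite ler_wpM2l ?expR_ge0 // yb // s0 (lt_trans ts).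
  rewrite mulrCA ler_piMr // -expRD expR_le1 addrC subr_le0 ler_wpM2l // ltW //.
apply: (@le_trans _ _ (\int[mu]_t (c%:E * ((nc (q t))%:E + \int[mu]_s (bR (t < pi) * (bR (0 < s) * nc (M (t - s))))%:E)))%E).
  apply: ge0_le_integral => //.
  - by move=> t _; rewrite lee_fin !mulr_ge0 ?bR_ge0 ?expR_ge0 ?nc_ge0.
  - apply/measurable_EFinP; apply: measurable_funM; first exact: (measurable_bR (measurable_itvb 0 x)).
    by apply: measurable_funM => //; exact/cmfun_nc/cmfun_V.
  - apply: measurable_funeM; apply: emeasurable_funD; first exact/measurable_EFinP.
    apply: (measurable_int_param mK) => p; by rewrite !mulr_ge0 ?bR_ge0 ?nc_ge0.
have mI : measurable_fun setT (fun t : R => \int[mu]_s (bR (t < pi) * (bR (0 < s) * nc (M (t - s))))%:E)%E.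
  apply: (measurable_int_param mK) => p; by rewrite !mulr_ge0 ?bR_ge0 ?nc_ge0.
have I0 (t : R) : (0 <= \int[mu]_s (bR (t < pi) * (bR (0 < s) * nc (M (t - s))))%:E)%E.
  by apply: integral_ge0 => s _; rewrite lee_fin !mulr_ge0 ?bR_ge0 ?nc_ge0.
rewrite ge0_integralZl_EFin //; last 2 first.
- by move=> t _; rewrite adde_ge0 // lee_fin nc_ge0.
- by apply: emeasurable_funD => //; exact/measurable_EFinP.
rewrite EFinM lee_wpmul2l ?lee_fin // ge0_integralD //; last 2 first.
- by move=> t _; rewrite lee_fin nc_ge0.
- exact/measurable_EFinP.
rewrite EFinD leeD //; first exact: vd_A hd.
exact: conv_bound.
Qed.

End data.
End volterra.

Section volterra_operator.
Context {R : realType}.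
Local Notation mu := (@lebesgue_measure R).
Context (q M : R -> R[i]) (A B : R) (hd : volterra_data q M A B).
Implicit Types (y v u : R -> R[i]) (l : R[i]).

(** For t < pi the argument t - s stays below t, so (pi - (t - s)) / (pi - t) >= 1 and the weighted
    integral of M dominates at the cost of the factor 1 / (pi - t). *)
Lemma conv_L1 y (c t : R) : cmfun y -> t < pi -> (forall s : R, ~~ (0 < s) -> y s = 0) ->
  (forall s : R, 0 < s < t -> nc (y s) <= c) -> L1 (fun s => M (t - s) * y s).
Proof.
move=> my tpi ysupp yb; have mn := cmfun_nc my; have mnM := cmfun_nc (vd_M hd).
split; first exact: (cmfun_conv1 hd).
have mh : measurable_fun setT (fun u : R => nc (M u) * (pi - u)).
  by apply: measurable_funM => //; apply: measurable_funB => //; exact: measurable_cst.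
have p0 : 0 < pi - t by rewrite subr_gt0.
apply: (@le_lt_trans _ _ (\int[mu]_s ((`|c| / (pi - t)) * (nc (M (t - s)) * (pi - (t - s))))%:E)%E).
  apply: le_int => [||s|s].
  - exact/cmfun_nc/(cmfun_conv1 hd).
  - apply: measurable_funM; first exact: measurable_cst.
    apply: (measurableT_comp mh); apply: measurable_funB => //; exact: measurable_cst.
  - exact: nc_ge0.
  have R0 : 0 <= `|c| / (pi - t) * (nc (M (t - s)) * (pi - (t - s))).
    by rewrite mulr_ge0 ?(Mpi_ge0 hd) // divr_ge0 // ltW.
  have [s0|s0] := boolP (0 < s); last by rewrite ysupp // mulr0 nc0.
  have [st|st] := boolP (0 < t - s < pi); last by rewrite (vd_Msupp hd st) mul0r nc0 // mul0r mulr0.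
  have /andP[ts _] := st; rewrite subr_gt0 in ts.
  rewrite ncM.
  have h1 : nc (y s) <= `|c| by rewrite (le_trans (yb s _)) ?ler_norm // s0.
  have h2 : 1 <= (pi - (t - s)) / (pi - t) by rewrite ler_pdivlMr // mul1r; lra.
  have -> : `|c| / (pi - t) * (nc (M (t - s)) * (pi - (t - s))) = nc (M (t - s)) * (`|c| * ((pi - (t - s)) / (pi - t))) by ring.
  rewrite ler_wpM2l ?nc_ge0 // (le_trans h1) // ler_peMr //.
under eq_integral do rewrite EFinM.
rewrite ge0_integralZl_EFin //; last 3 first.
- by move=> s _; rewrite lee_fin (Mpi_ge0 hd).
- apply/measurable_EFinP; apply: (measurableT_comp mh); apply: measurable_funB => //; exact: measurable_cst.
- by rewrite divr_ge0 // ltW.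
rewrite (@integral_refl R (fun u : R => (nc (M u) * (pi - u))%:E) t); last exact/measurable_EFinP.
rewrite lte_mul_pinfty ?lee_fin ?divr_ge0 ?(ltW p0) //.
exact: le_lt_trans (vd_B hd) (ltry _).
Qed.

Lemma V_linear (a b : R[i]) u v (c d t : R) : cmfun u -> cmfun v -> t < pi ->
  (forall s : R, ~~ (0 < s) -> u s = 0) -> (forall s : R, ~~ (0 < s) -> v s = 0) ->
  (forall s : R, 0 < s < t -> nc (u s) <= c) -> (forall s : R, 0 < s < t -> nc (v s) <= d) ->
  voltV q M (fun s => a * u s + b * v s) t = a * voltV q M u t + b * voltV q M v t.
Proof.
move=> mu' mv tpi us vs ub vb; rewrite /voltV.
have L1u := conv_L1 mu' tpi us ub; have L1v := conv_L1 mv tpi vs vb.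
rewrite (_ : cint _ = a * cint (fun s => M (t - s) * u s) + b * cint (fun s => M (t - s) * v s)).
  by ring.
rewrite -!cintZ // -cintD //; try exact: L1Z.
by apply: eq_cint => s; ring.
Qed.

Definition cutI v (x : R) : R[i] := cint (fun t => (0 < t < x)%R%:R * v t).

(* Cut off outside (0, pi), so that convolutions can be taken over the whole line. *)
Definition cutJ v (x : R) : R[i] := (0 < x < pi)%R%:R * cutI v x.

Lemma cmfun_cutI v : cmfun v -> cmfun (cutI v).
Proof.
move=> mv; apply: (@cmfun_cint _ _ _ (fun p : R * R => (0 < p.2 < p.1)%R%:R * v p.2)).
apply: cmfunM; last exact: (cmfun_comp measurable_snd mv).
apply: cmfun_bool; apply: measurable_and.
  by apply: measurable_fun_ltr; [exact: measurable_cst|exact: measurable_snd].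
by apply: measurable_fun_ltr; [exact: measurable_snd|exact: measurable_fst].
Qed.

Lemma cmfun_cutJ v : cmfun v -> cmfun (cutJ v).
Proof. by move=> mv; apply: cmfunM; [exact: cmfun_itv|exact: cmfun_cutI]. Qed.

Lemma cutJ_supp v (s : R) : ~~ (0 < s) -> cutJ v s = 0.
Proof. by rewrite /cutJ => /negPf ->; rewrite mul0r. Qed.

Lemma L1_cut v (c x : R) : cmfun v -> (forall t : R, 0 < t < x -> nc (v t) <= c) ->
  L1 (fun t => (0 < t < x)%R%:R * v t).
Proof.
move=> mv vc; split; first by apply: cmfunM => //; exact: cmfun_itv.
have [x0|x0] := leP x 0.
  rewrite (_ : (fun t : R => _) = fun=> 0%E); first by rewrite integral0.
  apply/funext => t; rewrite nc_boolM /bR; case: andP => [[t0 tx]|_]; last by rewrite mul0r.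
  by have := lt_trans t0 tx; rewrite ltNge x0.
apply: (@le_lt_trans _ _ (\int[mu]_t (`|c|%:E * ((0 < t < x)%R%:R)%:E))%E).
  under [leRHS]eq_integral do rewrite -EFinM.
  apply: le_int => [||t|t].
  - by apply/cmfun_nc/cmfunM => //; exact: cmfun_itv.
  - apply: measurable_funM; first exact: measurable_cst.
    exact: (measurable_boolR (measurable_itvb 0 x)).
  - exact: nc_ge0.
  rewrite nc_boolM /bR; case: (boolP (0 < t < x)) => [h|_]; last by rewrite mul0r mulr0.
  by rewrite mul1r mulr1 (le_trans (vc _ h)) // ler_norm.
rewrite ge0_integralZl_EFin //.
  by rewrite integral_itv_len ?(ltW x0) // -EFinM ltry.
by apply/measurable_EFinP; exact: (measurable_boolR (measurable_itvb 0 x)).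
Qed.

Lemma cutI_bound v (c g x : R) : cmfun v -> 0 < g -> 0 <= c -> 0 <= x ->
  (forall t : R, 0 < t < x -> nc (v t) <= c * expR (g * t)) ->
  nc (cutI v x) <= c / g * expR (g * x).
Proof.
move=> mv g0 c0 x0 vc; rewrite -lee_fin.
apply: (le_trans (nc_cint _)); first by apply: cmfunM => //; exact: cmfun_itv.
have mE : measurable_fun setT (fun t : R => g * expR (g * t)).
  apply: measurable_funM; first exact: measurable_cst.
  apply: measurableT_comp; first exact: measurable_expR.
  by apply: measurable_funM => //; exact: measurable_cst.
have mi : measurable_fun setT (fun t : R => (0 < t < x)%R%:R : R).
  exact: (measurable_boolR (measurable_itvb 0 x)).
apply: (@le_trans _ _ (\int[mu]_t ((c / g)%:E * ((0 < t < x)%R%:R * (g * expR (g * t)))%:E))%E).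
  under [leRHS]eq_integral do rewrite -EFinM.
  apply: le_int => [||t|t].
  - by apply/cmfun_nc/cmfunM => //; exact: cmfun_itv.
  - by apply: measurable_funM; [exact: measurable_cst|exact: measurable_funM].
  - exact: nc_ge0.
  rewrite nc_boolM /bR; case: (boolP (0 < t < x)) => [h|_]; last by rewrite !mul0r mulr0.
  by rewrite !mul1r mulrA divfK ?lt0r_neq0 // vc.
rewrite ge0_integralZl_EFin ?divr_ge0 ?(ltW g0) //; last 2 first.
- by move=> t _; rewrite lee_fin !mulr_ge0 ?expR_ge0 ?(ltW g0).
- by apply/measurable_EFinP; exact: measurable_funM.
rewrite integral_expR // -EFinM lee_fin ler_wpM2l ?divr_ge0 ?(ltW g0) //.
by rewrite gerBl.
Qed.

Lemma cutI_linear (a b : R[i]) u v (c d x : R) : cmfun u -> cmfun v ->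
  (forall t : R, 0 < t < x -> nc (u t) <= c) -> (forall t : R, 0 < t < x -> nc (v t) <= d) ->
  cutI (fun t => a * u t + b * v t) x = a * cutI u x + b * cutI v x.
Proof.
move=> mu' mv uc vd; have lu := L1_cut mu' uc; have lv := L1_cut mv vd.
rewrite /cutI -!cintZ // -cintD; try exact: L1Z.
by apply: eq_cint => t; ring.
Qed.

Lemma eq_cutI u v (x : R) : (forall t : R, 0 < t < x -> u t = v t) -> cutI u x = cutI v x.
Proof.
move=> uv; apply: eq_cint => t; case: (boolP (0 < t < x)) => [/uv ->//|_].
by rewrite !mul0r.
Qed.

(* The equation integrated once: v = S' satisfies v = 1 + voltT l v. *)
Definition voltT l v (x : R) : R[i] := cutI (fun t => voltV q M (cutJ v) t - l * cutJ v t) x.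

Lemma cmfun_voltT l v : cmfun v -> cmfun (voltT l v).
Proof.
move=> mv; apply: cmfun_cutI; apply: cmfunB; first exact/(cmfun_V hd)/cmfun_cutJ.
exact/cmfunZ/cmfun_cutJ.
Qed.

Lemma cutJ_bound v (c g x : R) : cmfun v -> 1 <= g -> 0 <= c ->
  (forall t : R, 0 < t <= pi -> nc (v t) <= c * expR (g * t)) ->
  nc (cutJ v x) <= c / g * expR (g * x).
Proof.
move=> mv g1 c0 vc; have g0 : 0 < g by rewrite (lt_le_trans _ g1).
rewrite nc_boolM /bR; have [/andP[x0 xpi]|_] := boolP (0 < x < pi); last first.
  by rewrite mul0r mulr_ge0 ?expR_ge0 // divr_ge0 // ltW.
rewrite mul1r; apply: cutI_bound => //; first exact: ltW.
by move=> t /andP[t0 tx]; apply: vc; rewrite t0 ltW // (lt_trans tx).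
Qed.

Lemma cut_expR_le (c g x : R) : 0 <= c -> 0 <= g -> forall s : R, 0 < s < x ->
  c * expR (g * s) <= c * expR (g * x).
Proof.
move=> c0 g0 s /andP[s0 sx]; rewrite ler_wpM2l // ler_expR ler_wpM2l // ltW //.
Qed.

Lemma L1_cutV y (c g x : R) : cmfun y -> x <= pi -> 0 <= c -> 0 <= g ->
  (forall s : R, ~~ (0 < s) -> y s = 0) ->
  (forall s : R, 0 < s < x -> nc (y s) <= c * expR (g * s)) ->
  L1 (fun t => (0 < t < x)%R%:R * voltV q M y t) /\
  (\int[mu]_t (nc ((0 < t < x)%R%:R * voltV q M y t))%:E <= (expR (g * x) * (c * (A + B)))%:E)%E.
Proof.
move=> my xpi c0 g0 ys yb.
have mV := cmfun_V hd my.
have h : (\int[mu]_t (nc ((0 < t < x)%R%:R * voltV q M y t))%:E <= (expR (g * x) * (c * (A + B)))%:E)%E.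
  have mE : measurable_fun setT (fun t : R => expR (- (g * t))).
    apply: measurableT_comp; first exact: measurable_expR.
    by apply: measurableT_comp => //; apply: measurable_funM => //; exact: measurable_cst.
  have mb : measurable_fun setT (fun t : R => bR (0 < t < x) * (expR (- (g * t)) * nc (voltV q M y t))).
    apply: measurable_funM; first exact: (measurable_bR (measurable_itvb 0 x)).
    by apply: measurable_funM => //; exact: cmfun_nc.
  apply: (@le_trans _ _ ((expR (g * x))%:E * \int[mu]_t (bR (0 < t < x) * (expR (- (g * t)) * nc (voltV q M y t)))%:E)%E).
    rewrite -ge0_integralZl_EFin ?expR_ge0 //; last 2 first.
    - by move=> t _; rewrite lee_fin !mulr_ge0 ?bR_ge0 ?expR_ge0 ?nc_ge0.
    - exact/measurable_EFinP.
    under [leRHS]eq_integral do rewrite -EFinM.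
    apply: le_int => [||t|t].
    - by apply/cmfun_nc/cmfunM => //; exact: cmfun_itv.
    - by apply: measurable_funM => //; exact: measurable_cst.
    - exact: nc_ge0.
    rewrite nc_boolM mulrCA /bR; have [/andP[t0 tx]|_] := boolP (0 < t < x); last by rewrite !mul0r.
    rewrite !mul1r mulrA -expRD ler_peMl ?nc_ge0 // -[leLHS]expR0 ler_expR -mulrBr mulr_ge0 // subr_ge0 ltW //.
  rewrite EFinM lee_wpmul2l ?lee_fin ?expR_ge0 //.
  exact: (V_bound hd).
split => //; split; first by apply: cmfunM => //; exact: cmfun_itv.
exact: le_lt_trans h (ltry _).
Qed.

(** Integrating e^(g t) gains 1/g. The q and M part uses the gain of the inner integral [cutJ] only;
    the l part has two integrations, and one gain is kept because g >= 1. For large g this is a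
    contraction. *)
Lemma voltT_bound l v (c g x : R) : cmfun v -> 1 <= g -> 0 <= c -> 0 < x <= pi ->
  (forall t : R, 0 < t <= pi -> nc (v t) <= c * expR (g * t)) ->
  nc (voltT l v x) <= c * ((A + B + nc l) / g) * expR (g * x).
Proof.
move=> mv g1 c0 /andP[x0 xpi] vc; have g0 : 0 < g by rewrite (lt_le_trans _ g1).
have mJ := cmfun_cutJ mv.
have Jb s : nc (cutJ v s) <= c / g * expR (g * s) by exact: cutJ_bound.
have cg : 0 <= c / g by rewrite divr_ge0 // ltW.
have [l1 b1] := @L1_cutV _ _ g x mJ xpi cg (ltW g0) (@cutJ_supp v) (fun s _ => Jb s).
have l2 : L1 (fun t => (0 < t < x)%R%:R * cutJ v t).
  apply: (@L1_cut _ (c / g * expR (g * x))) => // t tx.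
  by apply: (le_trans (Jb t)); exact: (cut_expR_le cg (ltW g0) tx).
have -> : voltT l v x = cutI (voltV q M (cutJ v)) x - l * cutI (cutJ v) x.
  rewrite /voltT /cutI -cintZ // -cintB //; last exact: L1Z.
  by apply: eq_cint => t; ring.
apply: (le_trans (ncB _ _)); rewrite ncM.
have h1 : nc (cutI (voltV q M (cutJ v)) x) <= expR (g * x) * (c / g * (A + B)).
  by rewrite -lee_fin; apply: le_trans b1; apply: nc_cint; exact: l1.1.
have h2 : nc (cutI (cutJ v) x) <= c / g / g * expR (g * x).
  by apply: cutI_bound => //; exact: ltW.
have h3 : c / g / g * expR (g * x) <= c / g * expR (g * x).
  by rewrite ler_wpM2r ?expR_ge0 // ler_pdivrMr // ler_peMr.
have -> : c * ((A + B + nc l) / g) * expR (g * x) = expR (g * x) * (c / g * (A + B)) + nc l * (c / g * expR (g * x)) by ring.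
by apply: lerD => //; rewrite ler_wpM2l ?nc_ge0 // (le_trans h2).
Qed.

Lemma cutJ_linear (a b : R[i]) u v (c d : R) : cmfun u -> cmfun v ->
  (forall t : R, 0 < t <= pi -> nc (u t) <= c) -> (forall t : R, 0 < t <= pi -> nc (v t) <= d) ->
  forall x, cutJ (fun t => a * u t + b * v t) x = a * cutJ u x + b * cutJ v x.
Proof.
move=> mu' mv uc vd x; rewrite /cutJ; case: (boolP (0 < x < pi)) => [/andP[x0 xpi]|_].
  rewrite !mul1r (@cutI_linear a b u v c d) // => t /andP[t0 tx].
    by apply: uc; rewrite t0 ltW // (lt_trans tx).
  by apply: vd; rewrite t0 ltW // (lt_trans tx).
by rewrite !mul0r !mulr0 addr0.
Qed.

Lemma voltT_linear l (a b : R[i]) u v (c d x : R) : cmfun u -> cmfun v -> x <= pi -> 0 <= c -> 0 <= d ->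
  (forall t : R, 0 < t <= pi -> nc (u t) <= c) -> (forall t : R, 0 < t <= pi -> nc (v t) <= d) ->
  voltT l (fun t => a * u t + b * v t) x = a * voltT l u x + b * voltT l v x.
Proof.
move=> mu' mv xpi c0 d0 uc vd.
have Jb w (e : R) : cmfun w -> 0 <= e -> (forall t : R, 0 < t <= pi -> nc (w t) <= e) ->
    forall s, nc (cutJ w s) <= e * expR (1 * s).
  move=> mw e0 wb s; have := @cutJ_bound w e 1 s mw (lexx _) e0; rewrite divr1; apply => t tp.
  rewrite (le_trans (wb _ tp)) // ler_peMr // -[leLHS]expR0 ler_expR mul1r; by case/andP: tp => /ltW.
have Ju := Jb _ _ mu' c0 uc; have Jv := Jb _ _ mv d0 vd.
have mJu := cmfun_cutJ mu'; have mJv := cmfun_cutJ mv.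
have [lu _] := @L1_cutV _ _ 1 x mJu xpi c0 ler01 (@cutJ_supp u) (fun s _ => Ju s).
have [lv _] := @L1_cutV _ _ 1 x mJv xpi d0 ler01 (@cutJ_supp v) (fun s _ => Jv s).
have ku : L1 (fun t => (0 < t < x)%R%:R * cutJ u t).
  apply: (@L1_cut _ (c * expR (1 * x))) => // t tx.
  by apply: (le_trans (Ju t)); exact: (cut_expR_le c0 ler01 tx).
have kv : L1 (fun t => (0 < t < x)%R%:R * cutJ v t).
  apply: (@L1_cut _ (d * expR (1 * x))) => // t tx.
  by apply: (le_trans (Jv t)); exact: (cut_expR_le d0 ler01 tx).
pose U t := voltV q M (cutJ u) t - l * cutJ u t.
pose W t := voltV q M (cutJ v) t - l * cutJ v t.
have LU : L1 (fun t => (0 < t < x)%R%:R * U t).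
  rewrite (_ : (fun t => _) = fun t => (0 < t < x)%R%:R * voltV q M (cutJ u) t - l * ((0 < t < x)%R%:R * cutJ u t)).
    exact: (L1B lu (L1Z l ku)).
  by apply/funext => t; rewrite /U; move: (voltV _ _ _ _) (cutJ _ _) => X Y; ring.
have LW : L1 (fun t => (0 < t < x)%R%:R * W t).
  rewrite (_ : (fun t => _) = fun t => (0 < t < x)%R%:R * voltV q M (cutJ v) t - l * ((0 < t < x)%R%:R * cutJ v t)).
    exact: (L1B lv (L1Z l kv)).
  by apply/funext => t; rewrite /W; move: (voltV _ _ _ _) (cutJ _ _) => X Y; ring.
have EJ : cutJ (fun t => a * u t + b * v t) = fun s => a * cutJ u s + b * cutJ v s.
  by apply/funext => s; exact: cutJ_linear uc vd s.
transitivity (cutI (fun t => a * U t + b * W t) x).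
  apply: eq_cutI => t /andP[t0 tx]; have tpi := lt_le_trans tx xpi.
  rewrite EJ (@V_linear a b _ _ (c * expR (1 * t)) (d * expR (1 * t))) //; try exact: cutJ_supp.
  - by rewrite /U /W; move: (voltV _ _ _ _) (voltV _ _ _ _) (cutJ u t) (cutJ v t) => X Y Z V; ring.
  - by move=> s st; apply: (le_trans (Ju s)); exact: (cut_expR_le c0 ler01 st).
  - by move=> s st; apply: (le_trans (Jv s)); exact: (cut_expR_le d0 ler01 st).
rewrite /voltT -/U -/W; move: (U) (W) LU LW => U' W' LU LW.
rewrite /cutI -!cintZ // -cintD; try exact: L1Z.
by congr cint; apply/funext => t; ring.
Qed.

Lemma eq_voltT l u v (x : R) : (forall t : R, 0 < t <= pi -> u t = v t) -> voltT l u x = voltT l v x.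
Proof.
move=> uv; have -> : voltT l u = voltT l v; last by [].
rewrite /voltT; have -> // : cutJ u = cutJ v.
apply/funext => s; rewrite /cutJ; case: (boolP (0 < s < pi)) => [/andP[s0 spi]|_]; last by rewrite !mul0r.
congr (_ * _); apply: eq_cutI => t /andP[t0 ts]; apply: uv.
by rewrite t0 ltW // (lt_trans ts).
Qed.

End volterra_operator.

(** * Analytic dependence on the spectral parameter *)

Section volterra_analytic.
Context {R : realType}.
Local Notation mu := (@lebesgue_measure R).
Context (q M : R -> R[i]) (A B : R) (hd : volterra_data q M A B).
Implicit Types (y v u : R -> R[i]) (l : R[i]).
Local Notation voltT := (voltT q M).

(** With h = l - l0 one has [voltT l] = [voltT l0] - h K, where K is double integration. Comparing
    powers of h, the Taylor coefficients solve v_0 = 1 + T v_0 and v_(j+1) = - K v_j + T v_(j+1)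
    with T = [voltT l0]. The remainders satisfy r_(m+1) = - h K r_m + T r_(m+1), so [gronwall]
    bounds them by powers of 4 |h|. *)
Lemma analytic_volterra (vl : R[i] -> R -> R[i]) :
  (forall l, cmfun (vl l)) ->
  (forall l, exists C : R, forall x, 0 < x <= pi -> nc (vl l x) <= C) ->
  (forall l x, 0 < x <= pi -> vl l x = 1 + voltT l (vl l) x) ->
  analytic (fun l => vl l pi).
Proof.
move=> mvl bvl evl l0.
have A0 := vd_A0 hd; have B0 := vd_B0 hd; have n0 := nc_ge0 l0.
(* Large enough for the contraction factor (A + B + |l|) / g of [voltT_bound] to stay below 3/4 for
   all |l - l0| <= 1/4. *)
pose g := 2 * (A + B + nc l0 + 1).
have g1 : 1 <= g by rewrite /g; lra.
have g0 : 0 < g by rewrite (lt_le_trans _ g1).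
pose D := [set x : R | 0 < x <= pi].
pose w (x : R) := expR (g * x).
have w0 x : 0 <= w x by exact: expR_ge0.
have w1 x : D x -> 1 <= w x.
  by move=> /andP[x0 _]; rewrite /w -[leLHS]expR0 ler_expR mulr_ge0 ?ltW.
have wpi x : D x -> w x <= w pi by move=> /andP[_ xpi]; rewrite ler_expR ler_wpM2l // ltW.
have piD : D pi by rewrite /D /= lexx pi_gt0.
have Tb l v a : nc (l - l0) <= 1 / 4 -> cmfun v -> 0 <= a -> (forall x, D x -> nc (v x) <= a * w x) ->
    forall x, D x -> nc (voltT l v x) <= (3 / 4 * a) * w x.
  move=> ll mv a0 va x Dx.
  apply: (le_trans (@voltT_bound R q M A B hd l v a g x mv g1 a0 Dx va)).
  rewrite ler_wpM2r ?w0 // mulrC ler_wpM2r // ler_pdivrMr // /g.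
  have := ncD (l - l0) l0; rewrite subrK; lra.
have sb v a : (forall x, D x -> nc (v x) <= a * w x) -> 0 <= a -> forall x, D x -> nc (v x) <= a * w pi.
  by move=> va a0 x Dx; rewrite (le_trans (va _ Dx)) // ler_wpM2l // wpi.
have Tlin l a b u v c d : cmfun u -> cmfun v -> 0 <= c -> 0 <= d ->
    (forall x, D x -> nc (u x) <= c * w x) -> (forall x, D x -> nc (v x) <= d * w x) ->
    forall x, D x -> voltT l (fun t => a * u t + b * v t) x = a * voltT l u x + b * voltT l v x.
  move=> mu' mv c0 d0 uc vd x /andP[_ xpi].
  apply: (@voltT_linear R q M A B hd l a b u v (c * w pi) (d * w pi)) => //; try by rewrite mulr_ge0.
    exact: sb uc c0.
  exact: sb vd d0.
have d0 : nc (l0 - l0) <= 1 / 4 by rewrite subrr nc0; lra.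
pose P v := cmfun v /\ exists2 c, 0 <= c & forall x, D x -> nc (v x) <= c * w x.
(* The implication is placed inside the existential, so that choice gives a total solution operator
   [sol] that can be iterated. *)
have solve u : exists v, P u -> P v /\ forall x, D x -> v x = u x + voltT l0 v x.
  have [[mu' [c c0 uc]]|nP] := pselect (P u); last by exists u.
  have [||||||v [mv vb ve]] := @neumann_series R D w (voltT l0) c u _ _ _ _ _ _ mu' uc.
  - by rewrite (_ : D = `]0, pi]%classic) //; apply/seteqP; split => x /=; rewrite in_itv.
  - by move=> x _; exact: w0.
  - by move=> v a mv a0 va; split; [exact: (cmfun_voltT hd)|exact: Tb].
  - move=> u1 u2 a b m1 m2 h1 h2 x Dx.
    have pos (e : R) (f : R -> R[i]) : (forall x, D x -> nc (f x) <= e * w x) -> 0 <= e.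
      move=> /(_ _ piD) h; have := le_trans (nc_ge0 _) h; rewrite pmulr_lge0 // expR_gt0 //.
    have -> : (fun x => u1 x + u2 x) = fun x => 1 * u1 x + 1 * u2 x.
      by apply/funext => t; rewrite !mul1r.
    rewrite (Tlin l0 1 1 u1 u2 a b m1 m2 (pos _ _ h1) (pos _ _ h2) h1 h2 x Dx).
    by move: (voltT l0 u1 x) (voltT l0 u2 x) => X Y; rewrite !mul1r.
  - by move=> u1 u2 h x Dx; apply: eq_voltT => t; exact: h.
  - exact: c0.
  exists v => _; split => //; split => //; exists (8 * c) => //; by rewrite mulr_ge0.
have [sol hsol] := choice solve.
pose K v := cutI (cutJ v).
have Kb v a : cmfun v -> 0 <= a -> (forall x, D x -> nc (v x) <= a * w x) ->
    forall x, D x -> nc (K v x) <= a * w x.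
  move=> mv a0 va x /andP[x0 xpi].
  have Jb s : nc (cutJ v s) <= a / g * expR (g * s) by exact: cutJ_bound.
  apply: (@le_trans _ _ (a / g / g * expR (g * x))).
    by apply: cutI_bound => //; [exact: cmfun_cutJ|rewrite divr_ge0 // ltW|exact: ltW].
  rewrite ler_wpM2r ?w0 // !ler_pdivrMr // -mulrA ler_peMr // mulr_ege1 //.
have PK v : P v -> P (K v).
  by move=> [mv [c c0 vc]]; split; [exact/cmfun_cutI/cmfun_cutJ|exists c => //; exact: Kb].
have PZ (a : R[i]) v : P v -> P (fun x => a * v x).
  move=> [mv [c c0 vc]]; split; first exact: cmfunZ.
  exists (nc a * c); first by rewrite mulr_ge0 ?nc_ge0.
  by move=> x Dx; rewrite ncM -mulrA ler_wpM2l ?nc_ge0 // vc.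
have PD u v : P u -> P v -> P (fun x => u x + v x).
  move=> [mu' [c c0 uc]] [mv [d d0' vd]]; split; first exact: cmfunD.
  exists (c + d); first exact: addr_ge0.
  by move=> x Dx; rewrite mulrDl (le_trans (ncD _ _)) // lerD ?uc ?vd.
pose vj := fix vj j := match j with 0%N => sol (fun=> 1) | j'.+1 => sol (fun x => - 1 * K (vj j') x) end.
have first_iterate : P (fun=> 1).
  by split; [exact: cmfun_cst|exists 1 => // x Dx; rewrite nc1 mul1r w1].
have Pvj j : P (vj j).
  elim: j => [|j ih] /=; first exact: (hsol _ first_iterate).1.
  exact: (hsol _ (PZ _ _ (PK _ ih))).1.
have Evj j x : D x -> vj j.+1 x = - K (vj j) x + voltT l0 (vj j.+1) x.
  have vjS : vj j.+1 = sol (fun x => - 1 * K (vj j) x) by [].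
  move=> Dx; rewrite vjS {1}((hsol _ (PZ (- 1) _ (PK _ (Pvj j)))).2 x Dx).
  by congr (_ + _); rewrite mulN1r.
have Evj0 x : D x -> vj 0%N x = 1 + voltT l0 (vj 0%N) x by move=> Dx; exact: (hsol _ first_iterate).2.
have Pvl l : P (vl l).
  split; first exact: mvl.
  have [C hC] := bvl l; exists `|C| => // x Dx; rewrite (le_trans (hC _ Dx)) // (le_trans (ler_norm _)) //.
  by rewrite ler_peMr // w1.
exists (fun j => vj j pi) => n.
exists (4 ^+ n.+1 * w pi), (1 / 4); split => // l ll.
pose h := l - l0.
pose r m x := vl l x - \sum_(j < m) vj j x * h ^+ j.
have rS m x : r m.+1 x = 1 * r m x + (- h ^+ m) * vj m x.
  by rewrite /r big_ord_recr /=; ring.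
have r0E : r 0%N = vl l by apply/funext => x; rewrite /r big_ord0 subr0.
have Pr m : P (r m).
  elim: m => [|m ih]; first by rewrite r0E.
  have -> : r m.+1 = fun x => 1 * r m x + (- h ^+ m) * vj m x by apply/funext => x; exact: rS.
  by apply: PD; exact: PZ.
have TE x : D x -> voltT l (vl l) x = voltT l0 (vl l) x - h * K (vl l) x.
  move=> Dx; have [mv [c c0 vc]] := Pvl l; have /andP[_ xpi] := Dx.
  have Jb s : nc (cutJ (vl l) s) <= c / g * expR (g * s) by exact: cutJ_bound.
  have cg : 0 <= c / g by rewrite divr_ge0 // ltW.
  have mJ := cmfun_cutJ mv.
  have [l1 _] := @L1_cutV R q M A B hd _ _ g x mJ xpi cg (ltW g0) (@cutJ_supp R (vl l)) (fun s _ => Jb s).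
  have l2 : L1 (fun t => (0 < t < x)%R%:R * cutJ (vl l) t).
    apply: (@L1_cut R _ (c / g * expR (g * x))) => // t tx.
    by apply: (le_trans (Jb t)); exact: (cut_expR_le cg (ltW g0) tx).
  rewrite /voltT /K /cutI -cintZ // -cintB //; last 2 first.
  - have -> : (fun x0 : R => (0 < x0 < x)%R%:R * (voltV q M (cutJ (vl l)) x0 - l0 * cutJ (vl l) x0)) =
        fun t => (0 < t < x)%R%:R * voltV q M (cutJ (vl l)) t - l0 * ((0 < t < x)%R%:R * cutJ (vl l) t).
      by apply/funext => t; move: (voltV _ _ _ _) (cutJ _ _) => X Y; ring.
    exact: (L1B l1 (L1Z l0 l2)).
  - exact: L1Z.
  by apply: eq_cint => t; rewrite /h; move: (voltV _ _ _ _) (cutJ _ _) => X Y; ring.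
have Er m x : D x -> r m.+1 x = - h * K (r m) x + voltT l0 (r m.+1) x.
  move: x; elim: m => [|m ih] x Dx.
    have [mv [c c0 vc]] := Pvl l; have [mv0 [d dd0 vd]] := Pvj 0%N.
    rewrite (_ : r 1%N = fun x => 1 * vl l x + (- 1) * vj 0%N x); last first.
      by apply/funext => y; rewrite rS r0E expr0.
    rewrite (Tlin l0 _ _ _ _ c d) // r0E {1}evl // {1}Evj0 // TE //.
    by move: (voltT l0 (vl l) x) (K (vl l) x) (voltT l0 (vj 0%N) x) => X Y Z; ring.
  have [mr [c c0 rc]] := Pr m.+1; have [mv [d dd0 vd]] := Pvj m.+1.
  have [mr' [c' c0' rc']] := Pr m; have [mv' [d' dd0' vd']] := Pvj m.
  have TS : voltT l0 (r m.+2) x = voltT l0 (r m.+1) x - h ^+ m.+1 * voltT l0 (vj m.+1) x.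
    rewrite (_ : r m.+2 = fun x => 1 * r m.+1 x + (- h ^+ m.+1) * vj m.+1 x); last first.
      by apply/funext => y; exact: rS.
    by rewrite (Tlin l0 _ _ _ _ c d) //; move: (voltT _ _ _) (voltT _ _ _) => X Y; ring.
  have KS : K (r m.+1) x = K (r m) x - h ^+ m * K (vj m) x.
    rewrite (_ : r m.+1 = fun x => 1 * r m x + (- h ^+ m) * vj m x); last first.
      by apply/funext => y; exact: rS.
    rewrite /K.
    have -> : cutJ (fun x => 1 * r m x + (- h ^+ m) * vj m x) = fun s => 1 * cutJ (r m) s + (- h ^+ m) * cutJ (vj m) s.
      apply/funext => s; apply: (@cutJ_linear R _ _ _ _ (c' * w pi) (d' * w pi)) => //.
        exact: sb rc' c0'.
      exact: sb vd' dd0'.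
    have Jb v a s : cmfun v -> 0 <= a -> (forall x, D x -> nc (v x) <= a * w x) -> 0 < s < x -> nc (cutJ v s) <= a / g * expR (g * x).
      move=> m0 a0 va sx; apply: (@le_trans _ _ (a / g * expR (g * s))); first exact: cutJ_bound.
      by apply: (cut_expR_le _ (ltW g0) sx); rewrite divr_ge0 // ltW.
    rewrite (@cutI_linear R _ _ _ _ (c' / g * expR (g * x)) (d' / g * expR (g * x))) //; try exact: cmfun_cutJ.
    - by move: (cutI _ _) (cutI _ _) => X Y; ring.
    - by move=> s; exact: Jb.
    - by move=> s; exact: Jb.
  rewrite rS mul1r {1}ih // {1}Evj // TS KS exprS.
  by move: (K (r m) x) (K (vj m) x) (voltT l0 (r m.+1) x) (voltT l0 (vj m.+1) x) => X Y Z W; ring.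
(* r_0 is the solution itself, bounded by 4 since its forcing term is 1. Each further step has
   forcing - h K r_m and K does not increase the weighted bound, so one factor 4 |h| appears. *)
have rb m : forall x, D x -> nc (r m x) <= ((4 * nc h) ^+ m * 4) * w x.
  elim: m => [|m ih].
    have [mv [C C0 vC]] := Pvl l.
    rewrite r0E expr0 mul1r => x Dx; rewrite -[4]mulr1.
    apply: (@gronwall R D w (voltT l) 1 C (vl l) (fun=> 1)); last exact: Dx.
    - by move=> y _; exact: w0.
    - by move=> a a0 va; exact: (Tb l _ _ (ltW ll) mv a0 va).
    - exact: ler01.
    - exact: C0.
    - exact: vC.
    - by move=> y Dy; rewrite nc1 mul1r w1.
    - by move=> y Dy; exact: evl.
  have [mv [C C0 vC]] := Pr m.+1; have [mv' _] := Pr m.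
  move=> x Dx.
  have -> : (4 * nc h) ^+ m.+1 * 4 = 4 * (nc h * ((4 * nc h) ^+ m * 4)) by rewrite exprS; ring.
  have p0 : 0 <= (4 * nc h) ^+ m * 4 by rewrite mulr_ge0 // exprn_ge0 // mulr_ge0 // nc_ge0.
  apply: (@gronwall R D w (voltT l0) (nc h * ((4 * nc h) ^+ m * 4)) C (r m.+1) (fun x => - h * K (r m) x)); last exact: Dx.
  - by move=> y _; exact: w0.
  - by move=> a a0 va; exact: (Tb l0 _ _ d0 mv a0 va).
  - by rewrite mulr_ge0 ?nc_ge0.
  - exact: C0.
  - exact: vC.
  - by move=> y Dy; rewrite ncM ncN -mulrA ler_wpM2l ?nc_ge0 //; exact: Kb.
  - by move=> y Dy; exact: Er.
have := rb n pi piD; rewrite /r -/h => hn; apply: (le_trans hn).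
by rewrite exprMn exprS le_eqVlt; apply/orP; left; apply/eqP; ring.
Qed.

End volterra_analytic.

(** * The sine-type solution *)

Section sine_solution.
Context {R : realType}.
Local Notation mu := (@lebesgue_measure R).
Implicit Types (f v y : R -> R[i]).

(** Coefficients are controlled on (0, pi) only; the extension by zero is measurable on the whole
    line. *)
Definition ext f (x : R) : R[i] := (0 < x < pi)%R%:R * f x.

Lemma Re_ext f : (fun x => complex.Re (ext f x)) = (fun x => complex.Re (f x)) \_ `]0, pi[%classic.
Proof.
apply/funext => x; rewrite patchE mem_setE in_itv /= /ext.
by case: (0 < x < pi); rewrite ?mul1r ?mul0r.
Qed.

Lemma Im_ext f : (fun x => complex.Im (ext f x)) = (fun x => complex.Im (f x)) \_ `]0, pi[%classic.
Proof.
apply/funext => x; rewrite patchE mem_setE in_itv /= /ext.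
by case: (0 < x < pi); rewrite ?mul1r ?mul0r.
Qed.

Lemma ext_supp f (x : R) : ~~ (0 < x < pi) -> ext f x = 0.
Proof. by rewrite /ext => /negPf ->; rewrite mul0r. Qed.

Lemma cmfun_ext f : measurable_fun `]0, pi[ (fun x : R => complex.Re (f x)) ->
  measurable_fun `]0, pi[ (fun x : R => complex.Im (f x)) -> cmfun (ext f).
Proof.
move=> mr mi; split.
  by rewrite Re_ext; exact: (measurable_restrictT _ (measurable_itv `]0, pi[)).1 mr.
by rewrite Im_ext; exact: (measurable_restrictT _ (measurable_itv `]0, pi[)).1 mi.
Qed.

(** The inverse is rewritten as exp(- ln(pi - x)), whose measurability on the line is immediate. *)
Lemma ext_conv_kernel (M0 : R -> R[i]) :
  ext (conv_kernel M0) = fun x => (expR (- ln (pi - x)))%:C * ext M0 x.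
Proof.
apply/funext => x; rewrite /ext /conv_kernel; case: (boolP (0 < x < pi)) => [/andP[_ xpi]|_].
  by rewrite !mul1r expRN lnK // posrE subr_gt0.
by rewrite !mul0r mulr0.
Qed.

Lemma cmfun_conv_kernel (M0 : R -> R[i]) : measurable_fun `]0, pi[ (fun x : R => complex.Re (M0 x)) ->
  measurable_fun `]0, pi[ (fun x : R => complex.Im (M0 x)) -> cmfun (ext (conv_kernel M0)).
Proof.
move=> mr mi; rewrite ext_conv_kernel; apply: cmfunM; last exact: cmfun_ext.
apply: cmfun_real; apply: measurableT_comp; first exact: measurable_expR.
apply: measurableT_comp => //; apply: measurableT_comp; first exact: measurable_ln.
by apply: measurable_funB => //; exact: measurable_cst.
Qed.

Lemma integrable_L1 f : mu.-integrable setT (fun x => (complex.Re (f x))%:E) ->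
  mu.-integrable setT (fun x => (complex.Im (f x))%:E) -> L1 f.
Proof.
move=> hr hi; have [mr ir] := integrableP _ _ _ hr; have [mi ii] := integrableP _ _ _ hi.
have cf : cmfun f by split; exact/measurable_EFinP.
split => //.
apply: (@le_lt_trans _ _ (\int[mu]_x (`|(complex.Re (f x))%:E| + `|(complex.Im (f x))%:E|))%E).
  under [leRHS]eq_integral do rewrite -EFinD.
  apply: le_int => [||x|x].
  - exact: cmfun_nc.
  - by apply: measurable_funD; apply: measurableT_comp => //; [exact: cf.1|exact: cf.2].
  - exact: nc_ge0.
  - exact: nc_ReIm.
rewrite ge0_integralD //; first exact: lte_add_pinfty.
  exact: measurableT_comp.
exact: measurableT_comp.
Qed.

Lemma L1_ext f : cintegrable `[0, pi] f -> L1 (ext f).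
Proof.
have sub : (`]0, (pi : R)[ `<=` `[0, pi])%classic by move=> x /=; exact: subset_itv_oo_cc.
move=> [hr hi]; apply: integrable_L1.
  have := Re_ext f => /(congr1 (fun g : R -> R => EFin \o g)); rewrite /comp => ->.
  have /integrable_mkcond : mu.-integrable `]0, pi[ (fun x => (complex.Re (f x))%:E).
    by apply: integrableS hr.
  move=> /(_ (measurable_itv _)); apply: eq_integrable => // x _ /=; by rewrite !patchE; case: ifP.
have := Im_ext f => /(congr1 (fun g : R -> R => EFin \o g)); rewrite /comp => ->.
have /integrable_mkcond : mu.-integrable `]0, pi[ (fun x => (complex.Im (f x))%:E).
  by apply: integrableS hi.
move=> /(_ (measurable_itv _)); apply: eq_integrable => // x _ /=; by rewrite !patchE; case: ifP.
Qed.

Lemma cintegral_cutI f (x : R) : cintegrable `[0, pi] f -> 0 <= x <= pi ->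
  cintegral `[0, x] f = cutI (ext f) x.
Proof.
move=> [hr hi] /andP[x0 xpi].
have sub : (`]0, x[ `<=` `[0, (pi : R)])%classic.
  move=> t /=; rewrite !in_itv /= => /andP[t0 tx]; rewrite (ltW t0) /=.
  by rewrite (le_trans (ltW tx)).
have sub' : (`]0, x] `<=` `[0, (pi : R)])%classic.
  move=> t /=; rewrite !in_itv /= => /andP[t0 tx]; rewrite (ltW t0) /=.
  by rewrite (le_trans tx).
transitivity (cintegral `]0, x[ f).
  rewrite /cintegral; congr (_ +i* _).
    rewrite -Rintegral_itv_obnd_cbnd; last by apply: integrableS hr.
    by rewrite -Rintegral_itv_bndo_bndc //; apply: integrableS hr.
  rewrite -Rintegral_itv_obnd_cbnd; last by apply: integrableS hi.
  by rewrite -Rintegral_itv_bndo_bndc //; apply: integrableS hi.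
rewrite cintegral_oo; apply: eq_cint => t; rewrite /ext.
case: (boolP (0 < t < x)) => [/andP[t0 tx]|_]; last by rewrite !mul0r.
by rewrite t0 (lt_le_trans tx xpi) !mul1r.
Qed.

Lemma cutI_ext f (x : R) : x <= pi -> cutI (ext f) x = cutI f x.
Proof.
move=> xpi; apply: eq_cutI => t /andP[t0 tx].
by rewrite /ext t0 (lt_le_trans tx xpi) mul1r.
Qed.

(** Nothing is known of [dy] outside [0, pi], so it is replaced by v = 1 + the integral of the
    extended second derivative: v agrees with [dy] on (0, pi], is measurable on the line and is
    bounded. Inserting the differential equation under this integral gives the Volterra equation. *)
Lemma sine_solution_volterra (q M0 : R -> R[i]) (rho : R[i]) y dy : in_L2 q -> in_L2 M0 ->
  is_sine_solution q M0 rho y dy -> exists v, [/\ cmfun v,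
    exists C : R, forall x : R, 0 < x <= pi -> nc (v x) <= C,
    forall x : R, 0 < x <= pi -> v x = dy x,
    forall x : R, 0 < x <= pi -> v x = 1 + voltT (ext q) (ext (conv_kernel M0)) (rho ^+ 2) v x
    & forall x : R, 0 < x < pi -> cutJ v x = y x].
Proof.
move=> [mqr mqi _] [mMr mMi _] [[d2y [[idy ydy] [id2y dyd2y]] ae] y0 dy0].
pose v x := 1 + cutI (ext d2y) x.
have ld := L1_ext id2y.
have mq : cmfun (ext q) by exact: cmfun_ext.
have mM := cmfun_conv_kernel mMr mMi.
have mv : cmfun v by apply: cmfunD; [exact: cmfun_cst|exact: cmfun_cutI ld.1].
have vE x : 0 < x <= pi -> v x = dy x.
  move=> /andP[x0 xpi]; rewrite dyd2y ?in_itv /= ?(ltW x0) //.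
  by rewrite dy0 cintegral_cutI // (ltW x0).
have JE x : 0 < x < pi -> cutJ v x = y x.
  move=> /andP[x0 xpi]; rewrite ydy ?in_itv /= ?(ltW x0) ?(ltW xpi) //.
  rewrite y0 add0r cintegral_cutI ?(ltW x0) ?(ltW xpi) // cutI_ext ?(ltW xpi) //.
  rewrite /cutJ x0 xpi mul1r; apply: eq_cutI => t /andP[t0 tx].
  by apply: vE; rewrite t0 (ltW (lt_trans tx xpi)).
exists v; split => //.
- case: ld => ld1 ld2.
  exists (1 + fine (\int[mu]_t (nc (ext d2y t))%:E)%E) => x _.
  rewrite (le_trans (ncD _ _)) // nc1 lerD2l -lee_fin fineK; last first.
    by rewrite ge0_fin_numE //; apply: integral_ge0 => t _; rewrite lee_fin nc_ge0.
  apply: (le_trans (nc_cint _)); first by apply: cmfunM => //; exact: cmfun_itv.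
  apply: le_int => [||t|t].
  - by apply/cmfun_nc/cmfunM => //; exact: cmfun_itv.
  - exact: cmfun_nc.
  - exact: nc_ge0.
  - by rewrite nc_boolM ler_piMl ?nc_ge0 // bR_le1.
- move=> x /andP[x0 xpi]; rewrite /v /voltT; congr (1 + _).
  (* The differential equation holds almost everywhere, which is enough under the integral sign. *)
  rewrite /cutI; apply: ae_eq_cint.
  + by apply: cmfunM; [exact: cmfun_itv|exact: ld.1].
  + apply: cmfunM; first exact: cmfun_itv.
    apply: cmfunB; last exact/cmfunZ/cmfun_cutJ.
    apply: cmfunD; first by apply: cmfunM => //; exact: cmfun_cutJ.
    apply: (@cmfun_cint _ _ _ (fun p : R * R => ext (conv_kernel M0) (p.1 - p.2) * cutJ v p.2)).
    apply: cmfunM; first exact: (cmfun_comp measurable_sub2 mM).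
    exact: (cmfun_comp measurable_snd (cmfun_cutJ mv)).
  + move: ae; apply: (@filterS _ _ (ae_filter_ringOfSetsType mu)) => t /= ht.
    case: (boolP (0 < t < x)) => [/andP[t0 tx]|_]; last by rewrite !mul0r.
    have tpi := lt_le_trans tx xpi.
    rewrite !mul1r /ext t0 tpi mul1r -/(ext _).
    have := ht _; rewrite in_itv /= t0 tpi => /(_ isT) h.
    rewrite JE ?t0 // -h /voltV JE ?t0 // {1}/ext t0 tpi mul1r.
    rewrite cintegral_oo.
    rewrite (_ : cint (fun s => (0 < s < t)%R%:R * _) = cint (fun s => ext (conv_kernel M0) (t - s) * cutJ v s)).
      by move: (cint _) (d2y t) (q t * y t) => X Y Z; ring.
    apply: eq_cint => s; rewrite /ext.
    have [s0|s0] := boolP (0 < s); last by rewrite cutJ_supp // mul0r mulr0.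
    have [st|st] /= := boolP (s < t); last first.
      rewrite (_ : (0 < t - s) = false) ?mul0r //.
      by apply/negbTE; rewrite subr_gt0.
    rewrite subr_gt0 st /= (_ : t - s < pi); last by lra.
    by rewrite mul1r mul1r JE // s0 (lt_trans st).
Qed.

End sine_solution.

Section l2_data.
Context {R : realType}.
Local Notation mu := (@lebesgue_measure R).

(* M is the singular kernel (pi - t)^-1 M_0, hence the weight in ld_b. *)
Record l2_data (q M : R -> R[i]) (a b : R) : Prop := L2Data {
  ld_q : cmfun q;
  ld_M : cmfun M;
  ld_qsupp : forall t, ~~ (0 < t < pi) -> q t = 0;
  ld_Msupp : forall t, ~~ (0 < t < pi) -> M t = 0;
  ld_a0 : 0 <= a;
  ld_b0 : 0 <= b;
  ld_a : (\int[mu]_t (nc (q t) ^+ 2)%:E <= (a ^+ 2)%:E)%E;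
  ld_b : (\int[mu]_t ((nc (M t) * (pi - t)) ^+ 2)%:E <= (b ^+ 2)%:E)%E }.

(** Cauchy-Schwarz against the indicator of (0, pi), with sqrt(pi) <= 2. This 2 is the origin of D =
    2 a + 2 b throughout. *)
Lemma CS_support (f : R -> R) (a : R) : measurable_fun setT f -> (forall t, 0 <= f t) ->
  (forall t, ~~ (0 < t < pi) -> f t = 0) -> 0 <= a ->
  (\int[mu]_t (f t ^+ 2)%:E <= (a ^+ 2)%:E)%E -> (\int[mu]_t (f t)%:E <= (2 * a)%:E)%E.
Proof.
move=> mf f0 fs a0 fa.
have mi : measurable_fun setT (fun t : R => bR (0 < t < pi) : R) := measurable_bR (measurable_itvb 0 pi).
have p4 : pi <= 4 :> R by have := pihalf_lt2 R; lra.
have p0 := pi_gt0 R.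
have h : (\int[mu]_t (bR (0 < t < (pi : R)) ^+ 2)%:E <= pi%:E)%E.
  have E (t : R) : bR (0 < t < (pi : R)) ^+ 2 = (0 < t < (pi : R))%R%:R :> R.
    by rewrite /bR; case: (0 < t < pi); rewrite ?expr1n ?expr0n.
  under eq_integral do rewrite E.
  by rewrite integral_itv_len ?(ltW p0) // subr0.
have := CS_le mf mi f0 (fun t => bR_ge0 _) fa h.
under eq_integral => t _.
  rewrite (_ : f t * bR (0 < t < pi) = f t); last first.
    by rewrite /bR; have [|/fs ->] := boolP (0 < t < pi); rewrite ?mulr1 ?mul0r.
  over.
move=> /le_trans; apply; rewrite lee_fin.
have -> : 2 * a = Num.sqrt ((2 * a) ^+ 2) by rewrite sqrtr_sqr ger0_norm // mulr_ge0.
rewrite ler_sqrt ?sqr_ge0 // exprMn mulrC ler_wpM2r ?sqr_ge0 //.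
by rewrite -natrX.
Qed.

Lemma l2_volterra q M a b : l2_data q M a b -> volterra_data q M (2 * a) (2 * b).
Proof.
move=> h; have mM := ld_M h; split.
- exact: ld_q h.
- exact: mM.
- exact: ld_qsupp h.
- exact: ld_Msupp h.
- apply: CS_support.
  + exact/cmfun_nc/(ld_q h).
  + by move=> t; exact: nc_ge0.
  + by move=> t /(ld_qsupp h) ->; rewrite nc0.
  + exact: ld_a0 h.
  + exact: ld_a h.
- apply: CS_support.
  + apply: measurable_funM; first exact: cmfun_nc.
    by apply: measurable_funB => //; exact: measurable_cst.
  + move=> t; have [/andP[_ tp]|/(ld_Msupp h) ->] := boolP (0 < t < pi); last by rewrite nc0 mul0r.
    by rewrite mulr_ge0 ?nc_ge0 // subr_ge0 ltW.
  + by move=> t /(ld_Msupp h) ->; rewrite nc0 mul0r.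
  + exact: ld_b0 h.
  + exact: ld_b h.
Qed.

Lemma L2norm_ext (f : R -> R[i]) : in_L2 f ->
  (\int[mu]_t (nc (ext f t) ^+ 2)%:E = (L2norm f ^+ 2)%:E)%E.
Proof.
move=> [mr mi fi].
have E : (\int[mu]_(t in `]0%R, (pi : R)[) (nc (f t) ^+ 2)%:E = \int[mu]_t (nc (ext f t) ^+ 2)%:E)%E.
  rewrite integral_mkcond; apply: eq_integral => t _; rewrite patchE mem_setE in_itv /= /ext.
  by case: (0 < t < pi); rewrite ?mul1r ?mul0r ?nc0 ?expr0n.
rewrite /L2norm sqr_sqrtr; last by apply: Rintegral_ge0 => t _; exact: sqr_ge0.
rewrite /Rintegral fineK E // ge0_fin_numE -?E //.
by apply: integral_ge0 => t _; rewrite lee_fin sqr_ge0.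
Qed.

(** The weight pi - t in [ld_b] cancels the denominator of the kernel, which leaves the norm of
    M_0. *)
Lemma in_L2_data (q M0 : R -> R[i]) : in_L2 q -> in_L2 M0 ->
  l2_data (ext q) (ext (conv_kernel M0)) (L2norm q) (L2norm M0).
Proof.
move=> hq hM; have [mqr mqi _] := hq; have [mMr mMi _] := hM; split.
- exact: cmfun_ext.
- exact: cmfun_conv_kernel.
- by move=> t; exact: ext_supp.
- by move=> t; exact: ext_supp.
- exact: sqrtr_ge0.
- exact: sqrtr_ge0.
- by rewrite L2norm_ext.
- rewrite -L2norm_ext // le_eqVlt; apply/orP; left; apply/eqP.
  apply: eq_integral => t _; congr (_ ^+ 2)%:E; rewrite /ext /conv_kernel !nc_boolM /bR.
  case: (boolP (0 < t < pi)) => [/andP[_ tp]|_]; last by rewrite !mul0r.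
  have tp' : 0 < pi - t by rewrite subr_gt0.
  by rewrite ncM nc_real gtr0_norm ?invr_gt0 // !mul1r mulrAC mulVf ?mul1r // gt_eqF.
Qed.

End l2_data.

(** * Variation of constants for a first-order integral equation *)

Section variation_of_constants.
Context {R : realType}.
Local Notation mu := (@lebesgue_measure R).

Lemma int_prod (f g : R -> R) (A B : R) : measurable_fun setT f -> measurable_fun setT g ->
  (forall x, 0 <= f x) -> (forall x, 0 <= g x) ->
  (\int[mu]_x (f x)%:E <= A%:E)%E -> (\int[mu]_x (g x)%:E <= B%:E)%E ->
  (\int[mu]_x \int[mu]_y (f x * g y)%:E <= (A * B)%:E)%E.
Proof.
move=> mf mg f0 g0 fA gB.
have B0 : 0 <= B.
  by rewrite -lee_fin (le_trans _ gB) //; apply: integral_ge0 => x _; rewrite lee_fin.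
have A0 : 0 <= A.
  by rewrite -lee_fin (le_trans _ fA) //; apply: integral_ge0 => x _; rewrite lee_fin.
apply: (@le_trans _ _ (\int[mu]_x (B%:E * (f x)%:E))%E).
  apply: ge0_le_integral => //.
  - by move=> x _; apply: integral_ge0 => y _; rewrite lee_fin mulr_ge0.
  - apply: (measurable_int_param (h := fun p : R * R => f p.1 * g p.2)).
      by apply: measurable_funM; apply: measurableT_comp.
    by move=> p; rewrite mulr_ge0.
  - by apply/measurable_EFinP; apply: measurable_funM => //; exact: measurable_cst.
  - move=> x _; under eq_integral do rewrite EFinM.
    rewrite ge0_integralZl_EFin //; last by apply/measurable_EFinP.
      by rewrite -EFinM mulrC EFinM lee_wpmul2l ?lee_fin.
    by move=> y _; rewrite lee_fin.
rewrite ge0_integralZl_EFin //; last by apply/measurable_EFinP.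
  by rewrite mulrC EFinM lee_wpmul2l ?lee_fin.
by move=> x _; rewrite lee_fin.
Qed.

Lemma int_prod_lt (h : R * R -> R[i]) (f g : R -> R) : cmfun h ->
  measurable_fun setT f -> measurable_fun setT g ->
  (forall x, 0 <= f x) -> (forall x, 0 <= g x) ->
  (\int[mu]_x (f x)%:E < +oo)%E -> (\int[mu]_x (g x)%:E < +oo)%E ->
  (forall p, nc (h p) <= f p.1 * g p.2) ->
  (\int[mu]_x \int[mu]_y (nc (h (x, y)))%:E < +oo)%E.
Proof.
move=> mh mf mg f0 g0 fA gB hfg.
have fin (u : R -> R) : (forall x, 0 <= u x) -> (\int[mu]_x (u x)%:E < +oo)%E ->
    (\int[mu]_x (u x)%:E <= (fine (\int[mu]_x (u x)%:E))%:E)%E.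
  move=> u0 uA; rewrite fineK // ge0_fin_numE //.
  by apply: integral_ge0 => x _; rewrite lee_fin.
apply: le_lt_trans (ltry (fine (\int[mu]_x (f x)%:E) * fine (\int[mu]_x (g x)%:E))).
apply: le_trans (int_prod mf mg f0 g0 (fin _ f0 fA) (fin _ g0 gB)).
apply: ge0_le_integral => //.
- by move=> x _; apply: integral_ge0 => y _; rewrite lee_fin nc_ge0.
- by apply: (measurable_int_param (h := fun p => nc (h p))); [exact: cmfun_nc|move=> p; exact: nc_ge0].
- apply: (measurable_int_param (h := fun p : R * R => f p.1 * g p.2)).
    by apply: measurable_funM; apply: measurableT_comp.
  by move=> p; rewrite mulr_ge0.
- move=> x _; apply: ge0_le_integral => //.
  + by move=> y _; rewrite lee_fin nc_ge0.
  + apply/measurable_EFinP; apply: cmfun_nc.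
    by apply: (cmfun_comp _ mh); exact: pair1_measurable.
  + by apply/measurable_EFinP; apply: measurable_funM => //; exact: measurable_cst.
  + by move=> y _; rewrite lee_fin (hfg (x, y)).
Qed.

Lemma cmfun_expZ (a : R[i]) : cmfun (fun t : R => cexp (a * t%:C)).
Proof. by apply/cmfun_cexp/cmfunZ/cmfun_real; exact: measurable_id. Qed.

Lemma cmfun_expB (a : R[i]) (x : R) : cmfun (fun t : R => cexp (a * (x - t)%:C)).
Proof.
apply/cmfun_cexp/cmfunZ/cmfun_real; apply: measurable_funB; first exact: measurable_cst.
exact: measurable_id.
Qed.

Lemma cexp_bound (a : R[i]) (s x : R) : `|s| <= x -> nc (cexp (a * s%:C)) <= expR (nc a * x).
Proof.
move=> sx; rewrite nc_cexp ler_expR; apply: (le_trans (ler_norm _)).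
apply: (le_trans (nc_Re _)); rewrite ncM nc_real.
by rewrite ler_wpM2l ?nc_ge0.
Qed.

Definition L1on (x : R) (f : R -> R[i]) := L1 (fun t => (0 < t < x)%R%:R * f t).

Lemma cutIZ (c : R[i]) (f : R -> R[i]) (x : R) : L1on x f ->
  L1on x (fun t => c * f t) /\ cutI (fun t => c * f t) x = c * cutI f x.
Proof.
have E : (fun t => (0 < t < x)%R%:R * (c * f t)) = (fun t => c * ((0 < t < x)%R%:R * f t)).
  by apply/funext => t; rewrite mulrCA.
move=> h; split; first by rewrite /L1on E; exact: L1Z.
by rewrite /cutI E cintZ.
Qed.

Lemma cutID (f g : R -> R[i]) (x : R) : L1on x f -> L1on x g ->
  L1on x (fun t => f t + g t) /\ cutI (fun t => f t + g t) x = cutI f x + cutI g x.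
Proof.
have E : (fun t => (0 < t < x)%R%:R * (f t + g t)) =
    (fun t => (0 < t < x)%R%:R * f t + (0 < t < x)%R%:R * g t).
  by apply/funext => t; rewrite mulrDr.
move=> h k; split; first by rewrite /L1on E; exact: L1D.
by rewrite /cutI E cintD.
Qed.

Lemma cutIB (f g : R -> R[i]) (x : R) : L1on x f -> L1on x g ->
  L1on x (fun t => f t - g t) /\ cutI (fun t => f t - g t) x = cutI f x - cutI g x.
Proof.
have E : (fun t => (0 < t < x)%R%:R * (f t - g t)) =
    (fun t => (0 < t < x)%R%:R * f t - (0 < t < x)%R%:R * g t).
  by apply/funext => t; rewrite mulrBr.
move=> h k; split; first by rewrite /L1on E; exact: L1B.
by rewrite /cutI E cintB.
Qed.

Lemma L1onM (u g : R -> R[i]) (c x : R) : cmfun u -> (forall t : R, 0 < t < x -> nc (u t) <= c) ->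
  L1on x g -> L1on x (fun t => u t * g t).
Proof.
move=> mu' uc hg; apply: (@L1_le _ _ (fun t => c%:C * ((0 < t < x)%R%:R * g t))).
- have -> : (fun t => (0 < t < x)%R%:R * (u t * g t)) = (fun t => u t * ((0 < t < x)%R%:R * g t)).
    by apply/funext => t; rewrite mulrCA.
  by apply: cmfunM => //; exact: hg.1.
- exact: L1Z.
- move=> t; rewrite nc_boolM ncM [leRHS]ncM nc_real nc_boolM /bR.
  case: (boolP (0 < t < x)) => [tx|_]; last by rewrite !mul0r mulr0.
  by rewrite !mul1r ler_wpM2r ?nc_ge0 // (le_trans (uc _ tx)) // ler_norm.
Qed.

Lemma L1on_bounded (u : R -> R[i]) (c x : R) : cmfun u -> (forall t : R, 0 < t < x -> nc (u t) <= c) ->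
  L1on x u.
Proof. by move=> mu' uc; exact: L1_cut uc. Qed.

(** Integration by parts for a merely integrable h, done by Fubini on s < t < x: the inner integral
    of a e^(a (x - t)) over (s, x) is e^(a (x - s)) - 1. *)
Lemma ibp_exp (a : R[i]) (h : R -> R[i]) (x : R) : 0 <= x -> cmfun h -> L1on x h ->
  cutI (fun t => a * cexp (a * (x - t)%:C) * cutI h t) x =
  cutI (fun s => (cexp (a * (x - s)%:C) - 1) * h s) x.
Proof.
move=> x0 mh lh.
pose H (p : R * R) : R[i] := ((0 < p.1 < x)%R%:R * (a * cexp (a * (x - p.1)%:C))) *
  ((0 < p.2 < p.1)%R%:R * h p.2).
have m1 : measurable_fun setT (fun p : R * R => p.1) := measurable_fst.
have m2 : measurable_fun setT (fun p : R * R => p.2) := measurable_snd.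
have mF : cmfun (fun t : R => (0 < t < x)%R%:R * (a * cexp (a * (x - t)%:C))).
  by apply: cmfunM; [exact: cmfun_itv|exact/cmfunZ/cmfun_expB].
have mH : cmfun H.
  apply: cmfunM; first exact: (cmfun_comp m1 mF).
  apply: cmfunM; last exact: (cmfun_comp m2 mh).
  apply: cmfun_bool; apply: measurable_and; apply: measurable_fun_ltr => //; exact: measurable_cst.
have E1 t : (0 < t < x)%R%:R * (a * cexp (a * (x - t)%:C) * cutI h t) = cint (fun s => H (t, s)).
  have [/andP[t0 tx]|nt] := boolP (0 < t < x); last first.
    by rewrite mul0r -[LHS]cint0; apply: eq_cint => s; rewrite /H /= (negPf nt) !mul0r.
  rewrite mul1r /cutI -cintZ; first by apply: eq_cint => s; rewrite /H /= t0 tx mul1r.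
  apply: (@L1_le _ _ (fun s => (0 < s < x)%R%:R * h s)) => //.
    by apply: cmfunM => //; exact: cmfun_itv.
  move=> s; rewrite !nc_boolM ler_wpM2r ?nc_ge0 // /bR.
  case: (boolP (0 < s < t)) => [/andP[s0 st]|_]; last exact: ler0n.
  by rewrite s0 (lt_trans st).
transitivity (cint (fun t => cint (fun s => H (t, s)))).
  by apply: eq_cint => t; rewrite E1.
rewrite cfubini //; last first.
  apply: (@int_prod_lt H (fun t => nc ((0 < t < x)%R%:R * (a * cexp (a * (x - t)%:C))))
     (fun s => nc ((0 < s < x)%R%:R * h s))) => //.
  - exact: cmfun_nc.
  - exact/cmfun_nc/lh.1.
  - by move=> t; exact: nc_ge0.
  - by move=> t; exact: nc_ge0.
  - apply: (@L1on_bounded _ (nc a * expR (nc a * x)) x _ _).2.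
      exact/cmfunZ/cmfun_expB.
    move=> t /andP[t0 tx]; rewrite ncM ler_wpM2l ?nc_ge0 //; apply: cexp_bound.
    by rewrite ger0_norm; lra.
  - exact: lh.2.
  - move=> [t s]; rewrite /H ncM /=; case: (boolP (0 < t < x)) => [/andP[t0 tx]|_]; last first.
      by rewrite !mul0r nc0 !mul0r.
    rewrite ler_wpM2l ?nc_ge0 // !nc_boolM ler_wpM2r ?nc_ge0 // /bR.
    case: (boolP (0 < s < t)) => [/andP[s0 st]|_]; last exact: ler0n.
    by rewrite s0 (lt_trans st).
apply: eq_cint => s.
have [/andP[s0 sx]|ns] := boolP (0 < s < x); last first.
  rewrite mul0r -[RHS]cint0; apply: eq_cint => t; rewrite /H /=.
  case: (boolP (0 < s < t)) => [/andP[s0 st]|_]; last by rewrite mul0r mulr0.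
  case: (boolP (0 < t < x)) => [/andP[t0 tx]|_]; last by rewrite !mul0r.
  by move: ns; rewrite s0 (lt_trans st).
transitivity (cint (fun t => (- cexp (a * x%:C) * h s) * ((s < t < x)%R%:R * (- a * cexp (- a * t%:C))))).
  apply: eq_cint => t; rewrite /H /= s0 /=.
  have -> : cexp (a * (x - t)%:C) = cexp (a * x%:C) * cexp (- a * t%:C).
    by rewrite -cexpD; congr cexp; rewrite rmorphB /=; ring.
  have [st|_] /= := boolP (s < t); last by rewrite !mul0r !mulr0.
  rewrite (lt_trans s0 st) /=; case: (t < x); rewrite ?mul1r ?mul0r ?mulr0 //.
  by ring.
rewrite cintZ; last first.
  apply: (@L1_le _ _ (fun t => (0 < t < x)%R%:R * (- a * cexp (- a * t%:C)))).
  - by apply: cmfunM; [exact: cmfun_itv|exact/cmfunZ/cmfun_expZ].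
  - apply: (@L1on_bounded _ (nc a * expR (nc a * x)) x); first exact/cmfunZ/cmfun_expZ.
    move=> t /andP[t0 tx]; rewrite ncM ncN ler_wpM2l ?nc_ge0 //; rewrite -[nc a]ncN; apply: cexp_bound.
    by rewrite ger0_norm; lra.
  - move=> t; rewrite !nc_boolM ler_wpM2r ?nc_ge0 // /bR.
    case: (boolP (s < t < x)) => [/andP[st tx]|_]; last exact: ler0n.
    by rewrite tx (lt_trans s0).
rewrite cint_cexp ?(ltW sx) // mul1r.
have e1 : cexp (a * x%:C) * cexp (- a * x%:C) = 1 by rewrite mulNr cexpN.
have e2 : cexp (a * x%:C) * cexp (- a * s%:C) = cexp (a * (x - s)%:C).
  by rewrite -cexpD; congr cexp; rewrite rmorphB /=; ring.
by rewrite -e2 -e1; ring.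
Qed.

(** Apply [ibp_exp] to h = a E + g, whose antiderivative is E - 1. The integrals of e^(a (x - t)) a
    E cancel on the two sides and the solution formula remains. *)
Lemma exp_variation (a : R[i]) (E g : R -> R[i]) (C x : R) : 0 <= x -> cmfun E -> cmfun g ->
  (forall t : R, 0 < t < x -> nc (E t) <= C) -> L1on x g ->
  (forall t : R, 0 < t <= x -> E t = 1 + cutI (fun s => a * E s + g s) t) -> 0 < x ->
  E x = cexp (a * x%:C) + cutI (fun s => cexp (a * (x - s)%:C) * g s) x.
Proof.
move=> x0 mE mg EC lg EE x1.
pose h s := a * E s + g s.
have lE : L1on x E by exact: L1on_bounded EC.
have [laE _] := cutIZ a lE.
have [lh _] := cutID laE lg.
have mh : cmfun h by apply: cmfunD => //; exact: cmfunZ.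
have eb t : 0 < t < x -> nc (cexp (a * (x - t)%:C)) <= expR (nc a * x).
  by move=> /andP[t0 tx]; apply: cexp_bound; rewrite ger0_norm; lra.
have me := cmfun_expB a x.
have := ibp_exp a x0 mh lh.
have leE : L1on x (fun t => cexp (a * (x - t)%:C) * (a * E t)) by exact: L1onM eb laE.
have leg : L1on x (fun t => cexp (a * (x - t)%:C) * g t) by exact: L1onM eb lg.
have lae : L1on x (fun t => a * cexp (a * (x - t)%:C)).
  by have [] := cutIZ a (L1on_bounded me eb).
have -> : cutI (fun t => a * cexp (a * (x - t)%:C) * cutI h t) x =
    cutI (fun t => cexp (a * (x - t)%:C) * (a * E t)) x - cutI (fun t => a * cexp (a * (x - t)%:C)) x.
  rewrite -(cutIB leE lae).2; apply: eq_cutI => t /andP[t0 tx].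
  by rewrite EE ?t0 ?ltW // -/h; ring.
have -> : cutI (fun s => (cexp (a * (x - s)%:C) - 1) * h s) x =
    cutI (fun t => cexp (a * (x - t)%:C) * (a * E t)) x + cutI (fun t => cexp (a * (x - t)%:C) * g t) x
    - cutI h x.
  rewrite -(cutID leE leg).2 -(cutIB (cutID leE leg).1 lh).2; apply: eq_cutI => t _.
  by rewrite /h; ring.
have -> : cutI (fun t => a * cexp (a * (x - t)%:C)) x = cexp (a * x%:C) - 1.
  have -> : cutI (fun t => a * cexp (a * (x - t)%:C)) x =
      cint (fun t => - cexp (a * x%:C) * ((0 < t < x)%R%:R * (- a * cexp (- a * t%:C)))).
    apply: eq_cint => t.
    have -> : cexp (a * (x - t)%:C) = cexp (a * x%:C) * cexp (- a * t%:C).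
      by rewrite -cexpD; congr cexp; rewrite rmorphB /=; ring.
    by ring.
  rewrite cintZ; last first.
    apply: (@L1on_bounded _ (nc a * expR (nc a * x)) x); first exact/cmfunZ/cmfun_expZ.
    move=> t /andP[t0 tx]; rewrite ncM ncN ler_wpM2l ?nc_ge0 //; rewrite -[nc a]ncN; apply: cexp_bound.
    by rewrite ger0_norm; lra.
  rewrite cint_cexp // mulrBr mulr0 cexp0 mulNr mulr1.
  have -> : cexp (a * x%:C) * cexp (- a * x%:C) = 1 by rewrite mulNr cexpN.
  by ring.
rewrite (EE x) ?x1 ?lexx // -/h.
move: (cutI _ _) (cutI _ _) (cutI _ _) (cexp _) => X Y Z W hh.
by apply/eqP; rewrite -subr_eq0; apply/eqP; move/eqP: hh; rewrite -subr_eq0 => /eqP hh; rewrite -[RHS]hh; ring.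
Qed.

End variation_of_constants.

Section trigonometric_form.
Context {R : realType}.
Local Notation mu := (@lebesgue_measure R).
Context (q M : R -> R[i]) (A B : R) (hd : volterra_data q M A B).

Lemma Im_mulr_real (z : R[i]) (x : R) : complex.Im (z * x%:C) = complex.Im z * x.
Proof. by rewrite cImM /= mulr0 add0r. Qed.

Lemma nc_trig (rho : R[i]) (x t : R) : t <= x ->
  nc (ccos (rho * (x - t)%:C)) <= expR (`|complex.Im rho| * (x - t)) /\
  nc (csin (rho * (x - t)%:C)) <= expR (`|complex.Im rho| * (x - t)).
Proof.
move=> tx; have E : `|complex.Im (rho * (x - t)%:C)| = `|complex.Im rho| * (x - t).
  by rewrite Im_mulr_real normrM (ger0_norm (x := x - t)) // subr_ge0.
by split; rewrite -E; [exact: nc_ccos|exact: nc_csin].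
Qed.

Lemma cmfun_ccosB (rho : R[i]) (x : R) : cmfun (fun t : R => ccos (rho * (x - t)%:C)).
Proof.
apply/cmfun_ccos/cmfunZ/cmfun_real; apply: measurable_funB; first exact: measurable_cst.
exact: measurable_id.
Qed.

Lemma cmfun_csinB (rho : R[i]) (x : R) : cmfun (fun t : R => csin (rho * (x - t)%:C)).
Proof.
apply/cmfun_csin/cmfunZ/cmfun_real; apply: measurable_funB; first exact: measurable_cst.
exact: measurable_id.
Qed.

(** The growth e^(g (x - t)) of the kernel and the weight e^(- g t) of [V_bound] match, so that
    exactly e^(g x) comes out. *)
Lemma cut_trig_bound (k y : R -> R[i]) (c g x : R) : cmfun k -> cmfun y -> 0 <= c -> 0 <= g -> x <= pi ->
  (forall t : R, 0 < t < x -> nc (k t) <= expR (g * (x - t))) ->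
  (forall s : R, ~~ (0 < s) -> y s = 0) ->
  (forall s : R, 0 < s < x -> nc (y s) <= c * expR (g * s)) ->
  nc (cutI (fun t => k t * voltV q M y t) x) <= c * (A + B) * expR (g * x).
Proof.
move=> mk my c0 g0 xpi kb ys yb; rewrite -lee_fin.
have mV := cmfun_V hd my.
have mE : measurable_fun setT (fun t : R => expR (- (g * t))).
  apply: measurableT_comp; first exact: measurable_expR.
  by apply: measurableT_comp => //; apply: measurable_funM => //; exact: measurable_cst.
have mb : measurable_fun setT (fun t : R => bR (0 < t < x) * (expR (- (g * t)) * nc (voltV q M y t))).
  apply: measurable_funM; first exact: (measurable_bR (measurable_itvb 0 x)).
  by apply: measurable_funM => //; exact: cmfun_nc.
apply: (le_trans (nc_cint _)).
  by apply: cmfunM; [exact: cmfun_itv|exact: cmfunM].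
apply: (@le_trans _ _ (\int[mu]_t ((expR (g * x))%:E * (bR (0 < t < x) * (expR (- (g * t)) * nc (voltV q M y t)))%:E))%E).
  under [leRHS]eq_integral do rewrite -EFinM.
  apply: le_int => [||t|t].
  - by apply/cmfun_nc/cmfunM; [exact: cmfun_itv|exact: cmfunM].
  - by apply: measurable_funM => //; exact: measurable_cst.
  - exact: nc_ge0.
  rewrite nc_boolM ncM [leRHS]mulrCA /bR; have [tx|_] := boolP (0 < t < x); last by rewrite !mul0r.
  rewrite !mul1r mulrA -expRD ler_wpM2r ?nc_ge0 //.
  have -> : g * x + - (g * t) = g * (x - t) by ring.
  exact: kb.
rewrite ge0_integralZl_EFin ?expR_ge0 //; last 2 first.
- by move=> t _; rewrite lee_fin !mulr_ge0 ?bR_ge0 ?expR_ge0 ?nc_ge0.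
- exact/measurable_EFinP.
rewrite [leRHS]EFinM muleC lee_wpmul2r ?lee_fin ?expR_ge0 //.
exact: (V_bound hd).
Qed.

Section solution.
Context (rho : R[i]) (v : R -> R[i]) (C : R) (mv : cmfun v).
Context (vC : forall x : R, 0 < x <= pi -> nc (v x) <= C).
Context (vE : forall x : R, 0 < x <= pi -> v x = 1 + voltT q M (rho ^+ 2) v x).

Local Notation V := (voltV q M (cutJ v)).

Let C0 : 0 <= C.
Proof. by apply: le_trans (vC (x := pi) _); rewrite ?nc_ge0 // lexx pi_gt0. Qed.

Let vC1 (t : R) : 0 < t <= pi -> nc (v t) <= C * expR (1 * t).
Proof.
move=> tp; rewrite (le_trans (vC tp)) // ler_peMr // -[leLHS]expR0 ler_expR mul1r.
by case/andP: tp => /ltW.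
Qed.

Let Jb (s : R) : nc (cutJ v s) <= C * expR (1 * s).
Proof. by have := @cutJ_bound R v C 1 s mv (lexx 1) C0 vC1; rewrite divr1. Qed.

Let mJ := cmfun_cutJ mv.
Let mV := cmfun_V hd mJ.

Lemma L1on_V (x : R) : x <= pi -> L1on x V.
Proof.
move=> xpi; exact: (L1_cutV hd mJ xpi C0 ler01 (@cutJ_supp R v) (fun s _ => Jb s)).1.
Qed.

Lemma L1on_v (x : R) : x <= pi -> L1on x v.
Proof.
move=> xpi; apply: (L1on_bounded mv (c := C)) => t /andP[t0 tx].
by apply: vC; rewrite t0 (le_trans (ltW tx)).
Qed.

Lemma L1on_cutI (x : R) : x <= pi -> L1on x (cutI v).
Proof.
move=> xpi; apply: (L1on_bounded (cmfun_cutI mv) (c := C * expR (1 * x))) => t /andP[t0 tx].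
apply: (@le_trans _ _ (C / 1 * expR (1 * t))).
  apply: cutI_bound => //; first exact: ltW.
  by move=> s /andP[s0 st]; apply: vC1; rewrite s0; lra.
by rewrite divr1 ler_wpM2l // ler_expR !mul1r ltW.
Qed.

(** Factorization of the second-order operator: with S the antiderivative of v, E = v + a S
    satisfies E' = a E + V, because v' = V - rho^2 S = V + a^2 S. *)
Lemma volterra_exp (a : R[i]) (x : R) : a ^+ 2 = - rho ^+ 2 -> 0 < x <= pi ->
  v x + a * cutI v x = cexp (a * x%:C) + cutI (fun s => cexp (a * (x - s)%:C) * V s) x.
Proof.
move=> a2 /andP[x0 xpi].
pose E t := v t + a * cutI v t.
have mE : cmfun E by apply: cmfunD => //; exact/cmfunZ/cmfun_cutI.
have Eb (t : R) : 0 < t < x -> nc (E t) <= C + nc a * (C * expR (1 * x)).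
  move=> /andP[t0 tx]; apply: (le_trans (ncD _ _)); apply: lerD.
    by apply: vC; rewrite t0; lra.
  rewrite ncM ler_wpM2l ?nc_ge0 //; apply: (@le_trans _ _ (C / 1 * expR (1 * t))).
    apply: cutI_bound => //; first exact: ltW.
    by move=> s /andP[s0 st]; apply: vC1; rewrite s0; lra.
  by rewrite divr1 ler_wpM2l // ler_expR !mul1r ltW.
apply: (exp_variation (ltW x0) mE mV Eb (L1on_V xpi) _ x0) => t /andP[t0 tx].
have tpi : t <= pi by rewrite (le_trans tx).
have l1 := L1on_V tpi; have l2 := L1on_v tpi; have l3 := L1on_cutI tpi.
have [l4 e4] := cutIZ a l2; have [l5 e5] := cutIZ (rho ^+ 2) l3.
have [l6 e6] := cutIB l1 l5; have [_ e7] := cutID l4 l6.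
rewrite /E vE ?t0 // -e4 -addrA; congr (1 + _).
have -> : voltT q M (rho ^+ 2) v t = cutI (fun s => V s - rho ^+ 2 * cutI v s) t.
  apply: eq_cutI => s /andP[s0 st]; rewrite {2}/cutJ s0 (lt_le_trans st tpi).
  by rewrite mul1r.
rewrite addrC -e7; apply: eq_cutI => s _.
have -> : rho ^+ 2 = - a ^+ 2 by rewrite a2 opprK.
by move: (V s) (v s) (cutI v s) => W X Y; ring.
Qed.

Let expb (a : R[i]) (x t : R) : 0 < t < x -> nc (cexp (a * (x - t)%:C)) <= expR (nc a * x).
Proof. by move=> /andP[t0 tx]; apply: cexp_bound; rewrite ger0_norm; lra. Qed.

(** Half sum and half difference of [volterra_exp] for a = i rho and a = - i rho. The second formula
    is left multiplied by rho, which keeps it valid at rho = 0. *)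
Lemma volterra_trig (x : R) : 0 < x <= pi ->
  v x = ccos (rho * x%:C) + cutI (fun s => ccos (rho * (x - s)%:C) * V s) x /\
  rho * cutI v x = csin (rho * x%:C) + cutI (fun s => csin (rho * (x - s)%:C) * V s) x.
Proof.
move=> xp; have /andP[x0 xpi] := xp.
pose a := 'i * rho.
have i2 : ('i : R[i]) ^+ 2 = -1 := sqr_i _.
have a2 : a ^+ 2 = - rho ^+ 2 by rewrite /a exprMn i2 mulN1r.
have b2 : (- a) ^+ 2 = - rho ^+ 2 by rewrite sqrrN.
have h1 := volterra_exp a2 xp; have h2 := volterra_exp b2 xp.
have l1 := L1onM (cmfun_expB a x) (@expb a x) (L1on_V xpi).
have l2 := L1onM (cmfun_expB (- a) x) (@expb (- a) x) (L1on_V xpi).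
have i0 : ('i : R[i]) != 0 := i_neq0.
have e (t : R) : 'i * (rho * t%:C) = a * t%:C by rewrite mulrA.
have -> : cutI (fun s => ccos (rho * (x - s)%:C) * V s) x =
    (cutI (fun s => cexp (a * (x - s)%:C) * V s) x + cutI (fun s => cexp (- a * (x - s)%:C) * V s) x) / 2.
  have [l3 <-] := cutID l1 l2; rewrite mulrC -(cutIZ _ l3).2; apply: eq_cutI => s _.
  rewrite /ccos e mulNr; by move: (cexp _) (cexp _) (V s) => X Y Z; ring.
have -> : cutI (fun s => csin (rho * (x - s)%:C) * V s) x =
    (cutI (fun s => cexp (a * (x - s)%:C) * V s) x - cutI (fun s => cexp (- a * (x - s)%:C) * V s) x) / (2 * 'i).
  have [l3 <-] := cutIB l1 l2; rewrite mulrC -(cutIZ _ l3).2; apply: eq_cutI => s _.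
  rewrite /csin e mulNr; by move: (cexp _) (cexp _) (V s) (_^-1) => X Y Z W; ring.
rewrite /ccos /csin e -mulNr.
move: h1 h2; move: (cutI _ _) (cutI _ _) (cutI _ _) (cexp _) (cexp _) => Q P S Y X h1 h2.
have vx : v x = X + P - a * S by rewrite -h1; ring.
have aS : a * S = (X + P - (Y + Q)) / 2 by rewrite -h1 -h2; field.
have i02 : 2 * 'i != 0 :> R[i] by rewrite mulf_neq0 ?pnatr_eq0.
split; first by rewrite vx aS; field.
apply: (mulfI i0); rewrite mulrA -/a aS.
by field.
Qed.

(** [gronwall] with weight e^(|Im rho| x): the integral term of [volterra_trig], divided by rho, has
    norm at most (A + B) / |rho| <= 3/4. *)
Lemma sine_bound : 0 < nc rho -> A + B <= 3 / 4 * nc rho -> forall x : R, 0 < x <= pi ->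
  nc (cutI v x) <= 4 / nc rho * expR (`|complex.Im rho| * x).
Proof.
move=> r0 AB.
have r0' : rho != 0 by rewrite -nc_gt0.
pose g (x : R) := rho^-1 * csin (rho * x%:C).
(* [gronwall] uses the operator at the solution only, so its dependence on S through V can stay
   implicit. *)
pose T (_ : R -> R[i]) (x : R) := rho^-1 * cutI (fun s => csin (rho * (x - s)%:C) * V s) x.
have -> : 4 / nc rho = 4 * (1 / nc rho) by rewrite div1r.
apply: (@gronwall R [set x : R | 0 < x <= pi] (fun x => expR (`|complex.Im rho| * x)) T (1 / nc rho)
  (C * expR (1 * pi)) (cutI v) g).
- by move=> x _; exact: expR_ge0.
- move=> c c0 Sc x /andP[x0 xpi].
  rewrite /T ncM ncV mulrC ler_pdivrMr //.
  apply: (@le_trans _ _ (c * (A + B) * expR (`|complex.Im rho| * x))).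
    apply: cut_trig_bound => //.
    - exact: cmfun_csinB.
    - by move=> t /andP[t0 tx]; exact: (nc_trig rho (ltW tx)).2.
    - exact: cutJ_supp.
    - move=> s /andP[s0 sx]; rewrite /cutJ s0 (lt_le_trans sx xpi) mul1r.
      by apply: Sc; rewrite /= s0 ltW // (lt_le_trans sx xpi).
  rewrite [leRHS]mulrAC ler_wpM2r ?expR_ge0 //.
  have -> : 3 / 4 * c * nc rho = c * (3 / 4 * nc rho) by ring.
  by rewrite ler_wpM2l.
- by rewrite divr_ge0 // ltW.
- by rewrite mulr_ge0 ?expR_ge0.
- move=> x /andP[x0 xpi].
  apply: (@le_trans _ _ (C / 1 * expR (1 * x))).
    apply: cutI_bound => //; first exact: ltW.
    by move=> s /andP[s0 st]; apply: vC1; rewrite s0; lra.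
  rewrite divr1 -mulrA ler_wpM2l // -expRD ler_expR.
  have : 0 <= `|complex.Im rho| * x by rewrite mulr_ge0 // ltW.
  by rewrite !mul1r; lra.
- move=> x /andP[x0 xpi]; rewrite /g ncM ncV mulrC div1r mulrC ler_wpM2l ?invr_ge0 ?nc_ge0 //.
  by have := (nc_trig rho (ltW x0)).2; rewrite subr0.
- move=> x xp; apply: (mulfI r0'); rewrite (volterra_trig xp).2 /g /T.
  by move: (csin _) (cutI _ _) => X Y; rewrite mulrDr !mulrA divff // !mul1r.
Qed.

(** One more iteration: the bound of [sine_bound] is put back into the integral terms of
    [volterra_trig]. *)
Lemma sine_close : 0 < nc rho -> A + B <= 3 / 4 * nc rho -> forall x : R, 0 < x <= pi ->
  nc (v x - ccos (rho * x%:C)) <= 4 / nc rho * (A + B) * expR (`|complex.Im rho| * x) /\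
  nc (rho * cutI v x - csin (rho * x%:C)) <= 4 / nc rho * (A + B) * expR (`|complex.Im rho| * x).
Proof.
move=> r0 AB x xp; have /andP[x0 xpi] := xp.
have c0 : 0 <= 4 / nc rho by rewrite divr_ge0 // ltW.
have Sb (s : R) : 0 < s < x -> nc (cutJ v s) <= 4 / nc rho * expR (`|complex.Im rho| * s).
  move=> /andP[s0 sx]; rewrite /cutJ s0 (lt_le_trans sx xpi) mul1r.
  by apply: sine_bound => //; rewrite s0 ltW // (lt_le_trans sx xpi).
split.
  rewrite (volterra_trig xp).1 [ccos _ + _]addrC addrK.
  apply: cut_trig_bound => //; first exact: cmfun_ccosB.
    by move=> t /andP[t0 tx]; exact: (nc_trig rho (ltW tx)).1.
  exact: cutJ_supp.
rewrite (volterra_trig xp).2 [csin _ + _]addrC addrK.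
apply: cut_trig_bound => //; first exact: cmfun_csinB.
  by move=> t /andP[t0 tx]; exact: (nc_trig rho (ltW tx)).2.
exact: cutJ_supp.
Qed.

End solution.
End trigonometric_form.

(** * Localization of the eigenvalues *)

Section unperturbed.
Context {R : realType}.
Local Notation mu := (@lebesgue_measure R).

Lemma volterra_data0 : @volterra_data R (fun=> 0) (fun=> 0) 0 0.
Proof.
split; try exact: cmfun_cst; try by [].
  by under eq_integral do rewrite nc0; rewrite integral0.
by under eq_integral do rewrite nc0 mul0r; rewrite integral0.
Qed.

Lemma cutI_trig (rho : R[i]) (x : R) : 0 <= x ->
  rho * cutI (fun t => ccos (rho * t%:C)) x = csin (rho * x%:C) /\
  rho * cutI (fun t => csin (rho * t%:C)) x = 1 - ccos (rho * x%:C).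
Proof.
move=> x0; pose a := 'i * rho.
have i0 : ('i : R[i]) != 0 := i_neq0.
have i2 : ('i : R[i]) ^+ 2 = -1 := sqr_i _.
have L (b : R[i]) : L1on x (fun t => cexp (b * t%:C)).
  apply: (L1on_bounded (cmfun_expZ b) (c := expR (nc b * x))) => t /andP[t0 tx].
  by apply: cexp_bound; rewrite ger0_norm; lra.
have I (b : R[i]) : b * cutI (fun t => cexp (b * t%:C)) x = cexp (b * x%:C) - 1.
  rewrite -(cutIZ b (L b)).2 /cutI cint_cexp //.
  by rewrite (_ : b * 0%:C = 0) ?cexp0 // mulr0.
have e (t : R) : 'i * (rho * t%:C) = a * t%:C by rewrite mulrA.
have -> : cutI (fun t => ccos (rho * t%:C)) x =
    (cutI (fun t => cexp (a * t%:C)) x + cutI (fun t => cexp (- a * t%:C)) x) / 2.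
  have [l3 <-] := cutID (L a) (L (- a)); rewrite mulrC -(cutIZ _ l3).2; apply: eq_cutI => s _.
  by rewrite /ccos e mulNr; move: (cexp _) (cexp _) => X Y; ring.
have -> : cutI (fun t => csin (rho * t%:C)) x =
    (cutI (fun t => cexp (a * t%:C)) x - cutI (fun t => cexp (- a * t%:C)) x) / (2 * 'i).
  have [l3 <-] := cutIB (L a) (L (- a)); rewrite mulrC -(cutIZ _ l3).2; apply: eq_cutI => s _.
  by rewrite /csin e mulNr; move: (cexp _) (cexp _) (_^-1) => X Y Z; ring.
have h1 := I a; have h2 := I (- a).
rewrite /ccos /csin e (_ : - (a * x%:C) = - a * x%:C); last by rewrite mulNr.
move: (cutI _ _) (cutI _ _) (cexp _) (cexp _) h1 h2 => Q P X Y h1 h2.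
have aP : rho * P = (Y - 1) / 'i by rewrite -h1 /a; field.
have aQ : rho * Q = (1 - X) / 'i by rewrite -[1 - X]opprB -h2 /a; field.
have i02 : 2 * 'i != 0 :> R[i] by rewrite mulf_neq0 ?pnatr_eq0.
split.
  by rewrite mulrA mulrDr aP aQ; field.
have -> : rho * ((P - Q) / (2 * 'i)) = (rho * P - rho * Q) / (2 * 'i) by field.
rewrite aP aQ; have -> : (Y - 1) / 'i - (1 - X) / 'i = (Y + X - 2) / 'i by field.
have -> : (Y + X - 2) / 'i / (2 * 'i) = (Y + X - 2) / (2 * 'i ^+ 2) by field.
by rewrite i2; field.
Qed.

Lemma cos_volterra (rho : R[i]) (x : R) : 0 < x <= pi ->
  ccos (rho * x%:C) = 1 + voltT (fun=> 0) (fun=> 0) (rho ^+ 2) (fun t => ccos (rho * t%:C)) x.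
Proof.
move=> /andP[x0 xpi].
have L : L1on x (fun t => csin (rho * t%:C)).
  apply: (@L1on_bounded R _ (expR (`|complex.Im rho| * x))).
    by apply/cmfun_csin/cmfunZ/cmfun_real; exact: measurable_id.
  move=> t /andP[t0 tx]; have := (@nc_trig R rho t 0 (ltW t0)).2; rewrite subr0 => /le_trans; apply.
  by rewrite ler_expR ler_wpM2l // ltW.
have -> : voltT (fun=> 0) (fun=> 0) (rho ^+ 2) (fun t => ccos (rho * t%:C)) x =
    cutI (fun t => - rho * csin (rho * t%:C)) x.
  apply: eq_cutI => t /andP[t0 tx].
  have -> : voltV (fun=> 0) (fun=> 0) (cutJ (fun t => ccos (rho * t%:C))) t = 0.
    rewrite /voltV mul0r add0r -[RHS]cint0; apply: eq_cint => s; by rewrite mul0r.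
  rewrite /cutJ t0 (lt_le_trans tx xpi) mul1r sub0r expr2 -mulrA (cutI_trig rho (ltW t0)).1.
  by rewrite mulNr.
by rewrite (cutIZ _ L).2 mulNr (cutI_trig rho (ltW x0)).2; ring.
Qed.

Definition cosG (l : R[i]) : R[i] := ccos (sqrtc l * (pi : R)%:C).

(** cos(rho x) solves the Volterra equation with zero coefficients ([cos_volterra]), so this is an
    instance of [analytic_volterra] rather than of a power series for cos(pi sqrt l). *)
Lemma analytic_cosG : analytic cosG.
Proof.
have m (l : R[i]) : cmfun (fun t : R => ccos (sqrtc l * t%:C)).
  by apply/cmfun_ccos/cmfunZ/cmfun_real; exact: measurable_id.
apply: (analytic_volterra volterra_data0 (vl := fun l t => ccos (sqrtc l * t%:C))).
- exact: m.
- move=> l; exists (expR (`|complex.Im (sqrtc l)| * pi)) => x /andP[x0 xpi].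
  have := (@nc_trig R (sqrtc l) x 0 (ltW x0)).1; rewrite subr0 => /le_trans; apply.
  by rewrite ler_expR ler_wpM2l.
- by move=> l x xp; rewrite {1}cos_volterra // sqr_sqrtc.
Qed.

(** Replacing j by 1 - j changes the sign of j - 1/2, so positive indices give all the squares. *)
Lemma half_intE (j : int) : exists2 k : nat, (0 < k)%N &
  (j%:~R - 1 / 2 : R) ^+ 2 = (k%:R - 1 / 2) ^+ 2.
Proof.
case: j => [[|n]|n].
- by exists 1%N => //; rewrite -pmulrn; field.
- by exists n.+1 => //; rewrite -pmulrn.
- by exists n.+2 => //; rewrite NegzE mulrNz -pmulrn -(natr1 n.+1); field.
Qed.

Lemma cos_half_int (k : nat) : (0 < k)%N -> cos ((k%:R - 1 / 2) * pi) = 0 :> R.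
Proof.
case: k => // k _.
have -> : (k.+1%:R - 1 / 2) * pi = pi / 2 + pi * k%:R :> R by rewrite -natr1; field.
elim: k => [|k ih]; first by rewrite mulr0 addr0 cos_pihalf.
by rewrite -(natr1 k) mulrDr mulr1 addrA cosDpi ih oppr0.
Qed.

Lemma cosG_half_int (k : nat) : (0 < k)%N -> cosG (((k%:R - 1 / 2) ^+ 2)%:C) = 0.
Proof.
move=> k0; pose b : R := k%:R - 1 / 2.
have : sqrtc ((b ^+ 2)%:C) ^+ 2 == b%:C ^+ 2 by rewrite sqr_sqrtc rmorphXn.
rewrite eqf_sqr /cosG -/b => /orP[/eqP ->|/eqP ->]; rewrite ?mulNr ?ccosN -rmorphM /= ccos_real cos_half_int //.
Qed.

Lemma cosG_zero (a : R[i]) : cosG a = 0 -> exists2 k : nat, (0 < k)%N &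
  a = ((k%:R - 1 / 2) ^+ 2)%:C.
Proof.
move=> Ga; have [c c0 h] := @ccos_lb R; have [j hj] := h (sqrtc a).
have [k k0 kE] := half_intE j; exists k => //; rewrite -kE.
move: hj; rewrite mulrC -/(cosG a) [_ * sqrtc a]mulrC -/(cosG a) Ga nc0.
rewrite pmulr_rle0 ?expR_gt0 // pmulr_rle0 // => hm.
have : nc (sqrtc a - (j%:~R - 1 / 2)%:C) <= 0 by move: hm; rewrite minElt; case: ifP => // _; rewrite ler10.
move=> h0; have /eqP : nc (sqrtc a - (j%:~R - 1 / 2)%:C) = 0 by apply/eqP; rewrite eq_le h0 nc_ge0.
by rewrite nc_eq0 subr_eq0 => /eqP e; rewrite rmorphXn /= -e sqr_sqrtc.
Qed.

Lemma half_int_sqr_sep (k m : nat) : (0 < k)%N -> (0 < m)%N -> k != m ->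
  1 <= `|(k%:R - 1 / 2) ^+ 2 - (m%:R - 1 / 2) ^+ 2| :> R.
Proof.
move=> k0 m0 km.
have -> : (k%:R - 1 / 2) ^+ 2 - (m%:R - 1 / 2) ^+ 2 = (k%:R - m%:R) * (k%:R + m%:R - 1) :> R by field.
have h1 : 1 <= k%:R :> R by rewrite ler1n.
have h2 : 1 <= m%:R :> R by rewrite ler1n.
rewrite normrM (ger0_norm (x := _ + _ - _)); last by lra.
have : 1 <= `|k%:R - m%:R| :> R.
  have sep (i j : nat) : (i < j)%N -> 1 <= j%:R - i%:R :> R.
    by move=> ij; have : i.+1%:R <= j%:R :> R by [rewrite ler_nat]; rewrite -(natr1 i); lra.
  case: (ltngtP k m) km => // [lt|gt] _.
    by rewrite distrC (le_trans (sep _ _ lt)) // ler_norm.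
  by rewrite (le_trans (sep _ _ gt)) // ler_norm.
nra.
Qed.

(** The zeros are simple. The upper bound is the first-order expansion; the lower bound comes from
    [ccos_lb] through z - b^2 = (sqrt z - b)(sqrt z + b), where the second factor is bounded near a.
    The Boolean is read as the order 0 or 1. *)
Lemma cosG_order (a : R[i]) : has_order cosG a (cosG a == 0).
Proof.
have [c hc] := analytic_cosG a.
have [M [e [e0 he]]] := hc 1%N.
have c0 : c 0%N = cosG a.
  have := he a; rewrite subrr nc0 big_ord_recl big_ord0 /= expr0 expr1 mulr0 mulr1 addr0 => /(_ e0) h.
  by apply/eqP; rewrite eq_sym -subr_eq0 -nc_eq0 eq_le h nc_ge0.
have hb z : nc (z - a) < e -> nc (cosG z - cosG a) <= `|M| * nc (z - a).
  move=> hz; have := he z hz; rewrite big_ord_recl big_ord0 /= expr0 expr1 mulr1 addr0 c0.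
  by move=> /le_trans; apply; rewrite ler_wpM2r ?nc_ge0 // ler_norm.
have [Ga|Ga] := eqVneq (cosG a) 0; last first.
  have g0 : 0 < nc (cosG a) by rewrite nc_gt0.
  have M1 : 0 < 2 * (`|M| + 1) by rewrite mulr_gt0 // ltr_wpDl.
  exists (nc (cosG a) / 2), (nc (cosG a) + `|M| * e), (Num.min e (nc (cosG a) / (2 * (`|M| + 1)))); split.
  - by rewrite divr_gt0.
  - by rewrite lt_min e0 divr_gt0.
  move=> z; rewrite lt_min => /andP[z1 z2]; rewrite expr0 !mulr1.
  have h := hb z z1; rewrite ltr_pdivlMr // in z2.
  have := ncD (cosG z - cosG a) (cosG a); rewrite subrK => h1.
  have := ncD (cosG a - cosG z) (cosG z); rewrite subrK ncC => h2.
  have z0 := nc_ge0 (z - a); have M0 := normr_ge0 M.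
  apply/andP; split; last by nra.
  by nra.
have [d d0 hd] := @ccos_lb R.
have [k k0 ak] := cosG_zero Ga.
pose K := 2 * (nc a + 1) + 1.
have na := nc_ge0 a.
have K1 : 1 <= K by rewrite /K; lra.
exists (d / K), `|M|, (Num.min e (1 / 2)); split; first by rewrite divr_gt0 // (lt_le_trans _ K1).
  by rewrite lt_min e0 /=; lra.
move=> z; rewrite lt_min expr1 => /andP[z1 z2]; apply/andP; split; last first.
  by have := hb z z1; rewrite Ga subr0.
have [j hj] := hd (sqrtc z); rewrite [_ * sqrtc z]mulrC -/(cosG z) in hj.
apply: le_trans hj.
have e1 : 1 <= expR (pi * `|complex.Im (sqrtc z)|).
  by rewrite -[leLHS]expR0 ler_expR mulr_ge0 // pi_ge0.
pose b : R[i] := (j%:~R - 1 / 2)%:C.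
have m0 : 0 <= Num.min 1 (nc (sqrtc z - b)) by rewrite le_min nc_ge0 andbT.
suff hm : nc (z - a) / K <= Num.min 1 (nc (sqrtc z - b)).
  rewrite -mulrA (le_trans (y := d * Num.min 1 (nc (sqrtc z - b)))) //.
    by rewrite ler_wpM2l ?(ltW d0) // mulrC.
  by rewrite ler_peMr // mulr_ge0 // ltW.
have Kp : 0 < K by rewrite (lt_le_trans _ K1).
have zs : nc (sqrtc z) <= nc a + 1.
  have := nc_sqrtc z; have := ncD (z - a) a; rewrite subrK => h1 h2.
  have s0 := nc_ge0 (sqrtc z); nra.
rewrite le_min; apply/andP; split; first by rewrite ler_pdivrMr //; lra.
rewrite ler_pdivrMr //.
have [big|small] := leP 1 (nc (sqrtc z - b)); first by nra.
have zb : z - b ^+ 2 = (sqrtc z - b) * (sqrtc z + b) by rewrite -{1}(sqr_sqrtc z); ring.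
have sb : nc (sqrtc z + b) <= K.
  have -> : sqrtc z + b = 2 * sqrtc z - (sqrtc z - b) by ring.
  have := ncB (2 * sqrtc z) (sqrtc z - b); rewrite ncM nc_nat /K; lra.
have step : nc (z - b ^+ 2) <= nc (sqrtc z - b) * K.
  by rewrite zb ncM ler_wpM2l ?nc_ge0.
apply: le_trans step.
have [m m0' mE] := half_intE j.
have b2 : b ^+ 2 = ((m%:R - 1 / 2) ^+ 2)%:C by rewrite /b -rmorphXn /= mE.
(* If [ccos_lb] returned the square root of another zero, that zero is at distance at least 1 from
   a, hence at least as far from z as a is, since |z - a| < 1/2. *)
have [km|km] := eqVneq k m; first by rewrite b2 ak km.
have sep : 1 <= nc (a - b ^+ 2).
  by rewrite b2 ak -rmorphB nc_real; exact: half_int_sqr_sep.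
have := ncD (a - z) (z - b ^+ 2); rewrite (_ : a - z + (z - b ^+ 2) = a - b ^+ 2); last by ring.
by rewrite [nc (a - z)]ncC; lra.
Qed.

Definition half_squares (n : nat) : seq R[i] := [seq ((k%:R - 1 / 2) ^+ 2)%:C | k <- iota 1 n].

Lemma half_square_inj (k m : nat) : (0 < k)%N -> (0 < m)%N ->
  ((k%:R - 1 / 2) ^+ 2)%:C = ((m%:R - 1 / 2) ^+ 2)%:C :> R[i] -> k = m.
Proof.
move=> k0 m0 e; apply/eqP; apply/negP => /negP km.
have := half_int_sqr_sep k0 m0 km; rewrite (_ : _ - _ = 0) ?normr0 ?ler10 //.
by apply/eqP; rewrite subr_eq0; apply/eqP; move: e => /(congr1 (@complex.Re R)).
Qed.

Lemma count_half_squares (n : nat) (a : R[i]) : (count_mem a (half_squares n) <= (cosG a == 0%R))%N.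
Proof.
rewrite count_uniq_mem; last first.
  rewrite map_inj_in_uniq ?iota_uniq // => k m; rewrite !mem_iota => /andP[k0 _] /andP[m0 _].
  exact: half_square_inj.
have [/mapP[k]|//] := boolP (a \in half_squares n).
by rewrite mem_iota => /andP[k0 _] ->; rewrite cosG_half_int ?eqxx.
Qed.

(** The hypothesis says that the list contains every zero of modulus at most r; since these are
    simple, none is left in the cofactor there. *)
Lemma cosG_factor (n : nat) (r : R) :
  (forall k : nat, (0 < k)%N -> (k%:R - 1 / 2) ^+ 2 <= r -> (k <= n)%N) ->
  exists g, [/\ forall z, cosG z = rootpoly (half_squares n) z * g z,
    forall z, taylor2 g z & forall z, nc z <= r -> g z != 0].
Proof.
move=> hn.
have [g [ag gE go]] := analytic_factor analytic_cosG cosG_order (count_half_squares n).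
exists g; split => // [z|z zr]; first exact: analytic_taylor2.
apply: has_order0.
suff e : ((cosG z == 0%R) - count_mem z (half_squares n) = 0)%N by have := go z; rewrite e.
have [Gz|//] := eqVneq (cosG z) 0.
have [k k0 zE] := cosG_zero Gz.
have : (0 < count_mem z (half_squares n))%N.
  rewrite -has_count; apply/hasP; exists z; last exact/eqP.
  rewrite zE; apply/mapP; exists k => //; rewrite mem_iota k0 add1n ltnS; apply: hn => //.
  by move: zr; rewrite zE nc_real ger0_norm // sqr_ge0.
by case: (count_mem _ _).
Qed.

End unperturbed.

(** * Trapping the roots near half-integers *)

Section localization.
Context {R : realType}.
Local Notation rho l := (sqrtc l).

(** Besides analyticity and the numbering of the zeros, this is all that the localization needs of
    the characteristic function; it is what [sine_close] gives at x = pi. *)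
Definition close_to_cos (F : R[i] -> R[i]) (D : R) := forall l : R[i],
  0 < nc (rho l) -> D <= 3 / 4 * nc (rho l) ->
  nc (F l - cosG l) <= 4 / nc (rho l) * D * expR (`|complex.Im (rho l)| * pi).

Lemma half_int_far (n : nat) (j : int) (z : R[i]) : nc z = n%:R ->
  1 / 2 <= nc (z - (j%:~R - 1 / 2)%:C).
Proof.
move=> zn.
have h1 := nc_lerB z (j%:~R - 1 / 2)%:C.
have h2 := nc_lerB (j%:~R - 1 / 2)%:C z; rewrite ncC in h2.
rewrite nc_real zn in h1 h2.
have [k k0 /eqP kE] := @half_intE R j.
have k1 : 1 <= k%:R :> R by rewrite ler1n.
have aE : `|j%:~R - 1 / 2| = k%:R - 1 / 2 :> R.
  move: kE; rewrite eqf_sqr => /orP[/eqP ->|/eqP ->]; rewrite ?normrN ger0_norm //; lra.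
rewrite aE in h1 h2.
have [nk|kn] := ltnP n k.
  have : n.+1%:R <= k%:R :> R by rewrite ler_nat.
  by rewrite -(natr1 n); lra.
have : k%:R <= n%:R :> R by rewrite ler_nat.
by lra.
Qed.

(** The circle of radius 1/4 encloses no half-integer; it replaces the degenerate circle of radius 0
    for the first root. *)
Lemma half_int_ge (j : int) (z : R[i]) : nc z = 1 / 4 -> 1 / 4 <= nc (z - (j%:~R - 1 / 2)%:C).
Proof.
move=> zn; have h2 := nc_lerB (j%:~R - 1 / 2)%:C z; rewrite ncC nc_real zn in h2.
have [k k0 /eqP kE] := @half_intE R j.
have k1 : 1 <= k%:R :> R by rewrite ler1n.
have aE : `|j%:~R - 1 / 2| = k%:R - 1 / 2 :> R.
  move: kE; rewrite eqf_sqr => /orP[/eqP ->|/eqP ->]; rewrite ?normrN ger0_norm //; lra.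
by rewrite aE in h2; lra.
Qed.

Lemma numbered_zeros_zero (F : R[i] -> R[i]) (mu : nat -> R[i]) (k : nat) : (0 < k)%N ->
  @numbered_zeros (R[i] : numFieldType) F mu -> F (mu k) = 0.
Proof.
move=> k0 [_ /(_ (mu k))[m zm cm]]; have := zero_of_order_has_order zm.
case: m zm cm => [_ cm _|m _ _]; last exact: has_orderS.
have : (size [:: k] <= 0)%N by apply: (card_size_le cm) => // j; rewrite inE => /eqP ->.
by [].
Qed.

Lemma pos_of_close (z w : R[i]) : nc (z - w) < nc w -> 0 < complex.Re (z * w^*).
Proof.
move=> zw; have -> : z * w^* = (nc w ^+ 2)%:C + (z - w) * w^* by rewrite -mul_conj; ring.
rewrite cReD /=; have := nc_Re ((z - w) * w^*); rewrite ncM nc_conj ler_norml => /andP[h _].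
by have w0 := nc_ge0 w; have z0 := nc_ge0 (z - w); nra.
Qed.

(** Comparison on |l| = n^2, that is on |rho| = n midway between half-integers, gives exactly n
    zeros inside, so k - 1 <= |rho_k| < k. At the zero, closeness to the cosine and [ccos_lb] bound
    the distance d to some half-integer j - 1/2 by a multiple of D / |rho_k|; this makes d small and
    then forces j = k. The crude half of the statement covers the indices below K D. *)
Lemma zero_localization : exists2 K : R, 0 < K &
  forall (F : R[i] -> R[i]) (mu : nat -> R[i]) (D : R), 0 <= D -> analytic F ->
  @numbered_zeros (R[i] : numFieldType) F mu -> close_to_cos F D ->
  (forall n : nat, (0 < n)%N -> K * D <= n%:R -> forall j : nat, (1 <= j <= n)%N ->
     nc (mu j) < n%:R ^+ 2) /\
  (forall k : nat, (0 < k)%N -> K * D <= k%:R ->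
     k%:R / 4 <= nc (rho (mu k)) /\
     nc (rho (mu k) - (k%:R - 1 / 2)%:C) <= K * D / k%:R /\
     nc (rho (mu k) - (k%:R - 1 / 2)%:C) <= 1 / 8).
Proof.
have [c c0 hc] := @ccos_lb R.
(* c K0 >= 32 makes the error 4 D / r smaller than the lower bound c / 4 of the cosine on the
   circle, and K0 >= 2 ensures D <= 3/4 r, the range of [close_to_cos]. *)
pose K0 := 32 / c + 2.
have K00 : 0 < K0 by rewrite /K0 ltr_wpDl // divr_ge0 // ltW.
have cK : 32 <= c * K0 by rewrite /K0 mulrDr mulrCA divff ?gt_eqF // mulr1; nra.
exists (4 * K0); first by rewrite mulr_gt0.
move=> F mu D D0 aF zF cF.
have K2D : 2 * D <= K0 * D by rewrite ler_wpM2r // /K0 lerDr divr_ge0 // ltW.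
have pos (r : R) : 0 < r -> K0 * D <= r ->
    (forall (z : R[i]) (j : int), nc z = r -> 1 / 4 <= nc (z - (j%:~R - 1 / 2)%:C)) ->
    forall l, nc l = r ^+ 2 -> 0 < complex.Re (F l * (cosG l)^*).
  move=> r0 Kr far l lr; apply: pos_of_close.
  have rl : nc (rho l) = r.
    apply/eqP; rewrite -(@eqrXn2 _ 2) ?nc_ge0 ?ltW //; by rewrite nc_sqrtc lr.
  have D34 : D <= 3 / 4 * nc (rho l).
    rewrite rl; lra.
  have := cF l; rewrite rl -rl => /(_ _ D34); rewrite rl r0 => /(_ isT) h.
  apply: (le_lt_trans h).
  have [j hj] := hc (rho l); rewrite [pi%:C * _]mulrC -/(cosG l) in hj.
  apply: lt_le_trans hj; rewrite [pi * _]mulrC ltr_pM2r ?expR_gt0 //.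
  apply: (@lt_le_trans _ _ (c * (1 / 4))); last first.
    by rewrite ler_wpM2l ?(ltW c0) // le_min (far _ _ rl) andbT; lra.
  rewrite mulrAC ltr_pdivrMr //.
  have : c * (K0 * D) <= c * r by rewrite ler_wpM2l // ltW.
  have cr : 0 < c * r by rewrite mulr_gt0.
  have : 32 * D <= c * K0 * D by rewrite ler_wpM2r.
  by rewrite -mulrA; lra.
have circ (n : nat) : (0 < n)%N -> K0 * D <= n%:R ->
    (forall j, (1 <= j <= n)%N -> nc (mu j) < n%:R ^+ 2) /\
    (forall j, (n < j)%N -> n%:R ^+ 2 <= nc (mu j)).
  move=> n0 Kn; have n1 : 1 <= n%:R :> R by rewrite ler1n.
  have [k k0 kn|g [gE tg g0]] := @cosG_factor R n (n%:R ^+ 2).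
    rewrite leqNgt; apply/negP => nk.
    have : n.+1%:R <= k%:R :> R by rewrite ler_nat.
    by rewrite -(natr1 n) => h; have k1 : 1 <= k%:R :> R by [rewrite ler1n]; nra.
  have sz : size (half_squares n : seq R[i]) = n by rewrite size_map size_iota.
  have [] := @count_zeros R F cosG g (n%:R ^+ 2) mu (half_squares n) _ aF zF _ gE _ g0 _.
  - by rewrite exprn_gt0 // ltr0n.
  - apply: (@pos n%:R) => //; first by rewrite ltr0n.
    by move=> z j zn; have := half_int_far j zn; lra.
  - by move=> z _.
  - move=> b /mapP[k]; rewrite mem_iota add1n ltnS => /andP[k0 kn] ->.
    have k1 : 1 <= k%:R :> R by rewrite ler1n.
    have kn' : k%:R <= n%:R :> R by rewrite ler_nat.
    by rewrite nc_real ger0_norm ?sqr_ge0 //; nra.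
  by rewrite sz.
(* For k = 1 there is no circle of radius k - 1. Inside |rho| = 1/4 the cosine has no zero, so the
   empty list of zeros is compared. *)
have small : K0 * D <= 1 / 4 -> forall j, (0 < j)%N -> (1 / 4) ^+ 2 <= nc (mu j).
  move=> Kn.
  have [k k0 kn|g [gE tg g0]] := @cosG_factor R 0 ((1 / 4) ^+ 2).
    by have k1 : 1 <= k%:R :> R by [rewrite ler1n]; nra.
  have [] := @count_zeros R F cosG g ((1 / 4) ^+ 2) mu (half_squares 0) _ aF zF _ gE _ g0 _ => //.
  - apply: (@pos (1 / 4)) => //.
    by move=> z j zn; exact: half_int_ge.
have KD : 0 <= K0 * D by rewrite mulr_ge0 // ltW.
split.
  move=> n n0 Kn; have Kn' : K0 * D <= n%:R by rewrite -mulrA in Kn; lra.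
  by have [h _] := circ n n0 Kn'; exact: h.
move=> k k0 Kk; rewrite -mulrA in Kk.
have k1 : 1 <= k%:R :> R by rewrite ler1n.
pose p := rho (mu k); have p0 := nc_ge0 p.
have pE : nc p ^+ 2 = nc (mu k) by exact: nc_sqrtc.
have up : nc p < k%:R.
  have [h _] := circ k k0 (ltac:(lra)); have := h k; rewrite k0 leqnn => /(_ isT).
  by rewrite -pE ltr_pXn2r // ?nnegrE ?ler0n.
have lo : (k%:R - 1 <= nc p) /\ k%:R / 4 <= nc p.
  case: k k0 Kk k1 @p p0 pE up => // [[|k]] _ Kk k1 p p0 pE up.
    have := small (ltac:(lra)) 1%N isT; rewrite -pE ler_pXn2r ?nnegrE //.
    by move=> h; split; lra.
  have kk : k.+1%:R = k.+2%:R - 1 :> R by rewrite -(natr1 k.+1) addrK.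
  have k2 : 1 <= k.+1%:R :> R by rewrite ler1n.
  have [_ h] := circ k.+1 isT (ltac:(lra)); have := h k.+2 (ltnSn _).
  by rewrite -pE ler_pXn2r ?nnegrE ?ler0n // => h'; split; lra.
case: lo => lo1 lo2.
split => //.
have [j hj] := hc p.
have pp : 0 < nc p by lra.
have D34 : D <= 3 / 4 * nc p.
  by lra.
have := cF (mu k) pp D34; rewrite (numbered_zeros_zero k0 zF) sub0r ncN => h.
have := le_trans hj; rewrite [pi%:C * _]mulrC => /(_ _ h).
rewrite [pi * _]mulrC ler_pM2r ?expR_gt0 // => {}h.
set d := nc (p - (j%:~R - 1 / 2)%:C) in h.
have d0 : 0 <= d := nc_ge0 _.
have kp : 0 < k%:R :> R by lra.
have h2 : Num.min 1 d * k%:R <= K0 * D / 2.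
  move: h; rewrite mulrAC ler_pdivlMr // => h.
  have m0 : 0 <= Num.min 1 d by rewrite le_min d0 ler01.
  have cm0 : 0 <= c * Num.min 1 d by rewrite mulr_ge0 // ltW.
  have h3 : c * Num.min 1 d * (k%:R / 4) <= 4 * D by apply: le_trans h; rewrite ler_wpM2l.
  have h4 : 32 * D <= c * K0 * D by rewrite ler_wpM2r.
  by rewrite -(ler_pM2l c0); lra.
have m8 : Num.min 1 d <= 1 / 8.
  by rewrite -(ler_pM2r kp); lra.
have dE : Num.min 1 d = d.
  by move: m8; rewrite minElt; case: ifP => // _; lra.
rewrite dE in h2 m8.
(* The principal root has nonnegative real part, which excludes j <= 0; then k - 1 <= |rho_k| < k
   and d <= 1/8 leave only j = k. *)
have jk : j%:~R = k%:R :> R.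
  have r1 := nc_Re (p - (j%:~R - 1 / 2)%:C); rewrite -/d cReB /= in r1.
  have r0 : 0 <= complex.Re p := sqrtc_Re_ge0 _.
  move: r1; rewrite ler_norml => /andP[_ r1].
  have r2 := nc_lerB (j%:~R - 1 / 2)%:C p; rewrite ncC -/d nc_real in r2.
  have r3 := nc_lerB p (j%:~R - 1 / 2)%:C; rewrite -/d nc_real in r3.
  have r1' : complex.Re p <= d + (j%:~R - 1 / 2) by lra.
  have j0 : (0 < j)%R by rewrite -(@ltr_int R) /=; lra.
  have j1 : 1 <= j%:~R :> R by rewrite -[1]/(1%:~R) ler_int -gtz0_ge1.
  rewrite ger0_norm in r2 r3; last by lra.
  have jk1 : (j < k.+1%:Z)%R by rewrite -(@ltr_int R) /= -[k.+1%:~R]/(k.+1%:R) -(natr1 k); lra.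
  have jk2 : (k%:Z < j + 1)%R by rewrite -(@ltr_int R) /= rmorphD /= -[k%:~R]/(k%:R); lra.
  have -> // : j = k%:Z.
  by apply/eqP; rewrite eq_le -!ltzD1 jk2 andbT -PoszD addn1.
rewrite -jk -/d; split; last by [].
rewrite jk ler_pdivlMr // -mulrA; lra.
Qed.

End localization.

Section elementary_bounds.
Context {R : realType}.
Local Notation mu := (@lebesgue_measure R).
Implicit Types z : R[i].

Lemma nc_cut_le (f : R -> R[i]) (c x : R) : cmfun f -> 0 <= x ->
  (forall t : R, 0 < t < x -> nc (f t) <= c) -> nc (cutI f x) <= c * x.
Proof.
move=> mf x0 fc; rewrite -lee_fin; apply: (le_trans (nc_cint _)).
  by apply: cmfunM => //; exact: cmfun_itv.
have [->|xn] := eqVneq x 0.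
  rewrite mulr0 integral0_eq // => t _; rewrite nc_boolM /bR.
  case: (boolP (0 < t < 0)) => [/andP[t0 t1]|_]; last by rewrite mul0r.
  by have := lt_trans t0 t1; rewrite ltxx.
have xp : 0 < x by rewrite lt_neqAle eq_sym xn.
have c0 : 0 <= c.
  by apply: le_trans (fc (x / 2) _); rewrite ?nc_ge0 // divr_gt0 //= ltr_pdivrMr //; lra.
apply: (@le_trans _ _ (\int[mu]_t (c%:E * ((0 < t < x)%R%:R)%:E))%E).
  under [leRHS]eq_integral do rewrite -EFinM.
  apply: le_int => [||t|t].
  - by apply/cmfun_nc/cmfunM => //; exact: cmfun_itv.
  - by apply: measurable_funM => //; exact: (measurable_boolR (measurable_itvb 0 x)).
  - exact: nc_ge0.
  rewrite nc_boolM /bR; case: (boolP (0 < t < x)) => [h|_]; last by rewrite mul0r mulr0.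
  by rewrite mul1r mulr1 fc.
rewrite ge0_integralZl_EFin //.
  by rewrite integral_itv_len // -EFinM subr0.
by apply/measurable_EFinP; exact: (measurable_boolR (measurable_itvb 0 x)).
Qed.

Lemma cint_itv (s x : R) : s <= x -> cint (fun t => (s < t < x)%R%:R) = (x - s)%:C.
Proof.
move=> sx; rewrite /cint /cintegral; apply: complex_eqP => /=.
  rewrite (_ : (fun x0 : R => complex.Re _) = fun x0 => (s < x0 < x)%R%:R); last first.
    by apply/funext => t; case: (s < t < x).
  by rewrite /Rintegral integral_itv_len.
rewrite (_ : (fun x0 : R => complex.Im _) = fun x0 => 0); last first.
  by apply/funext => t; case: (s < t < x).
by rewrite Rintegral_cst ?mul0r.
Qed.

Lemma nc_cexp_i (x : R) : nc (cexp ('i * x%:C)) = 1.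
Proof. by rewrite nc_cexp cReM /= mul0r mulr0 subrr expR0. Qed.

(** e^z - 1 is the integral of z e^(z t) over (0, 1). *)
Lemma nc_cexpB1 z : nc (cexp z - 1) <= nc z * expR (nc z).
Proof.
have := @cint_cexp R z 0 1 ler01; rewrite !mulr1 mulr0 cexp0 => <-.
rewrite -[leRHS]mulr1; apply: (@nc_cut_le (fun t => z * cexp (z * t%:C))) => //.
  exact/cmfunZ/cmfun_expZ.
move=> t /andP[t0 t1]; rewrite ncM ler_wpM2l ?nc_ge0 //.
have := @cexp_bound R z t 1; rewrite mulr1; apply.
by rewrite ger0_norm ltW.
Qed.

Lemma nc_csin_le z : nc (csin z) <= nc z * expR (nc z).
Proof.
have iz : nc ('i * z) = nc z by rewrite ncM nc_i mul1r.
have h1 := nc_cexpB1 ('i * z); have h2 := nc_cexpB1 (- ('i * z)).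
rewrite ncN iz in h1 h2.
have -> : csin z = ((cexp ('i * z) - 1) - (cexp (- ('i * z)) - 1)) / (2 * 'i).
  by rewrite /csin; congr (_ / _); ring.
rewrite ncM ncV ncM nc_i mulr1 nc_nat ler_pdivrMr //.
by apply: (le_trans (ncB _ _)); lra.
Qed.

Lemma nc_ccosB1 z : nc (ccos z - 1) <= nc z ^+ 2 * expR (nc z).
Proof.
have z2 : z = z / 2 + z / 2 by field.
have sc : ccos (z / 2) * ccos (z / 2) + csin (z / 2) * csin (z / 2) = 1.
  have := ccosD (z / 2) (- (z / 2)); rewrite subrr ccos0 ccosN csinN => h.
  by rewrite [RHS]h; ring.
have -> : ccos z - 1 = - (2 * (csin (z / 2) * csin (z / 2))).
  by rewrite {1}z2 ccosD -[X in _ - X]sc; ring.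
rewrite ncN (ncM 2) (ncM (csin _)) nc_nat.
have hz : nc (z / 2) = nc z / 2 by rewrite ncM ncV nc_nat.
have := nc_csin_le (z / 2); rewrite hz => h.
have E : expR (nc z) = expR (nc z / 2) * expR (nc z / 2).
  by rewrite -expRD; congr expR; field.
have s0 := nc_ge0 (csin (z / 2)); have z0 := nc_ge0 z.
have e0 := expR_gt0 (nc z / 2).
have hh : nc (csin (z / 2)) * nc (csin (z / 2)) <= (nc z / 2 * expR (nc z / 2)) * (nc z / 2 * expR (nc z / 2)).
  by rewrite ler_pM.
have : 0 <= nc z ^+ 2 * (expR (nc z / 2) * expR (nc z / 2)).
  by rewrite mulr_ge0 ?sqr_ge0 // mulr_ge0 // ltW.
rewrite E expr2; lra.
Qed.

(** sin z - z is z times the integral of cos(z t) - 1 over (0, 1), and cos - 1 is quadratic by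
    [nc_ccosB1]. *)
Lemma nc_csinB z : nc (csin z - z) <= nc z ^+ 3 * expR (nc z).
Proof.
have [h _] := @cutI_trig R z 1 ler01; rewrite mulr1 in h.
have mc : cmfun (fun t : R => ccos (z * t%:C)).
  by apply/cmfun_ccos/cmfunZ/cmfun_real; exact: measurable_id.
have lc : L1on 1 (fun t : R => ccos (z * t%:C)).
  apply: (L1on_bounded mc (c := expR (`|complex.Im z| * 1))) => t /andP[t0 t1].
  have := (@nc_trig R z t 0 (ltW t0)).1; rewrite subr0 => /le_trans; apply.
  by rewrite ler_expR ler_wpM2l // ltW.
have l1 : L1on 1 (fun=> 1 : R[i]).
  by apply: (L1on_bounded (cmfun_cst 1) (c := 1)) => t _; rewrite nc1.
have c1 : cutI (fun=> 1) 1 = 1 :> R[i].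
  rewrite -[RHS]/(1%:C) -[X in X%:C](subr0 (1 : R)) -cint_itv //; apply: eq_cint => t.
  by rewrite mulr1.
have -> : csin z - z = z * cutI (fun t => ccos (z * t%:C) - 1) 1.
  by rewrite (cutIB lc l1).2 c1 -h; ring.
rewrite ncM exprS -mulrA ler_wpM2l ?nc_ge0 // -[leRHS]mulr1.
apply: nc_cut_le => //; first exact: (cmfunB mc (cmfun_cst 1)).
move=> t /andP[t0 t1]; apply: (le_trans (nc_ccosB1 _)).
have zt : nc (z * t%:C) <= nc z.
  by rewrite ncM nc_real ger0_norm ?(ltW t0) // ler_piMr ?nc_ge0 // ltW.
by rewrite ler_pM ?sqr_ge0 ?expR_ge0 ?ler_expR // ler_pXn2r ?nnegrE ?nc_ge0.
Qed.

End elementary_bounds.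

(** * Bessel inequalities for nearly half-integer frequencies *)

Section bessel.
Context {R : realType}.
Local Notation mu := (@lebesgue_measure R).

(** Duality argument: let b_k be the coefficients and g the sum of conj(b_k) e_k. Orthogonality
    gives |g|^2 = 2 pi X with X the sum of the |b_k|^2, and X = int f g <= sqrt(F 2 pi X). The
    interval is (0, 2 pi), where exponentials with integer frequency differences are orthogonal. *)
Lemma bessel (w : nat -> R) (r : seq nat) (f : R -> R[i]) (F : R) : uniq r ->
  (forall j k, j \in r -> k \in r -> j != k -> w j != w k /\ cexp ('i * ((w j - w k) * (2 * pi))%:C) = 1) ->
  cmfun f -> (forall t : R, ~~ (0 < t < 2 * pi) -> f t = 0) -> 0 <= F ->
  (\int[mu]_t (nc (f t) ^+ 2)%:E <= F%:E)%E ->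
  \sum_(k <- r) nc (cint (fun t => f t * cexp ('i * (w k * t)%:C))) ^+ 2 <= 2 * pi * F.
Proof.
move=> ur hw mf fs F0 fF.
pose e k (t : R) : R[i] := cexp ('i * (w k * t)%:C).
have ne k t : nc (e k t) = 1 by exact: nc_cexp_i.
have me k : cmfun (e k).
  apply/cmfun_cexp/cmfunZ/cmfun_real; apply: measurable_funM => //; exact: measurable_cst.
pose I (t : R) : R[i] := (0 < t < 2 * pi)%R%:R.
have mI : cmfun I by exact: cmfun_itv.
have p2 : 0 < 2 * pi :> R by rewrite mulr_gt0 // pi_gt0.
have LI (g : R -> R[i]) (c : R) : cmfun g -> (forall t, nc (g t) <= c) -> L1 (fun t => I t * g t).
  by move=> mg gc; apply: (L1_cut mg (c := c)) => t _.
pose b k := cint (fun t => f t * e k t).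
pose X := \sum_(k <- r) nc (b k) ^+ 2.
rewrite -/X.
have X0 : 0 <= X by apply: sumr_ge0 => k _; exact: sqr_ge0.
pose g t := \sum_(k <- r) (b k)^* * e k t.
have mg : cmfun g by apply: cmfun_sum => k; exact: cmfunZ.
have gb : exists c, forall t, nc (g t) <= c.
  exists (\sum_(k <- r) nc (b k)) => t; apply: (le_trans (nc_sum _ _ _)).
  by apply: ler_sum => k _; rewrite ncM nc_conj ne mulr1.
have [c gc] := gb.
have mIg : cmfun (fun t => I t * g t) by exact: cmfunM.
have sI (h : R -> R) : (fun t => nc (I t * g t) ^+ 2) = (fun t => complex.Re (I t * (g t * (g t)^*))).
  apply/funext => t; rewrite mul_conj nc_boolM /I /bR.
  by case: (0 < t < 2 * pi); rewrite ?mul1r ?mul0r ?expr0n.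
have mgc : cmfun (fun t => (g t)^*).
  split; first by rewrite (_ : (fun _ => _) = fun t => complex.Re (g t)); [exact: mg.1|apply/funext => t; case: (g t)].
  rewrite (_ : (fun _ => _) = fun t => - complex.Im (g t)); last by apply/funext => t; case: (g t).
  by apply: measurableT_comp => //; exact: mg.2.
have orth j k : j \in r -> k \in r ->
    cint (fun t => I t * (e j t * (e k t)^*)) = if j == k then (2 * pi)%:C else 0.
  move=> jr kr.
  have ec t : (e k t)^* = cexp ('i * (- w k * t)%:C).
    rewrite /e !cexp_i_real mulNr cosN sinN; apply: complex_eqP => /=.
      by ring.
    by ring.
  have ee t : e j t * (e k t)^* = cexp ('i * (w j - w k)%:C * t%:C).
    rewrite ec /e -cexpD; congr cexp; rewrite !rmorphM rmorphB rmorphN /=; ring.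
  under eq_cint do rewrite ee.
  have [jk|jk] := eqVneq j k.
    rewrite jk subrr; transitivity (cint (fun t => I t * 1)).
      by apply: eq_cint => t; rewrite mulr0 mul0r cexp0.
    have -> : cint (fun t => I t * 1) = cint (fun t => (0 < t < 2 * pi)%R%:R).
      by apply: eq_cint => t; rewrite mulr1.
    by rewrite cint_itv ?(ltW p2) // subr0.
  have [wjk c1] := hw j k jr kr jk.
  pose a : R[i] := 'i * (w j - w k)%:C.
  have a0 : a != 0.
    rewrite mulf_neq0 ?i_neq0 // -nc_gt0 nc_real normr_gt0 subr_eq0 //.
  apply: (mulfI a0); rewrite mulr0 -cintZ; last first.
    apply: (LI _ (expR 0)) => [|t]; first exact: cmfun_expZ.
    by rewrite -mulrA -rmorphM nc_cexp_i expR0.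
  have := @cint_cexp R a 0 (2 * pi) (ltW p2).
  rewrite (_ : a * (2 * pi)%:C = 'i * ((w j - w k) * (2 * pi))%:C); last by rewrite /a -mulrA -rmorphM.
  rewrite c1 mulr0 cexp0 subrr => <-; apply: eq_cint => t; rewrite /I; ring.
have L1ee j k : L1 (fun t => I t * (e j t * (e k t)^*)).
  apply: (LI _ 1) => [|t]; last by rewrite ncM nc_conj !ne mulr1.
  apply: cmfunM => //.
  split; first by rewrite (_ : (fun _ => _) = fun t => complex.Re (e k t)); [exact: (me k).1|apply/funext => t; case: (e k t)].
  rewrite (_ : (fun _ => _) = fun t => - complex.Im (e k t)); last by apply/funext => t; case: (e k t).
  by apply: measurableT_comp => //; exact: (me k).2.
have expand t : I t * (g t * (g t)^*) =
    \sum_(j <- r) \sum_(k <- r) ((b j)^* * b k) * (I t * (e j t * (e k t)^*)).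
  rewrite /g rmorph_sum mulr_suml mulr_sumr; apply: eq_bigr => j _.
  rewrite mulr_sumr mulr_sumr; apply: eq_bigr => k _.
  rewrite rmorphM /= conjCK; ring.
have L1g : L1 (fun t => I t * (g t * (g t)^*)).
  rewrite (_ : (fun t => _) = fun t => \sum_(j <- r) \sum_(k <- r) ((b j)^* * b k) * (I t * (e j t * (e k t)^*))).
    by apply: L1_sum => j; apply: L1_sum => k; exact: L1Z.
  by apply/funext => t; exact: expand.
have G2 : (\int[mu]_t (nc (I t * g t) ^+ 2)%:E = (2 * pi * X)%:E)%E.
  under eq_integral => t _.
    have -> : nc (I t * g t) ^+ 2 = complex.Re (I t * (g t * (g t)^*)) by have := sI id => /(congr1 (@^~ t)).
    over.
  rewrite -Re_cint //; congr EFin.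
  have -> : cint (fun t => I t * (g t * (g t)^*)) = (2 * pi * X)%:C.
    transitivity (cint (fun t => \sum_(j <- r) \sum_(k <- r) ((b j)^* * b k) * (I t * (e j t * (e k t)^*)))).
      by apply: eq_cint => t; exact: expand.
    rewrite cint_sum; last by move=> j; apply: L1_sum => k; exact: L1Z.
    rewrite /X mulr_sumr rmorph_sum /= big_seq [RHS]big_seq; apply: eq_bigr => j jr.
    rewrite cint_sum; last by move=> k; exact: L1Z.
    transitivity (\sum_(k <- r) if k == j then (nc (b j) ^+ 2)%:C * (2 * pi)%:C else 0).
      rewrite big_seq [RHS]big_seq; apply: eq_bigr => k kr; rewrite cintZ //.
      rewrite orth // eq_sym; case: eqVneq => [->|_]; last by rewrite mulr0.
      by rewrite -mul_conj; ring.
    rewrite -big_mkcond -big_filter filter_pred1_uniq // big_seq1 -rmorphM /=.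
    by congr (_ %:C); ring.
  by [].
have XE : X <= Num.sqrt (F * (2 * pi * X)).
  have Lf k : L1 (fun t => f t * e k t).
    apply: (@L1_le _ _ (fun t => I t * (nc (f t))%:C)).
    - exact: cmfunM.
    - split; first by apply: cmfunM => //; apply: cmfun_real; exact: cmfun_nc.
      apply: (@le_lt_trans _ _ (Num.sqrt (F * (2 * pi)))%:E); last exact: ltry.
      have := @CS_le R (fun t => nc (f t)) (fun t => bR (0 < t < 2 * pi)) F (2 * pi) (cmfun_nc mf)
        (measurable_bR (measurable_itvb 0 _)) (fun t => nc_ge0 _) (fun t => bR_ge0 _) fF.
      move=> h; apply: (le_trans _ (h _)).
        rewrite le_eqVlt; apply/orP; left; apply/eqP; apply: eq_integral => t _.
        by rewrite nc_boolM nc_real ger0_norm ?nc_ge0 // mulrC.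
      have E (t : R) : bR (0 < t < 2 * pi) ^+ 2 = (0 < t < 2 * pi)%R%:R :> R.
        by rewrite /bR; case: (0 < t < 2 * pi); rewrite ?expr1n ?expr0n.
      under eq_integral do rewrite E.
      by rewrite integral_itv_len ?(ltW p2) // subr0.
    - move=> t; rewrite ncM ne mulr1 nc_boolM nc_real /bR.
      case: (boolP (0 < t < 2 * pi)) => [_|/fs ->]; last by rewrite nc0 mul0r.
      by rewrite mul1r ler_norm.
  have XR : X = complex.Re (cint (fun t => f t * (I t * g t))).
    have -> : cint (fun t => f t * (I t * g t)) = X%:C; last by [].
    transitivity (cint (fun t => \sum_(k <- r) (b k)^* * (f t * e k t))).
      apply: eq_cint => t; rewrite /I; case: (boolP (0 < t < 2 * pi)) => [_|/fs ->]; last first.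
        by rewrite mul0r big1 // => k _; rewrite mul0r mulr0.
      by rewrite mul1r /g mulr_sumr; apply: eq_bigr => k _; ring.
    rewrite cint_sum; last by move=> k; exact: L1Z.
    rewrite /X rmorph_sum; apply: eq_bigr => k _; rewrite cintZ // -/(b k) /=.
    by rewrite mulrC mul_conj.
  rewrite {1}XR; apply: (le_trans (ler_norm _)); apply: (le_trans (nc_Re _)).
  rewrite -lee_fin; apply: (le_trans (nc_cint _)); first exact: cmfunM.
  under eq_integral do rewrite ncM.
  apply: (CS_le (cmfun_nc mf) (cmfun_nc mIg) (fun t => nc_ge0 _) (fun t => nc_ge0 _) fF).
  by rewrite G2.
have [X1|] := eqVneq X 0; first by rewrite X1 mulr_ge0 // ltW.
move=> Xn; have Xp : 0 < X by rewrite lt_neqAle eq_sym Xn.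
have Y0 : 0 <= F * (2 * pi * X) by rewrite !mulr_ge0 // pi_ge0.
have := XE; rewrite -(@ler_pXn2r _ 2) ?nnegrE ?sqrtr_ge0 // sqr_sqrtr // expr2.
have -> : F * (2 * pi * X) = 2 * pi * F * X by ring.
by rewrite ler_pM2r.
Qed.

End bessel.

Section perturbed_bessel.
Context {R : realType}.
Local Notation mu := (@lebesgue_measure R).

Lemma inv_sqr_telescope (x : R) : 0 < x -> (x + 1) ^- 2 <= x^-1 - (x + 1)^-1.
Proof.
move=> x0; have x1 : 0 < x + 1 by lra.
rewrite -subr_ge0.
have -> : x^-1 - (x + 1)^-1 - (x + 1) ^- 2 = (x * (x + 1) ^+ 2)^-1.
  by field; apply/andP; split; lra.
by rewrite invr_ge0 mulr_ge0 ?sqr_ge0 // ltW.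
Qed.

Lemma sum_inv_sqr (r : seq nat) : uniq r -> (forall k, k \in r -> (0 < k)%N) ->
  \sum_(k <- r) (k%:R ^- 2 : R) <= 2.
Proof.
move=> ur r0.
have h (n : nat) : \sum_(k <- iota 1 n.+1) (k%:R ^- 2 : R) <= 2 - n.+1%:R^-1.
  elim: n => [|n ih]; first by rewrite big_seq1 expr1n invr1; lra.
  rewrite -[n.+2]addn1 iotaD big_cat big_seq1 /= add1n addn1.
  have n1 : 0 < n.+1%:R :> R by rewrite ltr0n.
  have T := inv_sqr_telescope n1; rewrite (natr1 n.+1) in T.
  by apply: (le_trans (lerD ih T)); rewrite addrA subrK.
pose N := \max_(k <- r) k.
have pr : perm_eq r [seq k <- iota 1 N.+1 | k \in r].
  apply: uniq_perm => //; first by rewrite filter_uniq // iota_uniq.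
  move=> k; rewrite mem_filter mem_iota; case: (boolP (k \in r)) => //= kr.
  by rewrite (r0 k kr) /= add1n ltnS leqW // /N; apply: leq_bigmax_seq.
rewrite (perm_big _ pr) big_filter /= big_mkcond.
apply: (le_trans _ (le_trans (h N) _)); last by rewrite gerBl invr_ge0 ler0n.
apply: ler_sum => k _; case: ifP => // _; by rewrite invr_ge0 exprn_ge0 // ler0n.
Qed.

(** The bound E / k makes the perturbation square summable, and the bound 1 keeps all frequencies in
    the strip |Im| <= 1. The list is finite but no later constant depends on it. *)
Definition near_half (r : seq nat) (p : nat -> R[i]) (E : R) := [/\ uniq r, 0 <= E &
  forall k, k \in r -> [/\ (0 < k)%N, nc (p k - (k%:R - 1 / 2)%:C) <= E / k%:R &
    nc (p k - (k%:R - 1 / 2)%:C) <= 1]].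

(** 4 pi is twice the constant of [bessel]; the second term is the perturbation, 8 (c1 E / k)^2 for
    each k, with the sum of the k^-2 at most 2. *)
Definition bessel_const (E : R) : R := 4 * pi + 16 * (2 * pi * expR (2 * pi)) ^+ 2 * E ^+ 2.

Lemma bessel_const_gt0 E : 0 < bessel_const E.
Proof.
apply: ltr_pwDl; first by rewrite mulr_gt0 // pi_gt0.
by apply: mulr_ge0; [apply: mulr_ge0|]; rewrite ?sqr_ge0.
Qed.

Lemma cexp_2pi_nat (n : nat) : cexp ('i * (n%:R * (2 * pi))%:C) = 1 :> R[i].
Proof.
elim: n => [|n ih]; first by rewrite mul0r mulr0 cexp0.
rewrite -(natr1 n) mulrDl mul1r rmorphD mulrDr cexpD ih mul1r cexp_i_real.
by rewrite [2 * pi]mulr_natl cos2pi sin2pi mulr0 addr0.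
Qed.

Lemma cexp_2pi_int (n : int) : cexp ('i * (n%:~R * (2 * pi))%:C) = 1 :> R[i].
Proof.
case: n => n; first exact: cexp_2pi_nat.
have := cexpN ('i * (n.+1%:R * (2 * pi) : R)%:C); rewrite cexp_2pi_nat mul1r => <-.
by congr cexp; rewrite NegzE mulrNz mulNr rmorphN mulrN.
Qed.

Lemma L2_L1 (f : R -> R[i]) (F : R) : cmfun f -> (forall t : R, ~~ (0 < t < pi) -> f t = 0) -> 0 <= F ->
  (\int[mu]_t (nc (f t) ^+ 2)%:E <= F%:E)%E ->
  L1 f /\ (\int[mu]_t (nc (f t))%:E <= (2 * Num.sqrt F)%:E)%E.
Proof.
move=> mf fs F0 fF.
have h : (\int[mu]_t (nc (f t))%:E <= (2 * Num.sqrt F)%:E)%E.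
  apply: CS_support; rewrite ?sqrtr_ge0 ?sqr_sqrtr //.
  - exact: cmfun_nc.
  - by move=> t; exact: nc_ge0.
  - by move=> t /fs ->; rewrite nc0.
by split => //; split => //; exact: le_lt_trans h (ltry _).
Qed.

Lemma L1_mul_bounded (f u : R -> R[i]) (c : R) : L1 f -> (forall t : R, ~~ (0 < t < pi) -> f t = 0) ->
  cmfun u -> (forall t : R, 0 < t < pi -> nc (u t) <= c) -> L1 (fun t => f t * u t).
Proof.
move=> lf fs mu' uc; apply: (@L1_le _ _ (fun t => c%:C * f t)).
- by apply: cmfunM => //; exact: lf.1.
- exact: L1Z.
- move=> t; rewrite ncM [leRHS]ncM nc_real mulrC.
  case: (boolP (0 < t < pi)) => [h|/fs ->]; last by rewrite nc0 !mulr0.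
  by rewrite ler_wpM2r ?nc_ge0 // (le_trans (uc _ h)) // ler_norm.
Qed.

Lemma sqr_normD_le (x y : R) : (x + y) ^+ 2 <= 2 * x ^+ 2 + 2 * y ^+ 2.
Proof. by have := sqr_ge0 (x - y); rewrite !expr2; lra. Qed.

Lemma sum_linear (r : seq nat) (u v : nat -> R) (x y : R) :
  \sum_(k <- r) (x * u k + y * v k) = x * \sum_(k <- r) u k + y * \sum_(k <- r) v k.
Proof. by rewrite big_split -!mulr_sumr. Qed.

(** The exponential at p_k is the one at k - 1/2 times 1 + d with |d| <= c1 E / k. The first part is
    [bessel], since th (k - 1/2) has integer differences; the second is bounded for each k by
    Cauchy-Schwarz and summed with k^-2. The phases needed later have th = 1, -1, 2 or -2. *)
Lemma perturbed_bessel (r : seq nat) (p : nat -> R[i]) (E : R) (th : int) (f : R -> R[i]) :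
  near_half r p E -> th != 0 -> `|th%:~R| <= 2 :> R ->
  cmfun f -> (forall t : R, ~~ (0 < t < pi) -> f t = 0) ->
  forall F : R, 0 <= F -> (\int[mu]_t (nc (f t) ^+ 2)%:E <= F%:E)%E ->
  \sum_(k <- r) nc (cint (fun t => f t * cexp ('i * p k * (th%:~R * t)%:C))) ^+ 2 <= bessel_const E * F.
Proof.
move=> [ur E0 hr] th0 th2 mf fs F F0 fF.
have pi0 := pi_gt0 R.
have [lf f1] := L2_L1 mf fs F0 fF.
pose w (k : nat) : R := th%:~R * (k%:R - 1 / 2).
have thR : th%:~R != 0 :> R by rewrite intr_eq0.
have bb : \sum_(k <- r) nc (cint (fun t => f t * cexp ('i * (w k * t)%:C))) ^+ 2 <= 2 * pi * F.
  apply: bessel => //.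
  - move=> j k jr kr jk; have wE : w j - w k = (th * (j%:Z - k%:Z))%:~R.
      rewrite intrM intrB /w -!pmulrn; ring.
    split; last by rewrite wE; exact: cexp_2pi_int.
    rewrite -subr_eq0 wE intr_eq0 mulf_neq0 // subr_eq0.
    by apply: contra jk => /eqP[->].
  - move=> t ht; apply: fs; apply: contra ht => /andP[-> tp] /=; lra.
pose c1 : R := 2 * pi * expR (2 * pi).
have c10 : 0 <= c1 by rewrite /c1 !mulr_ge0 ?expR_ge0 ?pi_ge0.
have step k : k \in r -> nc (cint (fun t => f t * cexp ('i * p k * (th%:~R * t)%:C))) ^+ 2 <=
    2 * nc (cint (fun t => f t * cexp ('i * (w k * t)%:C))) ^+ 2 + 8 * c1 ^+ 2 * E ^+ 2 * F * k%:R ^- 2.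
  move=> kr; have [k0 e1 e2] := hr k kr.
  set ep := p k - (k%:R - 1 / 2)%:C in e1 e2.
  have k0' : 0 < k%:R :> R by rewrite ltr0n.
  pose u (t : R) := cexp ('i * (w k * t)%:C).
  pose d (t : R) := cexp ('i * ep * (th%:~R * t)%:C) - 1.
  have ud t : cexp ('i * p k * (th%:~R * t)%:C) = u t * (1 + d t).
    rewrite /d addrC subrK /u -cexpD; congr cexp.
    by rewrite /ep /w !rmorphM rmorphB /=; ring.
  have mu1 : cmfun u.
    by apply/cmfun_cexp/cmfunZ/cmfun_real; apply: measurable_funM => //; exact: measurable_cst.
  have md : cmfun d.
    apply: cmfunB; last exact: cmfun_cst.
    by apply/cmfun_cexp/cmfunZ/cmfun_real; apply: measurable_funM => //; exact: measurable_cst.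
  have nu t : nc (u t) = 1 by exact: nc_cexp_i.
  have nd (t : R) : 0 < t < pi -> nc (d t) <= c1 * nc ep.
    move=> /andP[t0 tp].
    have hz : nc ('i * ep * (th%:~R * t)%:C) <= 2 * pi * nc ep.
      rewrite ncM ncM nc_i mul1r nc_real normrM (gtr0_norm t0) mulrC ler_wpM2r ?nc_ge0 //.
      by rewrite ler_pM // ltW.
    apply: (le_trans (nc_cexpB1 _)).
    have n0 := nc_ge0 ('i * ep * (th%:~R * t)%:C); have ne0 := nc_ge0 ep.
    rewrite /c1 [leRHS]mulrAC; apply: ler_pM => //.
    by rewrite ler_expR (le_trans hz) // ler_piMr // mulr_ge0 // ltW.
  have l1 : L1 (fun t => f t * u t) by apply: (L1_mul_bounded lf fs mu1 (c := 1)) => t _; rewrite nu.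
  have l2 : L1 (fun t => f t * (u t * d t)).
    apply: (L1_mul_bounded lf fs (cmfunM mu1 md) (c := c1 * nc ep)) => t ht.
    by rewrite ncM nu mul1r nd.
  have -> : cint (fun t => f t * cexp ('i * p k * (th%:~R * t)%:C)) =
      cint (fun t => f t * u t) + cint (fun t => f t * (u t * d t)).
    by rewrite -cintD //; apply: eq_cint => t; rewrite ud; ring.
  set b0 := cint (fun t => f t * u t); set b1 := cint _.
  have hb1 : nc b1 <= c1 * nc ep * (2 * Num.sqrt F).
    rewrite -lee_fin; apply: (le_trans (nc_cint l2.1)).
    apply: (@le_trans _ _ ((c1 * nc ep)%:E * \int[mu]_t (nc (f t))%:E)%E); last first.
      by rewrite [leRHS]EFinM lee_wpmul2l // lee_fin mulr_ge0 // nc_ge0.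
    rewrite -ge0_integralZl_EFin //; last 3 first.
    - by move=> t _; rewrite lee_fin nc_ge0.
    - by apply/measurable_EFinP; exact: cmfun_nc.
    - by rewrite mulr_ge0 ?nc_ge0.
    under [leRHS]eq_integral do rewrite -EFinM.
    apply: le_int => [||t|t].
    - exact: cmfun_nc l2.1.
    - by apply: measurable_funM; [exact: measurable_cst|exact: cmfun_nc].
    - exact: nc_ge0.
    - rewrite ncM (ncM (u t)) nu mul1r mulrC; case: (boolP (0 < t < pi)) => [ht|/fs ->].
        by rewrite ler_wpM2r ?nc_ge0 // nd.
      by rewrite nc0 !mulr0.
  have h2 : nc b1 ^+ 2 <= 4 * c1 ^+ 2 * E ^+ 2 * F * k%:R ^- 2.
    have hb2 : nc b1 <= c1 * (E / k%:R) * (2 * Num.sqrt F).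
      apply: (le_trans hb1); rewrite ler_wpM2r ?mulr_ge0 ?sqrtr_ge0 //.
      by rewrite ler_wpM2l.
    have R0 : 0 <= c1 * (E / k%:R) * (2 * Num.sqrt F).
      by rewrite !mulr_ge0 ?sqrtr_ge0 ?divr_ge0 // ltW.
    apply: (@le_trans _ _ ((c1 * (E / k%:R) * (2 * Num.sqrt F)) ^+ 2)).
      by rewrite ler_pXn2r ?nnegrE ?nc_ge0.
    rewrite !exprMn sqr_sqrtr // exprVn le_eqVlt; apply/orP; left; apply/eqP; ring.
  have hn : nc (b0 + b1) ^+ 2 <= (nc b0 + nc b1) ^+ 2.
    by rewrite ler_pXn2r ?nnegrE ?addr_ge0 ?nc_ge0 // ncD.
  have := sqr_normD_le (nc b0) (nc b1).
  by move: hn h2; lra.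
rewrite big_seq; apply: (le_trans (ler_sum _ step)); rewrite -big_seq.
rewrite sum_linear.
have s2 : \sum_(k <- r) (k%:R ^- 2 : R) <= 2 by apply: sum_inv_sqr => // k /hr[].
have P0 : 0 <= 8 * c1 ^+ 2 * E ^+ 2 * F.
  by apply: mulr_ge0 => //; apply: mulr_ge0; [apply: mulr_ge0|]; rewrite ?sqr_ge0.
have : 8 * c1 ^+ 2 * E ^+ 2 * F * \sum_(k <- r) (k%:R ^- 2 : R) <= 8 * c1 ^+ 2 * E ^+ 2 * F * 2.
  by rewrite ler_wpM2l.
move: bb; rewrite /bessel_const -/c1; move: (\sum_(_ <- _) _) (\sum_(_ <- _) _) => X Y; lra.
Qed.

Definition trig_const (E : R) : R := expR (2 * pi) * bessel_const E.

Lemma trig_const_gt0 (E : R) : 0 < trig_const E.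
Proof. by rewrite mulr_gt0 ?expR_gt0 // bessel_const_gt0. Qed.

Lemma le_real_ereal (X C : R) (I : \bar R) : 0 < C -> (0 <= I)%E ->
  (forall F : R, 0 <= F -> (I <= F%:E)%E -> X <= C * F) -> (X%:E <= C%:E * I)%E.
Proof.
move=> C0; case: I => [I|_ _|//]; last by rewrite gt0_muley ?lte_fin // leey.
by rewrite lee_fin => I0 h; rewrite -EFinM lee_fin; exact: h.
Qed.

Lemma trig_combination (X Y b0 b1 c sg : R[i]) (e : R) : nc X ^+ 2 <= e -> nc Y ^+ 2 <= e ->
  nc sg <= 1 -> nc c = 1 / 2 ->
  nc (c * (X * b0 + sg * Y * b1)) ^+ 2 <= e / 2 * (nc b0 ^+ 2 + nc b1 ^+ 2).
Proof.
move=> e11 e12 sg1 c2.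
have x0 := nc_ge0 X; have y0 := nc_ge0 Y; have n0 := nc_ge0 b0; have n1 := nc_ge0 b1.
have P0 : 0 <= (nc X * nc b0 + nc Y * nc b1) / 2.
  by apply: divr_ge0 => //; apply: addr_ge0; apply: mulr_ge0.
have n : nc (c * (X * b0 + sg * Y * b1)) <= (nc X * nc b0 + nc Y * nc b1) / 2.
  rewrite ncM c2 mulrC mul1r ler_wpM2r ?invr_ge0 //.
  by apply: (le_trans (ncD _ _)); rewrite !ncM lerD2l -mulrA ler_piMl // mulr_ge0.
have n2 : nc (c * (X * b0 + sg * Y * b1)) ^+ 2 <= ((nc X * nc b0 + nc Y * nc b1) / 2) ^+ 2.
  by rewrite ler_pXn2r ?nnegrE ?nc_ge0.
have g0 := sqr_normD_le (nc X * nc b0) (nc Y * nc b1).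
have g1 : nc X ^+ 2 * nc b0 ^+ 2 <= e * nc b0 ^+ 2 by rewrite ler_wpM2r ?sqr_ge0.
have g2 : nc Y ^+ 2 * nc b1 ^+ 2 <= e * nc b1 ^+ 2 by rewrite ler_wpM2r ?sqr_ge0.
move: n2 g0 g1 g2; rewrite expr_div_n !exprMn.
by move: (nc X ^+ 2) (nc Y ^+ 2) (nc b0 ^+ 2) (nc b1 ^+ 2) (nc _ ^+ 2) ((_ + _) ^+ 2) => *; lra.
Qed.

Lemma cexp_strip (p : R[i]) (y : R) : `|complex.Im p| <= 1 -> `|y| <= pi ->
  nc (cexp ('i * p * y%:C)) ^+ 2 <= expR (2 * pi) /\
  nc (cexp (- ('i * p * y%:C))) ^+ 2 <= expR (2 * pi).
Proof.
move=> hI yp.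
have hre : `|complex.Re ('i * p * y%:C)| <= pi.
  rewrite cReM /= mulr0 subr0 cReM /= mul0r mul1r sub0r normrM normrN -[pi]mul1r.
  by rewrite ler_pM.
rewrite !nc_cexp cReN; move: (complex.Re _) hre => x; rewrite ler_norml => /andP[h1 h2].
by rewrite -!expRM_natl !ler_expR; split; lra.
Qed.

(** Cosine (c = 1/2, sg = 1) and sine (c = 1/(2i), sg = -1) at once, from the frequencies th and -
    th. The constant phase y costs a factor of modulus at most e^pi in the strip, whose square is
    the exponential in [trig_const]. *)
Lemma trig_bessel_real (r : seq nat) (p : nat -> R[i]) (E : R) (th : int) (y : R) (f : R -> R[i]) (c sg : R[i]) :
  near_half r p E -> th != 0 -> `|th%:~R| <= 2 :> R -> `|y| <= pi ->
  cmfun f -> (forall t : R, ~~ (0 < t < pi) -> f t = 0) -> nc sg <= 1 -> nc c = 1 / 2 ->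
  forall F : R, 0 <= F -> (\int[mu]_t (nc (f t) ^+ 2)%:E <= F%:E)%E ->
  \sum_(k <- r) nc (cint (fun t => f t * (c * (cexp ('i * (p k * (y + th%:~R * t)%:C)) +
     sg * cexp (- ('i * (p k * (y + th%:~R * t)%:C))))))) ^+ 2 <= trig_const E * F.
Proof.
move=> hp th0 th2 yp mf fs sg1 c2 F F0 fF; have [ur E0 hr] := hp.
pose b (s : int) (k : nat) := cint (fun t => f t * cexp ('i * p k * (s%:~R * t)%:C)).
have h1 : \sum_(k <- r) nc (b th k) ^+ 2 <= bessel_const E * F by exact: perturbed_bessel.
have h2 : \sum_(k <- r) nc (b (- th) k) ^+ 2 <= bessel_const E * F.
  by apply: perturbed_bessel => //; rewrite ?oppr_eq0 // mulrNz normrN.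
have [lf _] := L2_L1 mf fs F0 fF.
have mexp (s : int) k : cmfun (fun t : R => cexp ('i * p k * (s%:~R * t)%:C)).
  by apply/cmfun_cexp/cmfunZ/cmfun_real; apply: measurable_funM => //; exact: measurable_cst.
have Lb (s : int) k : L1 (fun t => f t * cexp ('i * p k * (s%:~R * t)%:C)).
  apply: (L1_mul_bounded lf fs (mexp s k) (c := expR (nc ('i * p k) * (`|s%:~R| * pi)))) => t /andP[t0 tp].
  by apply: cexp_bound; rewrite normrM (gtr0_norm t0) ler_wpM2l // ltW.
have key k : k \in r ->
    nc (cint (fun t => f t * (c * (cexp ('i * (p k * (y + th%:~R * t)%:C)) +
      sg * cexp (- ('i * (p k * (y + th%:~R * t)%:C))))))) ^+ 2
    <= expR (2 * pi) / 2 * (nc (b th k) ^+ 2 + nc (b (- th) k) ^+ 2).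
  move=> kr; have [_ _ hk] := hr k kr.
  have hI : `|complex.Im (p k)| <= 1.
    by have := nc_Im (p k - (k%:R - 1 / 2)%:C); rewrite cImB /= subr0 => /le_trans; exact.
  have [e11 e12] := cexp_strip hI yp.
  have -> : cint (fun t => f t * (c * (cexp ('i * (p k * (y + th%:~R * t)%:C)) + sg * cexp (- ('i * (p k * (y + th%:~R * t)%:C)))))) =
      c * (cexp ('i * p k * y%:C) * b th k + sg * cexp (- ('i * p k * y%:C)) * b (- th) k).
    rewrite /b -!cintZ // -cintD; try exact: L1Z.
    rewrite -cintZ; last by apply: L1D; exact: L1Z.
    apply: eq_cint => t.
    have -> : 'i * (p k * (y + th%:~R * t)%:C) = 'i * p k * y%:C + 'i * p k * (th%:~R * t)%:C.
      by rewrite rmorphD /=; ring.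
    have -> : (- th)%:~R * t = - (th%:~R * t) :> R by rewrite mulrNz mulNr.
    rewrite opprD !cexpD rmorphN mulrN /=.
    by move: (cexp _) (cexp _) (cexp _) (cexp _) => X Y Z W; ring.
  exact: trig_combination.
rewrite big_seq; apply: (le_trans (ler_sum _ key)); rewrite -big_seq -mulr_sumr big_split /= /trig_const.
have e2 : 0 <= expR (2 * pi) / 2 :> R by rewrite divr_ge0 ?expR_ge0.
apply: (le_trans (ler_wpM2l e2 (lerD h1 h2))).
by move: (expR _) (bessel_const E) => X Y; rewrite le_eqVlt; apply/orP; left; apply/eqP; field.
Qed.

(** The right-hand side is an extended real because the lemma is applied for every t to M(t - s)
    g(s), whose square integral in s may be infinite for some t. *)
Lemma trig_bessel (r : seq nat) (p : nat -> R[i]) (E : R) (th : int) (y : R) (f : R -> R[i]) :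
  near_half r p E -> th != 0 -> `|th%:~R| <= 2 :> R -> `|y| <= pi ->
  cmfun f -> (forall t : R, ~~ (0 < t < pi) -> f t = 0) ->
  ((\sum_(k <- r) nc (cint (fun t => f t * ccos (p k * (y + th%:~R * t)%:C))) ^+ 2)%:E <=
   (trig_const E)%:E * \int[mu]_t (nc (f t) ^+ 2)%:E)%E /\
  ((\sum_(k <- r) nc (cint (fun t => f t * csin (p k * (y + th%:~R * t)%:C))) ^+ 2)%:E <=
   (trig_const E)%:E * \int[mu]_t (nc (f t) ^+ 2)%:E)%E.
Proof.
move=> hp th0 th2 yp mf fs.
have I0 : (0 <= \int[mu]_t (nc (f t) ^+ 2)%:E)%E.
  by apply: integral_ge0 => t _; rewrite lee_fin sqr_ge0.
split; apply: (le_real_ereal (trig_const_gt0 E) I0) => F F0 fF.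
  have s1 : nc (1 : R[i]) <= 1 by rewrite nc1.
  have c2 : nc (2^-1 : R[i]) = 1 / 2 by rewrite ncV nc_nat div1r.
  apply: le_trans (trig_bessel_real hp th0 th2 yp mf fs s1 c2 F0 fF).
  rewrite le_eqVlt; apply/orP; left; apply/eqP; apply: eq_bigr => k _; congr (nc _ ^+ 2).
  by apply: eq_cint => t; rewrite /ccos mul1r; congr (_ * _); rewrite mulrC.
have s1 : nc (- 1 : R[i]) <= 1 by rewrite ncN nc1.
have c2 : nc ((2 * 'i)^-1 : R[i]) = 1 / 2 by rewrite ncV ncM nc_i nc_nat mulr1 div1r.
apply: le_trans (trig_bessel_real hp th0 th2 yp mf fs s1 c2 F0 fF).
rewrite le_eqVlt; apply/orP; left; apply/eqP; apply: eq_bigr => k _; congr (nc _ ^+ 2).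
by apply: eq_cint => t; rewrite /csin mulN1r; congr (_ * _); rewrite mulrC.
Qed.

(** Since c <= sqrt W sqrt G, Cauchy-Schwarz bounds int c g_k by sqrt(A Z_k) with Z_k = int G g_k^2,
    and the Z_k add up to at most B. The bounds are returned as real numbers X k, ready to be
    squared and summed. *)
Lemma sum_CS (r : seq nat) (g : nat -> R -> R) (W G c : R -> R) (A B : R) :
  (forall k, measurable_fun setT (g k)) -> measurable_fun setT W -> measurable_fun setT G ->
  measurable_fun setT c ->
  (forall k t, 0 <= g k t) -> (forall t, 0 <= W t) -> (forall t, 0 <= G t) -> (forall t, 0 <= c t) ->
  (forall t, c t ^+ 2 <= W t * G t) -> 0 <= A ->
  (\int[mu]_t (W t)%:E <= A%:E)%E ->
  (\int[mu]_t (G t * \sum_(k <- r) g k t ^+ 2)%:E <= B%:E)%E ->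
  exists2 X : nat -> R, (forall k, k \in r -> 0 <= X k /\ (\int[mu]_t (c t * g k t)%:E <= (X k)%:E)%E) &
    \sum_(k <- r) X k ^+ 2 <= A * B.
Proof.
move=> mg mW mG mc g0 W0 G0 c0 cWG A0 hW hG.
have m2 k : measurable_fun setT (fun t => G t * g k t ^+ 2).
  by apply: measurable_funM => //; exact: measurable_funX.
pose Z k := (\int[mu]_t (G t * g k t ^+ 2)%:E)%E.
have Z0 k : (0 <= Z k)%E by apply: integral_ge0 => t _; rewrite lee_fin mulr_ge0 // sqr_ge0.
have ZS : (\sum_(k <- r) Z k <= B%:E)%E.
  apply: le_trans hG; rewrite /Z -ge0_integral_sum //.
  - rewrite le_eqVlt; apply/orP; left; apply/eqP; apply: eq_integral => t _.
    by rewrite sumEFin mulr_sumr.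
  - by move=> k; apply/measurable_EFinP; exact: m2.
  - by move=> k t _; rewrite lee_fin mulr_ge0 // sqr_ge0.
have Zfin k : k \in r -> Z k \is a fin_num.
  move=> kr; rewrite ge0_fin_numE //; apply: le_lt_trans (ltry B); apply: le_trans ZS.
  by rewrite (big_rem k) //= leeDl // sume_ge0.
have mS (h : R -> R) : measurable_fun setT h -> measurable_fun setT (fun t => Num.sqrt (h t)).
  by move=> mh; apply: measurableT_comp mh; apply: continuous_measurable_fun; exact: sqrt_continuous.
exists (fun k => Num.sqrt (A * fine (Z k))).
  move=> k kr; split; first exact: sqrtr_ge0.
  have h := @CS_le R (fun t => Num.sqrt (W t)) (fun t => Num.sqrt (G t) * g k t) A (fine (Z k)).
  apply: (le_trans _ (h _ _ _ _ _ _)).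
  - apply: le_int.
    + exact: measurable_funM.
    + by apply: measurable_funM; [exact: mS|apply: measurable_funM => //; exact: mS].
    + by move=> t; rewrite mulr_ge0.
    + move=> t; rewrite mulrA ler_wpM2r // -sqrtrM // -[leLHS](ger0_norm (c0 t)) -sqrtr_sqr.
      by rewrite ler_sqrt // mulr_ge0.
  - exact: mS.
  - by apply: measurable_funM => //; exact: mS.
  - by move=> t; exact: sqrtr_ge0.
  - by move=> t; rewrite mulr_ge0 ?sqrtr_ge0.
  - by under eq_integral do rewrite sqr_sqrtr //.
  - rewrite fineK ?Zfin // le_eqVlt; apply/orP; left; apply/eqP; apply: eq_integral => t _.
    by rewrite exprMn sqr_sqrtr.
have -> : \sum_(k <- r) Num.sqrt (A * fine (Z k)) ^+ 2 = A * \sum_(k <- r) fine (Z k).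
  by rewrite mulr_sumr; apply: eq_bigr => k _; rewrite sqr_sqrtr // mulr_ge0 // fine_ge0.
rewrite ler_wpM2l // -lee_fin -sumEFin; apply: le_trans ZS; rewrite big_seq [leRHS]big_seq.
by apply: lee_sum => k kr; rewrite fineK // Zfin.
Qed.

End perturbed_bessel.

(** * Square summability of the second-order terms *)

Section weights.
Context {R : realType}.
Local Notation mu := (@lebesgue_measure R).

Lemma ge0_le_integral_T (f g : R -> \bar R) : measurable_fun setT f -> measurable_fun setT g ->
  (forall x, (0 <= f x)%E) -> (forall x, (f x <= g x)%E) -> (\int[mu]_x f x <= \int[mu]_x g x)%E.
Proof. by move=> mf mg f0 fg; apply: ge0_le_integral => // x _. Qed.

Lemma measurable_slice1 (h : R * R -> R) (x : R) : measurable_fun setT h ->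
  measurable_fun setT (fun y : R => h (x, y)).
Proof. by move=> mh; apply: (measurableT_comp mh); exact: pair1_measurable. Qed.

Lemma measurable_slice2 (h : R * R -> R) (y : R) : measurable_fun setT h ->
  measurable_fun setT (fun x : R => h (x, y)).
Proof. by move=> mh; apply: (measurableT_comp mh); exact: pair2_measurable. Qed.

(* 1 / (pi - t) for t < pi, in a form measurable on the whole line. *)
Definition inv_weight (t : R) : R := expR (- ln (pi - t)).

Lemma inv_weightE (t : R) : t < pi -> inv_weight t = (pi - t)^-1.
Proof. by move=> tp; rewrite /inv_weight expRN lnK // posrE subr_gt0. Qed.

Lemma inv_weight_ge0 (t : R) : 0 <= inv_weight t.
Proof. exact: expR_ge0. Qed.

Lemma measurable_inv_weight : measurable_fun setT inv_weight.
Proof.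
apply: measurableT_comp; first exact: measurable_expR.
apply: measurableT_comp => //; apply: measurableT_comp; first exact: measurable_ln.
by apply: measurable_funB => //; exact: measurable_cst.
Qed.

(** This is log(pi / (pi - x)) for 0 < x < pi; only its finiteness and its integrals are used, never
    the closed form. *)
Definition log_weight (x : R) : \bar R := (\int[mu]_t (bR (0 < t < x) * inv_weight t)%:E)%E.

Lemma measurable_ltsf : measurable_fun setT (fun p : R * R => p.2 < p.1).
Proof. by apply: measurable_fun_ltr; [exact: measurable_snd|exact: measurable_fst]. Qed.

Lemma log_weight_ge0 (x : R) : (0 <= log_weight x)%E.
Proof. by apply: integral_ge0 => t _; rewrite lee_fin mulr_ge0 ?bR_ge0 ?inv_weight_ge0. Qed.

Lemma Lw_fin (x : R) : x < pi -> log_weight x \is a fin_num.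
Proof.
move=> xp; rewrite ge0_fin_numE ?log_weight_ge0 //.
have [x0|x0] := leP x 0.
  rewrite /log_weight integral0_eq // => t _; rewrite /bR.
  case: (boolP (0 < t < x)) => [/andP[t0 tx]|_]; last by rewrite mul0r.
  by have := lt_le_trans tx x0; rewrite ltNge ltW.
apply: (@le_lt_trans _ _ (\int[mu]_t (((pi - x)^-1)%:E * ((0 < t < x)%R%:R)%:E))%E).
  under [leRHS]eq_integral do rewrite -EFinM.
  apply: le_int => [||t|t].
  - by apply: measurable_funM; [exact: (measurable_bR (measurable_itvb 0 x))|exact: measurable_inv_weight].
  - by apply: measurable_funM => //; exact: (measurable_boolR (measurable_itvb 0 x)).
  - by rewrite mulr_ge0 ?bR_ge0 ?inv_weight_ge0.
  rewrite /bR; case: (boolP (0 < t < x)) => [/andP[t0 tx]|_]; last by rewrite mul0r mulr0.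
  rewrite mul1r mulr1 inv_weightE ?(lt_trans tx) // lef_pV2 ?posrE ?subr_gt0 ?(lt_trans tx) //.
  by rewrite lerD2l lerN2 ltW.
rewrite ge0_integralZl_EFin //.
- by rewrite integral_itv_len ?(ltW x0) // -EFinM ltry.
- by apply/measurable_EFinP; exact: (measurable_boolR (measurable_itvb 0 x)).
- by rewrite invr_ge0 subr_ge0 ltW.
Qed.

Lemma integral_bR_le (g : R -> R) (c s x : R) : measurable_fun setT g -> (forall t, 0 <= g t) -> 0 <= c ->
  s <= x -> (forall t, s < t < x -> g t <= c) -> (\int[mu]_t (bR (s < t < x) * g t)%:E <= (c * (x - s))%:E)%E.
Proof.
move=> mg g0 c0 sx gc.
apply: (@le_trans _ _ (\int[mu]_t (c%:E * ((s < t < x)%R%:R)%:E))%E).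
  under [leRHS]eq_integral do rewrite -EFinM.
  apply: le_int => [||t|t].
  - by apply: measurable_funM => //; exact: (measurable_bR (measurable_itvb s x)).
  - by apply: measurable_funM => //; exact: (measurable_boolR (measurable_itvb s x)).
  - by rewrite mulr_ge0 ?bR_ge0.
  - by rewrite /bR; case: (boolP (s < t < x)) => [/gc|_]; rewrite ?mul1r ?mulr1 ?mul0r ?mulr0.
rewrite ge0_integralZl_EFin //.
  by rewrite integral_itv_len // -EFinM.
by apply/measurable_EFinP; exact: (measurable_boolR (measurable_itvb s x)).
Qed.

(** By Tonelli the integral is that of (y - t) / (pi - t) over (0, y), and this quotient is at most
    1. The bound y, the same as for the constant 1, is what [integral_mm] asks for. *)
Lemma integral_log_weight (y : R) : 0 <= y <= pi -> (\int[mu]_x ((bR (0 < x < y))%:E * log_weight x) <= y%:E)%E.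
Proof.
move=> /andP[y0 yp].
pose h (p : R * R) := bR (0 < p.1 < y) * (bR (0 < p.2 < p.1) * inv_weight p.2).
have mh : measurable_fun setT h.
  apply: measurable_funM.
    exact: (measurableT_comp (measurable_bR (measurable_itvb 0 y)) measurable_fst).
  apply: measurable_funM; last exact: (measurableT_comp measurable_inv_weight measurable_snd).
  apply: measurable_bR; apply: measurable_and; last exact: measurable_ltsf.
  exact: (measurableT_comp (measurable_ltC 0) measurable_snd).
have h0 p : 0 <= h p by rewrite !mulr_ge0 ?bR_ge0 ?inv_weight_ge0.
have -> : (\int[mu]_x ((bR (0 < x < y))%:E * log_weight x) = \int[mu]_x \int[mu]_t (h (x, t))%:E)%E.
  apply: eq_integral => x _; rewrite /log_weight -ge0_integralZl_EFin ?bR_ge0 //.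
  - by move=> t _; rewrite lee_fin mulr_ge0 ?bR_ge0 ?inv_weight_ge0.
  - apply/measurable_EFinP; apply: measurable_funM; last exact: measurable_inv_weight.
    exact: (measurable_bR (measurable_itvb 0 x)).
rewrite tonelli //.
apply: (@le_trans _ _ (\int[mu]_t (((0 < t < y)%R%:R : R))%:E)%E); last first.
  by rewrite integral_itv_len // subr0.
apply: ge0_le_integral_T.
- apply: (measurable_int_param (h := fun p : R * R => h (p.2, p.1))) => //.
  by apply: (measurableT_comp mh); exact: measurable_swap.
- by apply/measurable_EFinP; exact: (measurable_boolR (measurable_itvb 0 y)).
- by move=> t; apply: integral_ge0 => x _; rewrite lee_fin.
move=> t; case: (boolP (0 < t < y)) => [/andP[t0 ty]|nt]; last first.
  rewrite integral0_eq // => x _; rewrite /h /bR /=.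
  case: (boolP (0 < x < y)) => [/andP[x0 xy]|_]; last by rewrite mul0r.
  case: (boolP (0 < t < x)) => [/andP[t0 tx]|_]; last by rewrite mul0r mulr0.
  by move: nt; rewrite t0 (lt_trans tx).
have tp : t < pi by apply: lt_le_trans yp.
apply: (@le_trans _ _ (\int[mu]_x (bR (t < x < y) * inv_weight t)%:E)%E).
  apply: le_int => [||x|x].
  - by apply: (measurableT_comp mh); exact: pair2_measurable.
  - by apply: measurable_funM; [exact: (measurable_bR (measurable_itvb t y))|exact: measurable_cst].
  - exact: h0.
  rewrite /h /= t0 /bR; case: (t < x) => /=; last by rewrite !mul0r mulr0.
  by case: (0 < x); case: (x < y); rewrite /= ?mul1r ?mul0r // inv_weight_ge0.
apply: (le_trans (integral_bR_le (measurable_cst (inv_weight t)) _ (inv_weight_ge0 t) (ltW ty) _)) => //.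
  by move=> ?; exact: inv_weight_ge0.
have -> : (true%:R : R) = 1 by [].
rewrite lee_fin inv_weightE // mulrC ler_pdivrMr ?subr_gt0 // mul1r.
by rewrite lerD2r.
Qed.

Lemma tonelli_conv (K g H : R -> R) : measurable_fun setT K -> measurable_fun setT g -> measurable_fun setT H ->
  (forall t, 0 <= K t) -> (forall t, 0 <= g t) -> (forall t, 0 <= H t) ->
  (\int[mu]_t \int[mu]_s (K t * (H s * g (t - s)))%:E =
   \int[mu]_u \int[mu]_t (g u * (K t * H (t - u)))%:E)%E.
Proof.
move=> mK mg mH K0 g0 H0.
have mh : measurable_fun setT (fun p : R * R => g p.2 * (K p.1 * H (p.1 - p.2))).
  apply: measurable_funM; first exact: (measurableT_comp mg measurable_snd).
  apply: measurable_funM; first exact: (measurableT_comp mK measurable_fst).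
  exact: (measurableT_comp mH measurable_sub2).
rewrite -(tonelli mh); last by move=> p; rewrite !mulr_ge0.
apply: eq_integral => t _.
rewrite -(@integral_refl R (fun u => (g u * (K t * H (t - u)))%:E) t); last first.
  apply/measurable_EFinP; apply: measurable_funM => //; apply: measurable_funM => //.
  by apply: (measurableT_comp mH); apply: measurable_funB => //; exact: measurable_cst.
by apply: eq_integral => s _; rewrite subKr; congr (_%:E); ring.
Qed.

End weights.

Section eta.
Context {R : realType}.

Lemma sqr_mulr_ge0 (x y : R) : 0 <= y -> 0 <= x ^+ 2 * y.
Proof. by move=> y0; apply: mulr_ge0 => //; exact: sqr_ge0. Qed.

Local Notation mu := (@lebesgue_measure R).
Context (q M : R -> R[i]) (a b : R) (hl : l2_data q M a b).
Context (r : seq nat) (p : nat -> R[i]) (E : R) (hp : near_half r p E).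
Local Notation T := (trig_const E).

Let mM := ld_M hl.
Let hd := l2_volterra hl.

Lemma Im_near_half k : k \in r -> `|complex.Im (p k)| <= 1.
Proof.
case: hp => _ _ hr /hr[_ _ hk].
by have := nc_Im (p k - (k%:R - 1 / 2)%:C); rewrite cImB /= subr0 => /le_trans; exact.
Qed.

Lemma trig_pi k (y : R) : k \in r -> `|y| <= pi ->
  nc (ccos (p k * y%:C)) <= expR pi /\ nc (csin (p k * y%:C)) <= expR pi.
Proof.
move=> /Im_near_half kr yp.
have h : `|complex.Im (p k * y%:C)| <= pi.
  by rewrite Im_mulr_real normrM -[pi]mul1r ler_pM.
by split; [apply: (le_trans (nc_ccos _))|apply: (le_trans (nc_csin _))]; rewrite ler_expR.
Qed.

Definition sn k (s : R) : R[i] := (0 < s < pi)%R%:R * csin (p k * s%:C).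

Lemma cmfun_csinZ (z : R[i]) : cmfun (fun t : R => csin (z * t%:C)).
Proof. by apply/cmfun_csin/cmfunZ/cmfun_real; exact: measurable_id. Qed.

Lemma cmfun_ccosZ (z : R[i]) : cmfun (fun t : R => ccos (z * t%:C)).
Proof. by apply/cmfun_ccos/cmfunZ/cmfun_real; exact: measurable_id. Qed.

Lemma cmfun_sn k : cmfun (sn k).
Proof. by apply: cmfunM; [exact: cmfun_itv|exact: cmfun_csinZ]. Qed.

Definition conv_sin k (t : R) : R[i] := cint (fun s => M (t - s) * sn k s).

Lemma cmfun_conv_sin k : cmfun (conv_sin k).
Proof. exact: (cmfun_cint (cmfun_conv2 hd (cmfun_sn k))). Qed.

(** For fixed u the product of the weights gives one factor pi - u and the length of the interval u
    < t < pi a second one, so |M(u)|^2 meets the square of its weight. It is used with K = pi - t, H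
    = 1 and with K = 1, H(s) = s. *)
Lemma conv_square_le (K H : R -> R) : measurable_fun setT K -> measurable_fun setT H ->
  (forall t, 0 <= K t) -> (forall t, 0 <= H t) ->
  (forall u t, 0 < u < pi -> K t * H (t - u) <= bR (u < t < pi) * (pi - u)) ->
  (\int[mu]_t \int[mu]_s (K t * (H s * nc (M (t - s)) ^+ 2))%:E <= (b ^+ 2)%:E)%E.
Proof.
move=> mK mH K0 H0 KH.
have mg : measurable_fun setT (fun u => nc (M u) ^+ 2).
  by apply: measurable_funX; exact: cmfun_nc.
have mh : measurable_fun setT (fun p : R * R => nc (M p.1) ^+ 2 * (K p.2 * H (p.2 - p.1))).
  apply: measurable_funM; first exact: (measurableT_comp mg measurable_fst).
  apply: measurable_funM; first exact: (measurableT_comp mK measurable_snd).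
  apply: (measurableT_comp mH).
  by apply: measurable_funB; [exact: measurable_snd|exact: measurable_fst].
rewrite (@tonelli_conv R K (fun u => nc (M u) ^+ 2) H mK mg mH K0 (fun=> sqr_ge0 _) H0).
apply: le_trans (ld_b hl).
apply: ge0_le_integral_T.
- apply: (measurable_int_param (h := fun p : R * R => nc (M p.1) ^+ 2 * (K p.2 * H (p.2 - p.1)))) => //.
  by move=> u; apply: sqr_mulr_ge0; exact: mulr_ge0.
- apply/measurable_EFinP; apply: measurable_funX; apply: measurable_funM; first exact: cmfun_nc.
  by apply: measurable_funB => //; exact: measurable_cst.
- by move=> u; apply: integral_ge0 => t _; rewrite lee_fin; apply: sqr_mulr_ge0; exact: mulr_ge0.
move=> u; have [up|/(ld_Msupp hl) Mu] := boolP (0 < u < pi); last first.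
  rewrite integral0_eq => [|t _]; last by rewrite Mu nc0 expr0n mul0r.
  by rewrite lee_fin sqr_ge0.
have /andP[u0 upi] := up; have pu : 0 <= pi - u by rewrite subr_ge0 ltW.
apply: (@le_trans _ _ (\int[mu]_t (bR (u < t < pi) * (nc (M u) ^+ 2 * (pi - u)))%:E)%E).
  apply: le_int => [||t|t].
  - exact: (measurable_slice1 u mh).
  - by apply: measurable_funM; [exact: (measurable_bR (measurable_itvb u pi))|exact: measurable_cst].
  - by apply: sqr_mulr_ge0; exact: mulr_ge0.
  - by rewrite [leRHS]mulrCA ler_wpM2l ?sqr_ge0 // KH.
have c0 : 0 <= nc (M u) ^+ 2 * (pi - u) := sqr_mulr_ge0 _ pu.
apply: (le_trans (integral_bR_le (measurable_cst _) (fun=> c0) c0 (ltW upi) (fun _ _ => lexx _))).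
by rewrite exprMn -mulrA -expr2.
Qed.

Lemma conv_bessel (g : R -> R[i]) (t : R) : cmfun g -> (forall s : R, ~~ (0 < s < pi) -> g s = 0) ->
  ((\sum_(k <- r) nc (cint (fun s => M (t - s) * (g s * csin (p k * s%:C)))) ^+ 2)%:E <=
   T%:E * \int[mu]_s (nc (g s) ^+ 2 * nc (M (t - s)) ^+ 2)%:E)%E /\
  ((\sum_(k <- r) nc (cint (fun s => M (t - s) * (g s * ccos (p k * s%:C)))) ^+ 2)%:E <=
   T%:E * \int[mu]_s (nc (g s) ^+ 2 * nc (M (t - s)) ^+ 2)%:E)%E.
Proof.
move=> mg gs.
pose f (s : R) := M (t - s) * g s.
have mf : cmfun f by exact: (cmfun_conv1 hd t mg).
have fs (s : R) : ~~ (0 < s < pi) -> f s = 0 by move=> /gs; rewrite /f => ->; rewrite mulr0.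
have th2 : `|1%:~R| <= 2 :> R by rewrite normr1; lra.
have y0 : `|0 : R| <= pi by rewrite normr0 pi_ge0.
have [hc hs] := trig_bessel hp (th := 1) isT th2 y0 mf fs.
have eI : (\int[mu]_s (nc (f s) ^+ 2)%:E = \int[mu]_s (nc (g s) ^+ 2 * nc (M (t - s)) ^+ 2)%:E)%E.
  by apply: eq_integral => s _; rewrite /f ncM exprMn mulrC.
rewrite -eI; split.
  apply: le_trans hs; rewrite le_eqVlt; apply/orP; left; apply/eqP; congr EFin.
  apply: eq_bigr => k _; congr (nc _ ^+ 2); apply: eq_cint => s.
  by rewrite add0r mul1r /f mulrA.
apply: le_trans hc; rewrite le_eqVlt; apply/orP; left; apply/eqP; congr EFin.
apply: eq_bigr => k _; congr (nc _ ^+ 2); apply: eq_cint => s.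
by rewrite add0r mul1r /f mulrA.
Qed.

Lemma measurable_pi_sub : measurable_fun setT (fun t : R => pi - t).
Proof. by apply: measurable_funB => //; exact: measurable_cst. Qed.

(** At fixed t, Bessel bounds the sum over k by the integral of |M(t - s)|^2 in s, which need not be
    integrable in t up to pi; the weight pi - t makes it so. *)
Lemma eta_weight :
  (\int[mu]_t (bR (0 < t < pi) * (pi - t) * \sum_(k <- r) nc (conv_sin k t) ^+ 2)%:E <= (T * b ^+ 2)%:E)%E.
Proof.
pose K (t : R) := bR (0 < t < pi) * (pi - t).
pose H (s : R) : R := bR (0 < s < pi).
have mK : measurable_fun setT K.
  by apply: measurable_funM; [exact: (measurable_bR (measurable_itvb 0 pi))|exact: measurable_pi_sub].
have mH : measurable_fun setT H by exact: (measurable_bR (measurable_itvb 0 pi)).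
have K0 t : 0 <= K t.
  rewrite /K /bR; case: (boolP (0 < t < pi)) => [/andP[_ tp]|_]; last by rewrite mul0r.
  by rewrite mul1r subr_ge0 ltW.
have H0 t : 0 <= H t by exact: bR_ge0.
have mg : measurable_fun setT (fun u => nc (M u) ^+ 2) by apply: measurable_funX; exact: cmfun_nc.
have mh : measurable_fun setT (fun p : R * R => H p.2 * nc (M (p.1 - p.2)) ^+ 2).
  apply: measurable_funM; first exact: (measurableT_comp mH measurable_snd).
  exact: (measurableT_comp mg measurable_sub2).
have h0 (u : R * R) : 0 <= H u.2 * nc (M (u.1 - u.2)) ^+ 2 by rewrite mulr_ge0 ?sqr_ge0.
have T0 := ltW (trig_const_gt0 E).
have KH u t : 0 < u < pi -> K t * H (t - u) <= bR (u < t < pi) * (pi - u).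
  move=> /andP[u0 up]; rewrite /K /H /bR subr_gt0.
  have [tp|_] := boolP (0 < t < pi); last by rewrite !mul0r mulr_ge0 ?ler0n // subr_ge0 ltW.
  have /andP[_ tp2] := tp; rewrite tp2 mul1r andbT.
  have [ut|_] /= := boolP (u < t); last by rewrite mulr0 mul0r.
  case: (t - u < pi); rewrite ?mulr1 ?mulr0 mul1r; last by rewrite subr_ge0 ltW.
  by rewrite lerD2l lerN2 ltW.
have := conv_square_le mK mH K0 H0 KH => hc.
rewrite EFinM; apply: (le_trans _ (lee_wpmul2l _ hc)); last by rewrite lee_fin.
rewrite -ge0_integralZl_EFin //; last 2 first.
- by move=> t _; apply: integral_ge0 => s _; rewrite lee_fin mulr_ge0 // (h0 (t, s)).
- apply: (measurable_int_param (h := fun p : R * R => K p.1 * (H p.2 * nc (M (p.1 - p.2)) ^+ 2))).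
    by apply: measurable_funM => //; exact: (measurableT_comp mK measurable_fst).
  by move=> u; rewrite mulr_ge0.
apply: ge0_le_integral_T.
- apply/measurable_EFinP; apply: measurable_funM => //.
  by apply: measurable_sum => k; apply: measurable_funX; exact: (cmfun_nc (cmfun_conv_sin k)).
- apply: measurable_funeM.
  apply: (measurable_int_param (h := fun p : R * R => K p.1 * (H p.2 * nc (M (p.1 - p.2)) ^+ 2))).
    by apply: measurable_funM => //; exact: (measurableT_comp mK measurable_fst).
  by move=> u; rewrite mulr_ge0.
- by move=> t; rewrite lee_fin mulr_ge0 ?K0 //; apply: sumr_ge0 => k _; exact: sqr_ge0.
move=> t; under [X in (_ <= _ * X)%E]eq_integral do rewrite EFinM.
rewrite ge0_integralZl_EFin ?K0 //; last 2 first.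
- by move=> s _; rewrite lee_fin (h0 (t, s)).
- by apply/measurable_EFinP; exact: (measurable_slice1 t mh).
rewrite muleCA EFinM lee_wpmul2l ?lee_fin ?K0 //.
have mI : cmfun (fun s : R => (0 < s < pi)%R%:R : R[i]) by exact: cmfun_itv.
have Is (s : R) : ~~ (0 < s < pi) -> (0 < s < pi)%R%:R = 0 :> R[i] by move=> /negPf ->.
have [hs _] := conv_bessel t mI Is.
apply: (le_trans hs); rewrite lee_wpmul2l ?lee_fin // le_eqVlt; apply/orP; left; apply/eqP.
by apply: eq_integral => s _; rewrite nc_nat /H /bR; case: (0 < s < pi); rewrite ?expr1n ?expr0n.
Qed.

(** Cauchy-Schwarz against the weight pi - t of [eta_weight] leaves the integral of 1 / (pi - t)
    over (0, x). The numbers Z k do not depend on x, so the dependence on x is confined to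
    [log_weight]. *)
Lemma eta_CS : exists Z : nat -> R, [/\ forall k, 0 <= Z k, \sum_(k <- r) Z k <= T * b ^+ 2 &
  forall k, k \in r -> forall x : R, 0 < x < pi ->
  ((nc (cutI (fun t => csin (p k * (x - t)%:C) * conv_sin k t) x) ^+ 2)%:E <= (expR pi ^+ 2 * Z k)%:E * log_weight x)%E].
Proof.
pose K (t : R) := bR (0 < t < pi) * (pi - t).
have mK : measurable_fun setT K.
  by apply: measurable_funM; [exact: (measurable_bR (measurable_itvb 0 pi))|exact: measurable_pi_sub].
have K0 t : 0 <= K t.
  rewrite /K /bR; case: (boolP (0 < t < pi)) => [/andP[_ tp]|_]; last by rewrite mul0r.
  by rewrite mul1r subr_ge0 ltW.
have me k : measurable_fun setT (fun t => nc (conv_sin k t)) by exact: (cmfun_nc (cmfun_conv_sin k)).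
have m2 k : measurable_fun setT (fun t => K t * nc (conv_sin k t) ^+ 2).
  by apply: measurable_funM => //; exact: measurable_funX.
pose Z k := (\int[mu]_t (K t * nc (conv_sin k t) ^+ 2)%:E)%E.
have Z0 k : (0 <= Z k)%E by apply: integral_ge0 => t _; rewrite lee_fin mulr_ge0 // sqr_ge0.
have ZS : (\sum_(k <- r) Z k <= (T * b ^+ 2)%:E)%E.
  apply: le_trans eta_weight; rewrite /Z -ge0_integral_sum //.
  - rewrite le_eqVlt; apply/orP; left; apply/eqP; apply: eq_integral => t _.
    by rewrite sumEFin mulr_sumr.
  - by move=> k; apply/measurable_EFinP; exact: m2.
  - by move=> k t _; rewrite lee_fin mulr_ge0 // sqr_ge0.
have Zfin k : k \in r -> Z k \is a fin_num.
  move=> kr; rewrite ge0_fin_numE //; apply: le_lt_trans (ltry (T * b ^+ 2)); apply: le_trans ZS.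
  by rewrite (big_rem k) //= leeDl // sume_ge0.
exists (fun k => fine (Z k)); split.
- by move=> k; exact: fine_ge0.
- rewrite -lee_fin -sumEFin; apply: le_trans ZS; rewrite big_seq [leRHS]big_seq.
  by apply: lee_sum => k kr; rewrite fineK // Zfin.
move=> k kr x /andP[x0 xpi].
have Lf := Lw_fin xpi.
have mW : measurable_fun setT (fun t : R => bR (0 < t < x) * inv_weight t).
  by apply: measurable_funM; [exact: (measurable_bR (measurable_itvb 0 x))|exact: measurable_inv_weight].
have mc : measurable_fun setT (fun t : R => bR (0 < t < x) : R).
  exact: (measurable_bR (measurable_itvb 0 x)).
have [||||||||X hX] := @sum_CS R [:: k] (fun k t => nc (conv_sin k t)) _ _ _ (fine (log_weight x)) (fine (Z k)) me mW mK mc.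
- by move=> j t; exact: nc_ge0.
- by move=> t; rewrite mulr_ge0 ?bR_ge0 ?inv_weight_ge0.
- exact: K0.
- by move=> t; exact: bR_ge0.
- move=> t; rewrite /K /bR; case: (boolP (0 < t < x)) => [/andP[t0 tx]|_]; last by rewrite expr0n !mul0r.
  have tp := lt_trans tx xpi.
  by rewrite t0 tp !mul1r expr1n inv_weightE // mulVf // gt_eqF // subr_gt0.
- by apply: fine_ge0; exact: log_weight_ge0.
- by rewrite fineK.
- under eq_integral do rewrite big_seq1.
  by rewrite fineK // Zfin.
rewrite big_seq1 => hX2; have [X0 XI] := hX k (mem_head _ _).
rewrite -(fineK Lf) -EFinM lee_fin -mulrA [fine (Z k) * _]mulrC.
have h : nc (cutI (fun t => csin (p k * (x - t)%:C) * conv_sin k t) x) <= expR pi * X k.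
  rewrite -lee_fin; apply: (le_trans (nc_cint _)).
    apply: cmfunM; first exact: cmfun_itv.
    by apply: cmfunM; [exact: cmfun_csinB|exact: cmfun_conv_sin].
  rewrite EFinM; apply: (le_trans _ (lee_wpmul2l _ XI)); last by rewrite lee_fin expR_ge0.
  rewrite -ge0_integralZl_EFin ?expR_ge0 //; last 2 first.
  - by move=> t _; rewrite lee_fin mulr_ge0 ?bR_ge0 ?nc_ge0.
  - by apply/measurable_EFinP; apply: measurable_funM; [exact: mc|exact: me].
  under [leRHS]eq_integral do rewrite -EFinM.
  apply: le_int => [||t|t].
  - apply/cmfun_nc/cmfunM; first exact: cmfun_itv.
    by apply: cmfunM; [exact: cmfun_csinB|exact: cmfun_conv_sin].
  - by apply: measurable_funM => //; apply: measurable_funM; [exact: mc|exact: me].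
  - exact: nc_ge0.
  rewrite nc_boolM ncM [leRHS]mulrCA /bR; case: (boolP (0 < t < x)) => [/andP[t0 tx]|_]; last by rewrite !mul0r.
  rewrite !mul1r ler_wpM2r ?nc_ge0 //; apply: (trig_pi kr _).2.
  by rewrite ger0_norm; lra.
apply: (@le_trans _ _ ((expR pi * X k) ^+ 2)).
  by rewrite ler_pXn2r ?nnegrE ?nc_ge0 // mulr_ge0 // expR_ge0.
by rewrite exprMn ler_wpM2l ?sqr_ge0.
Qed.

End eta.

Definition volterra_solution {R : realType} (q M : R -> R[i]) (rho : R[i]) (v : R -> R[i]) :=
  [/\ cmfun v, exists C : R, forall x : R, 0 < x <= pi -> nc (v x) <= C &
    forall x : R, 0 < x <= pi -> v x = 1 + voltT q M (rho ^+ 2) v x].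

(** * Second approximation of the solution *)

Section beta.
Context {R : realType}.
Local Notation mu := (@lebesgue_measure R).
Context (q M : R -> R[i]) (a b : R) (hl : l2_data q M a b).
Context (r : seq nat) (p : nat -> R[i]) (E : R) (hp : near_half r p E).
Context (v : nat -> R -> R[i]).
Context (hv : forall k, k \in r -> volterra_solution q M (p k) (v k)).
Local Notation T := (trig_const E).
Local Notation D := (2 * a + 2 * b).
Context (hk : forall k, k \in r -> k%:R / 4 <= nc (p k)).
Context (hD : forall k, k \in r -> D <= 3 / 4 * nc (p k)).
Local Notation sn := (sn p).
Local Notation conv_sin := (conv_sin M p).

Let mq := ld_q hl.
Let mM := ld_M hl.
Let hd := l2_volterra hl.

Lemma D_ge0 : 0 <= D.
Proof. by have := ld_a0 hl; have := ld_b0 hl; lra. Qed.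

Let r_gt0 k : k \in r -> 0 < k%:R :> R.
Proof. by case: hp => _ _ hr /hr[k0 _ _]; rewrite ltr0n. Qed.

Lemma p_gt0 k : k \in r -> 0 < nc (p k).
Proof. by move=> kr; apply: lt_le_trans (hk kr); rewrite divr_gt0 // r_gt0. Qed.

Lemma expR_Im_le k (x : R) : k \in r -> 0 <= x <= pi -> expR (`|complex.Im (p k)| * x) <= expR pi.
Proof.
move=> /(Im_near_half hp) h /andP[x0 xp]; rewrite ler_expR -[leRHS]mul1r.
by rewrite ler_pM.
Qed.

(** Error of S against its first approximation sin(p s) / p; it is of order D / p^2 by
    [resid_bound]. *)
Definition resid k (s : R) : R[i] := cutJ (v k) s - (p k)^-1 * sn k s.

Lemma cmfun_resid k : k \in r -> cmfun (resid k).
Proof.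
by move=> /hv[mv _ _]; apply: cmfunB; [exact: cmfun_cutJ|exact/cmfunZ/cmfun_sn].
Qed.

Lemma resid_supp k (s : R) : ~~ (0 < s) -> resid k s = 0.
Proof. by move=> s0; rewrite /resid cutJ_supp // /sn (negPf s0) mul0r mulr0 subr0. Qed.

Lemma sine_close_p k (x : R) : k \in r -> 0 < x <= pi ->
  nc (p k * cutI (v k) x - csin (p k * x%:C)) <= 4 / nc (p k) * D * expR (`|complex.Im (p k)| * x).
Proof.
move=> kr xp; have [mv [C vC] vE] := hv kr.
exact: (sine_close hd mv vC vE (p_gt0 kr) (hD kr) xp).2.
Qed.

Lemma resid_bound k (s : R) : k \in r -> 0 < s < pi ->
  nc (resid k s) <= 4 / nc (p k) ^+ 2 * D * expR (`|complex.Im (p k)| * s).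
Proof.
move=> kr sp; have /andP[s0 s1] := sp.
have p0 : p k != 0 by rewrite -nc_gt0 p_gt0.
have -> : resid k s = (p k)^-1 * (p k * cutI (v k) s - csin (p k * s%:C)).
  by rewrite /resid /cutJ /sn sp !mul1r mulrBr mulKf.
rewrite ncM ncV mulrC ler_pdivrMr ?p_gt0 //.
apply: (le_trans (sine_close_p kr _)); first by rewrite s0 ltW.
rewrite le_eqVlt; apply/orP; left; apply/eqP; field.
by rewrite gt_eqF // p_gt0.
Qed.

Lemma sn_bound k (s : R) : k \in r -> nc (sn k s) <= expR pi.
Proof.
move=> kr; rewrite nc_boolM /bR; case: (boolP (0 < s < pi)) => [/andP[s0 sp]|_]; last first.
  by rewrite mul0r expR_ge0.
by rewrite mul1r; apply: (trig_pi hp kr _).2; rewrite ger0_norm ltW.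
Qed.

Definition cQ k (x : R) : R[i] := (0 < x < pi)%R%:R * (ccos (p k * x%:C) * cutI q x).

(* With S the antiderivative of v, p^2 S = p sin(p x) - 1/2 cos(p x) int_0^x q + beta, where
   beta is square summable over k. *)
Definition beta k (x : R) : R[i] := (0 < x < pi)%R%:R *
  (p k ^+ 2 * cutI (v k) x - p k * csin (p k * x%:C) + 1 / 2 * (ccos (p k * x%:C) * cutI q x)).

Lemma cmfun_cQ k : cmfun (cQ k).
Proof. by apply: cmfunM; [exact: cmfun_itv|apply: cmfunM; [exact: cmfun_ccosZ|exact: cmfun_cutI]]. Qed.

Lemma cmfun_beta k : k \in r -> cmfun (beta k).
Proof.
move=> /hv[mv _ _]; apply: cmfunM; first exact: cmfun_itv.
apply: cmfunD; last by apply: cmfunZ; apply: cmfunM; [exact: cmfun_ccosZ|exact: cmfun_cutI].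
by apply: cmfunB; apply: cmfunZ; [exact: cmfun_cutI|exact: cmfun_csinZ].
Qed.

Lemma L1on_q (x : R) : L1on x q.
Proof.
have lq : L1 q by split => //; exact: le_lt_trans (vd_A hd) (ltry _).
apply: (@L1_le _ _ q) => //; first by apply: cmfunM => //; exact: cmfun_itv.
by move=> t; rewrite nc_boolM ler_piMl ?nc_ge0 // bR_le1.
Qed.

Lemma L1on_volt (y : R -> R[i]) (c x : R) : cmfun y -> x <= pi -> (forall s : R, ~~ (0 < s) -> y s = 0) ->
  0 <= c -> (forall s : R, 0 < s < x -> nc (y s) <= c) -> L1on x (voltV q M y).
Proof.
move=> my xp ys c0 yc.
apply: (L1_cutV hd my xp c0 (lexx 0) ys _).1 => s sx.
by rewrite mul0r expR0 mulr1 yc.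
Qed.

Lemma voltV_sn k (t : R) : voltV q M (sn k) t = q t * sn k t + conv_sin k t.
Proof. by []. Qed.

Lemma voltV_split k (t : R) : k \in r -> t < pi ->
  voltV q M (cutJ (v k)) t = (p k)^-1 * voltV q M (sn k) t + voltV q M (resid k) t.
Proof.
move=> kr tp; have msn := cmfun_sn p k; have mr := cmfun_resid kr.
have -> : cutJ (v k) = fun s => (p k)^-1 * sn k s + 1 * resid k s.
  by apply/funext => s; rewrite /resid mul1r addrC subrK.
have t0 : forall s, ~~ (0 < s) -> sn k s = 0 by move=> s /negPf s0; rewrite /sn s0 mul0r.
rewrite (@V_linear R q M _ _ hd _ _ _ _ (expR pi) (4 / nc (p k) ^+ 2 * D * expR pi)) ?mul1r //.
- exact: resid_supp.
- by move=> s _; exact: sn_bound.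
- move=> s /andP[s0 st]; have sp : 0 < s < pi by rewrite s0 (lt_trans st).
  apply: (le_trans (resid_bound kr sp)).
  rewrite ler_wpM2l //; first by rewrite !mulr_ge0 ?D_ge0 ?invr_ge0 ?sqr_ge0 // exprn_ge0 // nc_ge0.
  by apply: expR_Im_le => //; rewrite (ltW s0) /=; case/andP: sp => _ /ltW.
Qed.

(** The bound p^-2 on [resid] leaves a factor 1/p after multiplication by p, so these terms are
    square summable by size alone; 1/|p| <= 4/k turns 4 into 16. *)
Lemma resid_volt k (x : R) : k \in r -> 0 < x < pi ->
  nc (p k * cutI (fun t => csin (p k * (x - t)%:C) * voltV q M (resid k) t) x) <=
  16 * D ^+ 2 * expR pi / k%:R.
Proof.
move=> kr /andP[x0 xp]; have pp := p_gt0 kr; have D0 := D_ge0.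
rewrite ncM.
have c0 : 0 <= 4 / nc (p k) ^+ 2 * D by rewrite mulr_ge0 ?D_ge0 // divr_ge0 // exprn_ge0 // nc_ge0.
have h : nc (cutI (fun t => csin (p k * (x - t)%:C) * voltV q M (resid k) t) x) <=
    4 / nc (p k) ^+ 2 * D * D * expR (`|complex.Im (p k)| * x).
  apply: (cut_trig_bound hd) => //.
  - exact: cmfun_csinB.
  - exact: cmfun_resid.
  - exact: ltW.
  - by move=> t /andP[t0 tx]; exact: (nc_trig (p k) (ltW tx)).2.
  - exact: resid_supp.
  - by move=> s /andP[s0 sx]; apply: resid_bound => //; rewrite s0 (lt_trans sx).
have h2 : 4 / nc (p k) ^+ 2 * D * D * expR (`|complex.Im (p k)| * x) <= 4 / nc (p k) ^+ 2 * D * D * expR pi.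
  rewrite ler_wpM2l //; first by rewrite mulr_ge0 ?D_ge0.
  by apply: expR_Im_le => //; rewrite (ltW x0) ltW.
apply: (@le_trans _ _ (4 * D ^+ 2 * expR pi / nc (p k))).
  apply: (le_trans (ler_wpM2l (nc_ge0 _) (le_trans h h2))).
  rewrite le_eqVlt; apply/orP; left; apply/eqP; field.
  by rewrite gt_eqF.
rewrite ler_pdivrMr // [leRHS]mulrAC ler_pdivlMr ?r_gt0 //.
have X0 : 0 <= D ^+ 2 * expR pi by apply: sqr_mulr_ge0; exact: expR_ge0.
have hk4 : k%:R <= 4 * nc (p k) by have := hk kr; lra.
have := ler_wpM2l X0 hk4; rewrite -!mulrA; move: (expR pi) (D ^+ 2) => x1 x2; lra.
Qed.

(** Multiply the formula for p S in [volterra_trig] by p and insert S = sin(p s) / p + [resid]. In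
    the q part, 2 sin(p (x - t)) sin(p t) = cos(p (x - 2t)) - cos(p x): the second term is the
    explicit one removed in [beta], and the first is a Bessel integral. *)
Lemma beta_decomp k (x : R) : k \in r -> 0 < x < pi ->
  beta k x = 1 / 2 * cutI (fun t => q t * ccos (p k * (x + (- 2)%:~R * t)%:C)) x
    + cutI (fun t => csin (p k * (x - t)%:C) * conv_sin k t) x
    + p k * cutI (fun t => csin (p k * (x - t)%:C) * voltV q M (resid k) t) x.
Proof.
move=> kr xp; have /andP[x0 x1] := xp; have [mv [C vC] vE] := hv kr.
have xpi : x <= pi := ltW x1.
have p0 : p k != 0 by rewrite -nc_gt0 p_gt0.
have msn := cmfun_sn p k; have mr := cmfun_resid kr.
have sn0 s : ~~ (0 < s) -> sn k s = 0 by move=> /negPf s0; rewrite /sn s0 mul0r.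
have mcs := cmfun_csinB (p k) x.
have csb (t : R) : 0 < t < x -> nc (csin (p k * (x - t)%:C)) <= expR pi.
  move=> /andP[t0 tx]; apply: (trig_pi hp kr _).2; rewrite ger0_norm; lra.
have e0 : 0 <= expR pi :> R := expR_ge0 _.
have lsn : L1on x (voltV q M (sn k)).
  by apply: (L1on_volt msn xpi sn0 e0) => s _; exact: sn_bound.
have c0 : 0 <= 4 / nc (p k) ^+ 2 * D * expR pi.
  by rewrite mulr_ge0 // mulr_ge0 ?D_ge0 // divr_ge0 // exprn_ge0 // nc_ge0.
have lre : L1on x (voltV q M (resid k)).
  apply: (L1on_volt mr xpi (@resid_supp k) c0) => s /andP[s0 sx].
  have sp : 0 < s < pi by rewrite s0 (lt_trans sx).
  apply: (le_trans (resid_bound kr sp)); rewrite ler_wpM2l //.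
    by rewrite mulr_ge0 ?D_ge0 // divr_ge0 // exprn_ge0 // nc_ge0.
  by apply: expR_Im_le => //; rewrite (ltW s0) /=; case/andP: sp => _ /ltW.
have lqs : L1on x (fun t => q t * sn k t).
  apply: (@L1_le _ _ (fun t => (expR pi)%:C * ((0 < t < x)%R%:R * q t))).
  - by apply: cmfunM; [exact: cmfun_itv|exact: cmfunM].
  - exact: L1Z (L1on_q x).
  - move=> t; rewrite nc_boolM ncM [leRHS]ncM nc_real ger0_norm // nc_boolM mulrCA.
    have w : 0 <= bR (0 < t < x) * nc (q t) by rewrite mulr_ge0 ?bR_ge0 ?nc_ge0.
    have := ler_wpM2l w (sn_bound t kr).
    by move: (bR _) (nc (q t)) (nc (sn k t)) (expR pi) => x1' x2 x3 x4; lra.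
have leta : L1on x (conv_sin k).
  have [l1 _] := cutIB lsn lqs.
  rewrite (_ : conv_sin k = fun t => voltV q M (sn k) t - q t * sn k t) //.
  by apply/funext => t; rewrite voltV_sn addrC addKr.
have tr := (volterra_trig hd mv vC vE (x := x) (ltac:(by rewrite x0 xpi))).2.
have l1 := L1onM mcs csb lsn; have l2 := L1onM mcs csb lre.
have l3 := L1onM mcs csb lqs; have l4 := L1onM mcs csb leta.
have [l5 e5] := cutIZ (p k)^-1 l1; have [_ e6] := cutID l5 l2.
have e7 : cutI (fun t => csin (p k * (x - t)%:C) * voltV q M (cutJ (v k)) t) x =
    (p k)^-1 * cutI (fun t => csin (p k * (x - t)%:C) * voltV q M (sn k) t) x
    + cutI (fun t => csin (p k * (x - t)%:C) * voltV q M (resid k) t) x.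
  rewrite -e5 -e6; apply: eq_cutI => t /andP[t0 tx].
  rewrite voltV_split //; last by rewrite (lt_trans tx).
  by move: (csin _) (voltV _ _ _ _) (voltV _ _ _ _) (_^-1) => X Y Z W; ring.
have e8 : cutI (fun t => csin (p k * (x - t)%:C) * voltV q M (sn k) t) x =
    cutI (fun t => csin (p k * (x - t)%:C) * (q t * sn k t)) x + cutI (fun t => csin (p k * (x - t)%:C) * conv_sin k t) x.
  rewrite -(cutID l3 l4).2; apply: eq_cutI => t _; rewrite voltV_sn.
  by move: (csin _) (conv_sin k t) => X Y; ring.
have lq := L1on_q x.
have lqc : L1on x (fun t => q t * ccos (p k * (x + (- 2)%:~R * t)%:C)).
  rewrite (_ : (fun t => _) = fun t => ccos (p k * (x + (- 2)%:~R * t)%:C) * q t).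
    apply: (L1onM (c := expR pi) _ _ lq).
      apply/cmfun_ccos/cmfunZ/cmfun_real; apply: measurable_funD; first exact: measurable_cst.
      by apply: measurable_funM => //; exact: measurable_cst.
    move=> t /andP[t0 tx]; apply: (trig_pi hp kr _).1; rewrite ler_norml.
    by rewrite (_ : (- 2)%:~R = - 2 :> R) //; apply/andP; split; lra.
  by apply/funext => t; rewrite mulrC.
have e9 : cutI (fun t => csin (p k * (x - t)%:C) * (q t * sn k t)) x =
   1 / 2 * cutI (fun t => q t * ccos (p k * (x + (- 2)%:~R * t)%:C)) x - 1 / 2 * ccos (p k * x%:C) * cutI q x.
  have [l9 e9] := cutIZ (1 / 2) lqc; have [l10 e10] := cutIZ (1 / 2 * ccos (p k * x%:C)) lq.
  rewrite -e9 -e10 -(cutIB l9 l10).2; apply: eq_cutI => t /andP[t0 tx].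
  have tp : 0 < t < pi by rewrite t0 (lt_trans tx).
  rewrite /sn tp [true%:R * csin _]mul1r.
  have -> : p k * (x + (- 2)%:~R * t)%:C = p k * (x - t)%:C + - (p k * t%:C).
    by rewrite (_ : x + (- 2)%:~R * t = (x - t) - t) ?rmorphB /= ?mulrBr //; ring.
  have -> : p k * x%:C = p k * (x - t)%:C + p k * t%:C.
    by rewrite -mulrDr -rmorphD /= subrK.
  rewrite !ccosD ccosN csinN.
  by move: (csin _) (csin _) (ccos _) (ccos _) (q t) => X Y Z W U; field.
rewrite /beta xp [true%:R * _]mul1r expr2 -[p k * p k * _]mulrA tr e7 e8 e9.
move: (cutI _ _) (cutI _ _) (cutI _ _) (cutI q x) (csin _) (ccos _) => X Y Z U S C'.
by field.
Qed.

(** The factor 3 comes from the square of a sum of three terms; 512 is 16 squared, from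
    [resid_volt], times the bound 2 for the sum of the k^-2. *)
Definition beta_c1 : R := 3 * (T * a ^+ 2 + 512 * (D ^+ 2 * expR pi) ^+ 2).
Definition beta_c2 : R := 3 * (expR pi ^+ 2 * (T * b ^+ 2)).

Lemma sqr_norm3_le (x y z : R) : (x + y + z) ^+ 2 <= 3 * (x ^+ 2 + y ^+ 2 + z ^+ 2).
Proof.
have h1 := sqr_ge0 (x - y); have h2 := sqr_ge0 (y - z); have h3 := sqr_ge0 (x - z).
by move: h1 h2 h3; rewrite !expr2; lra.
Qed.

Lemma beta_sum (x : R) : 0 < x < pi ->
  ((\sum_(k <- r) nc (beta k x) ^+ 2)%:E <= beta_c1%:E + beta_c2%:E * log_weight x)%E.
Proof.
move=> xp; have /andP[x0 x1] := xp.
have [ur E0 hr] := hp.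
have [Z [Z0 ZS hZ]] := eta_CS hl hp.
pose A k := cutI (fun t => q t * ccos (p k * (x + (- 2)%:~R * t)%:C)) x.
have Lf := Lw_fin x1; have L0 := fine_ge0 (log_weight_ge0 x).
have T0 := ltW (trig_const_gt0 E).
have hA : \sum_(k <- r) nc (A k) ^+ 2 <= T * a ^+ 2.
  pose f (t : R) := (0 < t < x)%R%:R * q t.
  have mf : cmfun f by apply: cmfunM => //; exact: cmfun_itv.
  have fs (t : R) : ~~ (0 < t < pi) -> f t = 0 by move=> /(ld_qsupp hl); rewrite /f => ->; rewrite mulr0.
  have th2 : `|(- 2)%:~R| <= 2 :> R by rewrite normrN ger0_norm.
  have xa : `|x| <= pi by rewrite gtr0_norm // ltW.
  have [hc _] := trig_bessel hp (th := - 2) isT th2 xa mf fs.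
  rewrite -lee_fin; apply: (@le_trans _ _ (T%:E * \int[mu]_t (nc (f t) ^+ 2)%:E)%E).
    apply: le_trans hc; rewrite le_eqVlt; apply/orP; left; apply/eqP; congr EFin.
    apply: eq_bigr => k _; congr (nc _ ^+ 2); apply: eq_cint => t.
    by rewrite /f mulrA.
  rewrite [leRHS]EFinM lee_wpmul2l ?lee_fin //; apply: le_trans (ld_a hl).
  apply: le_int => [||t|t].
  - by apply: measurable_funX; exact: cmfun_nc.
  - by apply: measurable_funX; exact: cmfun_nc.
  - exact: sqr_ge0.
  - by rewrite ler_pXn2r ?nnegrE ?nc_ge0 // nc_boolM ler_piMl ?nc_ge0 // bR_le1.
rewrite -(fineK Lf) -EFinM -EFinD lee_fin.
have step k : k \in r -> nc (beta k x) ^+ 2 <=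
    3 * nc (A k) ^+ 2 + 3 * (expR pi ^+ 2 * fine (log_weight x)) * Z k + 3 * (16 * D ^+ 2 * expR pi) ^+ 2 * k%:R ^- 2.
  move=> kr; rewrite beta_decomp // -/(A k).
  have hB := hZ k kr x xp; rewrite -(fineK Lf) -EFinM lee_fin in hB.
  have hC := resid_volt kr xp.
  move: (cutI _ _) (p k * cutI _ _) hB hC => B C hB hC.
  have n1 : nc (1 / 2 * A k + B + C) <= nc (A k) + nc B + nc C.
    apply: (le_trans (ncD _ _)); rewrite lerD2r; apply: (le_trans (ncD _ _)); rewrite lerD2r.
    rewrite ncM ncM ncV nc1 nc_nat; have := nc_ge0 (A k); lra.
  have n2 : nc (1 / 2 * A k + B + C) ^+ 2 <= (nc (A k) + nc B + nc C) ^+ 2.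
    by rewrite ler_pXn2r ?nnegrE ?addr_ge0 ?nc_ge0.
  have n3 := sqr_norm3_le (nc (A k)) (nc B) (nc C).
  have n4 : nc C ^+ 2 <= (16 * D ^+ 2 * expR pi) ^+ 2 * k%:R ^- 2.
    rewrite -exprVn -exprMn ler_pXn2r ?nnegrE ?nc_ge0 //.
    exact: le_trans (nc_ge0 _) hC.
  rewrite -[X in _ <= _ + X]mulrA; move: n2 n3 n4 hB.
  move: (nc _ ^+ 2) (nc (A k) ^+ 2) (nc B ^+ 2) (nc C ^+ 2) ((_ + _ + _) ^+ 2) => y1 y2 y3 y4 y5.
  move: (_ ^+ 2 * k%:R ^- 2) (expR pi ^+ 2) (fine _) (Z k) => y6 y7 y8 y9.
  by move=> h1 h2 h3 h4; lra.
rewrite big_seq; apply: (le_trans (ler_sum _ step)); rewrite -big_seq !big_split -!mulr_sumr.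
have s2 : \sum_(k <- r) (k%:R ^- 2 : R) <= 2 by apply: sum_inv_sqr => // k /hr[].
have g1 : 0 <= 3 * (16 * D ^+ 2 * expR pi) ^+ 2 by rewrite mulr_ge0 // sqr_ge0.
have g2 : 0 <= 3 * (expR pi ^+ 2 * fine (log_weight x)).
  by rewrite mulr_ge0 //; apply: sqr_mulr_ge0.
have g3 := ler_wpM2l g2 ZS; have g4 := ler_wpM2l g1 s2.
have e : 3 * (16 * D ^+ 2 * expR pi) ^+ 2 * 2 = 3 * (512 * (D ^+ 2 * expR pi) ^+ 2) by ring.
rewrite e in g4; rewrite /beta_c1 /beta_c2.
have -> : 3 * (T * a ^+ 2 + 512 * (D ^+ 2 * expR pi) ^+ 2) + 3 * (expR pi ^+ 2 * (T * b ^+ 2)) * fine (log_weight x) =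
  3 * (T * a ^+ 2) + 3 * (expR pi ^+ 2 * fine (log_weight x)) * (T * b ^+ 2) + 3 * (512 * (D ^+ 2 * expR pi) ^+ 2) by ring.
apply: lerD => //; apply: lerD => //; by rewrite ler_wpM2l.
Qed.

End beta.

Section second_order.
Context {R : realType}.
Local Notation mu := (@lebesgue_measure R).
Context (q M : R -> R[i]) (a b : R) (hl : l2_data q M a b).
Context (r : seq nat) (p : nat -> R[i]) (E : R) (hp : near_half r p E).
Context (v : nat -> R -> R[i]).
Context (hv : forall k, k \in r -> volterra_solution q M (p k) (v k)).
Local Notation T := (trig_const E).
Local Notation D := (2 * a + 2 * b).
Context (hk : forall k, k \in r -> k%:R / 4 <= nc (p k)).
Context (hD : forall k, k \in r -> D <= 3 / 4 * nc (p k)).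
Local Notation beta := (beta q p v).
Local Notation cQ := (cQ q p).
Local Notation C1 := (beta_c1 a b E).
Local Notation C2 := (beta_c2 b E).

Let mq := ld_q hl.
Let mM := ld_M hl.
Let hd := l2_volterra hl.
Let a0 := ld_a0 hl.
Let b0 := ld_b0 hl.

Lemma beta_supp k (s : R) : ~~ (0 < s < pi) -> beta k s = 0.
Proof. by rewrite /beta => /negPf ->; rewrite mul0r. Qed.

Lemma beta_c1_ge0 : 0 <= C1.
Proof.
have T0 := ltW (trig_const_gt0 E).
rewrite /beta_c1; apply: mulr_ge0; first exact: ler0n.
apply: addr_ge0; first exact: (mulr_ge0 T0 (sqr_ge0 _)).
by apply: mulr_ge0; [exact: ler0n|exact: sqr_ge0].
Qed.

Lemma beta_c2_ge0 : 0 <= C2.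
Proof.
have T0 := ltW (trig_const_gt0 E).
rewrite /beta_c2; apply: mulr_ge0; first exact: ler0n.
exact: sqr_mulr_ge0 _ (mulr_ge0 T0 (sqr_ge0 _)).
Qed.

Definition log_weight_fine (x : R) : R := bR (0 < x < pi) * \int[mu]_t (bR (0 < t < x) * inv_weight t).

Lemma log_weight_fineE (x : R) : ((bR (0 < x < pi))%:E * log_weight x)%E = (log_weight_fine x)%:E.
Proof.
rewrite /log_weight_fine /bR; case: (boolP (0 < x < pi)) => [/andP[_ xp]|_]; last by rewrite mul0e mul0r.
by rewrite mul1e mul1r /Rintegral fineK // Lw_fin.
Qed.

Lemma log_weight_fine_ge0 x : 0 <= log_weight_fine x.
Proof. by rewrite mulr_ge0 ?bR_ge0 //; apply: Rintegral_ge0 => t _; rewrite mulr_ge0 ?bR_ge0 ?inv_weight_ge0. Qed.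

Lemma measurable_log_weight_fine : measurable_fun setT log_weight_fine.
Proof.
apply: measurable_funM; first exact: (measurable_bR (measurable_itvb 0 pi)).
apply: (measurable_Rint_param (h := fun p : R * R => bR (0 < p.2 < p.1) * inv_weight p.2)).
apply: measurable_funM; last exact: (measurableT_comp measurable_inv_weight measurable_snd).
apply: measurable_bR; apply: measurable_and; last exact: measurable_ltsf.
exact: (measurableT_comp (measurable_ltC 0) measurable_snd).
Qed.

Lemma integral_lw (y : R) : 0 <= y <= pi -> (\int[mu]_x (bR (x < y) * log_weight_fine x)%:E <= y%:E)%E.
Proof.
move=> yp; apply: le_trans (integral_log_weight yp); rewrite le_eqVlt; apply/orP; left; apply/eqP.
apply: eq_integral => x _; rewrite EFinM -log_weight_fineE muleA -EFinM; congr (_%:E * _)%E.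
rewrite /bR; have [xy|_] := boolP (x < y); rewrite ?andbF ?mul0r // andbT mul1r.
by case/andP: yp => _ yp; rewrite (lt_le_trans xy yp) andbT.
Qed.

(** [beta_sum] integrated against G. The test [k \in r] makes the family measurable for every index,
    as [sum_CS] requires, since [v k] is controlled for k in r only. *)
Lemma integral_beta (G : R -> R) (A1 A2 : R) : measurable_fun setT G -> (forall x, 0 <= G x) ->
  (forall x : R, ~~ (0 < x < pi) -> G x = 0) ->
  (\int[mu]_x (G x)%:E <= A1%:E)%E -> (\int[mu]_x (G x * log_weight_fine x)%:E <= A2%:E)%E ->
  (\int[mu]_x (G x * \sum_(k <- r) (if k \in r then nc (beta k x) else 0) ^+ 2)%:E
    <= (C1 * A1 + C2 * A2)%:E)%E.
Proof.
move=> mG G0 Gs h1 h2.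
have ml := measurable_log_weight_fine.
apply: (@le_trans _ _ (\int[mu]_x ((C1 * G x)%:E + (C2 * (G x * log_weight_fine x))%:E))%E).
  under [leRHS]eq_integral do rewrite -EFinD.
  apply: le_int => [||x|x].
  - apply: measurable_funM => //; apply: measurable_sum => k; apply: measurable_funX.
    by case: (boolP (k \in r)) => // kr; exact: (cmfun_nc (cmfun_beta hl hv kr)).
  - apply: measurable_funD; apply: measurable_funM => //; try exact: measurable_cst.
    exact: measurable_funM.
  - by rewrite mulr_ge0 // sumr_ge0 // => k _; exact: sqr_ge0.
  have [xp|/Gs ->] := boolP (0 < x < pi); last by rewrite !(mul0r, mulr0) addr0.
  have := beta_sum hl hp hv hk hD xp; have /andP[_ x1] := xp.
  have -> : log_weight x = (log_weight_fine x)%:E by rewrite -log_weight_fineE /bR xp mul1e.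
  rewrite -EFinM -EFinD lee_fin => h.
  rewrite (_ : \sum_(k <- r) (if k \in r then nc (beta k x) else 0) ^+ 2 = \sum_(k <- r) nc (beta k x) ^+ 2); last first.
    by rewrite big_seq [RHS]big_seq; apply: eq_bigr => k ->.
  have := ler_wpM2l (G0 x) h; move: (\sum_(k <- r) _) (log_weight_fine x) (G x) => x1' x2 x3; lra.
have p1 x : (0 <= (G x)%:E)%E by rewrite lee_fin.
have p2 x : (0 <= (G x * log_weight_fine x)%:E)%E by rewrite lee_fin mulr_ge0 ?log_weight_fine_ge0.
have m1 : measurable_fun setT (fun x => (G x)%:E) by apply/measurable_EFinP.
have m2 : measurable_fun setT (fun x => (G x * log_weight_fine x)%:E) by apply/measurable_EFinP; exact: measurable_funM.
rewrite ge0_integralD //.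
- rewrite EFinD; apply: leeD.
    under eq_integral do rewrite EFinM.
    by rewrite ge0_integralZl_EFin ?beta_c1_ge0 // [leRHS]EFinM lee_wpmul2l ?lee_fin ?beta_c1_ge0.
  under eq_integral do rewrite EFinM.
  by rewrite ge0_integralZl_EFin ?beta_c2_ge0 // [leRHS]EFinM lee_wpmul2l ?lee_fin ?beta_c2_ge0.
- by move=> x _; rewrite lee_fin mulr_ge0 ?beta_c1_ge0.
- by under eq_fun do rewrite EFinM; apply: measurable_funeM.
- by move=> x _; rewrite lee_fin mulr_ge0 ?beta_c2_ge0 // mulr_ge0 ?log_weight_fine_ge0.
- by under eq_fun do rewrite EFinM; apply: measurable_funeM.
Qed.

Lemma measurable_gbeta k : measurable_fun setT (fun x => if k \in r then nc (beta k x) else 0).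
Proof. by case: (boolP (k \in r)) => // kr; exact: (cmfun_nc (cmfun_beta hl hv kr)). Qed.

Lemma gbeta_ge0 k x : 0 <= if k \in r then nc (beta k x) else 0.
Proof. by case: ifP => // _; exact: nc_ge0. Qed.

Lemma integral_bR_pi : (\int[mu]_x (bR (0 < x < (pi : R)))%:E = (pi : R)%:E)%E.
Proof. by rewrite integral_itv_len ?pi_ge0 // subr0. Qed.

Lemma q_beta : exists2 X : nat -> R,
  (forall k, k \in r -> 0 <= X k /\ (\int[mu]_t (nc (q t) * nc (beta k t))%:E <= (X k)%:E)%E) &
  \sum_(k <- r) X k ^+ 2 <= a ^+ 2 * (C1 * pi + C2 * pi).
Proof.
have mG : measurable_fun setT (fun x : R => bR (0 < x < pi) : R) := measurable_bR (measurable_itvb 0 pi).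
have mnq := cmfun_nc mq.
have [||||||||X hX XS] := @sum_CS R r (fun k x => if k \in r then nc (beta k x) else 0)
  (fun x => nc (q x) ^+ 2) (fun x => bR (0 < x < pi)) (fun x => nc (q x)) (a ^+ 2) (C1 * pi + C2 * pi)
  measurable_gbeta (measurable_funX 2 mnq) mG mnq.
- exact: gbeta_ge0.
- by move=> t; exact: sqr_ge0.
- by move=> t; exact: bR_ge0.
- by move=> t; exact: nc_ge0.
- move=> t; rewrite /bR; case: (boolP (0 < t < pi)) => [_|/(ld_qsupp hl) ->]; first by rewrite mulr1.
  by rewrite nc0 expr0n mulr0.
- exact: sqr_ge0.
- exact: ld_a hl.
- apply: integral_beta => //.
  + by move=> x; rewrite /bR => /negPf ->.
  + by rewrite integral_bR_pi.
  + have p1 (y : R) : y = pi -> 0 <= y <= pi by move=> ->; rewrite pi_ge0 lexx.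
    apply: le_trans (integral_lw (p1 _ erefl)); rewrite le_eqVlt; apply/orP; left; apply/eqP.
    apply: eq_integral => x _; congr (_%:E); rewrite /log_weight_fine !mulrA /bR; congr (_ * _).
    by case: (0 < x); case: (x < pi); rewrite ?mul0r ?mulr0 ?mulr1.
exists X => // k kr; have [X0 h] := hX k kr; split => //; apply: le_trans h.
by rewrite kr.
Qed.

(** The mass that convolution with |M| sends into t < pi from a unit mass at s, so that the integral
    of |M * beta| over (0, pi) is at most the integral of [kernel_mass] times |beta|. It is finite
    for s > 0 because pi - u > s there. *)
Definition kernel_mass (s : R) : R := bR (0 < s < pi) * \int[mu]_u (bR (u < pi - s) * nc (M u)).

Let mh2 : measurable_fun setT (fun p : R * R => bR (p.2 < pi - p.1) * nc (M p.2)).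
Proof.
apply: measurable_funM; last exact: (measurableT_comp (cmfun_nc mM) measurable_snd).
apply: measurable_bR; apply: measurable_fun_ltr; first exact: measurable_snd.
by apply: measurable_funB; [exact: measurable_cst|exact: measurable_fst].
Qed.

Lemma kernel_massE (s : R) : ((bR (0 < s < pi))%:E * \int[mu]_u (bR (u < pi - s) * nc (M u))%:E)%E = (kernel_mass s)%:E.
Proof.
rewrite /kernel_mass /bR; case: (boolP (0 < s < pi)) => [/andP[s0 sp]|_]; last by rewrite mul0e mul0r.
rewrite mul1e mul1r /Rintegral fineK //.
rewrite ge0_fin_numE; last by apply: integral_ge0 => u _; rewrite lee_fin mulr_ge0 ?ler0n ?nc_ge0.
apply: (@le_lt_trans _ _ (\int[mu]_u ((s^-1)%:E * (nc (M u) * (pi - u))%:E))%E).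
  under [leRHS]eq_integral do rewrite -EFinM.
  apply: le_int => [||u|u].
  - exact: (measurable_slice1 s mh2).
  - by apply: measurable_funM => //; apply: measurable_funM; [exact: cmfun_nc|exact: measurable_pi_sub].
  - by rewrite mulr_ge0 ?ler0n ?nc_ge0.
  have P0 : 0 <= s^-1 * (nc (M u) * (pi - u)) by rewrite mulr_ge0 ?(Mpi_ge0 hd) // invr_ge0 ltW.
  have [us|_] := boolP (u < pi - s); last by rewrite mul0r.
  rewrite mul1r mulrCA ler_peMr ?nc_ge0 // mulrC ler_pdivlMr // mul1r; lra.
rewrite ge0_integralZl_EFin.
- by rewrite lte_mul_pinfty ?lee_fin ?invr_ge0 ?(ltW s0) //; exact: le_lt_trans (vd_B hd) (ltry _).
- by [].
- by move=> u _; rewrite lee_fin (Mpi_ge0 hd).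
- by apply/measurable_EFinP; apply: measurable_funM; [exact: cmfun_nc|exact: measurable_pi_sub].
- by rewrite invr_ge0 ltW.
Qed.

Lemma kernel_mass_ge0 s : 0 <= kernel_mass s.
Proof. by rewrite mulr_ge0 ?bR_ge0 //; apply: Rintegral_ge0 => u _; rewrite mulr_ge0 ?bR_ge0 ?nc_ge0. Qed.

Lemma measurable_kernel_mass : measurable_fun setT kernel_mass.
Proof.
apply: measurable_funM; first exact: (measurable_bR (measurable_itvb 0 pi)).
exact: (measurable_Rint_param mh2).
Qed.

(** By Tonelli the integral is that of |M(u)| times the integral of w over (0, pi - u), which is at
    most pi - u, exactly the weight of M. Both w = 1 and the logarithmic weight qualify. *)
Lemma integral_mm (w : R -> R) : measurable_fun setT w -> (forall s, 0 <= w s) ->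
  (forall y : R, 0 <= y <= pi -> (\int[mu]_s (bR (0 < s < pi) * (bR (s < y) * w s))%:E <= y%:E)%E) ->
  (\int[mu]_s (kernel_mass s * w s)%:E <= (2 * b)%:E)%E.
Proof.
move=> mw w0 hw.
pose h (p : R * R) := (bR (0 < p.1 < pi) * w p.1) * (bR (p.2 < pi - p.1) * nc (M p.2)).
have mb : measurable_fun setT (fun x : R => bR (0 < x < pi) : R) := measurable_bR (measurable_itvb 0 pi).
have mh : measurable_fun setT h.
  apply: measurable_funM mh2; apply: (measurableT_comp (f := fun s : R => bR (0 < s < pi) * w s) _ measurable_fst).
  exact: measurable_funM.
have h0 u : 0 <= h u by rewrite !mulr_ge0 ?bR_ge0 ?nc_ge0.
have -> : (\int[mu]_s (kernel_mass s * w s)%:E = \int[mu]_s \int[mu]_u (h (s, u))%:E)%E.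
  apply: eq_integral => s _; rewrite EFinM -kernel_massE muleAC -EFinM /h /=.
  under [RHS]eq_integral do rewrite EFinM.
  rewrite ge0_integralZl_EFin //.
  - by move=> u _; rewrite lee_fin mulr_ge0 ?bR_ge0 ?nc_ge0.
  - by apply/measurable_EFinP; exact: (measurable_slice1 s mh2).
  - by rewrite mulr_ge0 ?bR_ge0.
rewrite tonelli //; apply: le_trans (vd_B hd).
apply: ge0_le_integral_T.
- apply: (measurable_int_param (h := fun p : R * R => h (p.2, p.1))) => //.
  by apply: (measurableT_comp mh); exact: measurable_swap.
- by apply/measurable_EFinP; apply: measurable_funM; [exact: cmfun_nc|exact: measurable_pi_sub].
- by move=> u; apply: integral_ge0 => s _; rewrite lee_fin.
move=> u; have [/andP[u0 up]|/(ld_Msupp hl) Mu] := boolP (0 < u < pi); last first.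
  rewrite integral0_eq => [|s _]; last by rewrite /h /= Mu nc0 !mulr0.
  by rewrite Mu nc0 mul0r.
have yp : 0 <= pi - u <= pi by apply/andP; split; lra.
rewrite EFinM; apply: (le_trans _ (lee_wpmul2l _ (hw _ yp))); last by rewrite lee_fin nc_ge0.
rewrite -ge0_integralZl_EFin ?nc_ge0 //; last 2 first.
- by move=> s _; rewrite lee_fin !mulr_ge0 ?bR_ge0.
- apply/measurable_EFinP; apply: measurable_funM => //; apply: measurable_funM => //.
  exact: (measurable_bR (measurable_ltCr _)).
rewrite le_eqVlt; apply/orP; left; apply/eqP; apply: eq_integral => s _.
rewrite -EFinM; congr EFin; rewrite /h /=.
by rewrite (_ : (u < pi - s) = (s < pi - u)); [ring|apply/idP/idP; lra].
Qed.

Lemma kernel_mass_beta : exists2 X : nat -> R,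
  (forall k, k \in r -> 0 <= X k /\ (\int[mu]_t (kernel_mass t * nc (beta k t))%:E <= (X k)%:E)%E) &
  \sum_(k <- r) X k ^+ 2 <= 2 * b * (C1 * (2 * b) + C2 * (2 * b)).
Proof.
have h1 : (\int[mu]_s (kernel_mass s)%:E <= (2 * b)%:E)%E.
  have := @integral_mm (fun=> 1) (measurable_cst _) (fun=> ler01).
  under eq_integral do rewrite mulr1.
  apply => y /andP[y0 yp]; apply: (@le_trans _ _ (\int[mu]_s (bR (0 < s < y) * 1)%:E)%E).
    apply: le_int => [||s|s].
    - apply: measurable_funM; first exact: (measurable_bR (measurable_itvb 0 pi)).
      by apply: measurable_funM => //; exact: (measurable_bR (measurable_ltCr _)).
    - by apply: measurable_funM => //; exact: (measurable_bR (measurable_itvb 0 y)).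
    - by rewrite !mulr_ge0 ?bR_ge0.
    - by rewrite /bR; case: (0 < s); case: (s < pi); case: (s < y); rewrite /= ?mul1r ?mul0r.
  apply: (le_trans (integral_bR_le (measurable_cst _) (fun=> ler01) ler01 y0 (fun _ _ => lexx _))).
  by rewrite mul1r subr0.
have h2 : (\int[mu]_s (kernel_mass s * log_weight_fine s)%:E <= (2 * b)%:E)%E.
  apply: integral_mm; [exact: measurable_log_weight_fine|exact: log_weight_fine_ge0|move=> y yp].
  apply: le_trans (integral_lw yp); rewrite le_eqVlt; apply/orP; left; apply/eqP.
  apply: eq_integral => s _; congr EFin; rewrite mulrCA; congr (_ * _).
  by rewrite /log_weight_fine mulrA -/(bR _) /bR; case: (0 < s < pi); rewrite ?mul1r ?mul0r.
have B0 : 0 <= 2 * b by rewrite mulr_ge0.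
have [||||||||X hX XS] := @sum_CS R r (fun k x => if k \in r then nc (beta k x) else 0)
  kernel_mass kernel_mass kernel_mass (2 * b) (C1 * (2 * b) + C2 * (2 * b)) measurable_gbeta measurable_kernel_mass measurable_kernel_mass measurable_kernel_mass.
- exact: gbeta_ge0.
- exact: kernel_mass_ge0.
- exact: kernel_mass_ge0.
- exact: kernel_mass_ge0.
- by move=> t; rewrite expr2.
- exact: B0.
- exact: h1.
- apply: integral_beta => //; [exact: measurable_kernel_mass|exact: kernel_mass_ge0|].
  by move=> x; rewrite /kernel_mass /bR => /negPf ->; rewrite mul0r.
exists X => // k kr; have [X0 h] := hX k kr; split => //; apply: le_trans h.
by rewrite kr.
Qed.

(** The cosine is at most e^pi in the strip. The double integral of the convolution part is taken in
    t first, and the inner integral is dominated by [kernel_mass]. *)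
Lemma cos_volt_beta (k : nat) (X Y : R) : k \in r ->
  (\int[mu]_t (nc (q t) * nc (beta k t))%:E <= X%:E)%E -> (\int[mu]_t (kernel_mass t * nc (beta k t))%:E <= Y%:E)%E ->
  nc (cutI (fun t => ccos (p k * (pi - t)%:C) * voltV q M (beta k) t) pi) <= expR pi * (X + Y).
Proof.
move=> kr hX hY; have mbe := cmfun_beta hl hv kr; have mV := cmfun_V hd mbe.
have mnb := cmfun_nc mbe; have mnM := cmfun_nc mM; have mnq := cmfun_nc mq.
have mi : measurable_fun setT (fun x : R => bR (0 < x < pi) : R) := measurable_bR (measurable_itvb 0 pi).
pose h (z : R * R) := bR (0 < z.1 < pi) * (nc (M (z.1 - z.2)) * nc (beta k z.2)).
have mh : measurable_fun setT h.
  apply: measurable_funM; first exact: (measurableT_comp mi measurable_fst).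
  by apply: measurable_funM; [exact: (measurableT_comp mnM measurable_sub2)|exact: (measurableT_comp mnb measurable_snd)].
have h0 z : 0 <= h z by rewrite !mulr_ge0 ?bR_ge0 ?nc_ge0.
have mHi : measurable_fun setT (fun t => \int[mu]_s (h (t, s))%:E)%E by exact: (measurable_int_param mh h0).
have mqb : measurable_fun setT (fun t => (nc (q t) * nc (beta k t))%:E).
  by apply/measurable_EFinP; exact: measurable_funM.
have hM : (\int[mu]_t \int[mu]_s (h (t, s))%:E <= Y%:E)%E.
  apply: le_trans hY; rewrite tonelli //.
  apply: ge0_le_integral_T.
  - by apply: (measurable_int_param (h := fun z : R * R => h (z.2, z.1))); [apply: (measurableT_comp mh); exact: measurable_swap|move=> z; exact: h0].
  - by apply/measurable_EFinP; apply: measurable_funM => //; exact: measurable_kernel_mass.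
  - by move=> s; apply: integral_ge0 => t _; rewrite lee_fin.
  move=> s; have [sp|/beta_supp be0] := boolP (0 < s < pi); last first.
    rewrite integral0_eq => [|t _]; last by rewrite /h /= be0 nc0 !mulr0.
    by rewrite be0 nc0 mulr0.
  rewrite EFinM -kernel_massE /bR sp mul1e muleC.
  have mg : measurable_fun setT (fun u : R => bR (u < pi - s) * nc (M u)) := measurable_slice1 s mh2.
  rewrite -(@integral_shift R (fun u => (bR (u < pi - s) * nc (M u))%:E) s); last by apply/measurable_EFinP.
  rewrite -ge0_integralZl_EFin ?nc_ge0 //; last 2 first.
  - by move=> t _; rewrite lee_fin mulr_ge0 ?bR_ge0 ?nc_ge0.
  - apply/measurable_EFinP; apply: (measurableT_comp mg); exact: measurable_subr.
  under [leRHS]eq_integral do rewrite -EFinM.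
  apply: le_int => [||t|t].
  - exact: (measurable_slice2 s mh).
  - by apply: measurable_funM => //; apply: (measurableT_comp mg); exact: measurable_subr.
  - exact: h0.
  rewrite /h /= mulrA mulrC ler_wpM2l ?nc_ge0 // ler_wpM2r ?nc_ge0 // /bR ltrD2r.
  by case: (0 < t); case: (t < pi); rewrite ?ler01 ?lexx.
rewrite -lee_fin; apply: (le_trans (nc_cint _)).
  by apply: cmfunM; [exact: cmfun_itv|apply: cmfunM => //; exact: cmfun_ccosB].
apply: (@le_trans _ _ (\int[mu]_t ((expR pi)%:E * ((nc (q t) * nc (beta k t))%:E + \int[mu]_s (h (t, s))%:E)))%E).
  apply: ge0_le_integral_T.
  - apply/measurable_EFinP; apply: cmfun_nc.
    by apply: cmfunM; [exact: cmfun_itv|apply: cmfunM => //; exact: cmfun_ccosB].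
  - by apply: measurable_funeM; apply: emeasurable_funD.
  - by move=> t; rewrite lee_fin nc_ge0.
  move=> t; rewrite nc_boolM; have [/andP[t0 tp]|tn] := boolP (0 < t < pi); last first.
    rewrite /bR mul0r mule_ge0 ?lee_fin ?expR_ge0 // adde_ge0 //.
      by rewrite lee_fin mulr_ge0 ?nc_ge0.
    by apply: integral_ge0 => s _; rewrite lee_fin.
  rewrite /bR mul1r ncM EFinM; apply: (@le_trans _ _ ((expR pi)%:E * (nc (voltV q M (beta k) t))%:E)%E).
    rewrite lee_wpmul2r ?lee_fin ?nc_ge0 //; apply: (trig_pi hp kr _).1.
    by rewrite ger0_norm; lra.
  rewrite lee_wpmul2l ?lee_fin ?expR_ge0 //; apply: (le_trans (nc_V hd t mbe)).
  rewrite leeD2l // le_eqVlt; apply/orP; left; apply/eqP; apply: eq_integral => s _.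
  by rewrite /h /= t0 tp /bR mul1r.
rewrite ge0_integralZl_EFin ?expR_ge0 //; last 2 first.
- move=> t _; rewrite adde_ge0 ?lee_fin ?mulr_ge0 ?nc_ge0 //.
  by apply: integral_ge0 => s _; rewrite lee_fin.
- exact: emeasurable_funD.
rewrite [leRHS]EFinM lee_wpmul2l ?lee_fin ?expR_ge0 // ge0_integralD //.
- by rewrite EFinD leeD.
- by move=> t _; rewrite lee_fin mulr_ge0 ?nc_ge0.
- by move=> t _; apply: integral_ge0 => s _; rewrite lee_fin.
Qed.

Lemma Q_bound (s : R) : 0 <= s -> nc (cutI q s) ^+ 2 <= a ^+ 2 * s /\ nc (cutI q s) <= 2 * a.
Proof.
move=> s0; have mnq := cmfun_nc mq.
have mi : measurable_fun setT (fun x : R => bR (0 < x < s) : R) := measurable_bR (measurable_itvb 0 s).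
have h1 : ((nc (cutI q s))%:E <= \int[mu]_t (nc (q t) * bR (0 < t < s))%:E)%E.
  apply: (le_trans (nc_cint _)); first by apply: cmfunM => //; exact: cmfun_itv.
  by rewrite le_eqVlt; apply/orP; left; apply/eqP; apply: eq_integral => t _; rewrite nc_boolM mulrC.
split.
  have h2 : (\int[mu]_t (bR (0 < t < s) ^+ 2)%:E <= s%:E)%E.
    have e (t : R) : bR (0 < t < s) ^+ 2 = (0 < t < s)%R%:R :> R.
      by rewrite /bR; case: (0 < t < s); rewrite ?expr1n ?expr0n.
    under eq_integral do rewrite e.
    by rewrite integral_itv_len // subr0.
  have := le_trans h1 (CS_le mnq mi (fun t => nc_ge0 _) (fun t => bR_ge0 _) (ld_a hl) h2).
  rewrite lee_fin => h3; have P0 : 0 <= a ^+ 2 * s by exact: sqr_mulr_ge0.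
  by rewrite -(sqr_sqrtr P0) ler_pXn2r ?nnegrE ?nc_ge0 ?sqrtr_ge0.
rewrite -lee_fin; apply: (le_trans h1); apply: le_trans (vd_A hd).
apply: le_int => [||t|t].
- exact: measurable_funM.
- by [].
- by rewrite mulr_ge0 ?nc_ge0 ?bR_ge0.
- by rewrite ler_piMr ?nc_ge0 // bR_le1.
Qed.

Definition zeta k (t : R) : R[i] := cint (fun s => M (t - s) * cQ k s).

Lemma cmfun_zeta k : cmfun (zeta k).
Proof. exact: (cmfun_cint (cmfun_conv2 hd (cmfun_cQ hl p k))). Qed.

Lemma zeta_sum : exists2 X : nat -> R,
  (forall k, k \in r -> 0 <= X k /\ (\int[mu]_t (bR (0 < t < pi) * nc (zeta k t))%:E <= (X k)%:E)%E) &
  \sum_(k <- r) X k ^+ 2 <= pi * (T * a ^+ 2 * b ^+ 2).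
Proof.
pose K (t : R) : R := bR (0 < t < pi).
pose H (s : R) : R := bR (0 < s < pi) * s.
have mK : measurable_fun setT K := measurable_bR (measurable_itvb 0 pi).
have mH : measurable_fun setT H by exact: measurable_funM.
have K0 t : 0 <= K t by exact: bR_ge0.
have H0 t : 0 <= H t.
  by rewrite /H /bR; case: (boolP (0 < t < pi)) => [/andP[t0 _]|_]; rewrite ?mul1r ?mul0r // ltW.
have mz k : measurable_fun setT (fun t => nc (zeta k t)) := cmfun_nc (cmfun_zeta k).
have KH u t : 0 < u < pi -> K t * H (t - u) <= bR (u < t < pi) * (pi - u).
  move=> /andP[u0 up]; have pu : 0 <= pi - u by rewrite subr_ge0 ltW.
  rewrite /K /H /bR subr_gt0.
  have [tp|_] := boolP (0 < t < pi); last by rewrite !mul0r mulr_ge0 ?ler0n.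
  have /andP[_ tp2] := tp; rewrite tp2 mul1r andbT.
  have [ut|_] /= := boolP (u < t); last by rewrite mul0r mul0r.
  case: (t - u < pi); rewrite ?mul1r ?mul0r //.
  by rewrite lerD2r ltW.
have hc := conv_square_le hl mK mH K0 H0 KH.
have mg : measurable_fun setT (fun u => nc (M u) ^+ 2) by apply: measurable_funX; exact: cmfun_nc.
have mh : measurable_fun setT (fun z : R * R => K z.1 * (H z.2 * nc (M (z.1 - z.2)) ^+ 2)).
  apply: measurable_funM; first exact: (measurableT_comp mK measurable_fst).
  apply: measurable_funM; first exact: (measurableT_comp mH measurable_snd).
  exact: (measurableT_comp mg measurable_sub2).
have hh0 (z : R * R) : 0 <= K z.1 * (H z.2 * nc (M (z.1 - z.2)) ^+ 2).
  by apply: mulr_ge0 => //; apply: mulr_ge0; rewrite ?sqr_ge0.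
have T0 := ltW (trig_const_gt0 E).
have mQ : cmfun (fun s : R => (0 < s < pi)%R%:R * cutI q s).
  by apply: cmfunM; [exact: cmfun_itv|exact: cmfun_cutI].
have Qs (s : R) : ~~ (0 < s < pi) -> (0 < s < pi)%R%:R * cutI q s = 0.
  by move=> /negPf ->; rewrite mul0r.
have TA0 : 0 <= T * a ^+ 2 by apply: mulr_ge0; rewrite ?sqr_ge0.
have hG : (\int[mu]_t (K t * \sum_(k <- r) nc (zeta k t) ^+ 2)%:E <= (T * a ^+ 2 * b ^+ 2)%:E)%E.
  rewrite [leRHS]EFinM; apply: (le_trans _ (lee_wpmul2l _ hc)); last by rewrite lee_fin.
  rewrite -ge0_integralZl_EFin //; last 2 first.
  - by move=> t _; apply: integral_ge0 => s _; rewrite lee_fin (hh0 (t, s)).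
  - exact: (measurable_int_param mh hh0).
  apply: ge0_le_integral_T.
  - apply/measurable_EFinP; apply: measurable_funM => //.
    by apply: measurable_sum => k; apply: measurable_funX.
  - by apply: measurable_funeM; exact: (measurable_int_param mh hh0).
  - by move=> t; rewrite lee_fin mulr_ge0 ?K0 //; apply: sumr_ge0 => k _; exact: sqr_ge0.
  move=> t; have [_ hs] := conv_bessel hl hp t mQ Qs.
  have -> : \sum_(k <- r) nc (zeta k t) ^+ 2 =
      \sum_(k <- r) nc (cint (fun s => M (t - s) * ((0 < s < pi)%R%:R * cutI q s * ccos (p k * s%:C)))) ^+ 2.
    apply: eq_bigr => k _; congr (nc _ ^+ 2); apply: eq_cint => s.
    by rewrite /cQ; congr (_ * _); rewrite -mulrA; congr (_ * _); rewrite mulrC.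
  rewrite EFinM; apply: (le_trans (lee_wpmul2l _ hs)); first by rewrite lee_fin.
  rewrite [(T * a ^+ 2)%:E]EFinM muleCA -muleA lee_wpmul2l ?lee_fin //.
  rewrite -ge0_integralZl_EFin ?K0 //; last 2 first.
  - by move=> s _; rewrite lee_fin; apply: sqr_mulr_ge0; exact: sqr_ge0.
  - apply/measurable_EFinP; apply: measurable_funM; first by apply: measurable_funX; exact: cmfun_nc.
    by apply: (measurableT_comp mg); apply: measurable_funB => //; exact: measurable_cst.
  rewrite -ge0_integralZl_EFin ?sqr_ge0 //; last 2 first.
  - by move=> s _; rewrite lee_fin (hh0 (t, s)).
  - by apply/measurable_EFinP; exact: (measurable_slice1 t mh).
  under eq_integral do rewrite -EFinM.
  under [leRHS]eq_integral do rewrite -EFinM.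
  apply: le_int => [||s|s].
  - apply: measurable_funM => //; apply: measurable_funM; first by apply: measurable_funX; exact: cmfun_nc.
    by apply: (measurableT_comp mg); apply: measurable_funB => //; exact: measurable_cst.
  - by apply: measurable_funM => //; exact: (measurable_slice1 t mh).
  - by apply: mulr_ge0 => //; apply: sqr_mulr_ge0; exact: sqr_ge0.
  rewrite [leRHS]mulrCA ler_wpM2l // [leRHS]mulrA ler_wpM2r ?sqr_ge0 // nc_boolM /H /bR.
  case: (boolP (0 < s < pi)) => [/andP[s0 _]|_]; last by rewrite !mul0r expr0n mulr0.
  by rewrite !mul1r (Q_bound (ltW s0)).1.
have [|||||||X hX XS] := @sum_CS R r (fun k t => nc (zeta k t)) K K K pi _ mz mK mK mK _ _ _ _ _ _ _ hG.
- by move=> k t; exact: nc_ge0.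
- exact: K0.
- exact: K0.
- exact: K0.
- by move=> t; rewrite expr2.
- exact: pi_ge0.
- by rewrite integral_bR_pi.
by exists X.
Qed.

End second_order.

(** * The eigenvalue equation and its quadratic term *)

Section remainder.
Context {R : realType}.
Local Notation mu := (@lebesgue_measure R).
Context (q M : R -> R[i]) (a b : R) (hl : l2_data q M a b).
Context (r : seq nat) (p : nat -> R[i]) (E : R) (hp : near_half r p E).
Context (v : nat -> R -> R[i]).
Context (hv : forall k, k \in r -> volterra_solution q M (p k) (v k)).
Local Notation T := (trig_const E).
Local Notation D := (2 * a + 2 * b).
Context (hk : forall k, k \in r -> k%:R / 4 <= nc (p k)).
Context (hD : forall k, k \in r -> D <= 3 / 4 * nc (p k)).
Local Notation beta := (beta q p v).
Local Notation cQ := (cQ q p).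
Local Notation C1 := (beta_c1 a b E).
Local Notation C2 := (beta_c2 b E).
Local Notation zeta := (zeta q M p).
Local Notation resid := (resid p v).
Local Notation sn := (sn p).

Let mq := ld_q hl.
Let mM := ld_M hl.
Let hd := l2_volterra hl.
Let a0 := ld_a0 hl.
Let b0 := ld_b0 hl.

Lemma trig_half k : (0 < k)%N ->
  ccos ((k%:R - 1 / 2)%:C * (pi : R)%:C) = 0 :> R[i] /\
  csin ((k%:R - 1 / 2)%:C * (pi : R)%:C) ^+ 2 = 1 :> R[i].
Proof.
move=> k0; rewrite -rmorphM ccos_real csin_real cos_half_int //; split => //.
by rewrite -rmorphXn sin2cos2 cos_half_int // expr0n subr0.
Qed.

Lemma nc_csin_half k : (0 < k)%N -> nc (csin ((k%:R - 1 / 2)%:C * (pi : R)%:C) : R[i]) = 1.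
Proof.
move=> /trig_half[_ h]; apply/eqP; rewrite -(@eqrXn2 _ 2) ?nc_ge0 //.
by rewrite -ncX h nc1 expr1n.
Qed.

Local Notation ep k := (p k - (k%:R - 1 / 2)%:C).

Lemma p_ep k : p k = (k%:R - 1 / 2)%:C + ep k.
Proof. by rewrite addrC subrK. Qed.

Lemma trig_p_pi k : k \in r ->
  ccos (p k * (pi : R)%:C) = - (csin ((k%:R - 1 / 2)%:C * (pi : R)%:C) * csin (ep k * (pi : R)%:C)) /\
  csin (p k * (pi : R)%:C) = csin ((k%:R - 1 / 2)%:C * (pi : R)%:C) * ccos (ep k * (pi : R)%:C).
Proof.
case: hp => _ _ hr /hr[k0 _ _]; have [c s] := trig_half k0.
have -> : p k * (pi : R)%:C = (k%:R - 1 / 2)%:C * (pi : R)%:C + ep k * (pi : R)%:C.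
  by rewrite -mulrDl -p_ep.
rewrite ccosD csinD c; split; first by rewrite mul0r sub0r.
by rewrite mul0r addr0.
Qed.

Lemma ep_pi_bound k : k \in r -> nc (ep k * (pi : R)%:C) <= pi * (E / k%:R) /\ nc (ep k * (pi : R)%:C) <= pi.
Proof.
case: hp => _ _ hr /hr[k0 h1 h2].
rewrite ncM nc_real (gtr0_norm (pi_gt0 R)) mulrC; split; first by rewrite ler_wpM2l ?pi_ge0.
by rewrite -[leRHS]mulr1 ler_wpM2l ?pi_ge0.
Qed.

Lemma cos_pi_bound k : k \in r -> nc (ccos (p k * (pi : R)%:C)) <= pi * expR pi * E / k%:R.
Proof.
move=> kr; have k0 : (0 < k)%N by case: hp => _ _ hr; case/hr: kr.
have [h1 h2] := ep_pi_bound kr.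
rewrite (trig_p_pi kr).1 ncN ncM nc_csin_half // mul1r.
apply: (le_trans (nc_csin_le _)).
have -> : pi * expR pi * E / k%:R = pi * (E / k%:R) * expR pi by ring.
by rewrite ler_pM ?nc_ge0 ?expR_ge0 // ler_expR.
Qed.

Definition qQ_term k : R[i] := cutI (fun t => ccos (p k * (pi - t)%:C) * (q t * cQ k t)) pi.

Lemma cmfun_ccos_pi k : cmfun (fun t : R => ccos (p k * (pi - t)%:C)).
Proof. exact: cmfun_ccosB. Qed.

Lemma ccos_pi_bound k (t : R) : k \in r -> 0 < t < pi -> nc (ccos (p k * (pi - t)%:C)) <= expR pi.
Proof. by move=> kr /andP[t0 tp]; apply: (trig_pi hp kr _).1; rewrite ger0_norm; lra. Qed.

Definition qQ (t : R) : R[i] := q t * cutI q t.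

Lemma qQ_facts : [/\ cmfun qQ, forall t : R, ~~ (0 < t < pi) -> qQ t = 0, L1 qQ,
  nc (cint qQ) <= 4 * a ^+ 2 & (\int[mu]_t (nc (qQ t) ^+ 2)%:E <= (4 * a ^+ 2 * a ^+ 2)%:E)%E].
Proof.
have mqQ : cmfun qQ by apply: cmfunM => //; exact: cmfun_cutI.
have sQ t : ~~ (0 < t < pi) -> qQ t = 0 by move=> /(ld_qsupp hl); rewrite /qQ => ->; rewrite mul0r.
have bQ t : nc (qQ t) <= 2 * a * nc (q t).
  rewrite /qQ ncM mulrC; have [/andP[t0 _]|/(ld_qsupp hl) ->] := boolP (0 < t < pi); last first.
    by rewrite nc0 !mulr0.
  by rewrite ler_wpM2r ?nc_ge0 // (Q_bound hl (ltW t0)).2.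
have a2 : 0 <= 2 * a by rewrite mulr_ge0.
have mnq := cmfun_nc mq.
have I1 : (\int[mu]_t (nc (qQ t))%:E <= (4 * a ^+ 2)%:E)%E.
  have -> : 4 * a ^+ 2 = 2 * a * (2 * a) by rewrite expr2; ring.
  rewrite EFinM; apply: (le_trans _ (lee_wpmul2l _ (vd_A hd))); last by rewrite lee_fin.
  rewrite -ge0_integralZl_EFin //; last 2 first.
  - by move=> t _; rewrite lee_fin nc_ge0.
  - by apply/measurable_EFinP.
  under [leRHS]eq_integral do rewrite -EFinM.
  apply: le_int => [||t|t]; [exact: cmfun_nc|by apply: measurable_funM|exact: nc_ge0|exact: bQ].
split => //.
- by split => //; exact: le_lt_trans I1 (ltry _).
- by rewrite -lee_fin; apply: le_trans I1; exact: nc_cint.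
rewrite EFinM; apply: (le_trans _ (lee_wpmul2l _ (ld_a hl))); last by rewrite lee_fin mulr_ge0 ?sqr_ge0.
rewrite -ge0_integralZl_EFin //; last 3 first.
- by move=> t _; rewrite lee_fin sqr_ge0.
- by apply/measurable_EFinP; exact: measurable_funX.
- by rewrite mulr_ge0 ?sqr_ge0.
under [leRHS]eq_integral do rewrite -EFinM.
apply: le_int => [||t|t].
- by apply: measurable_funX; exact: cmfun_nc.
- by apply: measurable_funM => //; exact: measurable_funX.
- exact: sqr_ge0.
have -> : 4 * a ^+ 2 * nc (q t) ^+ 2 = (2 * a * nc (q t)) ^+ 2 by rewrite !exprMn; ring.
by rewrite ler_pXn2r ?nnegrE ?nc_ge0 ?mulr_ge0 ?nc_ge0.
Qed.

(** Product formula for the two cosines. The first term is O(1/k) because cos(pi p_k) nearly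
    vanishes; the second is a Bessel integral with phase pi - 2t. *)
Lemma qQ_termE k : k \in r -> qQ_term k = 1 / 2 * (ccos (p k * (pi : R)%:C) * cint qQ) +
  1 / 2 * cint (fun t => qQ t * ccos (p k * (pi + (- 2)%:~R * t)%:C)).
Proof.
move=> kr; have [mqQ sQ LQ _ _] := qQ_facts.
have mc : cmfun (fun t : R => ccos (p k * (pi + (- 2)%:~R * t)%:C)).
  apply/cmfun_ccos/cmfunZ/cmfun_real; apply: measurable_funD; first exact: measurable_cst.
  by apply: measurable_funM => //; exact: measurable_cst.
have Lc : L1 (fun t => qQ t * ccos (p k * (pi + (- 2)%:~R * t)%:C)).
  apply: (L1_mul_bounded LQ sQ mc (c := expR pi)) => t /andP[t0 tp].
  apply: (trig_pi hp kr _).1; rewrite (_ : (- 2)%:~R = - 2 :> R) // ler_norml.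
  by apply/andP; split; lra.
have L2 := L1Z (1 / 2) (L1Z (ccos (p k * (pi : R)%:C)) LQ); have L3 := L1Z (1 / 2) Lc.
rewrite -(cintZ _ LQ) -(cintZ _ (L1Z _ LQ)) -(cintZ _ Lc) -(cintD L2 L3).
apply: eq_cint => t; have [tp|nt] := boolP (0 < t < pi); last first.
  by rewrite mul0r sQ // mul0r !mulr0 addr0.
rewrite /cQ tp /qQ.
have -> : p k * (pi + (- 2)%:~R * t)%:C = p k * (pi - t)%:C + - (p k * t%:C).
  by rewrite (_ : pi + (- 2)%:~R * t = (pi - t) - t) ?rmorphB /= ?mulrBr //; ring.
have -> : p k * (pi : R)%:C = p k * (pi - t)%:C + p k * t%:C.
  by rewrite -mulrDr -rmorphD /= subrK.
rewrite !ccosD ccosN csinN [true%:R * _]mul1r [true%:R * _]mul1r.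
by move: (csin _) (csin _) (ccos _) (ccos _) (q t) (cutI q t) => X Y Z W U V; field.
Qed.

Lemma qQ_term_sum : \sum_(k <- r) nc (qQ_term k) ^+ 2 <=
  4 * (2 * pi * expR pi * E * a ^+ 2) ^+ 2 + 2 * T * a ^+ 2 * a ^+ 2.
Proof.
have [mqQ sQ LQ iQ I2] := qQ_facts; have [ur E0 hr] := hp.
pose B k := cint (fun t => qQ t * ccos (p k * (pi + (- 2)%:~R * t)%:C)).
have T0 := ltW (trig_const_gt0 E).
have hB : \sum_(k <- r) nc (B k) ^+ 2 <= T * (4 * a ^+ 2 * a ^+ 2).
  have th2 : `|(- 2)%:~R| <= 2 :> R by rewrite normrN ger0_norm.
  have xa : `|pi : R| <= pi by rewrite gtr0_norm // pi_gt0.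
  have [hc _] := trig_bessel hp (th := - 2) isT th2 xa mqQ sQ.
  by rewrite -lee_fin EFinM; apply: (le_trans hc); rewrite lee_wpmul2l ?lee_fin.
pose c := 2 * pi * expR pi * E * a ^+ 2.
have step k : k \in r -> nc (qQ_term k) ^+ 2 <= 2 * c ^+ 2 * k%:R ^- 2 + 1 / 2 * nc (B k) ^+ 2.
  move=> kr; rewrite qQ_termE // -/(B k).
  have h1 : nc (1 / 2 * (ccos (p k * (pi : R)%:C) * cint qQ)) <= c * k%:R^-1.
    have -> : c * k%:R^-1 = 1 / 2 * ((pi * expR pi * E / k%:R) * (4 * a ^+ 2)) by rewrite /c; field; rewrite pnatr_eq0; case: (hr k kr) => [k0 _ _]; rewrite -lt0n.
    rewrite ncM (_ : nc (1 / 2) = 1 / 2); last by rewrite ncM ncV nc1 nc_nat.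
    by rewrite ler_wpM2l ?divr_ge0 // ncM ler_pM ?nc_ge0 // cos_pi_bound.
  have h2 : nc (1 / 2 * B k) = 1 / 2 * nc (B k) by rewrite !ncM ncV nc1 nc_nat.
  have h3 := ncD (1 / 2 * (ccos (p k * (pi : R)%:C) * cint qQ)) (1 / 2 * B k).
  have h4 := le_trans h3 (lerD h1 (lexx _)).
  have h5 : nc (1 / 2 * (ccos (p k * (pi : R)%:C) * cint qQ) + 1 / 2 * B k) ^+ 2 <= (c * k%:R^-1 + nc (1 / 2 * B k)) ^+ 2.
    by rewrite ler_pXn2r ?nnegrE ?nc_ge0 //; apply: le_trans h4; exact: nc_ge0.
  apply: (le_trans h5); apply: (le_trans (sqr_normD_le _ _)).
  rewrite h2 !exprMn exprVn; move: (nc (B k) ^+ 2) (_ ^- 2) (c ^+ 2) => x1 x2 x3.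
  by rewrite le_eqVlt; apply/orP; left; apply/eqP; field.
rewrite big_seq; apply: (le_trans (ler_sum _ step)); rewrite -big_seq sum_linear.
have s2 : \sum_(k <- r) (k%:R ^- 2 : R) <= 2 by apply: sum_inv_sqr => // k /hr[].
have c20 : 0 <= 2 * c ^+ 2 by apply: mulr_ge0; [exact: ler0n|exact: sqr_ge0].
have := ler_wpM2l c20 s2; move: hB; rewrite -/c.
move: (\sum_(k <- r) nc (B k) ^+ 2) (\sum_(k <- r) _) (c ^+ 2) (T) (a ^+ 2) => x1 x2 x3 x4 x5.
lra.
Qed.

(** This is the Q(rho) of the equation for - cos(pi rho). The factor p^2 compensates the size of
    [resid], so square summability has to come from oscillation. *)
Definition quadratic_term k : R[i] := p k ^+ 2 * cutI (fun t => ccos (p k * (pi - t)%:C) * voltV q M (resid k) t) pi.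

Lemma cQ_bound k (s : R) : k \in r -> nc (cQ k s) <= expR pi * (2 * a).
Proof.
move=> kr; rewrite nc_boolM /bR; case: (boolP (0 < s < pi)) => [/andP[s0 sp]|_]; last first.
  by rewrite mul0r mulr_ge0 ?expR_ge0 // mulr_ge0.
rewrite mul1r ncM ler_pM ?nc_ge0 //; last exact: (Q_bound hl (ltW s0)).2.
by apply: (trig_pi hp kr _).1; rewrite ger0_norm ltW.
Qed.

Lemma cQ_supp k (s : R) : ~~ (0 < s) -> cQ k s = 0.
Proof. by rewrite /cQ => /negPf ->; rewrite mul0r. Qed.

Definition resid_const k : R := 4 / nc (p k) ^+ 2 * D * expR pi.

Lemma resid_le_const k (s : R) : k \in r -> s < pi -> nc (resid k s) <= resid_const k.
Proof.
move=> kr sp; have P0 : 0 <= 4 / nc (p k) ^+ 2 * D.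
  by rewrite mulr_ge0 ?(D_ge0 hl) // divr_ge0 // exprn_ge0 // nc_ge0.
have [s0|s0] := boolP (0 < s); last first.
  by rewrite resid_supp // nc0 mulr_ge0 ?expR_ge0.
have sp' : 0 < s < pi by rewrite s0.
apply: (le_trans (resid_bound hl hp hv hk hD kr sp')); rewrite ler_wpM2l //.
by apply: (expR_Im_le hp) => //; rewrite !ltW.
Qed.

Lemma resid_const_ge0 k : 0 <= resid_const k.
Proof. by rewrite mulr_ge0 ?expR_ge0 // mulr_ge0 ?(D_ge0 hl) // divr_ge0 // exprn_ge0 // nc_ge0. Qed.

Lemma voltV_beta k (t : R) : k \in r -> t < pi ->
  voltV q M (beta k) t = p k ^+ 2 * voltV q M (resid k) t + 1 / 2 * (q t * cQ k t + zeta k t).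
Proof.
move=> kr tp; have mr := cmfun_resid hv kr; have p0 : p k != 0 by rewrite -nc_gt0 (p_gt0 hp hk).
have -> : beta k = fun s => p k ^+ 2 * resid k s + 1 / 2 * cQ k s.
  apply/funext => s; rewrite /beta /resid /cQ /sn /cutJ; case: (0 < s < pi).
    rewrite ![true%:R * _]mul1r; move: (cutI _ _) (cutI _ _) (csin _) (ccos _) => X Y Z W.
    by field.
  by rewrite !mul0r !mulr0 subr0 mulr0 addr0.
rewrite (@V_linear R q M _ _ hd _ _ _ _ (resid_const k) (expR pi * (2 * a))) //.
- exact: (cmfun_cQ hl).
- exact: resid_supp.
- exact: cQ_supp.
- by move=> s /andP[s0 st]; apply: resid_le_const => //; exact: lt_trans tp.
- by move=> s _; exact: cQ_bound.
Qed.

Lemma L1on_resid k (x : R) : k \in r -> x <= pi -> L1on x (voltV q M (resid k)).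
Proof.
move=> kr xp; apply: (L1on_volt hl (cmfun_resid hv kr) xp _ (resid_const_ge0 k)).
  exact: resid_supp.
by move=> s /andP[_ sx]; apply: resid_le_const => //; exact: lt_le_trans xp.
Qed.

Lemma L1on_cQ k (x : R) : k \in r -> x <= pi -> L1on x (voltV q M (cQ k)).
Proof.
move=> kr xp; have c0 : 0 <= expR pi * (2 * a) by rewrite mulr_ge0 ?expR_ge0 // mulr_ge0.
apply: (L1on_volt hl (cmfun_cQ hl p k) xp (@cQ_supp k) c0) => s _; exact: cQ_bound.
Qed.

(** Substitute p^2 [resid] = [beta] - [cQ] / 2. The first part is summable by [beta_sum]; the second
    is explicit, and Bessel applies to its q part and to its convolution part separately. *)
Lemma quadratic_term_decomp k : k \in r ->
  quadratic_term k = cutI (fun t => ccos (p k * (pi - t)%:C) * voltV q M (beta k) t) pi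
    - 1 / 2 * (qQ_term k + cutI (fun t => ccos (p k * (pi - t)%:C) * zeta k t) pi).
Proof.
move=> kr; have mc := cmfun_ccos_pi k.
have cb (t : R) : 0 < t < pi -> nc (ccos (p k * (pi - t)%:C)) <= expR pi by exact: ccos_pi_bound.
have l1 := L1onM mc cb (L1on_resid kr (lexx _)).
have l2 := L1onM mc cb (L1on_cQ kr (lexx _)).
have lqQ : L1on pi (fun t => q t * cQ k t).
  have lq := L1on_q hl (pi : R).
  have c0 : 0 <= expR pi * (2 * a) by rewrite mulr_ge0 ?expR_ge0 // mulr_ge0.
  have := L1onM (cmfun_cQ hl p k) (fun t _ => cQ_bound t kr) lq.
  by rewrite (_ : (fun t => cQ k t * q t) = fun t => q t * cQ k t) //; apply/funext => t; rewrite mulrC.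
have l3 := L1onM mc cb lqQ.
have lz : L1on pi (zeta k).
  have [h _] := cutIB (L1on_cQ kr (lexx _)) lqQ.
  rewrite (_ : zeta k = fun t => voltV q M (cQ k) t - q t * cQ k t) //.
  by apply/funext => t; rewrite /voltV addrC addKr.
have l4 := L1onM mc cb lz.
have [l5 e5] := cutID l3 l4; have [l6 e6] := cutIZ (1 / 2) l5; have [l7 e7] := cutIZ (p k ^+ 2) l1.
have -> : cutI (fun t => ccos (p k * (pi - t)%:C) * voltV q M (beta k) t) pi = quadratic_term k +
   1 / 2 * (qQ_term k + cutI (fun t => ccos (p k * (pi - t)%:C) * zeta k t) pi).
  rewrite /quadratic_term /qQ_term -e5 -e6 -e7 -(cutID l7 l6).2; apply: eq_cutI => t /andP[t0 tp].
  rewrite voltV_beta //.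
  by move: (ccos _) (voltV _ _ _ _) (cQ k t) (zeta k t) => X Y Z W; ring.
by rewrite addrK.
Qed.

Definition quadratic_const : R := 4 * (expR pi ^+ 2 * (a ^+ 2 * (C1 * pi + C2 * pi)) +
  expR pi ^+ 2 * (2 * b * (C1 * (2 * b) + C2 * (2 * b))) +
  expR pi ^+ 2 * (pi * (T * a ^+ 2 * b ^+ 2)) +
  (4 * (2 * pi * expR pi * E * a ^+ 2) ^+ 2 + 2 * T * a ^+ 2 * a ^+ 2)).

Lemma sqr_norm4_le (x y z w : R) : (x + y + z + w) ^+ 2 <= 4 * (x ^+ 2 + y ^+ 2 + z ^+ 2 + w ^+ 2).
Proof.
have h1 := sqr_ge0 (x - y); have h2 := sqr_ge0 (y - z); have h3 := sqr_ge0 (x - z).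
have h4 := sqr_ge0 (x - w); have h5 := sqr_ge0 (y - w); have h6 := sqr_ge0 (z - w).
by move: h1 h2 h3 h4 h5 h6; rewrite !expr2; lra.
Qed.

Lemma quadratic_term_sum : \sum_(k <- r) nc (quadratic_term k) ^+ 2 <= quadratic_const.
Proof.
have [X hX XS] := q_beta hl hp hv hk hD; have [Y hY YS] := kernel_mass_beta hl hp hv hk hD.
have [Z hZ ZS] := zeta_sum hl hp.
have e0 : 0 <= expR pi :> R := expR_ge0 _.
have step k : k \in r -> nc (quadratic_term k) ^+ 2 <= 4 * (expR pi ^+ 2 * X k ^+ 2 + expR pi ^+ 2 * Y k ^+ 2
    + expR pi ^+ 2 * Z k ^+ 2 + nc (qQ_term k) ^+ 2).
  move=> kr; have [X0 X1] := hX k kr; have [Y0 Y1] := hY k kr; have [Z0 Z1] := hZ k kr.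
  have h1 := cos_volt_beta hl hp hv kr X1 Y1.
  have h2 : nc (cutI (fun t => ccos (p k * (pi - t)%:C) * zeta k t) pi) <= expR pi * Z k.
    have mz := cmfun_zeta hl p k.
    rewrite -lee_fin; apply: (le_trans (nc_cint _)).
      by apply: cmfunM; [exact: cmfun_itv|apply: cmfunM => //; exact: cmfun_ccos_pi].
    rewrite EFinM; apply: (le_trans _ (lee_wpmul2l _ Z1)); last by rewrite lee_fin.
    rewrite -ge0_integralZl_EFin //; last 2 first.
    - by move=> t _; rewrite lee_fin mulr_ge0 ?bR_ge0 ?nc_ge0.
    - apply/measurable_EFinP; apply: measurable_funM; last exact: cmfun_nc.
      exact: (measurable_bR (measurable_itvb 0 pi)).
    under [leRHS]eq_integral do rewrite -EFinM.
    apply: le_int => [||t|t].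
    - apply/cmfun_nc/cmfunM; first exact: cmfun_itv.
      by apply: cmfunM => //; exact: cmfun_ccos_pi.
    - apply: measurable_funM => //; apply: measurable_funM; last exact: cmfun_nc.
      exact: (measurable_bR (measurable_itvb 0 pi)).
    - exact: nc_ge0.
    rewrite nc_boolM ncM [leRHS]mulrCA /bR; case: (boolP (0 < t < pi)) => [tp|_]; last by rewrite !mul0r.
    by rewrite !mul1r ler_wpM2r ?nc_ge0 // ccos_pi_bound.
  rewrite quadratic_term_decomp //.
  move: (cutI _ _) (cutI _ _) h1 h2 => V U h1 h2.
  have n1 : nc (U - 1 / 2 * (qQ_term k + V)) <= expR pi * X k + expR pi * Y k + expR pi * Z k + nc (qQ_term k).
    apply: (le_trans (ncB _ _)); rewrite ncM (_ : nc (1 / 2) = 1 / 2); last by rewrite ncM ncV nc1 nc_nat.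
    have := ncD (qQ_term k) V; have := nc_ge0 (qQ_term k); have := nc_ge0 V; move: h1 h2.
    by move: (nc _) (nc _) (nc _) (nc _) => y1 y2 y3 y4; lra.
  have n2 : nc (U - 1 / 2 * (qQ_term k + V)) ^+ 2 <= (expR pi * X k + expR pi * Y k + expR pi * Z k + nc (qQ_term k)) ^+ 2.
    by rewrite ler_pXn2r ?nnegrE ?nc_ge0 //; apply: le_trans n1; exact: nc_ge0.
  apply: (le_trans n2); apply: (le_trans (sqr_norm4_le _ _ _ _)).
  by rewrite !exprMn.
rewrite big_seq; apply: (le_trans (ler_sum _ step)); rewrite -big_seq -mulr_sumr /quadratic_const ler_wpM2l //.
rewrite !big_split -!mulr_sumr; apply: lerD; last exact: qQ_term_sum.
have e2 : 0 <= expR pi ^+ 2 :> R := sqr_ge0 _.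
by apply: lerD; [apply: lerD|]; rewrite ler_wpM2l.
Qed.

Definition first_iterate k : R[i] := cutI (fun t => ccos (p k * (pi - t)%:C) * voltV q M (sn k) t) pi.

(** The first formula of [volterra_trig] at x = pi, with S split into sin(p s) / p and [resid]. *)
Lemma eigen_eq k : k \in r -> v k pi = 0 ->
  - ccos (p k * (pi : R)%:C) = (p k)^-1 * first_iterate k + p k ^- 2 * quadratic_term k.
Proof.
move=> kr v0; have [mv [C vC] vE] := hv kr; have mc := cmfun_ccos_pi k.
have cb (t : R) : 0 < t < pi -> nc (ccos (p k * (pi - t)%:C)) <= expR pi by exact: ccos_pi_bound.
have l1 := L1onM mc cb (L1on_resid kr (lexx _)).
have lsn : L1on pi (voltV q M (sn k)).
  have sn0 s : ~~ (0 < s) -> sn k s = 0 by move=> /negPf s0; rewrite /sn s0 mul0r.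
  by apply: (L1on_volt hl (cmfun_sn p k) (lexx _) sn0 (expR_ge0 pi)) => s _; exact: (sn_bound hp).
have l2 := L1onM mc cb lsn; have [l3 e3] := cutIZ (p k)^-1 l2; have [_ e4] := cutID l3 l1.
have [tr _] := volterra_trig hd mv vC vE (x := pi) (ltac:(by rewrite pi_gt0 lexx)).
have p0 : p k != 0 by rewrite -nc_gt0 (p_gt0 hp hk).
have e5 : cutI (fun t => ccos (p k * (pi - t)%:C) * voltV q M (cutJ (v k)) t) pi =
    (p k)^-1 * first_iterate k + p k ^- 2 * quadratic_term k.
  have -> : p k ^- 2 * quadratic_term k = cutI (fun t => ccos (p k * (pi - t)%:C) * voltV q M (resid k) t) pi.
    by rewrite /quadratic_term; move: (cutI _ _) => X; rewrite mulKf // expf_neq0.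
  rewrite /first_iterate -e3 -e4; apply: eq_cutI => t /andP[t0 tp].
  rewrite (voltV_split hl hp hv hk hD kr tp).
  by move: (ccos _) (voltV _ _ _ _) (voltV _ _ _ _) (_^-1) => X Y Z W; ring.
rewrite -e5; move: tr; rewrite v0; move: (cutI _ _) (ccos _) => X Y /eqP.
by rewrite eq_sym addrC addr_eq0 => /eqP ->.
Qed.

End remainder.

(** * The first-order term *)

Section first_order.
Context {R : realType}.
Local Notation mu := (@lebesgue_measure R).
Context (q M : R -> R[i]) (a b : R) (hl : l2_data q M a b).
Implicit Types rho : R[i].

Let mq := ld_q hl.
Let mM := ld_M hl.
Let hd := l2_volterra hl.

(** This is the E(rho) of the equation for - cos(pi rho). The product of M with pi - u is M_0 on (0,
    pi), so the last integral is not singular. *)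
Definition linear_term rho : R[i] := csin (rho * (pi : R)%:C) * cint q
  + cint (fun t => q t * csin (rho * (2 * t - pi)%:C))
  + cint (fun u => M u * (pi - u)%:C * csin (rho * (pi - u)%:C)).

Lemma trig_norm_bound rho (y : R) : `|y| <= pi ->
  nc (ccos (rho * y%:C)) <= expR (nc rho * pi) /\ nc (csin (rho * y%:C)) <= expR (nc rho * pi).
Proof.
move=> yp; have h : `|complex.Im (rho * y%:C)| <= nc rho * pi.
  by rewrite Im_mulr_real normrM ler_pM // nc_Im.
by split; [apply: (le_trans (nc_ccos _))|apply: (le_trans (nc_csin _))]; rewrite ler_expR.
Qed.

Lemma ccos_csin (x y : R[i]) : 2 * (ccos x * csin y) = csin (x + y) - csin (x - y).
Proof. by rewrite !csinD csinN ccosN; ring. Qed.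

(** The reflection t -> pi + u - t preserves the interval (u, pi) and changes the sign of the
    integrand. *)
Lemma cint_sin_antisym rho (u : R) : cint (fun t => (u < t < pi)%R%:R * csin (rho * (pi + u - 2 * t)%:C)) = 0.
Proof.
pose f (t : R) := (u < t < pi)%R%:R * csin (rho * (pi + u - 2 * t)%:C).
have mf : cmfun f.
  apply: cmfunM; first exact: cmfun_itv.
  apply/cmfun_csin/cmfunZ/cmfun_real; apply: measurable_funB; first exact: measurable_cst.
  by apply: measurable_funM => //; exact: measurable_cst.
have h := cint_refl (pi + u) mf; rewrite -/f.
have e : (fun t => f (pi + u - t)) = (fun t => (- 1) * f t).
  apply/funext => t; rewrite /f (_ : (u < pi + u - t < pi) = (u < t < pi)).
    have -> : rho * (pi + u - 2 * (pi + u - t))%:C = - (rho * (pi + u - 2 * t)%:C).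
      by rewrite (_ : pi + u - 2 * (pi + u - t) = - (pi + u - 2 * t)); [rewrite rmorphN mulrN|ring].
    by rewrite csinN; ring.
  by apply/andP/andP => -[h1 h2]; split; lra.
have Lf : L1 f.
  split => //; apply: (@le_lt_trans _ _ (\int[mu]_t (bR (u < t < pi) * expR (nc rho * `|pi - u|))%:E)%E).
    apply: le_int => [||t|t].
    - exact: cmfun_nc.
    - by apply: measurable_funM; [exact: (measurable_bR (measurable_itvb u pi))|exact: measurable_cst].
    - exact: nc_ge0.
    rewrite /f nc_boolM /bR; case: (boolP (u < t < pi)) => [/andP[t0 t1]|_]; last by rewrite !mul0r.
    rewrite !mul1r; apply: (le_trans (nc_csin _)); rewrite ler_expR Im_mulr_real normrM.
    by rewrite ler_pM ?nc_Im // [`|pi - u|]ger0_norm ?ler_norml; [apply/andP; split; lra|lra].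
  have [up|pu] := leP u pi.
    apply: (le_lt_trans (integral_bR_le (measurable_cst _) (fun=> expR_ge0 _) (expR_ge0 _) up (fun _ _ => lexx _))).
    exact: ltry.
  rewrite integral0_eq ?ltry // => t _; rewrite /bR; case: (boolP (u < t < pi)) => [/andP[t0 t1]|_]; last by rewrite mul0r.
  by have := lt_trans (lt_trans t0 t1) pu; rewrite ltxx.
move: h; rewrite e cintZ // mulN1r => h.
have : cint f + cint f = 0 by rewrite -{1}h addNr.
by move=> /eqP; rewrite -mulr2n mulrn_eq0 /= => /eqP.
Qed.

(** Twice the product is sin(rho (pi - u)) minus a term odd about the midpoint of (u, pi). The
    length pi - u of the interval is the factor that removes the singularity of the kernel. *)
Lemma cint_cos_sin rho (u : R) : 0 < u < pi ->
  2 * cint (fun t => (u < t < pi)%R%:R * (ccos (rho * (pi - t)%:C) * csin (rho * (t - u)%:C))) =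
  (pi - u)%:C * csin (rho * (pi - u)%:C).
Proof.
move=> /andP[u0 up].
have mi := @cmfun_itv R u pi.
have msn : cmfun (fun t : R => csin (rho * (t - u)%:C)).
  by apply/cmfun_csin/cmfunZ/cmfun_real; apply: measurable_funB => //; exact: measurable_cst.
have mp : cmfun (fun t : R => csin (rho * (pi + u - 2 * t)%:C)).
  apply/cmfun_csin/cmfunZ/cmfun_real; apply: measurable_funB; first exact: measurable_cst.
  by apply: measurable_funM => //; exact: measurable_cst.
pose K := expR (nc rho * pi).
have LI (g : R -> R[i]) (c : R) : cmfun g -> (forall t : R, u < t < pi -> nc (g t) <= c) ->
    L1 (fun t => (u < t < pi)%R%:R * g t).
  move=> mg gc; apply: (@L1_le _ _ (fun t => (0 < t < pi)%R%:R * c%:C)).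
  - by apply: cmfunM.
  - apply: (@L1on_bounded R (fun=> c%:C) `|c|); first exact: cmfun_cst.
    by move=> t _; rewrite nc_real.
  - move=> t; rewrite !nc_boolM nc_real /bR; case: (boolP (u < t < pi)) => [/[dup] ut /andP[t0 t1]|_].
      by rewrite (lt_trans u0 t0) t1 !mul1r (le_trans (gc _ ut)) // ler_norm.
    by rewrite mul0r mulr_ge0 ?ler0n.
have L1' : L1 (fun t => (u < t < pi)%R%:R * (ccos (rho * (pi - t)%:C) * csin (rho * (t - u)%:C))).
  apply: (LI _ (K * K)); first by apply: cmfunM => //; exact: cmfun_ccosB.
  move=> t /andP[t0 t1]; rewrite ncM ler_pM ?nc_ge0 //.
    by apply: (trig_norm_bound rho _).1; rewrite ger0_norm; lra.
  by apply: (trig_norm_bound rho _).2; rewrite ger0_norm; lra.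
have L2 : L1 (fun t => (u < t < pi)%R%:R * csin (rho * (pi - u)%:C)).
  by apply: (LI _ (nc (csin (rho * (pi - u)%:C)))) => [|t _]; [exact: cmfun_cst|exact: lexx].
have L3 : L1 (fun t => (u < t < pi)%R%:R * csin (rho * (pi + u - 2 * t)%:C)).
  apply: (LI _ K) => // t /andP[t0 t1]; apply: (trig_norm_bound rho _).2.
  by rewrite ler_norml; apply/andP; split; lra.
rewrite -cintZ //.
transitivity (cint (fun t => (u < t < pi)%R%:R * csin (rho * (pi - u)%:C) -
    (u < t < pi)%R%:R * csin (rho * (pi + u - 2 * t)%:C))).
  apply: eq_cint => t; rewrite mulrCA ccos_csin.
  have -> : rho * (pi - t)%:C + rho * (t - u)%:C = rho * (pi - u)%:C.
    by rewrite -mulrDr -rmorphD; congr (_ * _%:C); ring.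
  have -> : rho * (pi - t)%:C - rho * (t - u)%:C = rho * (pi + u - 2 * t)%:C.
    by rewrite -mulrBr -rmorphB; congr (_ * _%:C); ring.
  by rewrite mulrBr.
rewrite cintB // cint_sin_antisym subr0.
have L4 : L1 (fun t : R => (u < t < pi)%R%:R : R[i]).
  have := LI (fun=> 1) 1 (cmfun_cst 1) (fun t _ => ltac:(by rewrite nc1)).
  by rewrite (_ : (fun t : R => _) = fun t : R => (u < t < pi)%R%:R : R[i]) //; apply/funext => t; rewrite mulr1.
transitivity (cint (fun t => csin (rho * (pi - u)%:C) * (u < t < pi)%R%:R)).
  by apply: eq_cint => t; rewrite mulrC.
by rewrite cintZ // cint_itv ?(ltW up) // mulrC.
Qed.

(** The q part is a product formula under the integral. In the M part the convolution is written as
    an integral over u of M(u) and exchanged with the integral over t; the inner integral is then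
    [cint_cos_sin]. *)
Lemma first_iterateE (p : nat -> R[i]) k : 2 * first_iterate q M p k = linear_term (p k).
Proof.
pose rho := p k; pose K := expR (nc rho * pi).
have K0 : 0 <= K by exact: expR_ge0.
have mc : cmfun (fun t : R => ccos (rho * (pi - t)%:C)) by exact: cmfun_ccosB.
have cb (t : R) : 0 < t < pi -> nc (ccos (rho * (pi - t)%:C)) <= K.
  by move=> /andP[t0 tp]; apply: (trig_norm_bound rho _).1; rewrite ger0_norm; lra.
have sb (s : R) : nc (sn p k s) <= K.
  rewrite nc_boolM /bR; case: (boolP (0 < s < pi)) => [/andP[s0 sp]|_]; last by rewrite mul0r.
  by rewrite mul1r; apply: (trig_norm_bound rho _).2; rewrite ger0_norm; lra.
have msn := cmfun_sn p k.
have sn0 s : ~~ (0 < s) -> sn p k s = 0 by move=> /negPf s0; rewrite /sn s0 mul0r.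
have lV : L1on pi (voltV q M (sn p k)).
  by apply: (L1on_volt hl msn (lexx _) sn0 K0) => s _; exact: sb.
have lq : L1 q by split => //; exact: le_lt_trans (vd_A hd) (ltry _).
have lqs : L1on pi (fun t => q t * sn p k t).
  have := L1onM msn (fun t _ => sb t) (L1on_q hl pi).
  by rewrite (_ : (fun t => sn p k t * q t) = fun t => q t * sn p k t) //; apply/funext => t; rewrite mulrC.
have leta : L1on pi (conv_sin M p k).
  have [h _] := cutIB lV lqs.
  rewrite (_ : conv_sin M p k = fun t => voltV q M (sn p k) t - q t * sn p k t) //.
  by apply/funext => t; rewrite /voltV addrC addKr.
have l1 := L1onM mc cb lqs; have l2 := L1onM mc cb leta.
have -> : first_iterate q M p k = cutI (fun t => ccos (rho * (pi - t)%:C) * (q t * sn p k t)) pi +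
    cutI (fun t => ccos (rho * (pi - t)%:C) * conv_sin M p k t) pi.
  rewrite -(cutID l1 l2).2; apply: eq_cutI => t _; rewrite /voltV -/(conv_sin M p k t).
  by move: (ccos _) (conv_sin _ _ _ _) => X Y; ring.
rewrite mulrDr; congr (_ + _).
  have ms2 : cmfun (fun t : R => csin (rho * (2 * t - pi)%:C)).
    apply/cmfun_csin/cmfunZ/cmfun_real; apply: measurable_funB; last exact: measurable_cst.
    by apply: measurable_funM => //; exact: measurable_cst.
  have L2 : L1 (fun t => q t * csin (rho * (2 * t - pi)%:C)).
    apply: (L1_mul_bounded lq (ld_qsupp hl) ms2 (c := K)) => t /andP[t0 tp].
    by apply: (trig_norm_bound rho _).2; rewrite ler_norml; apply/andP; split; lra.
  rewrite -(cutIZ 2 l1).2 -(cintZ _ lq) -(cintD (L1Z _ lq) L2); apply: eq_cint => t.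
  have [tp|/[dup] ntp /(ld_qsupp hl) ->] := boolP (0 < t < pi); last by rewrite !(mul0r, mulr0) addr0.
  rewrite [true%:R * _]mul1r /sn tp [true%:R * _]mul1r.
  have -> : 2 * (ccos (rho * (pi - t)%:C) * (q t * csin (p k * t%:C))) =
    q t * (2 * (ccos (rho * (pi - t)%:C) * csin (rho * t%:C))).
    by rewrite -/rho; move: (ccos _) (csin _) => X Y; ring.
  rewrite ccos_csin.
  have -> : rho * (pi - t)%:C + rho * t%:C = rho * (pi : R)%:C by rewrite -mulrDr -rmorphD /= subrK.
  have -> : rho * (pi - t)%:C - rho * t%:C = - (rho * (2 * t - pi)%:C).
    by rewrite -mulrBr -rmorphB (_ : pi - t - t = - (2 * t - pi)); [rewrite rmorphN mulrN|ring].
  by rewrite csinN; move: (csin _) (csin _) => X Y; ring.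
pose H (z : R * R) : R[i] := ((0 < z.1 < pi)%R%:R * ccos (rho * (pi - z.1)%:C)) * (M z.2 * sn p k (z.1 - z.2)).
have mF : cmfun (fun t : R => (0 < t < pi)%R%:R * ccos (rho * (pi - t)%:C)).
  by apply: cmfunM => //; exact: cmfun_itv.
have mH : cmfun H.
  apply: cmfunM; first exact: (cmfun_comp measurable_fst mF).
  apply: cmfunM; first exact: (cmfun_comp measurable_snd mM).
  exact: (cmfun_comp measurable_sub2 msn).
have Mu_s t : cmfun (fun u : R => M u * sn p k (t - u)).
  apply: cmfunM => //; apply: (cmfun_comp _ msn); apply: measurable_funB => //; exact: measurable_cst.
(* Absolute convergence for Fubini: the cosine and the sine are at most K, and the rest is
   [conv_bound] after the reflection u -> t - u. *)
have fin : (\int[mu]_t \int[mu]_u (nc (H (t, u)))%:E < +oo)%E.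
  apply: (@le_lt_trans _ _ ((K * K)%:E * (2 * b)%:E)%E); last by rewrite -EFinM ltry.
  apply: (le_trans _ (lee_wpmul2l _ (conv_bound hd))); last by rewrite lee_fin mulr_ge0.
  have mT : measurable_fun setT (fun z : R * R => bR (z.1 < pi) * (bR (0 < z.2) * nc (M (z.1 - z.2)))).
    apply: measurable_funM; first exact: (measurableT_comp (measurable_bR (measurable_ltCr _)) measurable_fst).
    apply: measurable_funM; first exact: (measurableT_comp (measurable_bR (measurable_ltC _)) measurable_snd).
    exact: (measurableT_comp (cmfun_nc mM) measurable_sub2).
  have T0 (z : R * R) : 0 <= bR (z.1 < pi) * (bR (0 < z.2) * nc (M (z.1 - z.2))).
    by rewrite !mulr_ge0 ?bR_ge0 ?nc_ge0.
  rewrite -ge0_integralZl_EFin //; last 3 first.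
  - by move=> t _; apply: integral_ge0 => s _; rewrite lee_fin (T0 (t, s)).
  - exact: (measurable_int_param mT T0).
  - by rewrite mulr_ge0.
  apply: ge0_le_integral_T.
  - by apply: (measurable_int_param (h := fun z => nc (H z))); [exact: cmfun_nc|move=> z; exact: nc_ge0].
  - by apply: measurable_funeM; exact: (measurable_int_param mT T0).
  - by move=> t; apply: integral_ge0 => s _; rewrite lee_fin nc_ge0.
  move=> t; rewrite -(@integral_refl R (fun u => (nc (H (t, u)))%:E) t); last first.
    by apply/measurable_EFinP; exact: (measurable_slice1 t (cmfun_nc mH)).
  rewrite -ge0_integralZl_EFin //; last 3 first.
  - by move=> s _; rewrite lee_fin (T0 (t, s)).
  - by apply/measurable_EFinP; exact: (measurable_slice1 t mT).
  - by rewrite mulr_ge0.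
  under [leRHS]eq_integral do rewrite -EFinM.
  apply: le_int => [||s|s].
  - apply: (measurableT_comp (measurable_slice1 t (cmfun_nc mH))).
    by apply: measurable_funB => //; exact: measurable_cst.
  - by apply: measurable_funM => //; exact: (measurable_slice1 t mT).
  - exact: nc_ge0.
  rewrite /H /= subKr ncM [nc (M _ * _)]ncM.
  have h1 : nc ((0 < t < pi)%R%:R * ccos (rho * (pi - t)%:C)) <= bR (t < pi) * K.
    rewrite nc_boolM /bR; case: (boolP (0 < t < pi)) => [/[dup] tp /andP[_ ->]|_]; last first.
      by rewrite mul0r mulr_ge0 ?ler0n.
    by rewrite ler_wpM2l ?ler0n // cb.
  have h2 : nc (sn p k s) <= bR (0 < s) * K.
    rewrite /bR; have [s0|/sn0 ->] := boolP (0 < s); first by rewrite mul1r.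
    by rewrite nc0 mul0r.
  apply: (@le_trans _ _ ((bR (t < pi) * K) * (nc (M (t - s)) * (bR (0 < s) * K)))).
    by rewrite ler_pM ?mulr_ge0 ?nc_ge0 // ler_wpM2l ?nc_ge0.
  by rewrite le_eqVlt; apply/orP; left; apply/eqP; ring.
have -> : cutI (fun t => ccos (rho * (pi - t)%:C) * conv_sin M p k t) pi = cint (fun t => cint (fun u => H (t, u))).
  apply: eq_cint => t; rewrite /conv_sin.
  have -> : cint (fun s => M (t - s) * sn p k s) = cint (fun u => M u * sn p k (t - u)).
    by rewrite -[RHS](cint_refl t (Mu_s t)); apply: eq_cint => s; rewrite subKr.
  have [tp|/[dup] ntp /negPf e] := boolP (0 < t < pi); last first.
    by rewrite mul0r -[LHS]cint0; apply: eq_cint => u; rewrite /H /= e !mul0r.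
  have Lt : L1 (fun u => M u * sn p k (t - u)).
    have /andP[_ tp2] := tp.
    have := conv_L1 hd msn tp2 sn0 (fun s _ => sb s) => -[_ i1]; split; first exact: Mu_s.
    rewrite -(@integral_refl R (fun u => (nc (M u * sn p k (t - u)))%:E) t); last first.
      by apply/measurable_EFinP; exact: cmfun_nc.
    by under eq_integral do rewrite subKr.
  rewrite mulrA -cintZ //; apply: eq_cint => u; rewrite /H /= tp.
  by rewrite [true%:R * _]mul1r.
rewrite cfubini //.
have LM : L1 (fun u => M u * (pi - u)%:C).
  split; first by apply: cmfunM => //; apply: cmfun_real; exact: measurable_pi_sub.
  apply: le_lt_trans (ltry (2 * b)); apply: le_trans (vd_B hd).
  apply: le_int => [||u|u].
  - by apply/cmfun_nc/cmfunM => //; apply: cmfun_real; exact: measurable_pi_sub.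
  - by apply: measurable_funM; [exact: cmfun_nc|exact: measurable_pi_sub].
  - exact: nc_ge0.
  rewrite ncM nc_real; have [/andP[_ up]|/(ld_Msupp hl) ->] := boolP (0 < u < pi); last by rewrite nc0 !mul0r.
  by rewrite ger0_norm // subr_ge0 ltW.
have inner u : cint (fun t => H (t, u)) = 1 / 2 * (M u * (pi - u)%:C * csin (rho * (pi - u)%:C)).
  have [up|/(ld_Msupp hl) Mu] := boolP (0 < u < pi); last first.
    rewrite Mu !mul0r mulr0 -[RHS]cint0; apply: eq_cint => t; by rewrite /H /= Mu !(mul0r, mulr0).
  have /andP[u0 u1] := up.
  have mcs : cmfun (fun t => (u < t < pi)%R%:R * (ccos (rho * (pi - t)%:C) * csin (rho * (t - u)%:C))).
    apply: cmfunM; first exact: cmfun_itv.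
    apply: cmfunM => //.
    by apply/cmfun_csin/cmfunZ/cmfun_real; apply: measurable_funB => //; exact: measurable_cst.
  have Lcs : L1 (fun t => (u < t < pi)%R%:R * (ccos (rho * (pi - t)%:C) * csin (rho * (t - u)%:C))).
    apply: (@L1_le _ _ (fun t => (0 < t < pi)%R%:R * (K * K)%:C)) => //.
      apply: (@L1on_bounded R (fun=> (K * K)%:C) (K * K)); first exact: cmfun_cst.
      by move=> t _; rewrite nc_real ger0_norm // mulr_ge0.
    move=> t; rewrite !nc_boolM nc_real /bR; case: (boolP (u < t < pi)) => [/andP[t0 t1]|_]; last first.
      by rewrite mul0r mulr_ge0 ?ler0n.
    rewrite (lt_trans u0 t0) t1 !mul1r ncM ger0_norm ?mulr_ge0 // ler_pM ?nc_ge0 //.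
      by apply: cb; rewrite (lt_trans u0 t0).
    by apply: (trig_norm_bound rho _).2; rewrite ger0_norm; lra.
  transitivity (cint (fun t => M u * ((u < t < pi)%R%:R * (ccos (rho * (pi - t)%:C) * csin (rho * (t - u)%:C))))).
    apply: eq_cint => t; rewrite /H /= /sn -/rho.
    rewrite (_ : ((0 < t < pi)%R%:R : R[i]) * ccos (rho * (pi - t)%:C) * (M u * ((0 < t - u < pi)%R%:R * csin (rho * (t - u)%:C))) =
       ((0 < t < pi)%R%:R * (0 < t - u < pi)%R%:R) * (M u * (ccos (rho * (pi - t)%:C) * csin (rho * (t - u)%:C)))); last by ring.
    rewrite mulrCA; congr (_ * _); rewrite subr_gt0.
    have [ut|nut] := boolP (u < t); last by rewrite mulr0.
    rewrite (lt_trans u0 ut) /=; have [tp|_] := boolP (t < pi); last by rewrite mul0r.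
    by rewrite (_ : t - u < pi); [rewrite mulr1|lra].
  rewrite cintZ // -[M u * _ * _]mulrA -(cint_cos_sin rho up).
  by move: (cint _) (M u) => X Y; field.
have LE : L1 (fun u => M u * (pi - u)%:C * csin (rho * (pi - u)%:C)).
  apply: (L1_mul_bounded LM _ (c := K)) => [t /(ld_Msupp hl) ->||t /andP[t0 tp]]; first by rewrite mul0r.
    exact: cmfun_csinB.
  by apply: (trig_norm_bound rho _).2; rewrite ger0_norm; lra.
rewrite (_ : (fun u => cint _) = fun u => 1 / 2 * (M u * (pi - u)%:C * csin (rho * (pi - u)%:C))); last first.
  by apply/funext => u; exact: inner.
by rewrite cintZ //; move: (cint _) => X; field.
Qed.

End first_order.

(** * From the eigenvalue equation to the remainder *)

Section asymptotics.
Context {R : realType}.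
Local Notation mu := (@lebesgue_measure R).

(** The difference is symmetric about c, so it equals 2 cos(c y) sin(e y / 2) and the error against
    its linear part comes from sin w - w. That error is cubic in e; the weaker |e|^2 suffices. *)
Lemma csin_increment (c e : R[i]) (y : R) : nc e <= 1 -> `|y| <= pi -> nc (ccos (c * y%:C)) <= expR pi ->
  nc (csin ((c + e / 2) * y%:C) - csin ((c - e / 2) * y%:C) - e * y%:C * ccos (c * y%:C))
    <= pi ^+ 3 * expR (2 * pi) * nc e ^+ 2.
Proof.
move=> e1 yp hc; pose w := e / 2 * y%:C.
have -> : csin ((c + e / 2) * y%:C) - csin ((c - e / 2) * y%:C) - e * y%:C * ccos (c * y%:C) =
    2 * (ccos (c * y%:C) * (csin w - w)).
  rewrite mulrDl mulrBl -/w !csinD ccosN csinN.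
  have -> : e * y%:C = 2 * w by rewrite /w; field.
  by move: w (ccos _) (csin _) (ccos _) (csin _) => w X Y Z V; ring.
have e0 := nc_ge0 e; have p0 := pi_ge0 R.
have nw : nc w <= pi / 2 * nc e.
  by rewrite /w !ncM ncV nc_real nc_nat; have := ler_wpM2l e0 yp; lra.
have w1 : nc w <= pi by apply: (le_trans nw); have := ler_wpM2l p0 e1; lra.
have w3 : nc w ^+ 3 <= pi ^+ 3 / 8 * nc e ^+ 2.
  apply: (@le_trans _ _ ((pi / 2 * nc e) ^+ 3)).
    by rewrite ler_pXn2r ?nnegrE ?nc_ge0 // mulr_ge0 // divr_ge0.
  have -> : (pi / 2 * nc e) ^+ 3 = pi ^+ 3 / 8 * (nc e ^+ 2 * nc e) by field.
  rewrite ler_wpM2l ?divr_ge0 ?exprn_ge0 // -[leRHS]mulr1 ler_wpM2l ?exprn_ge0 //.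
rewrite ncM nc_nat (ncM (ccos _)).
have h := nc_csinB w.
have h2 : nc (csin w - w) <= pi ^+ 3 / 8 * nc e ^+ 2 * expR pi.
  by apply: (le_trans h); rewrite ler_pM ?exprn_ge0 ?nc_ge0 ?expR_ge0 // ler_expR.
have h3 := ler_pM (nc_ge0 _) (nc_ge0 _) hc h2.
have -> : expR (2 * pi) = expR pi * expR pi :> R by rewrite -expRD; congr expR; ring.
have X0 : 0 <= pi ^+ 3 * nc e ^+ 2 * (expR pi * expR pi).
  by rewrite !mulr_ge0 ?expR_ge0 ?exprn_ge0.
by move: h3 X0; move: (nc (ccos _)) (nc (_ - _)) (expR pi) (nc e ^+ 2) (pi ^+ 3) => x1 x2 x3 x4 x5; lra.
Qed.

Lemma sqr1_mulr (s x y : R[i]) : s ^+ 2 = 1 -> s * x = y -> x = s * y.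
Proof. by move=> s2 <-; rewrite mulrA -expr2 s2 mul1r. Qed.

Lemma sqr_scale4_le (x y z w c : R) : (x + 2 * c * y + 2 * c * z + 16 * w) ^+ 2 <=
  4 * (x ^+ 2 + 4 * c ^+ 2 * y ^+ 2 + 4 * c ^+ 2 * z ^+ 2 + 256 * w ^+ 2).
Proof. by apply: (le_trans (sqr_norm4_le _ _ _ _)); rewrite le_eqVlt; apply/orP; left; apply/eqP; ring. Qed.

Lemma half_le (x y : R) : x <= 4 / y -> 1 / 2 * x <= 2 / y.
Proof. by move: (y^-1) => z; lra. Qed.

Lemma sum_linear4 (r : seq nat) (u1 u2 u3 u4 : nat -> R) (x1 x2 x3 x4 : R) :
  \sum_(k <- r) (x1 * u1 k + x2 * u2 k + x3 * u3 k + x4 * u4 k) =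
  x1 * \sum_(k <- r) u1 k + x2 * \sum_(k <- r) u2 k + x3 * \sum_(k <- r) u3 k + x4 * \sum_(k <- r) u4 k.
Proof. by rewrite !big_split -!mulr_sumr. Qed.

Lemma ncB3 (x1 x2 x3 y1 y2 y3 : R[i]) :
  nc ((x1 + x2 + x3) - (y1 + y2 + y3)) <= nc (x1 - y1) + nc (x2 - y2) + nc (x3 - y3).
Proof.
have -> : (x1 + x2 + x3) - (y1 + y2 + y3) = (x1 - y1) + (x2 - y2) + (x3 - y3) by ring.
by apply: (le_trans (ncD _ _)); rewrite lerD2r ncD.
Qed.

Context (q M : R -> R[i]) (a b : R) (hl : l2_data q M a b).
Context (r : seq nat) (p : nat -> R[i]) (E : R) (hp : near_half r p E).
Local Notation T := (trig_const E).
Local Notation D := (2 * a + 2 * b).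
Local Notation r0 k := ((k%:R - 1 / 2)%:C : R[i]).
Local Notation ep k := (p k - r0 k).

Let mq := ld_q hl.
Let mM := ld_M hl.
Let hd := l2_volterra hl.
Let a0 := ld_a0 hl.
Let b0 := ld_b0 hl.

(** Midpoint of k - 1/2 and p k, where the increment of the sine is linearized; as it again
    satisfies [near_half], Bessel applies to the resulting cosines. *)
Definition midp k : R[i] := r0 k + ep k / 2.

Lemma near_half_mid : near_half r midp E.
Proof.
case: hp => ur E0 hr; split => // k /hr[k0 h1 h2].
have -> : midp k - r0 k = ep k / 2 by rewrite /midp addrAC subrr add0r.
have h3 : nc (ep k / 2) <= nc (ep k).
  by rewrite ncM ncV nc_nat; have := nc_ge0 (ep k); lra.
by split => //; exact: (le_trans h3).
Qed.

Lemma near_half_exact : near_half r (fun k => r0 k) E.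
Proof.
case: hp => ur E0 hr; split => // k /hr[k0 h1 h2]; rewrite subrr nc0; split => //.
by rewrite divr_ge0.
Qed.

(** Moving the frequency from p k to k - 1/2 costs E / k times a cosine integral that is square
    summable in k, plus O(k^-2). A bound by E / k alone would lose the summability of delta. *)
Lemma sin_shift (f : R -> R[i]) (g : R -> R) (B : R) k : k \in r -> L1 f ->
  (forall t : R, ~~ (0 < t < pi) -> f t = 0) -> measurable_fun setT g ->
  (forall t : R, 0 < t < pi -> `|g t| <= pi) -> (\int[mu]_t (nc (f t))%:E <= B%:E)%E ->
  nc (cint (fun t => f t * csin (p k * (g t)%:C)) - cint (fun t => f t * csin (r0 k * (g t)%:C))) <=
  E / k%:R * nc (cint (fun t => f t * (g t)%:C * ccos (midp k * (g t)%:C))) +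
    pi ^+ 3 * expR (2 * pi) * B * (E / k%:R) ^+ 2.
Proof.
move=> kr Lf fs mg gp fB; have [_ E0 hr] := hp; have [k0 e1 e2] := hr k kr.
have mf := Lf.1; have mgc : cmfun (fun t => (g t)%:C : R[i]) by exact: cmfun_real.
have ms c : cmfun (fun t => csin (c * (g t)%:C)) by apply/cmfun_csin/cmfunZ.
have mc c : cmfun (fun t => ccos (c * (g t)%:C)) by apply/cmfun_ccos/cmfunZ.
have Ls c : c = p k \/ c = r0 k -> L1 (fun t => f t * csin (c * (g t)%:C)).
  move=> hc; apply: (L1_mul_bounded Lf fs (ms c) (c := expR pi)) => t tp.
  by case: hc => ->; [exact: (trig_pi hp kr (gp _ tp)).2|exact: (trig_pi near_half_exact kr (gp _ tp)).2].
have L1p := Ls (p k) (or_introl erefl); have L1r := Ls (r0 k) (or_intror erefl).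
have Lg : L1 (fun t => f t * (g t)%:C).
  by apply: (L1_mul_bounded Lf fs mgc (c := pi)) => t tp; rewrite nc_real; exact: gp.
have Lc : L1 (fun t => f t * (g t)%:C * ccos (midp k * (g t)%:C)).
  apply: (L1_mul_bounded Lg _ (mc _) (c := expR pi)) => t; first by move=> /fs ->; rewrite mul0r.
  by move=> tp; exact: (trig_pi near_half_mid kr (gp _ tp)).1.
pose rem t := f t * (csin (p k * (g t)%:C) - csin (r0 k * (g t)%:C) - ep k * (g t)%:C * ccos (midp k * (g t)%:C)).
have mrem : cmfun rem.
  apply: (cmfunM mf); apply: cmfunB; first exact: (cmfunB (ms _) (ms _)).
  exact: (cmfunM (cmfunZ _ mgc) (mc _)).
have B0 : 0 <= B.
  by rewrite -lee_fin; apply: le_trans fB; apply: integral_ge0 => t _; rewrite lee_fin nc_ge0.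
pose c3 := pi ^+ 3 * expR (2 * pi) * (E / k%:R) ^+ 2.
have c30 : 0 <= c3 by rewrite /c3 !mulr_ge0 ?expR_ge0 ?exprn_ge0 ?pi_ge0 ?divr_ge0.
have rb t : nc (rem t) <= c3 * nc (f t).
  rewrite /rem ncM mulrC; case: (boolP (0 < t < pi)) => [tp|/fs ->]; last by rewrite nc0 !mulr0.
  rewrite ler_wpM2r ?nc_ge0 //.
  have := csin_increment e2 (gp _ tp) (trig_pi near_half_mid kr (gp _ tp)).1.
  have -> : midp k + ep k / 2 = p k by rewrite /midp; move: (p k) (r0 k) => X Y; field.
  have -> : midp k - ep k / 2 = r0 k by rewrite /midp; move: (p k) (r0 k) => X Y; field.
  move=> /le_trans; apply; rewrite /c3 ler_wpM2l ?mulr_ge0 ?expR_ge0 ?exprn_ge0 ?pi_ge0 //.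
  by rewrite ler_pXn2r ?nnegrE ?nc_ge0 ?divr_ge0.
have Lcf := L1Z (c3%:C) Lf.
have Lrem : L1 rem.
  by apply: (L1_le mrem Lcf) => t; rewrite (ncM c3%:C) nc_real ger0_norm.
have -> : cint (fun t => f t * csin (p k * (g t)%:C)) - cint (fun t => f t * csin (r0 k * (g t)%:C)) =
    ep k * cint (fun t => f t * (g t)%:C * ccos (midp k * (g t)%:C)) + cint rem.
  rewrite -(cintB L1p L1r) -(cintZ _ Lc) -(cintD (L1Z _ Lc) Lrem); apply: eq_cint => t.
  by rewrite /rem; move: (csin _) (csin _) (ccos _) => X Y Z; ring.
apply: (le_trans (ncD _ _)); apply: lerD.
  by rewrite ncM ler_wpM2r ?nc_ge0.
rewrite -lee_fin; apply: (le_trans (nc_cint mrem)).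
rewrite (_ : _ * _ * B * _ = c3 * B); last by rewrite /c3; ring.
rewrite EFinM; apply: (le_trans _ (lee_wpmul2l _ fB)); last by rewrite lee_fin.
rewrite -ge0_integralZl_EFin //; last 2 first.
- by move=> t _; rewrite lee_fin nc_ge0.
- by apply/measurable_EFinP; exact: cmfun_nc.
under [leRHS]eq_integral do rewrite -EFinM.
apply: le_int => [||t|t]; [exact: cmfun_nc| |exact: nc_ge0|exact: rb].
by apply: measurable_funM => //; exact: cmfun_nc.
Qed.

Definition shift_q k := cint (fun t => q t * (- pi + 2%:~R * t)%:C * ccos (midp k * (- pi + 2%:~R * t)%:C)).
Definition shift_M k := cint (fun u => M u * (pi - u)%:C * (pi + (- 1)%:~R * u)%:C * ccos (midp k * (pi + (- 1)%:~R * u)%:C)).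

Lemma L1_q : L1 q.
Proof. by split => //; exact: le_lt_trans (vd_A hd) (ltry _). Qed.

Lemma M_weight : [/\ L1 (fun u => M u * (pi - u)%:C), forall t : R, ~~ (0 < t < pi) -> M t * (pi - t)%:C = 0,
  (\int[mu]_u (nc (M u * (pi - u)%:C))%:E <= (2 * b)%:E)%E &
  (\int[mu]_u (nc (M u * (pi - u)%:C) ^+ 2)%:E <= (b ^+ 2)%:E)%E].
Proof.
have mMw : cmfun (fun u => M u * (pi - u)%:C).
  by apply: cmfunM => //; apply: cmfun_real; exact: measurable_pi_sub.
have e u : nc (M u * (pi - u)%:C) = nc (M u) * (pi - u).
  rewrite ncM nc_real; have [/andP[_ up]|/(ld_Msupp hl) ->] := boolP (0 < u < pi); last by rewrite nc0 !mul0r.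
  by rewrite ger0_norm // subr_ge0 ltW.
have h1 : (\int[mu]_u (nc (M u * (pi - u)%:C))%:E <= (2 * b)%:E)%E.
  by under eq_integral do rewrite e; exact: vd_B hd.
split => //.
- by split => //; exact: le_lt_trans h1 (ltry _).
- by move=> t /(ld_Msupp hl) ->; rewrite mul0r.
- by under eq_integral do rewrite e; exact: ld_b hl.
Qed.

Lemma phase_q (t : R) : 0 < t < pi -> `|- pi + 2%:~R * t| <= pi.
Proof. by move=> /andP[t0 tp]; rewrite (_ : 2%:~R = 2 :> R) // ler_norml; apply/andP; split; lra. Qed.

Lemma phase_M (t : R) : 0 < t < pi -> `|pi + (- 1)%:~R * t| <= pi.
Proof. by move=> /andP[t0 tp]; rewrite (_ : (- 1)%:~R = - 1 :> R) // ler_norml; apply/andP; split; lra. Qed.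

Lemma measurable_phase (y : R) (th : int) : measurable_fun setT (fun t : R => y + th%:~R * t).
Proof.
apply: measurable_funD; first exact: measurable_cst.
by apply: measurable_funM => //; exact: measurable_cst.
Qed.

Lemma phase_bessel (f : R -> R[i]) (th : int) (y c : R) : cmfun f ->
  (forall t : R, ~~ (0 < t < pi) -> f t = 0) -> th != 0 -> `|th%:~R| <= 2 :> R -> `|y| <= pi ->
  (forall t : R, 0 < t < pi -> `|y + th%:~R * t| <= pi) -> 0 <= c ->
  (\int[mu]_t (nc (f t) ^+ 2)%:E <= c%:E)%E ->
  \sum_(k <- r) nc (cint (fun t => f t * (y + th%:~R * t)%:C * ccos (midp k * (y + th%:~R * t)%:C))) ^+ 2
    <= T * (pi ^+ 2 * c).
Proof.
move=> mf fs th0 th2 yp gp c0 fc.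
have mg : cmfun (fun t => f t * (y + th%:~R * t)%:C).
  by apply: cmfunM => //; apply: cmfun_real; exact: measurable_phase.
have gs (t : R) : ~~ (0 < t < pi) -> f t * (y + th%:~R * t)%:C = 0 by move=> /fs ->; rewrite mul0r.
have [h _] := trig_bessel near_half_mid th0 th2 yp mg gs.
rewrite -lee_fin; apply: (le_trans h).
have T0 : (0 <= T%:E)%E by rewrite lee_fin ltW // trig_const_gt0.
rewrite [leRHS](EFinM T); apply: (lee_wpmul2l T0).
rewrite EFinM; apply: (le_trans _ (lee_wpmul2l _ fc)); last by rewrite lee_fin sqr_ge0.
rewrite -ge0_integralZl_EFin //; last 3 first.
- by move=> t _; rewrite lee_fin sqr_ge0.
- by apply/measurable_EFinP; apply: measurable_funX; exact: cmfun_nc.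
- exact: sqr_ge0.
under [leRHS]eq_integral do rewrite -EFinM.
apply: le_int => [||t|t].
- by apply: measurable_funX; exact: cmfun_nc.
- by apply: measurable_funM => //; apply: measurable_funX; exact: cmfun_nc.
- exact: sqr_ge0.
rewrite ncM nc_real exprMn mulrC; case: (boolP (0 < t < pi)) => [tp|/fs ->]; last first.
  by rewrite nc0 expr0n /= !mulr0.
by rewrite ler_wpM2r ?sqr_ge0 // ler_pXn2r ?nnegrE ?pi_ge0 // gp.
Qed.

Lemma shift_q_sum : \sum_(k <- r) nc (shift_q k) ^+ 2 <= T * (pi ^+ 2 * a ^+ 2).
Proof.
apply: phase_bessel => //.
- exact: ld_qsupp hl.
- by rewrite ger0_norm.
- by rewrite normrN gtr0_norm // pi_gt0.
- exact: phase_q.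
- exact: sqr_ge0.
- exact: ld_a hl.
Qed.

Lemma shift_M_sum : \sum_(k <- r) nc (shift_M k) ^+ 2 <= T * (pi ^+ 2 * b ^+ 2).
Proof.
have [[mw _] ws _ w2] := M_weight.
apply: phase_bessel => //.
- by rewrite normrN normr1; lra.
- by rewrite gtr0_norm // pi_gt0.
- exact: phase_M.
- exact: sqr_ge0.
Qed.

Lemma linear_termE (rho : R[i]) : linear_term q M rho = csin (rho * (pi : R)%:C) * cint q
  + cint (fun t => q t * csin (rho * (- pi + 2%:~R * t)%:C))
  + cint (fun u => M u * (pi - u)%:C * csin (rho * (pi + (- 1)%:~R * u)%:C)).
Proof.
have e1 : (fun t => q t * csin (rho * (2 * t - pi)%:C)) = fun t => q t * csin (rho * (- pi + 2%:~R * t)%:C).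
  by apply/funext => t; rewrite (_ : 2 * t - pi = - pi + 2%:~R * t) // addrC.
have e2 : (fun u => M u * (pi - u)%:C * csin (rho * (pi - u)%:C)) =
    fun u => M u * (pi - u)%:C * csin (rho * (pi + (- 1)%:~R * u)%:C).
  by apply/funext => t; rewrite (_ : (- 1)%:~R * t = - t) // mulN1r.
by rewrite /linear_term e1 e2.
Qed.

Definition linear_diff_const : R := (pi ^+ 2 * expR pi + pi ^+ 3 * expR (2 * pi)) * D.

Lemma nc_cint_q : nc (cint q) <= 2 * a.
Proof. by rewrite -lee_fin; apply: le_trans (vd_A hd); exact: nc_cint. Qed.

Lemma linear_term_diff k : k \in r -> nc (linear_term q M (p k) - linear_term q M (r0 k)) <=
  E / k%:R * (nc (shift_q k) + nc (shift_M k)) + linear_diff_const * (E / k%:R) ^+ 2.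
Proof.
move=> kr; have [log_weight ws w1 _] := M_weight; have [_ E0 hr] := hp; have [k0 e1 e2] := hr k kr.
have h1 := sin_shift kr L1_q (ld_qsupp hl) (measurable_phase (- pi) 2) phase_q (vd_A hd).
have h2 := sin_shift kr log_weight ws (measurable_phase pi (- 1)) phase_M w1.
have h3 : nc (csin (p k * (pi : R)%:C) * cint q - csin (r0 k * (pi : R)%:C) * cint q) <=
    pi ^+ 2 * expR pi * (E / k%:R) ^+ 2 * (2 * a).
  rewrite -mulrBl ncM ler_pM ?nc_ge0 ?nc_cint_q // (trig_p_pi hp kr).2.
  rewrite -[X in _ - X]mulr1 -mulrBr ncM nc_csin_half // mul1r.
  have [f1 f2] := ep_pi_bound hp kr.
  apply: (le_trans (nc_ccosB1 _)).
  have -> : pi ^+ 2 * expR pi * (E / k%:R) ^+ 2 = (pi * (E / k%:R)) ^+ 2 * expR pi by rewrite exprMn; ring.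
  rewrite ler_pM ?exprn_ge0 ?nc_ge0 ?expR_ge0 // ?ler_expR //.
  by rewrite ler_pXn2r ?nnegrE ?nc_ge0 // mulr_ge0 ?pi_ge0 ?divr_ge0.
rewrite !linear_termE; apply: (le_trans (ncB3 _ _ _ _ _ _)).
apply: (le_trans (lerD (lerD h3 h1) h2)); rewrite -/(shift_q k) -/(shift_M k) /linear_diff_const.
have h4 : 0 <= pi ^+ 2 * expR pi * (E / k%:R) ^+ 2 * (2 * b).
  by apply: mulr_ge0; [apply: mulr_ge0; [apply: mulr_ge0|]|apply: mulr_ge0] => //; rewrite ?sqr_ge0 ?expR_ge0.
by move: h4; move: (E / _) (nc _) (nc _) (expR _) (expR _) => x1 x2 x3 x4 x5 h4; rewrite -subr_ge0; apply: (le_trans h4); rewrite le_eqVlt; apply/orP; left; apply/eqP; ring.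
Qed.

Lemma linear_term_half_bound k : k \in r -> nc (linear_term q M (r0 k)) <= 2 * D.
Proof.
move=> kr; have [log_weight ws w1 _] := M_weight; have [_ E0 hr] := hp; have [k0 e1 e2] := hr k kr.
have sreal (y : R) : nc (csin (r0 k * y%:C)) <= 1.
  by rewrite -rmorphM csin_real nc_real ler_norml; apply/andP; split; [exact: sin_geN1|exact: sin_le1].
have ms (g : R -> R) : measurable_fun setT g -> cmfun (fun t => csin (r0 k * (g t)%:C)).
  by move=> mg; apply/cmfun_csin/cmfunZ/cmfun_real.
have bd (f : R -> R[i]) (g : R -> R) (B : R) : cmfun f -> measurable_fun setT g ->
    (\int[mu]_t (nc (f t))%:E <= B%:E)%E -> nc (cint (fun t => f t * csin (r0 k * (g t)%:C))) <= B.
  move=> mf mg fB; have mfs : cmfun (fun t => f t * csin (r0 k * (g t)%:C)) by apply: cmfunM => //; exact: ms.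
  rewrite -lee_fin; apply: (le_trans (nc_cint mfs)); apply: le_trans fB.
  apply: le_int => [||t|t]; [exact: cmfun_nc|exact: cmfun_nc|exact: nc_ge0|].
  by rewrite ncM -[leRHS]mulr1 ler_wpM2l ?nc_ge0.
have g1 := bd q _ _ mq (measurable_phase (- pi) 2) (vd_A hd).
have g2 := bd _ _ _ log_weight.1 (measurable_phase pi (- 1)) w1.
have g3 : nc (csin (r0 k * (pi : R)%:C) * cint q) <= 2 * a.
  by rewrite ncM nc_csin_half // mul1r nc_cint_q.
rewrite linear_termE; apply: (le_trans (ncD _ _)); have g4 := ncD (csin (r0 k * (pi : R)%:C) * cint q)
  (cint (fun t => q t * csin (r0 k * (- pi + 2%:~R * t)%:C))).
apply: (le_trans (lerD (le_trans g4 (lerD g3 g1)) g2)).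
rewrite -subr_ge0 (_ : _ - _ = 2 * b); last by ring.
by rewrite mulr_ge0.
Qed.

Context (v : nat -> R -> R[i]).
Context (hv : forall k, k \in r -> volterra_solution q M (p k) (v k)).
Context (hk : forall k, k \in r -> k%:R / 4 <= nc (p k)).
Context (hD : forall k, k \in r -> D <= 3 / 4 * nc (p k)).
Context (v0 : forall k, k \in r -> v k pi = 0).
Local Notation sg k := (csin (r0 k * (pi : R)%:C)).

(** An exact identity: [eigen_eq] multiplied by the sign sin(pi (k - 1/2)), whose square is 1,
    expresses sin(pi ep). The right-hand side collects the replacement of sin(pi ep) by pi ep, of p
    by k - 1/2 in the numerator and in the denominator, and the quadratic term. *)
Lemma expansion k : k \in r ->
  (pi : R)%:C * ep k - sg k * linear_term q M (r0 k) / (2 * r0 k) =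
  (ep k * (pi : R)%:C - csin (ep k * (pi : R)%:C)) +
  sg k * ((linear_term q M (p k) - linear_term q M (r0 k)) / (2 * p k) - linear_term q M (r0 k) * ep k / (2 * p k * r0 k) + p k ^- 2 * quadratic_term q M p v k).
Proof.
move=> kr; have [_ _ hr] := hp; have [k0 _ _] := hr k kr; have [_ s2] := @trig_half R k k0.
have p0 : p k != 0 by rewrite -nc_gt0 (p_gt0 hp hk).
have r00 : r0 k != 0.
  rewrite -nc_gt0 nc_real normr_gt0; have : 1 <= k%:R :> R by rewrite ler1n.
  by move=> k1; apply: lt0r_neq0; lra.
have := eigen_eq hl hp hv hk hD kr (v0 kr).
rewrite (trig_p_pi hp kr).1 opprK => h.
have h1 : csin (ep k * (pi : R)%:C) = sg k * (linear_term q M (p k) / (2 * p k) + p k ^- 2 * quadratic_term q M p v k).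
  rewrite -(first_iterateE hl p k); have -> : 2 * first_iterate q M p k / (2 * p k) = (p k)^-1 * first_iterate q M p k.
    by move: (first_iterate _ _ _ _) p0; move: (p k) => X Y X0; field.
  exact: (sqr1_mulr s2 h).
rewrite h1; move: (linear_term _ _ _) (linear_term _ _ _) (quadratic_term _ _ _ _ _) (csin _) p0 r00.
move: (p k) (r0 k) => X Y A B C S X0 Y0; by field; rewrite X0.
Qed.

(** The remainder as it is defined by the asymptotic formula once the three coefficients are
    gathered in [linear_term]; this is meaningful for any sequence p. *)
Definition delta_k k : R[i] := k%:R ^+ 2 * (ep k - sg k * linear_term q M (r0 k) / (2 * (pi : R)%:C * r0 k)).

Definition delta_c : R := pi ^+ 3 * expR pi * E ^+ 3 + 2 * linear_diff_const * E ^+ 2 + 8 * D * E.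

(** Each term of [expansion], multiplied by k^2, is either O(1/k), collected in [delta_c], or one of
    the square summable sequences. The numerical constants come from 1/|p_k| <= 4/k and 1/(k - 1/2)
    <= 2/k. *)
Lemma delta_bound k : k \in r ->
  nc (delta_k k) <= delta_c / k%:R + 2 * E * (nc (shift_q k) + nc (shift_M k)) + 16 * nc (quadratic_term q M p v k).
Proof.
move=> kr; have [_ E0 hr] := hp; have [k0 e1 e2] := hr k kr.
have kp : 0 < k%:R :> R by rewrite ltr0n.
have k1 : 1 <= k%:R :> R by rewrite ler1n.
have pk := p_gt0 hp hk kr; have p0 : p k != 0 by rewrite -nc_gt0.
have hpk := hk kr.
have ip : (nc (p k))^-1 <= 4 / k%:R.
  by rewrite -[leRHS]invrK lef_pV2 ?posrE ?invr_gt0 ?divr_gt0 // invf_div.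
have r0n : nc (r0 k) = k%:R - 1 / 2 by rewrite nc_real ger0_norm //; lra.
have rn : r0 k != 0 by rewrite -nc_gt0 r0n; lra.
have ir : (nc (r0 k))^-1 <= 2 / k%:R.
  by rewrite -[leRHS]invrK lef_pV2 ?posrE ?invr_gt0 ?divr_gt0 // ?invf_div r0n; lra.
have ip0 : 0 <= (nc (p k))^-1 by rewrite invr_ge0 nc_ge0.
have ir0 : 0 <= (nc (r0 k))^-1 by rewrite invr_ge0 nc_ge0.
have pi1 : 1 <= pi :> R by have := pi_ge2 R; lra.
have i2 : nc (2 : R[i])^-1 = 1 / 2 by rewrite ncV nc_nat; lra.
have t1 : nc (ep k * (pi : R)%:C - csin (ep k * (pi : R)%:C)) <= pi ^+ 3 * expR pi * (E / k%:R) ^+ 3.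
  have [f1 f2] := ep_pi_bound hp kr.
  rewrite -ncN opprB; apply: (le_trans (nc_csinB _)).
  have -> : pi ^+ 3 * expR pi * (E / k%:R) ^+ 3 = (pi * (E / k%:R)) ^+ 3 * expR pi by rewrite exprMn; ring.
  rewrite ler_pM ?exprn_ge0 ?nc_ge0 ?expR_ge0 // ?ler_expR //.
  by rewrite ler_pXn2r ?nnegrE ?nc_ge0 // mulr_ge0 ?pi_ge0 ?divr_ge0.
have t2 : nc ((linear_term q M (p k) - linear_term q M (r0 k)) / (2 * p k)) <=
    (E / k%:R * (nc (shift_q k) + nc (shift_M k)) + linear_diff_const * (E / k%:R) ^+ 2) * (2 / k%:R).
  rewrite ncM; apply: ler_pM; rewrite ?nc_ge0 ?linear_term_diff //.
  by rewrite invfM ncM i2 ncV; lra.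
have t3 : nc (linear_term q M (r0 k) * ep k / (2 * p k * r0 k)) <= 2 * D * (E / k%:R) * (2 / k%:R * (2 / k%:R)).
  rewrite ncM; apply: ler_pM; rewrite ?nc_ge0 //.
    by rewrite ncM ler_pM ?nc_ge0 // linear_term_half_bound.
  rewrite !invfM ncM ler_pM ?nc_ge0 // ?ncV //.
  by rewrite ncM i2 ncV; exact: half_le ip.
have t4 : nc (p k ^- 2 * quadratic_term q M p v k) <= (4 / k%:R) ^+ 2 * nc (quadratic_term q M p v k).
  by rewrite ncM ler_wpM2r ?nc_ge0 // -exprVn ncX ncV ler_pXn2r ?nnegrE ?divr_ge0.
have hE := expansion kr; have [s1 _] : nc (sg k) = 1 /\ True by rewrite nc_csin_half.
have total : nc ((pi : R)%:C * ep k - sg k * linear_term q M (r0 k) / (2 * r0 k)) <=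
   k%:R ^- 2 * (delta_c / k%:R + 2 * E * (nc (shift_q k) + nc (shift_M k)) + 16 * nc (quadratic_term q M p v k)).
  rewrite hE; apply: (le_trans (ncD _ _)); rewrite (ncM (sg k)) s1 [1 * nc _]mul1r.
  apply: (le_trans (lerD t1 (le_trans (ncD _ _) (lerD (le_trans (ncB _ _) (lerD t2 t3)) t4)))).
  rewrite /delta_c; move: (linear_diff_const) (nc _) (nc _) (nc _) (expR _) kp => c y1 y2 y3 y4 kp.
  by rewrite le_eqVlt; apply/orP; left; apply/eqP; field; rewrite gt_eqF.
have -> : delta_k k = (pi^-1)%:C * (k%:R ^+ 2 * ((pi : R)%:C * ep k - sg k * linear_term q M (r0 k) / (2 * r0 k))).
  have pin : (pi : R)%:C != 0 by rewrite -nc_gt0 nc_real normr_gt0 gt_eqF // pi_gt0.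
  have -> : (pi^-1)%:C = ((pi : R)%:C)^-1 :> R[i] by rewrite -fmorphV.
  rewrite /delta_k; move: (csin _) (linear_term _ _ _) rn pin; move: (r0 k) (p k) ((pi : R)%:C) => A B C X Y rn pin.
  by field; rewrite rn.
have ipi : nc ((pi^-1)%:C : R[i]) <= 1 by rewrite nc_real ger0_norm ?invr_ge0 ?pi_ge0 // invf_le1 // pi_gt0.
rewrite ncM; apply: (le_trans (ler_wpM2r (nc_ge0 _) ipi)); rewrite [1 * nc _]mul1r ncM ncX nc_nat.
apply: (le_trans (ler_wpM2l _ total)); first by rewrite exprn_ge0.
by rewrite mulrA divff ?mul1r // expf_neq0 // gt_eqF.
Qed.

Lemma delta_sum : \sum_(k <- r) nc (delta_k k) ^+ 2 <=
  4 * (2 * delta_c ^+ 2 + 4 * E ^+ 2 * (T * (pi ^+ 2 * a ^+ 2)) + 4 * E ^+ 2 * (T * (pi ^+ 2 * b ^+ 2))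
       + 256 * quadratic_const a b E).
Proof.
have [ur E0 hr] := hp.
have step k : k \in r -> nc (delta_k k) ^+ 2 <= 4 * (delta_c ^+ 2 * k%:R ^- 2 +
    4 * E ^+ 2 * nc (shift_q k) ^+ 2 + 4 * E ^+ 2 * nc (shift_M k) ^+ 2 + 256 * nc (quadratic_term q M p v k) ^+ 2).
  move=> kr; have h := delta_bound kr.
  have h2 : nc (delta_k k) ^+ 2 <= (delta_c / k%:R + 2 * E * nc (shift_q k) + 2 * E * nc (shift_M k) + 16 * nc (quadratic_term q M p v k)) ^+ 2.
    have h' : nc (delta_k k) <= delta_c / k%:R + 2 * E * nc (shift_q k) + 2 * E * nc (shift_M k) + 16 * nc (quadratic_term q M p v k).
      by apply: (le_trans h); rewrite mulrDr addrA.
    by rewrite ler_pXn2r ?nnegrE ?nc_ge0 //; apply: le_trans h'; exact: nc_ge0.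
  by apply: (le_trans h2); apply: (le_trans (sqr_scale4_le _ _ _ _ _)); rewrite expr_div_n.
rewrite big_seq; apply: (le_trans (ler_sum _ step)); rewrite -big_seq -mulr_sumr ler_wpM2l //.
have E2 : 0 <= 4 * E ^+ 2 by apply: mulr_ge0; [exact: ler0n|exact: sqr_ge0].
have s2 : \sum_(k <- r) (k%:R ^- 2 : R) <= 2 by apply: sum_inv_sqr => // k /hr[].
have h1 := ler_wpM2l (sqr_ge0 delta_c) s2.
have h2 := ler_wpM2l E2 shift_q_sum; have h3 := ler_wpM2l E2 shift_M_sum.
have h4 := quadratic_term_sum hl hp hv hk hD.
rewrite sum_linear4; apply: lerD; last exact: (ler_wpM2l _ h4).
by apply: (lerD (lerD _ h2) h3); rewrite [leRHS]mulrC.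
Qed.

End asymptotics.

(** * Assembly *)

Section homogeneous_bounds.
Context {R : realType} (c r0 : R).
Local Notation data := (R * R * R * R)%type.
Local Notation a z := z.1.1.1.
Local Notation b z := z.1.1.2.
Local Notation E z := z.1.2.
Local Notation eta_ z := z.2.

(* z = (a, b, E, eta) with a, b the norms of q and M_0, E the constant in
   |p k - (k - 1/2)| <= E / k, and eta the norm of the pair. *)
Definition small_data (z : data) := [/\ 0 <= a z <= eta_ z, 0 <= b z <= eta_ z, 0 <= E z <= c * eta_ z & eta_ z <= r0].

(** The index counts powers of the norm eta, uniformly for eta <= r0. Degrees add under products, so
    the order of an explicit constant is read off its expression. *)
Definition big_O (m : nat) (f : data -> R) := exists C : R, forall z, small_data z -> `|f z| <= C * eta_ z ^+ m.

Lemma small_eta z : small_data z -> 0 <= eta_ z.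
Proof. by case=> /andP[h1 h2] _ _ _; exact: le_trans h2. Qed.

Lemma bigO_cst (x : R) : big_O 0 (fun=> x).
Proof. by exists `|x| => z _; rewrite expr0 mulr1. Qed.

Lemma bigO_a : big_O 1 (fun z => a z).
Proof. by exists 1 => z [/andP[h1 h2] _ _ _]; rewrite expr1 mul1r ger0_norm. Qed.

Lemma bigO_b : big_O 1 (fun z => b z).
Proof. by exists 1 => z [_ /andP[h1 h2] _ _]; rewrite expr1 mul1r ger0_norm. Qed.

Lemma bigO_E : big_O 1 (fun z => E z).
Proof. by exists c => z [_ _ /andP[h1 h2] _]; rewrite expr1 ger0_norm. Qed.

Lemma bigOD m f g : big_O m f -> big_O m g -> big_O m (fun z => f z + g z).
Proof.
move=> [C hf] [C' hg]; exists (C + C') => z hz; rewrite mulrDl.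
by apply: (le_trans (ler_normD _ _)); rewrite lerD ?hf ?hg.
Qed.

Lemma bigOM m n f g : big_O m f -> big_O n g -> big_O (m + n) (fun z => f z * g z).
Proof.
move=> [C hf] [C' hg]; exists (C * C') => z hz; rewrite exprD mulrACA normrM.
by rewrite ler_pM ?hf ?hg.
Qed.

Lemma bigOZ m x f : big_O m f -> big_O m (fun z => x * f z).
Proof. by move=> hf; exact: (bigOM (bigO_cst x) hf). Qed.

Lemma bigOX m n f : big_O m f -> big_O (m * n) (fun z => f z ^+ n).
Proof.
move=> [C hf]; exists (C ^+ n) => z hz; rewrite exprM -exprMn normrX.
by apply: lerXn2r (hf z hz); rewrite nnegrE ?normr_ge0 //; apply: le_trans (hf z hz).
Qed.

Lemma bigO_weaken m n f : (n <= m)%N -> big_O m f -> big_O n f.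
Proof.
move=> nm [C hf]; exists (`|C| * `|r0| ^+ (m - n)) => z hz.
have e0 := small_eta hz; have [_ _ _ er] := hz.
have h : C * eta_ z ^+ m <= `|C| * eta_ z ^+ m by rewrite ler_wpM2r ?exprn_ge0 // ler_norm.
apply: (le_trans (hf z hz)); apply: (le_trans h).
rewrite -{1}(subnK nm) exprD mulrA ler_wpM2r ?exprn_ge0 // ler_wpM2l //.
by apply: lerXn2r; rewrite ?nnegrE // (le_trans er) // ler_norm.
Qed.

Lemma bigO_D : big_O 1 (fun z => 2 * a z + 2 * b z).
Proof. by apply: bigOD; apply: bigOZ; [exact: bigO_a|exact: bigO_b]. Qed.

Lemma bigO_trig_const : big_O 0 (fun z => trig_const (E z)).
Proof.
apply: bigOZ; apply: bigOD; first exact: bigO_cst.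
by apply: bigOZ; apply: (bigO_weaken (leq0n (1 * 2))); exact: (bigOX 2 bigO_E).
Qed.

Lemma bigO_c1 : big_O 2 (fun z => beta_c1 (a z) (b z) (E z)).
Proof.
have ha := bigOX 2 bigO_a; have hD := bigOX 2 bigO_D.
apply: bigOZ; apply: bigOD; first exact: (bigOM bigO_trig_const ha).
apply: bigOZ; apply: (@bigO_weaken 4) => //.
exact: (bigOX 2 (bigOM hD (bigO_cst _))).
Qed.

Lemma bigO_c2 : big_O 2 (fun z => beta_c2 (b z) (E z)).
Proof. by apply: bigOZ; apply: bigOZ; exact: (bigOM bigO_trig_const (bigOX 2 bigO_b)). Qed.

Lemma bigO_quadratic_const : big_O 4 (fun z => quadratic_const (a z) (b z) (E z)).
Proof.
have ha := bigOX 2 bigO_a; have hb := bigOX 2 bigO_b; have hT := bigO_trig_const.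
have h1 := bigO_c1; have h2 := bigO_c2; have h2b := bigOZ 2 bigO_b.
apply: bigOZ; apply: bigOD; first apply: bigOD; first apply: bigOD.
- apply: bigOZ; apply: (bigOM ha); apply: bigOD; [exact: (bigOM h1 (bigO_cst _))|exact: (bigOM h2 (bigO_cst _))].
- apply: bigOZ; apply: (bigOM h2b); apply: bigOD; [exact: (bigOM h1 h2b)|exact: (bigOM h2 h2b)].
- by apply: bigOZ; apply: bigOZ; exact: (bigOM (bigOM hT ha) hb).
apply: bigOD.
  apply: bigOZ; apply: (@bigO_weaken 6) => //.
  exact: (bigOX 2 (bigOM (bigOZ (2 * pi * expR pi) bigO_E) ha)).
exact: (bigOM (bigOM (bigOZ 2 hT) ha) ha).
Qed.

Lemma bigO_delta_c : big_O 2 (fun z => delta_c (a z) (b z) (E z)).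
Proof.
have hE := bigO_E; have hD := bigO_D.
apply: bigOD; first apply: bigOD.
- by apply: bigOZ; apply: (@bigO_weaken 3) => //; exact: (bigOX 3 hE).
- apply: (@bigO_weaken 3) => //; apply: (bigOM (m := 1) _ (bigOX 2 hE)).
  by apply: bigOZ; exact: bigOZ hD.
- exact: (bigOM (bigOZ 8 hD) hE).
Qed.

(** The right-hand side of [delta_sum]. Its degree 4 is the square of the quadratic order that is
    claimed. *)
Definition good_const (z : data) : R :=
  4 * (2 * delta_c (a z) (b z) (E z) ^+ 2
       + 4 * E z ^+ 2 * (trig_const (E z) * (pi ^+ 2 * a z ^+ 2))
       + 4 * E z ^+ 2 * (trig_const (E z) * (pi ^+ 2 * b z ^+ 2))
       + 256 * quadratic_const (a z) (b z) (E z)).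

Lemma bigO_good_const : big_O 4 good_const.
Proof.
have hE := bigOZ 4 (bigOX 2 bigO_E); have hT := bigO_trig_const.
have ha := bigOZ (pi ^+ 2) (bigOX 2 bigO_a); have hb := bigOZ (pi ^+ 2) (bigOX 2 bigO_b).
apply: bigOZ; apply: bigOD; last exact: bigOZ bigO_quadratic_const.
apply: bigOD; first apply: bigOD.
- by apply: bigOZ; exact: (bigOX 2 bigO_delta_c).
- exact: (bigOM hE (bigOM hT ha)).
- exact: (bigOM hE (bigOM hT hb)).
Qed.

End homogeneous_bounds.

Section main_terms.
Context {R : realType}.
Local Notation mu := (@lebesgue_measure R).

Lemma csin_half_shift (k : nat) (t : R) : (0 < k)%N ->
  csin ((k%:R - 1 / 2)%:C * (2 * t - pi)%:C) =
  - (csin ((k%:R - 1 / 2)%:C * (pi : R)%:C) * (cos ((2 * k%:R - 1) * t))%:C) :> R[i].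
Proof.
move=> k0; have [c0 _] := @trig_half R k k0.
have -> : ((k%:R - 1 / 2)%:C : R[i]) * (2 * t - pi)%:C = ((2 * k%:R - 1) * t)%:C - (k%:R - 1 / 2)%:C * (pi : R)%:C.
  by rewrite -!rmorphM -rmorphB; congr (_%:C); field.
by rewrite csinD csinN ccosN c0 mulr0 add0r ccos_real; ring.
Qed.

Lemma csin_half_sub (k : nat) (u : R) : (0 < k)%N ->
  csin ((k%:R - 1 / 2)%:C * (pi - u)%:C) =
  csin ((k%:R - 1 / 2)%:C * (pi : R)%:C) * (cos ((2 * k%:R - 1) * u / 2))%:C :> R[i].
Proof.
move=> k0; have [c0 _] := @trig_half R k k0.
have -> : ((k%:R - 1 / 2)%:C : R[i]) * (pi - u)%:C = (k%:R - 1 / 2)%:C * (pi : R)%:C - ((2 * k%:R - 1) * u / 2)%:C.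
  by rewrite -!rmorphM -rmorphB; congr (_%:C); field.
by rewrite csinD csinN ccosN c0 mul0r addr0 ccos_real.
Qed.

Lemma nat_odd_cast (k : nat) : (0 < k)%N -> (2 * k - 1)%N%:R = 2 * k%:R - 1 :> R.
Proof. by move=> k0; rewrite natrB ?natrM // muln_gt0. Qed.

Lemma L1_ext_L2 (q : R -> R[i]) : in_L2 q -> L1 (ext q).
Proof.
move=> hq; have [mr mi _] := hq.
apply: (L2_L1 (F := L2norm q ^+ 2) (cmfun_ext mr mi) (@ext_supp _ _) (sqr_ge0 _) _).1.
by rewrite L2norm_ext.
Qed.

Lemma cos_bound (x : R) : nc ((cos x)%:C : R[i]) <= 1.
Proof. by rewrite nc_real ler_norml; apply/andP; split; [exact: cos_geN1|exact: cos_le1]. Qed.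

(** At k - 1/2 the cosine of pi (k - 1/2) vanishes, so every sine in [linear_term] becomes the sign
    sin(pi (k - 1/2)) times a cosine of the defining integrals of the coefficients; the extra sign
    squares to 1. The hypothesis on k makes the subtraction in the index exact. *)
Lemma linear_term_half (q M0 : R -> R[i]) (k : nat) : in_L2 q -> in_L2 M0 -> (0 < k)%N ->
  csin ((k%:R - 1 / 2)%:C * (pi : R)%:C) * linear_term (ext q) (ext (conv_kernel M0)) (k%:R - 1 / 2)%:C =
  (pi : R)%:C * mean q - (pi / 2)%:C * a_coef q (2 * k - 1) + (pi / 2)%:C * m_coef M0 (2 * k - 1).
Proof.
move=> hq hM k0; have [_ s2] := @trig_half R k k0.
set s := csin _ in s2 *.
have pin : pi != 0 :> R by rewrite gt_eqF // pi_gt0.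
have Lq := L1_ext_L2 hq; have LM := L1_ext_L2 hM.
have mcos (x : R) : cmfun (fun t : R => (cos (x * t))%:C : R[i]).
  rewrite (_ : (fun t : R => _) = fun t : R => ccos ((x * t)%:C)); last first.
    by apply/funext => t; rewrite ccos_real.
  by apply/cmfun_ccos/cmfun_real; apply: measurable_funM => //; exact: measurable_cst.
have e1 : (pi : R)%:C * mean q = cint (ext q).
  by rewrite /mean mulrA -rmorphM divff // mul1r cintegral_oo.
have mcos2 (x : R) : cmfun (fun t : R => (cos (x * t / 2))%:C : R[i]).
  have := mcos (x / 2); rewrite (_ : (fun t : R => _) = fun t : R => (cos (x * t / 2))%:C) //.
  by apply/funext => t; rewrite mulrAC.
have e2 : (pi / 2)%:C * a_coef q (2 * k - 1) = cint (fun t => ext q t * (cos ((2 * k%:R - 1) * t))%:C).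
  rewrite /a_coef mulrA -rmorphM (_ : pi / 2 * (2 / pi) = 1); last by rewrite mulrA divfK ?pnatr_eq0 // divff.
  rewrite mul1r cintegral_oo nat_odd_cast //; apply: eq_cint => t; by rewrite /ext mulrA.
have e3 : (pi / 2)%:C * m_coef M0 (2 * k - 1) = cint (fun t => ext M0 t * (cos ((2 * k%:R - 1) * t / 2))%:C).
  rewrite /m_coef mulrA -rmorphM (_ : pi / 2 * (2 / pi) = 1); last by rewrite mulrA divfK ?pnatr_eq0 // divff.
  rewrite mul1r cintegral_oo nat_odd_cast //; apply: eq_cint => t; by rewrite /ext mulrA.
have L2 : L1 (fun t => ext q t * (cos ((2 * k%:R - 1) * t))%:C).
  by apply: (L1_mul_bounded Lq (@ext_supp _ _) (mcos _) (c := 1)) => t _; exact: cos_bound.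
have L3 : L1 (fun t => ext M0 t * (cos ((2 * k%:R - 1) * t / 2))%:C).
  by apply: (L1_mul_bounded LM (@ext_supp _ _) (mcos2 _) (c := 1)) => t _; exact: cos_bound.
have f2 : cint (fun t => ext q t * csin ((k%:R - 1 / 2)%:C * (2 * t - pi)%:C)) =
    - s * cint (fun t => ext q t * (cos ((2 * k%:R - 1) * t))%:C).
  rewrite -(cintZ _ L2); apply: eq_cint => t; rewrite csin_half_shift // -/s.
  by move: (ext q t) (cos _)%:C => X Y; ring.
have f3 : cint (fun u => ext (conv_kernel M0) u * (pi - u)%:C * csin ((k%:R - 1 / 2)%:C * (pi - u)%:C)) =
    s * cint (fun t => ext M0 t * (cos ((2 * k%:R - 1) * t / 2))%:C).
  rewrite -(cintZ _ L3); apply: eq_cint => t; rewrite csin_half_sub // -/s.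
  have -> : ext (conv_kernel M0) t * (pi - t)%:C = ext M0 t.
    rewrite /ext /conv_kernel; case: (boolP (0 < t < pi)) => [/andP[_ tp]|_]; last by rewrite !mul0r.
    rewrite !mul1r mulrAC -rmorphM mulVf ?mul1r // gt_eqF // subr_gt0 //.
  by move: (ext M0 t) (cos _)%:C => X Y; ring.
rewrite e1 e2 e3 /linear_term f2 f3 -/s; move: (cint _) (cint _) (cint _) => X Y Z.
have -> : s * (s * Z + - s * Y + s * X) = s ^+ 2 * (Z - Y + X) by rewrite expr2; ring.
by rewrite s2 mul1r.
Qed.

(** An identity for every z, since [delta_k] is by definition what is missing; that z is a root
    enters only in the estimates. *)
Lemma main_terms (q M0 : R -> R[i]) (k : nat) (z : R[i]) : in_L2 q -> in_L2 M0 -> (0 < k)%N ->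
  z = k%:R - 1 / 2 + mean q / (2 * k%:R - 1) - a_coef q (2 * k - 1) / (2 * (2 * k%:R - 1))
      + m_coef M0 (2 * k - 1) / (2 * (2 * k%:R - 1))
      + delta_k (ext q) (ext (conv_kernel M0)) (fun=> z) k / k%:R ^+ 2.
Proof.
move=> hq hM k0; have h := linear_term_half hq hM k0.
have kn : k%:R != 0 :> R[i] by rewrite pnatr_eq0 -lt0n.
have oddn : 2 * k%:R - 1 != 0 :> R[i].
  have -> : 2 * k%:R - 1 = (2 * k%:R - 1)%:C :> R[i] by rewrite rmorphB rmorphM !rmorph_nat.
  rewrite -nc_gt0 nc_real normr_gt0; apply: lt0r_neq0.
  have : 1 <= k%:R :> R by rewrite ler1n.
  lra.
have pin : (pi : R)%:C != 0 :> R[i] by rewrite -nc_gt0 nc_real normr_gt0 gt_eqF // pi_gt0.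
have re : (k%:R - 1 / 2)%:C = k%:R - 1 / 2 :> R[i].
  by rewrite rmorphB rmorph_nat rmorphM fmorphV rmorph_nat rmorph1.
have p2 : (pi / 2)%:C = (pi : R)%:C / 2 :> R[i] by rewrite rmorphM fmorphV rmorph_nat.
rewrite /delta_k h p2; move: (mean q) (a_coef _ _) (m_coef _ _) => X Y Z; rewrite re.
move: ((pi : R)%:C) pin => P P0; move: (k%:R) kn oddn => K K0 O0.
field; apply/and3P; split; [exact: K0|by rewrite [K * 2]mulrC|exact: P0].
Qed.

End main_terms.

Section assembly.
Context {R : realType}.
Local Notation rho l := (sqrtc l).

Lemma poweR_half_le (S : \bar R) (C x : R) : (0 <= S)%E -> 0 <= C -> 0 <= x ->
  (S <= ((C * x) ^+ 2)%:E)%E -> (S `^ (1 / 2) <= (C * x)%:E)%E.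
Proof.
move=> S0 C0 x0; case: S S0 => [s|_ /=|//]; last by rewrite leNgt ltry.
rewrite lee_fin => s0; rewrite lee_fin => h; rewrite div1r poweR_EFin lee_fin powR12_sqrt //.
by rewrite -[leRHS]ger0_norm ?mulr_ge0 // -sqrtr_sqr ler_wsqrtr.
Qed.

Lemma nneseries_le_partial (u : nat -> R) (B : R) : (forall k, 0 <= u k) ->
  (forall n, \sum_(k <- iota 1 n) u k <= B) -> (\sum_(1 <= k <oo) (u k)%:E <= B%:E)%E.
Proof.
move=> u0 uB; apply: lime_le.
  by apply: is_cvg_nneseries => n _ _; rewrite lee_fin.
by apply: nearW => n; rewrite sumEFin lee_fin; exact: uB.
Qed.

Lemma nc_sqrtc_lt (z : R[i]) (x : R) : 0 <= x -> nc z < x ^+ 2 -> nc (sqrtc z) < x.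
Proof. by move=> x0 h; rewrite -(@ltr_pXn2r _ 2) ?nnegrE ?nc_ge0 // -ncX sqr_sqrtc. Qed.

(** The given solutions are replaced by Volterra solutions indexed by l, with rho = [sqrtc l]; only
    rho^2 = l enters their equation, so the branch cut of the root does not disturb analyticity. *)
Lemma eigenvalue_data (q M0 : R -> R[i]) (mu : nat -> R[i]) : in_L2 q -> in_L2 M0 ->
  dn_eigenvalues q M0 mu -> exists F : R[i] -> R[i], exists V : R[i] -> R -> R[i],
    [/\ analytic F, @numbered_zeros (R[i] : numFieldType) F mu,
      close_to_cos F (2 * L2norm q + 2 * L2norm M0),
      forall l, volterra_solution (ext q) (ext (conv_kernel M0)) (rho l) (V l) &
      forall l, V l pi = F l].
Proof.
move=> hq hM [S [dS [hS hmu]]].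
have hl := in_L2_data hq hM; have hd := l2_volterra hl.
have /choice[V hV] l := sine_solution_volterra hq hM (hS (rho l)).
have pip (y : R) : 0 < y -> 0 < y <= y by move=> ->; rewrite lexx.
have VF l : V l pi = dS pi (rho l) by have [_ _ h _ _] := hV l; exact: (h _ (pip _ (pi_gt0 R))).
exists (fun l => dS pi (rho l)), V; split => //.
- rewrite (_ : (fun l => _) = fun l => V l pi); last by apply/funext => l; rewrite VF.
  apply: (analytic_volterra hd) => [l|l|l x xp]; first by have [] := hV l.
    by have [_ h _ _ _] := hV l.
  by have [_ _ _ h _] := hV l; rewrite {1}h // sqr_sqrtc.
- move=> l r0 AB; have [mv [C vC] _ vE _] := hV l; rewrite -VF /cosG.
  exact: (sine_close hd mv vC vE r0 AB (pip _ (pi_gt0 R))).1.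
- by move=> l; have [mv vC _ vE _] := hV l; split.
Qed.

End assembly.

Theorem theorem2 (R : realType) (r0 : R) (r0_gt0 : 0 < r0) :
  exists C : R, forall q M0 : R -> R[i],
    in_L2 q -> in_L2 M0 -> pair_norm q M0 <= r0 ->
    forall mu : nat -> R[i], dn_eigenvalues q M0 mu ->
    exists delta : nat -> R[i],
      (forall k : nat, (1 <= k)%N ->
         sqrtc (mu k) =
           k%:R - 1 / 2
           + mean q / (2 * k%:R - 1)
           - a_coef q (2 * k - 1) / (2 * (2 * k%:R - 1))
           + m_coef M0 (2 * k - 1) / (2 * (2 * k%:R - 1))
           + delta k / k%:R ^+ 2) /\
      ((\sum_(1 <= k <oo) (Normc.normc (delta k) ^+ 2)%:E) `^ (1 / 2)
         <= (C * pair_norm q M0 ^+ 2)%:E)%E.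
Proof.
have [K K0 loc] := @zero_localization R.
(* For k >= K' D the summand 16/3 gives D <= 3/16 k <= 3/4 |rho_k|, by |rho_k| >= k / 4; this is the
   standing assumption of the estimates. *)
pose K' := K + 16 / 3; have K'0 : 0 < K' by rewrite addr_gt0 // divr_gt0.
have KK' : K <= K' by rewrite lerDl divr_ge0.
have [G hG] := bigO_good_const (2 * K') r0.
(* Since D <= 2 eta <= 2 r0, N depends on r0 only, bounds every index k < K' D, and is itself an
   admissible circle for the crude localization. *)
pose N := (Num.bound (2 * K' * r0)).+1.
have N0 : 0 < N%:R :> R by rewrite ltr0n.
have hN : 2 * K' * r0 <= N%:R.
  have h : 0 <= 2 * K' * r0 by rewrite !mulr_ge0 // ltW.
  by apply: (le_trans (ltW (archi_boundP h))); rewrite ler_nat.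
pose B := (2 * (N%:R ^+ 3 * (2 * N%:R + 4 * r0) * (2 * K') ^+ 2) ^+ 2 + `|G|) : R.
have B0 : 0 <= B by rewrite addr_ge0 // mulr_ge0 // sqr_ge0.
exists (Num.sqrt B) => q M0 hq hM hr mu hmu.
set eta_ := pair_norm q M0 in hr *.
have [F [V [Fan Fmu Fcos hV VF]]] := eigenvalue_data hq hM hmu.
have hl := in_L2_data hq hM; have a0 := ld_a0 hl; have b0 := ld_b0 hl.
set a := L2norm q in hl Fcos a0; set b := L2norm M0 in hl Fcos b0.
have ab : eta_ = a + 2 * b by [].
pose D := 2 * a + 2 * b; have D0 : 0 <= D by rewrite /D; lra.
have D1 : D <= 2 * eta_ by rewrite ab /D; lra.
have eta0 : 0 <= eta_ by rewrite ab; lra.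
have [loc1 loc2] := loc F mu D D0 Fan Fmu Fcos.
pose p k := sqrtc (mu k).
pose delta k := delta_k (ext q) (ext (conv_kernel M0)) p k.
exists delta; split; first by move=> k k0; exact: main_terms.
have ED : K' * D <= 2 * K' * eta_ by have := ler_wpM2l (ltW K'0) D1; lra.
have E0 : 0 <= K' * D by rewrite mulr_ge0 // ltW.
pose good k := K' * D <= k%:R.
have gK k : good k -> K * D <= k%:R by apply: le_trans; rewrite ler_wpM2r.
have good_sum n : \sum_(k <- iota 1 n | good k) nc (delta k) ^+ 2 <= `|G| * eta_ ^+ 4.
  pose r := [seq k <- iota 1 n | good k].
  have rP k : k \in r -> (0 < k)%N /\ good k.
    by rewrite mem_filter mem_iota => /andP[-> /andP[-> _]].
  have hp : near_half r p (K' * D).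
    split; first by rewrite filter_uniq // iota_uniq.
    - by [].
    move=> k /rP[k0 kg]; have [_ [h1 h2]] := loc2 k k0 (gK k kg); split => //.
      by apply: (le_trans h1); rewrite ler_wpM2r ?invr_ge0 ?ler0n // ler_wpM2r.
    by apply: (le_trans h2); lra.
  have hv k : k \in r -> volterra_solution (ext q) (ext (conv_kernel M0)) (p k) (V (mu k)).
    by move=> _; exact: hV.
  have hk k : k \in r -> k%:R / 4 <= nc (p k).
    by move=> /rP[k0 kg]; have [h _] := loc2 k k0 (gK k kg).
  have hD k : k \in r -> D <= 3 / 4 * nc (p k).
    move=> kr; have [_ kg] := rP k kr; have := hk k kr; have : 16 / 3 * D <= k%:R.
      by apply: le_trans kg; rewrite ler_wpM2r // /K'; lra.
    by move: (nc _) => y; lra.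
  have v0 k : k \in r -> V (mu k) pi = 0.
    by move=> /rP[k0 _]; rewrite VF; exact: numbered_zeros_zero Fmu.
  have := delta_sum hl hp hv hk hD v0; rewrite big_filter => /le_trans; apply.
  have hz : small_data (2 * K') r0 (a, b, K' * D, eta_).
    by split => //=; apply/andP; split => //; rewrite ?ab; lra.
  apply: (le_trans (ler_norm _)); apply: (le_trans (hG _ hz)).
  by rewrite ler_wpM2r ?exprn_ge0 // ler_norm.
(* N^2 (2 N + 4 r0) bounds |delta_k| for the exceptional k. The third power of N pays for the
   division by k <= N, which lets the sum of the k^-2 be reused. The last factor is at least 1 as
   soon as an exceptional k exists, and it supplies the power eta^2. *)
pose bb := N%:R ^+ 3 * (2 * N%:R + 4 * r0) * (2 * K' * eta_) ^+ 2.
(* A k that is not good forces eta_ to be bounded below, so a crude bound on delta k is enough. *)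
have bad_bound k : (0 < k)%N -> ~~ good k -> nc (delta k) <= bb / k%:R.
  move=> k0; rewrite /good -ltNge => kb.
  have kN : (k <= N)%N.
    rewrite -(ler_nat R); apply: (le_trans (ltW kb)); apply: (le_trans ED); apply: le_trans hN.
    by rewrite ler_wpM2l // mulr_ge0 // ltW.
  have k1 : 1 <= k%:R :> R by rewrite ler1n.
  have kn : k%:R <= N%:R :> R by rewrite ler_nat.
  have e1 : 1 <= (2 * K' * eta_) ^+ 2.
    by rewrite exprn_ege1 // (le_trans k1) // (le_trans (ltW kb)).
  (* No fine localization is available here; the crude count on the circle of radius N still bounds
     the root. *)
  have mN : nc (p k) < N%:R.
    apply: nc_sqrtc_lt; first exact: ltW.
    apply: loc1 => //; last by rewrite k0.
    apply: le_trans hN; apply: (@le_trans _ _ (K' * D)); first by rewrite ler_wpM2r.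
    by apply: (le_trans ED); rewrite ler_wpM2l // mulr_ge0 // ltW.
  (* The estimate of [linear_term] at the half-integer needs no root, so the exact frequency with
     tolerance 0 serves. *)
  have hp0 : near_half [:: k] (fun j => (j%:R - 1 / 2)%:C : R[i]) 0.
    by split => // j; rewrite inE => /eqP ->; rewrite subrr nc0 mul0r.
  have hE := linear_term_half_bound hl hp0 (mem_head k [::]).
  have pi1 : 1 <= pi :> R by have := pi_ge2 R; lra.
  have rn : nc (k%:R - 1 / 2)%:C = k%:R - 1 / 2 :> R by rewrite nc_real ger0_norm //; lra.
  have h : nc (delta k) <= N%:R ^+ 2 * (2 * N%:R + 4 * r0).
    rewrite /delta /delta_k ncM ncX nc_nat; apply: ler_pM; rewrite ?sqr_ge0 ?nc_ge0 //.
      by rewrite ler_pXn2r ?nnegrE ?ler0n.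
    apply: (le_trans (ncB _ _)).
    have h1 : nc (p k - (k%:R - 1 / 2)%:C) <= 2 * N%:R.
      by apply: (le_trans (ncB _ _)); rewrite rn; lra.
    have h2 : nc (csin ((k%:R - 1 / 2)%:C * (pi : R)%:C) * linear_term (ext q) (ext (conv_kernel M0)) (k%:R - 1 / 2)%:C
        / (2 * (pi : R)%:C * (k%:R - 1 / 2)%:C)) <= 4 * r0.
      rewrite ncM (ncM (csin _)) nc_csin_half // [1 * _]mul1r ncV (ncM (2 * _)) (ncM 2) rn nc_nat nc_real (gtr0_norm (pi_gt0 R)).
      have dn : 1 <= 2 * pi * (k%:R - 1 / 2) :> R.
        rewrite (_ : 2 * pi * (k%:R - 1 / 2) = pi * (2 * k%:R - 1)); last by field.
        by rewrite -[leLHS]mulr1 ler_pM //; lra.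
      apply: (@le_trans _ _ (2 * D * 1)); last by lra.
      rewrite ler_pM ?nc_ge0 ?invr_ge0 ?(le_trans ler01 dn) //.
      by rewrite invf_le1 // (lt_le_trans ltr01 dn).
    by move: h1 h2; move: (nc _) (nc _) => y1 y2; lra.
  apply: (le_trans h); rewrite ler_pdivlMr ?ltr0n // /bb.
  have X0 : 0 <= N%:R ^+ 2 * (2 * N%:R + 4 * r0).
    by rewrite mulr_ge0 ?exprn_ge0 // addr_ge0 ?mulr_ge0 // ltW.
  apply: (@le_trans _ _ (N%:R ^+ 2 * (2 * N%:R + 4 * r0) * N%:R)); first by rewrite ler_wpM2l.
  have -> : N%:R ^+ 2 * (2 * N%:R + 4 * r0) * N%:R = N%:R ^+ 3 * (2 * N%:R + 4 * r0) * 1 by ring.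
  rewrite ler_wpM2l // mulr_ge0 ?exprn_ge0 //.
  by rewrite addr_ge0 ?mulr_ge0 // ltW.
have bad_sum n : \sum_(k <- iota 1 n | ~~ good k) nc (delta k) ^+ 2 <= 2 * bb ^+ 2.
  have bb2 : 0 <= bb ^+ 2 by exact: sqr_ge0.
  have kp k : k \in [seq k <- iota 1 n | ~~ good k] -> (0 < k)%N.
    by rewrite mem_filter mem_iota => /andP[_ /andP[]].
  rewrite -big_filter big_seq.
  apply: (@le_trans _ _ (\sum_(k <- [seq k <- iota 1 n | ~~ good k]) bb ^+ 2 * k%:R ^- 2)).
    rewrite [leRHS]big_seq; apply: ler_sum => k kr; have k0 := kp k kr.
    move: kr; rewrite mem_filter => /andP[kb _]; rewrite -expr_div_n.
    have h := bad_bound k k0 kb.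
    by apply: lerXn2r (h); rewrite nnegrE ?nc_ge0 //; exact: le_trans (nc_ge0 _) h.
  rewrite -mulr_sumr mulrC; apply: ler_wpM2r => //.
  by apply: sum_inv_sqr => //; rewrite filter_uniq // iota_uniq.
apply: poweR_half_le; rewrite ?sqrtr_ge0 ?sqr_ge0 //.
  by apply: nneseries_ge0 => n _ _; rewrite lee_fin sqr_ge0.
apply: nneseries_le_partial => [k|n]; first exact: sqr_ge0.
rewrite exprMn sqr_sqrtr // (bigID good) /=.
apply: (le_trans (lerD (good_sum n) (bad_sum n))).
by rewrite le_eqVlt /B /bb; apply/orP; left; apply/eqP; ring.
Qed.
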